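(* Fix $a>1$, let $Y=(Y_t:t>0)$ be the STIT tessellation process on $\mathbb{R}^\ell$ driven by $\Lambda$, and set $\mathcal{Z}_s=a^sY_{a^s}$, $s\in\mathbb{R}$. For any window $W$, the process $\mathcal{Z}\wedge W=(\mathcal{Z}_s\wedge W:s\in\mathbb{R})$ is a stationary Markov process that is mixing in time: $$\lim_{t\to\infty}\mathbb{P}\big(\mathcal{Z}\wedge W\in\widehat{A},\ \sigma^t\circ(\mathcal{Z}\wedge W)\in\widehat{B}\big)=\mathbb{P}(\mathcal{Z}\wedge W\in\widehat{A})\,\mathbb{P}(\mathcal{Z}\wedge W\in\widehat{B})$$ for all events $\widehat{A},\widehat{B}$ in the Borel $\sigma$-field $\mathcal{B}(D_{\mathbb{T}_W})$. Hence $(D_{\mathbb{T}_W}(\mathbb{R}),\mathcal{B}(D_{\mathbb{T}_W}),\mu^{\mathcal{Z}}_W,(\sigma^t:t\in\mathbb{R}))$ is a mixing shift flow.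
   Context: Fix $\ell\ge 1$. A polytope is the convex hull of a finite point set in $\mathbb{R}^\ell$, always assumed to have nonempty interior. A tessellation of $\mathbb{R}^\ell$ is a countable, locally finite family of polytopes (cells) with pairwise disjoint interiors and union $\mathbb{R}^\ell$; $\mathbb{T}$ is the set of all tessellations. With $\mathbb{F}'$ the space of nonempty closed subsets of $\mathbb{R}^\ell$ with the Fell topology, and $\mathbb{F}(\mathbb{F}')$ the space of closed subsets of $\mathbb{F}'$ with the Fell topology (compact metrizable), $\mathbb{T}$ is a Borel subset of $\mathbb{F}(\mathbb{F}')$ and carries the trace Borel $\sigma$-field $\mathcal{B}(\mathbb{T})$. For $c\ne 0$, $cT=\{cC:C\in T\}$. A window $W$ is a polytope with nonempty interior; $\mathbb{T}_W$ is the set of (finite) tessellations of $W$ into polytopes with disjoint interiors, a Borel subset of $\mathbb{F}(\mathbb{F}'_W)$ (closed subsets, with the Fell topology, of the space $\mathbb{F}'_W$ of nonempty closed subsets of $W$ with the Fell topology; this is compact metrizable), and $\mathbb{T}_W$ carries the induced metric and Borel $\sigma$-field. For $T\in\mathbb{T}$, $T\wedge W=\{C\cap W:C\in T,\ \mathrm{int}(C\cap W)\ne\emptyset\}\in\mathbb{T}_W$. STIT process. Let $\Lambda$ be a nonzero $\sigma$-finite translation invariant measure on the space $\mathcal{H}$ of hyperplanes of $\mathbb{R}^\ell$ such that there is no line to which all hyperplanes of the support of $\Lambda$ are parallel. For a set $B\subseteq\mathbb{R}^\ell$ put $[B]=\{H\in\mathcal{H}:H\cap B\ne\emptyset\}$;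 one has $0<\Lambda([W])<\infty$ for every window $W$, and $\Lambda_W=\Lambda([W])^{-1}\Lambda(\cdot\cap[W])$. For a window $W$, $Y\wedge W=(Y_t\wedge W:t\ge 0)$ is the pure jump càdlàg Markov process in $\mathbb{T}_W$ starting from $Y_0\wedge W=\{W\}$ in which, independently, each present cell $C$ has an exponential lifetime with parameter $\Lambda([C])$, at the end of which $C$ is replaced by the two cells into which it is divided by a random hyperplane of law $\Lambda_C$ (independent of everything else). These laws are consistent: $(Y\wedge W')\wedge W\sim Y\wedge W$ for $W\subseteq W'$, where $\sim$ denotes equality of distributions. The STIT tessellation process $Y=(Y_t:t>0)$ is the $\mathbb{T}$-valued Markov process whose restriction to each window $W$ has this law. $D_{\mathbb{T}_W}(\mathbb{R})$ is the space of càdlàg trajectories $\mathbb{R}\to\mathbb{T}_W$ with the Skorohod topology, and $\mathcal{B}(D_{\mathbb{T}_W})$ is its Borel $\sigma$-field. The process $\mathcal{Z}\wedge W$ has càdlàg trajectories and $\mu^{\mathcal{Z}}_W$ is its law on $(D_{\mathbb{T}_W}(\mathbb{R}),\mathcal{B}(D_{\mathbb{T}_W}))$. The shift is $\sigma^t(x_s:s\in\mathbb{R})=(x_{s+t}:s\in\mathbb{R})$. Stationary means that $\sigma^t\circ(\mathcal{Z}\wedge W)\sim\mathcal{Z}\wedge W$ for all $t\in\mathbb{R}$. A flow is a probability space $(\Omega,\mathcal{B}(\Omega),\mu)$ with a family $(\psi^t:t\in\mathbb{R})$ of measure-preserving measurable transformations; it is a shift flow when $\psi^t$ are the shifts $\sigma^t$,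 and it is mixing if $\lim_{t\to\infty}\mu(\psi^{-t}A\cap B)=\mu(A)\mu(B)$ for all measurable $A,B$.
   Formalization: Càdlàg paths of Z∧W are assumed (this forces 0 ∈ W), with left limits taken in F(F'_W) instead of T_W: a cell leaving W flattens onto its boundary, so left limits in T_W never exist, and if 0 ∉ W entering cells break right continuity, so the law on D is undefined. *)

(* Defs.v *)
From HB Require Import structures.
From mathcomp Require Import all_boot all_order all_algebra.
From mathcomp Require Import finmap all_classical all_reals all_analysis.

Set Implicit Arguments.
Unset Strict Implicit.
Unset Printing Implicit Defensive.

Import Order.TTheory GRing.Theory Num.Theory.
Import numFieldNormedType.Exports.

Local Open Scope classical_set_scope.
Local Open Scope ring_scope.

Notation borel X := (g_sigma_algebraType (@open X)).

(* If every member of [P] is closed, [fell P] carries the trace on [P] of the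
   Fell topology of the space of closed subsets of [X]: a subbase is given by
   the sets of all A missing a compact K and of all A hitting an open G. *)
Definition fell (X : topologicalType) (P : set (set X)) : Type := set_type P.

HB.instance Definition _ X P := gen_eqMixin (@fell X P).
HB.instance Definition _ X P := gen_choiceMixin (@fell X P).

Definition fell_subbase (X : topologicalType) (P : set (set X)) :
    set (set (fell P)) :=
  [set [set A : fell P | val A `&` K = set0] | K in @compact X] `|`
  [set [set A : fell P | val A `&` G !=set0] | G in @open X].

HB.instance Definition _ X P := isSubBaseTopological.Build (@fell X P)
  (@fell_subbase X P) id.

Record compatible_metric (R : realType) (X : topologicalType) :=
  CompatibleMetric {
    mdistance :> X -> X -> R ;
    mdistance_eq0 : forall x y, mdistance x y = 0 <-> x = y ;
    mdistance_sym : forall x y, mdistance x y = mdistance y x ;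
    mdistance_triangle : forall x y z,
      mdistance x z <= mdistance x y + mdistance y z ;
    mdistance_nbhs : forall x (A : set X),
      nbhs x A <-> exists2 e : R, 0 < e & [set y | mdistance x y < e] `<=` A }.

Section Tessellations.
Variables (R : realType) (l : nat).
Let V := 'rV[R]_l.+1.

Definition dot (u x : V) : R := \sum_i u ord0 i * x ord0 i.

Definition conv_hull (s : seq V) : set V :=
  [set x | exists w : 'rV[R]_(size s),
     [/\ forall i, 0 <= w ord0 i, \sum_i w ord0 i = 1
       & x = \sum_i w ord0 i *: s`_i]].

Definition polytope (C : set V) : Prop :=
  (exists s : seq V, C = conv_hull s) /\ C° !=set0.

Record window := Window { window_set :> set V ; windowP : polytope window_set }.

(* [Fne setT] is F' and [Fne W] is F'_W; likewise [FF setT] is F(F') and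
   [FF W] is F(F'_W). *)
Definition Fne (B : set V) : Type :=
  fell [set A : set V | [/\ closed A, A !=set0 & A `<=` B]].
HB.instance Definition _ B := Topological.on (Fne B).

Definition FF (B : set V) : Type := fell [set T : set (Fne B) | closed T].
HB.instance Definition _ B := Topological.on (FF B).

Lemma FF_point_proof B : set0 \in [set T : set (Fne B) | closed T].
Proof. by rewrite inE /=; exact: closed0. Qed.
HB.instance Definition _ B := isPointed.Build (FF B)
  (exist _ set0 (FF_point_proof B) : FF B).

Definition cells (B : set V) (T : FF B) : set (set V) :=
  [set val C | C in (val T : set (Fne B))].

Definition divides_into_polytopes (B : set V) (S : set (set V)) : Prop :=
  [/\ forall C, S C -> polytope C,
      forall C D, S C -> S D -> C <> D -> C° `&` D° = set0
    & \bigcup_(C in S) C = B].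

Definition locally_finite (S : set (set V)) : Prop :=
  forall K : set V, compact K -> finite_set [set C | S C /\ C `&` K !=set0].

Definition tessellation : set (FF setT) :=
  [set T | [/\ countable (cells T), locally_finite (cells T)
             & divides_into_polytopes setT (cells T)]].

Definition tessellation_of (W : set V) : set (FF W) :=
  [set T | finite_set (cells T) /\ divides_into_polytopes W (cells T)].

Definition TW (W : window) : Type := set_type (@tessellation_of W).
HB.instance Definition _ W :=
  Topological.copy (TW W) (set_type (@tessellation_of W)).

Let simplex n : set 'rV[R]_n :=
  [set w | (forall i, 0 <= w ord0 i) /\ \sum_i w ord0 i = 1].

Let continuous_bigsum (I : Type) (r : seq I) (T : topologicalType)
    (U : normedModType R) (f : I -> T -> U) :
  (forall i, continuous (f i)) -> continuous (fun x => \sum_(i <- r) f i x).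
Proof.
move=> cf; elim: r => [|i r IH].
  rewrite (_ : (fun _ => _) = fun=> 0); first exact: cst_continuous.
  by apply/funext => x; rewrite big_nil.
rewrite (_ : (fun _ => _) = (fun x => f i x + \sum_(j <- r) f j x)).
  by move=> x; apply: cvgD; [exact: cf|exact: IH].
by apply/funext => x; rewrite big_cons.
Qed.

Let simplex_compact n : compact (@simplex n).
Proof.
apply: (@subclosed_compact _ _
  [set w : 'rV[R]_n | forall i, `[0, 1]%classic (w ord0 i)]).
- rewrite (_ : @simplex n = (\bigcap_(i in [set: 'I_n])
      ((fun w : 'rV[R]_n => w ord0 i) @^-1` [set x | 0 <= x])) `&`
      ((fun w : 'rV[R]_n => \sum_i w ord0 i) @^-1` [set x | x = 1])).
    apply: closedI.
      apply: closed_bigI => i _.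
      apply: preimage_closed; last exact: closed_ge.
      by move=> w _; exact: coord_continuous.
    apply: preimage_closed; last exact: closed_eq.
    by move=> w _; apply: continuous_bigsum => i; exact: coord_continuous.
  apply/seteqP; split => w /=; first by move=> [w0 w1]; split => // i _; exact: w0.
  by move=> [w0 w1]; split => // i; exact: w0.
- have h : compact [set w : 'rV[R]_n | forall i, `[0, 1]%classic (w ord0 i)].
    by apply: (@rV_compact R n (fun=> `[0, 1]%classic)) => i; exact: segment_compact.
  exact: h.
- move=> w [w0 w1] i /=; rewrite in_itv/= w0/= -w1 (bigD1 i)//= lerDl.
  by apply: sumr_ge0.
Qed.

Lemma conv_hull_closed (s : seq V) : closed (conv_hull s).
Proof.
pose f (w : 'rV[R]_(size s)) : V := \sum_i w ord0 i *: s`_i.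
rewrite (_ : conv_hull s = f @` @simplex (size s)).
  apply: compact_closed; first exact: norm_hausdorff.
  apply: continuous_compact; last exact: simplex_compact.
  apply: continuous_subspaceT; apply: continuous_bigsum => i w.
  by apply: (@cvgZr_tmp R V _ (nbhs w)); exact: coord_continuous.
apply/seteqP; split => x /=.
  by move=> [w [w0 w1 ->]]; exists w.
by move=> [w [w0 w1] <-]; exists w.
Qed.

Lemma window_in_Fne (W : window) :
  (W : set V) \in [set A : set V | [/\ closed A, A !=set0 & A `<=` W]].
Proof.
case: W => W [[s Ws] [x Wx]]; rewrite inE; split => //=.
  by rewrite Ws; exact: conv_hull_closed.
by exists x; exact: interior_subset Wx.
Qed.

Definition whole_cell (W : window) : Fne W :=
  exist (fun A => A \in _) _ (window_in_Fne W).

Lemma open_miss (B : set V) (x : V) :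
  open [set C : Fne B | val C `&` [set x] = set0].
Proof.
set M := (X in open X).
have sM : @fell_subbase V [set A | [/\ closed A, A !=set0 & A `<=` B]] M.
  by left; exists [set x] => //; exact: compact_set1.
exists [set M]; last by rewrite bigcup_set1.
move=> _ ->; exists [fset M]%fset.
  by move=> A /fset1P ->; rewrite inE; exact: sM.
apply/seteqP; split => [C|C MC A]; last by move=> /fset1P ->.
by move=> /(_ M); apply; exact/fset1P.
Qed.

Lemma whole_closed (W : window) :
  [set whole_cell W] \in [set T : set (Fne W) | closed T].
Proof.
rewrite inE /= -openC.
rewrite (_ : ~` _ = \bigcup_(x in (W : set V))
    [set C : Fne W | val C `&` [set x] = set0]).
  by apply: bigcup_open => x _; exact: open_miss.
apply/seteqP; split => C /=.
  move=> CW; apply: contrapT => H; apply: CW; apply: val_inj => /=.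
  have /set_mem [_ _ CW] := valP C.
  apply/seteqP; split => // x Wx; apply: contrapT => Cx; apply: H; exists x => //=.
  by apply/seteqP; split => // y [Cy yx]; apply: Cx; rewrite -yx.
move=> [x Wx] /= /seteqP[H _] CE; apply: (H x); split => //=.
by rewrite CE.
Qed.

Definition whole_FF (W : window) : FF W :=
  exist (fun A => A \in _) _ (whole_closed W).

Lemma whole_tessellation (W : window) : whole_FF W \in @tessellation_of W.
Proof.
have cE : cells (whole_FF W) = [set (W : set V)] by rewrite /cells /= image_set1.
rewrite inE /tessellation_of /= cE; split; first exact: finite_set1.
split; first by move=> C ->; exact: windowP.
- by move=> C D -> ->.
- by rewrite bigcup_set1.
Qed.

Definition whole (W : window) : TW W :=
  exist (fun A => A \in _) _ (whole_tessellation W).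

HB.instance Definition _ (W : window) := isPointed.Build (TW W) (whole W).

(* The tessellation of W with set of cells [S]. It is unique when it exists;
   [whole W] is a junk value for [S] that are not tessellations of W. *)
Definition tess_with_cells (W : window) (S : set (set V)) : TW W :=
  xget (whole W) [set T | cells (val T : FF W) = S].

Definition restrict_tess (W : window) (T : FF setT) : TW W :=
  tess_with_cells W
    [set C `&` W | C in [set C | cells T C /\ (C `&` W)° !=set0]].

(* cT; the default of [xget] is never used when T is a tessellation, c != 0. *)
Definition scale_tess (c : R) (T : FF setT) : FF setT :=
  xget T [set T' | cells T' = [set [set c *: x | x in C] | C in cells T]].

End Tessellations.

Section Hyperplanes.
Variables (R : realType) (l : nat).
Let V := 'rV[R]_l.+1.

Definition is_hyperplane : set (set V) :=
  [set h | exists u : V, exists2 c : R, u != 0 & h = [set x | dot u x = c]].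

Definition hyperplane : Type := fell is_hyperplane.
HB.instance Definition _ := Topological.on hyperplane.

Lemma hyperplane_point_proof :
  [set x | dot (const_mx 1) x = 0] \in is_hyperplane.
Proof.
rewrite inE; exists (const_mx 1); exists 0 => //.
by apply/eqP => /matrixP/(_ ord0 ord0)/eqP; rewrite !mxE oner_eq0.
Qed.
HB.instance Definition _ := isPointed.Build hyperplane
  (exist (fun h => h \in is_hyperplane) _ hyperplane_point_proof).

Definition hits (B : set V) : set hyperplane :=
  [set h : hyperplane | val h `&` B !=set0].

Definition translate_hyperplanes (x : V) (A : set hyperplane) : set hyperplane :=
  [set h : hyperplane | exists2 g : hyperplane, A g & val h = [set y + x | y in val g]].

Definition measure_support (m : set hyperplane -> \bar R) : set hyperplane :=
  [set h | forall U : set hyperplane, open U -> U h -> (0 < m U)%E].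

(* Finiteness on the hyperplanes hitting a window is part of the setting: it
   does not follow from sigma-finiteness and translation invariance. *)
Record driving_measure (m : {measure set (borel hyperplane) -> \bar R}) : Prop :=
  DrivingMeasure {
    driving_neq0 : m setT != 0%E ;
    driving_sigma_finite : sigma_finite setT m ;
    driving_invariant : forall (x : V) (A : set (borel hyperplane)),
      measurable A -> m (translate_hyperplanes x A) = m A ;
    driving_directions : ~ exists2 v : V, v != 0 &
      forall h, measure_support m h -> forall x, val h x -> val h (x + v) ;
    driving_windows : forall W : window R l, (m (hits W) < +oo)%E }.

(* One of the two closed half-spaces bounded by h: the lower one for
   [b = false], relative to the normal vector whose first nonzero coordinate is
   positive. This choice only decides which of two new cells comes first. *)
Definition half_space (b : bool) (h : hyperplane) : set V :=
  [set x | exists u : V, exists c : R,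
     [/\ exists2 i, 0 < u ord0 i & forall j : 'I_l.+1, (j < i)%N -> u ord0 j = 0,
         val h = [set y | dot u y = c]
       & if b then c <= dot u x else dot u x <= c]].

Variable Lambda : {measure set (borel hyperplane) -> \bar R}.

Definition rate (C : set V) : R := fine (Lambda (hits C)).

Definition hit_law (C : set V) (A : set hyperplane) : R :=
  fine (Lambda (A `&` hits C)) / rate C.

(* Cells are indexed by finite words: the cells dividing [C_v] are [C_(v0)] and
   [C_(v1)]. [tau v] is the lifetime of [C_v], and [h v] the hyperplane dividing
   it at its death. *)
Definition cell (W : set V) (h : seq bool -> hyperplane) (v : seq bool) : set V :=
  W `&` [set x | forall i, (i < size v)%N ->
                   half_space (nth false v i) (h (take i v)) x].

Definition birth (tau : seq bool -> R) (v : seq bool) : R :=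
  \sum_(i < size v) tau (take i v).

Definition tree_tess (W : window R l) (tau : seq bool -> R)
    (h : seq bool -> hyperplane) (t : R) : TW W :=
  tess_with_cells W
    [set cell W h v | v in [set v | birth tau v <= t < birth tau v + tau v]].

Section TreeLaw.
Variables (d : measure_display) (T : measurableType d) (P : probability T R).
Variables (W : window R l) (tau : seq bool -> T -> R)
  (h : seq bool -> T -> borel hyperplane).

Definition history (n : nat) : set (set T) :=
  <<s [set E | exists2 v : seq bool, (size v < n)%N &
         (exists2 B : set R, measurable B & E = tau v @^-1` B) \/
         (exists2 B : set (borel hyperplane), measurable B & E = h v @^-1` B)] >>.

(* Given all that happened to the cells of generations below n, the pairs
   (lifetime, dividing hyperplane) of the cells C of generation n are
   independent, and each has law Exp(Lambda [C]) x Lambda_C. *)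
Record division_tree : Prop := DivisionTree {
  tree_lifetime : forall v, measurable_fun setT (tau v) ;
  tree_hyperplane : forall v, measurable_fun setT (h v) ;
  tree_law : forall n (G : set T) (t : seq bool -> R)
      (A : seq bool -> set (borel hyperplane)),
    history n G -> (forall v, 0 <= t v) -> (forall v, measurable (A v)) ->
    P (G `&` [set w | forall v, size v = n -> t v < tau v w /\ A v (h v w)]) =
    (\int[P]_(w in G) (\prod_(v : n.-tuple bool)
       (expR (- (rate (cell W (h^~ w) v) * t v)) *
        hit_law (cell W (h^~ w) v) (A v)))%:E)%E ;
  tree_measurable : forall t, 0 <= t ->
    measurable_fun setT
      (fun w => tree_tess W (tau^~ w) (h^~ w) t : borel (TW W)) }.

End TreeLaw.

Definition pure_jump_cadlag (W : window R l) (y : R -> TW W) : Prop :=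
  forall t, 0 <= t ->
    (\forall s \near t^'+, y s = y t) /\
    (0 < t -> exists T, \forall s \near t^'-, y s = T).

(* The process [y] (indexed by t >= 0) has the law of Y /\ W: almost all its
   trajectories are cadlag step functions, and its finite-dimensional
   distributions are those of the cell division process. *)
Definition cell_division_process (W : window R l) (d : measure_display)
    (T : measurableType d) (P : probability T R) (y : R -> T -> TW W) : Prop :=
  {ae P, forall w, pure_jump_cadlag (y^~ w)} /\
  exists (d' : measure_display) (T' : measurableType d') (P' : probability T' R)
      (tau : seq bool -> T' -> R) (h : seq bool -> T' -> borel hyperplane),
    division_tree P' W tau h /\
    forall n (t : 'I_n -> R) (A : 'I_n -> set (borel (TW W))),
      (forall i, 0 <= t i) -> (forall i, measurable (A i)) ->
      P [set w | forall i, A i (y (t i) w)] =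
      P' [set w | forall i, A i (tree_tess W (tau^~ w) (h^~ w) (t i))].

End Hyperplanes.

Section Markov.
Variables (R : realType) (d d' : measure_display) (T : measurableType d)
  (E : measurableType d') (P : probability T R).

Definition past (I : set R) (X : R -> T -> E) (s : R) : set (set T) :=
  <<s [set A | exists r, [/\ I r, r <= s &
         exists2 B : set E, measurable B & A = X r @^-1` B]] >>.

(* [g \o X s] is a version of P(X_t \in B | past s); thus it is also one of
   P(X_t \in B | X_s). *)
Definition markov_process (I : set R) (X : R -> T -> E) : Prop :=
  (forall t, I t -> measurable_fun setT (X t)) /\
  forall s t (B : set E), I s -> I t -> s <= t -> measurable B ->
    exists g : E -> R,
      [/\ measurable_fun setT g, forall x, 0 <= g x <= 1 &
          forall A, past I X s A ->
            P (A `&` X t @^-1` B) = (\int[P]_(w in A) (g (X s w))%:E)%E].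

End Markov.

Section StitProcess.
Variables (R : realType) (l : nat) (d : measure_display) (T : measurableType d)
  (P : probability T R).
Variable Lambda : {measure set (borel (hyperplane R l)) -> \bar R}.

(* Only the values [Y t] with t > 0 matter. *)
Record stit_process (Y : R -> T -> borel (FF [set: 'rV[R]_l.+1])) : Prop :=
  StitProcess {
    stit_tessellation : forall t w, 0 < t -> tessellation (Y t w) ;
    stit_markov : markov_process P [set t | 0 < t] Y ;
    stit_window : forall W : window R l, cell_division_process Lambda P
      (fun t w => if 0 < t then restrict_tess W (Y t w) else whole W) }.

Definition renormalized (a : R) (Y : R -> T -> FF [set: 'rV[R]_l.+1])
    (s : R) (w : T) : FF [set: 'rV[R]_l.+1] :=
  scale_tess (a `^ s) (Y (a `^ s) w).

End StitProcess.

Section Trajectories.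
Variables (R : realType) (l : nat) (W : window R l).

(* Right continuity is in T_W; left limits are taken in the compact space
   F(F'_W) containing T_W. Indeed when a cell of the growing tessellation
   Z leaves W, its trace on W flattens out to a subset of the boundary of W. *)
Definition cadlag (x : R -> TW W) : Prop :=
  forall t, x s @[s --> t^'+] --> x t /\
    exists L : FF W, (val (x s) : FF W) @[s --> t^'-] --> L.

Record trajectory := Trajectory {
  trajectory_fun :> R -> TW W ;
  trajectory_cadlag : cadlag trajectory_fun }.

Lemma cadlag_shift (x : R -> TW W) (t : R) :
  cadlag x -> cadlag (fun s => x (s + t)).
Proof.
move=> cx u; have [xr [L xl]] := cx (u + t).
have ct : (fun s => s + t) @ u --> u + t by apply: cvgD; [exact: cvg_id|exact: cvg_cst].
split.
  move=> A /xr Ar; have := ct _ Ar; apply: (@filterS _ (nbhs u)) => s /= Hs us.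
  by apply: Hs; rewrite ltrD2r.
exists L => A /xl Al; have := ct _ Al; apply: (@filterS _ (nbhs u)) => s /= Hs us.
by apply: Hs; rewrite ltrD2r.
Qed.

Definition shift_traj (t : R) (x : trajectory) : trajectory :=
  Trajectory (cadlag_shift t (trajectory_cadlag x)).

Lemma cadlag_whole : cadlag (fun=> whole W).
Proof.
move=> t; split; first exact: cvg_cst.
by exists (val (whole W)); exact: cvg_cst.
Qed.

(* D_{T_W}(R), with the Skorohod topology for the metric [rho]. *)
Definition skorohod (rho : compatible_metric R (FF W)) : Type := trajectory.

Variable rho : compatible_metric R (FF W).

HB.instance Definition _ := gen_eqMixin (skorohod rho).
HB.instance Definition _ := gen_choiceMixin (skorohod rho).
HB.instance Definition _ := isPointed.Build (skorohod rho)
  (Trajectory cadlag_whole).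

(* A sequence x_n converges to x iff it is eventually in every
   [skorohod_nbhs x m e], i.e. iff there are increasing homeomorphisms lam_n of
   R such that lam_n t - t and rho (x_n t) (x (lam_n t)) tend to 0 uniformly
   for t in compact sets. *)
Definition skorohod_nbhs (x : skorohod rho) (m e : R) : set (skorohod rho) :=
  [set y | exists lam : R -> R,
     [/\ {homo lam : s t / s < t}, bijective lam &
         forall t, `|t| <= m ->
           `|lam t - t| < e /\ rho (val (y t)) (val (x (lam t))) < e]].

Definition skorohod_open : set (set (skorohod rho)) :=
  [set U | forall x, U x ->
     exists m e : R, 0 < e /\ skorohod_nbhs x m e `<=` U].

Lemma skorohod_openT : skorohod_open setT.
Proof. by move=> x _; exists 0, 1; split. Qed.

Lemma skorohod_openI : setI_closed skorohod_open.
Proof.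
move=> A B oA oB x [/oA[m [e [e0 mA]]] /oB[n [f [f0 nB]]]].
exists (Num.max m n), (Num.min e f); split; first by rewrite lt_min e0.
by move=> y [lam [incr bij yx]]; split; [apply: mA|apply: nB];
  exists lam; split=> // t tm; have := yx t; rewrite le_max tm ?orbT;
  move=> /(_ isT)[]; rewrite !lt_min => /andP[? ?] /andP[? ?].
Qed.

Lemma skorohod_open_bigU (I : Type) (f : I -> set (skorohod rho)) :
  (forall i, skorohod_open (f i)) -> skorohod_open (\bigcup_i f i).
Proof.
move=> of_ x [i _ /of_[m [e [e0 fi]]]]; exists m, e; split => //.
by move=> y /fi fiy; exists i.
Qed.

HB.instance Definition _ := isOpenTopological.Build (skorohod rho)
  skorohod_openT skorohod_openI skorohod_open_bigU.

End Trajectories.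

Section Flows.
Variables (R : realType) (d : measure_display) (D : measurableType d)
  (mu : probability D R) (psi : R -> D -> D).

Definition is_flow : Prop := forall t,
  measurable_fun setT (psi t) /\
  forall A, measurable A -> mu (psi t @^-1` A) = mu A.

Definition mixing : Prop := forall A B, measurable A -> measurable B ->
  mu (psi t @^-1` A `&` B) @[t --> +oo] --> (mu A * mu B)%E.

End Flows.

(* Main.v *)
(* A tessellation of W is determined by which pairs of points from a countable dense subset
   of the interior of W lie in the interior of a common cell, so all laws involved are determined
   by the partitions that the cells induce on finitely many points. Under the STIT process these partitions
   form a Markov chain: a block splits into A and B at rate [kappa A B], the Lambda-measure of
   the hyperplanes with A below and B above. This follows from the division tree by conditioning
   on one generation after the other. As Lambda is translation invariant, kappa is homogeneous
   of degree 1 in the points, whence stationarity.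

   Mixing: seen from Y, the point p of W at time s + t is a^-(s+t) p at time a^(s+t). As t tends
   to infinity these points contract to the origin, so at any fixed time they all lie in one cell with
   probability tending to 1, and on that event their future is independent of the past.

   The Markov property of the restricted process needs W to contain the origin: then every
   point seen at time t was inside W, in the coordinates of time s, at every earlier time s.
   This is a consequence of the trajectories being cadlag. If 0 is not in W, then with positive probability the
   cell of 0 misses W at some time and later enters it; at the time of entry its trace on W is flat, and
   the trajectory is not right continuous in T_W.

   The Skorohod Borel sets are generated by the values at rational times, because finitely many
   ball-to-ball switches of a trajectory, located at rational times up to e, determine it
   up to a time change of size e. *)

Require Import Defs.
From HB Require Import structures.
From mathcomp Require Import all_boot all_order all_algebra.
From mathcomp Require Import finmap all_classical all_reals all_analysis.
From mathcomp Require Import measurable_realfun ring lra.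

Set Implicit Arguments.
Unset Strict Implicit.
Unset Printing Implicit Defensive.

Import Order.TTheory GRing.Theory Num.Theory.
Import numFieldNormedType.Exports HBNNSimple.

Local Open Scope classical_set_scope.
Local Open Scope ring_scope.

(** Laws of partitions are tested on products of a function f over the blocks. Since blocks fragment
    independently, the generator closes on such products and gives one differential equation per
    block, triangular in the number of points; nested observation times give [value]. The event that
    two points are apart is a product over blocks, the event that they are together is not: hence
    all basic events are negated ([avoid]), and they are stable under intersection. Two obstacles
    separate the tree from these equations. Its law is given on events (lifetime above t, hyperplane
    in A) for a whole generation, while functions of lifetimes and hyperplanes are needed; the cells
    are therefore treated one at a time, all others being frozen as weights. And the tree is
    infinite: the bound on the expected sum of exp (- theta birth) over a generation halves from one
    generation to the next, so finitely many generations determine the law in the limit. Tangent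
    hyperplanes are discarded throughout ([qhits] instead of [hits]): what is left is measurable
    jointly in the hyperplane and the random cell. *)

Lemma adde_cancel (R : realType) (s a b : \bar R) :
  s \is a fin_num -> (s + a = s + b)%E -> a = b.
Proof. by move=> sf H; rewrite -(addeK a sf) -(addeK b sf) [(a + s)%E]addeC H [(b + s)%E]addeC. Qed.

(** * Equality of weighted image measures *)

Section PushDensity.
Context (R : realType) d1 (T1 : measurableType d1) d2 (T2 : measurableType d2)
  d (E : measurableType d).
Variables (m1 : {measure set T1 -> \bar R}) (m2 : {measure set T2 -> \bar R}).
Variables (X1 : T1 -> E) (X2 : T2 -> E) (g1 : T1 -> R) (g2 : T2 -> R).
Hypotheses (mX1 : measurable_fun setT X1) (mX2 : measurable_fun setT X2).
Hypotheses (mg1 : measurable_fun setT g1) (mg2 : measurable_fun setT g2).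
Hypotheses (g1_ge0 : forall x, 0 <= g1 x) (g2_ge0 : forall x, 0 <= g2 x).
Variable C : set (set E).
Hypotheses (CE : @measurable _ E = <<s C >>) (CI : setI_closed C).
Hypothesis fing : (\int[m1]_x (g1 x)%:E < +oo)%E.
Hypothesis gT : (\int[m1]_x (g1 x)%:E = \int[m2]_x (g2 x)%:E)%E.
Hypothesis gC : forall D, C D ->
  (\int[m1]_x (g1 x * \1_D (X1 x))%:E = \int[m2]_x (g2 x * \1_D (X2 x))%:E)%E.

Let mI dd (T : measurableType dd) (X : T -> E) (g : T -> R) D :
  measurable_fun setT X -> measurable_fun setT g -> measurable D ->
  measurable_fun setT (EFin \o (fun x => g x * \1_D (X x))).
Proof.
move=> mX mg mD; apply/measurable_EFinP; apply: measurable_funM => //.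
by apply: measurableT_comp => //; exact: measurable_indic.
Qed.

(** Dynkin induction: both sides are measures in D, finite because the weights are integrable
    ([fing] and [gT]). Finiteness enters at complements, where the mass of a set is subtracted from
    the total mass. *)
Lemma push_density_set D : measurable D ->
  (\int[m1]_x (g1 x * \1_D (X1 x))%:E = \int[m2]_x (g2 x * \1_D (X2 x))%:E)%E.
Proof.
move=> mD; have : <<s C >> D by rewrite -CE.
move: D {mD}; apply: (dynkin_induction CE CI).
- by under eq_integral do rewrite indicT mulr1;
  under [RHS]eq_integral do rewrite indicT mulr1.
- exact: gC.
- have key dd (T : measurableType dd) (m : {measure set T -> \bar R}) (X : T -> E)
     (g : T -> R) (S : set E) : measurable_fun setT X -> measurable_fun setT g ->
     (forall x, 0 <= g x) -> measurable S ->
     (\int[m]_x (g x)%:E = \int[m]_x (g x * \1_S (X x))%:E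
       + \int[m]_x (g x * \1_(~` S) (X x))%:E)%E.
    move=> mX mg g0 mS; rewrite -ge0_integralD//=; last 4 first.
    - by move=> x _; rewrite lee_fin mulr_ge0.
    - exact: mI.
    - by move=> x _; rewrite lee_fin mulr_ge0.
    - by apply: mI => //; exact: measurableC.
    apply: eq_integral => x _; rewrite -EFinD -mulrDr; congr EFin.
    by rewrite !indicE in_setC; case: (_ \in _); rewrite /= ?addr0 ?add0r mulr1.
  move=> S mS PS; have := gT; rewrite (key _ _ m1 X1 g1 S)// (key _ _ m2 X2 g2 S)// PS.
  have fS : (\int[m2]_x (g2 x * \1_S (X2 x))%:E)%E \is a fin_num.
    rewrite ge0_fin_numE; last first.
      by apply: integral_ge0 => x _; rewrite lee_fin mulr_ge0.
    rewrite -PS; apply: le_lt_trans fing; apply: ge0_le_integral => //.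
    - by move=> x _; rewrite lee_fin mulr_ge0.
    - exact: mI.
    - exact/measurable_EFinP.
    - move=> x _; rewrite lee_fin ler_piMr// indicE; case: (_ \in _) => //=.
  exact: adde_cancel.
- have key dd (T : measurableType dd) (m : {measure set T -> \bar R}) (X : T -> E)
     (g : T -> R) (F : (set E)^nat) : measurable_fun setT X -> measurable_fun setT g ->
     (forall x, 0 <= g x) -> (forall n, measurable (F n)) -> trivIset setT F ->
     (\int[m]_x (g x * \1_(\bigcup_k F k) (X x))%:E =
       \sum_(k <oo) \int[m]_x (g x * \1_(F k) (X x))%:E)%E.
    move=> mX mg g0 mF tF; rewrite -integral_nneseries//=; last 2 first.
    - by move=> n; exact: mI.
    - by move=> n x _; rewrite lee_fin mulr_ge0.
    apply: eq_integral => x _.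
    under eq_eseriesr do rewrite EFinM.
    rewrite nneseriesZl//.
    rewrite EFinM; congr (_ * _)%E.
    by rewrite indic_bigcup.
  move=> F mF tF PF; rewrite !key//.
  by apply: eq_eseriesr => n _; exact: PF.
Qed.

Lemma push_density (J : E -> R) : measurable_fun setT J -> (forall x, 0 <= J x) ->
  (\int[m1]_x (g1 x * J (X1 x))%:E = \int[m2]_x (g2 x * J (X2 x))%:E)%E.
Proof.
move=> mJ J0.
have mJE : measurable_fun setT (EFin \o J) by exact/measurable_EFinP.
pose h := nnsfun_approx measurableT mJE.
have hJ y : (h n y)%:E @[n --> \oo] --> (J y)%:E.
  by apply: (cvg_nnsfun_approx measurableT mJE) => // x _ /=; rewrite lee_fin.
have key dd (T : measurableType dd) (m : {measure set T -> \bar R}) (X : T -> E)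
     (g : T -> R) : measurable_fun setT X -> measurable_fun setT g ->
     (forall x, 0 <= g x) ->
     (\int[m]_x (g x * h n (X x))%:E)%E @[n --> \oo] --> (\int[m]_x (g x * J (X x))%:E)%E.
  move=> mX mg g0.
  have mg' n : measurable_fun setT (EFin \o (fun x => g x * h n (X x))).
    apply/measurable_EFinP; apply: measurable_funM => //.
    by apply: measurableT_comp.
  rewrite (_ : (\int[m]_x (g x * J (X x))%:E)%E =
    (\int[m]_x (limn (fun n => (g x * h n (X x))%:E)))%E).
    apply: cvg_monotone_convergence => //.
    - by move=> n x _; rewrite lee_fin mulr_ge0.
    - move=> x _ a b ab; rewrite lee_fin ler_wpM2l//.
      by have /lefP := nd_nnsfun_approx measurableT mJE ab; exact.
  apply: eq_integral => x _; apply/esym/cvg_lim => //.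
  under eq_fun do rewrite EFinM.
  rewrite EFinM; apply: cvgeZl => //; exact: hJ.
have keyn n : (\int[m1]_x (g1 x * h n (X1 x))%:E = \int[m2]_x (g2 x * h n (X2 x))%:E)%E.
  have key2 dd (T : measurableType dd) (m : {measure set T -> \bar R}) (X : T -> E)
     (g : T -> R) : measurable_fun setT X -> measurable_fun setT g ->
     (forall x, 0 <= g x) -> (\int[m]_x (g x * h n (X x))%:E)%E =
     (\sum_(y \in range (h n)) (y%:E * \int[m]_x (g x * \1_(h n @^-1` [set y]) (X x))%:E))%E.
    move=> mX mg g0.
    have mS y : measurable (h n @^-1` [set y]) by exact: measurable_funPTI.
    transitivity (\sum_(y \in range (h n)) (\int[m]_x (y * (g x * \1_(h n @^-1` [set y]) (X x)))%:E))%E.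
      (* Exchanging sum and integral asks for nonnegative terms at every real y, not only at the
         values of [h n]; on the range, y equals its absolute value. *)
      transitivity (\sum_(y \in range (h n)) (\int[m]_x (`|y| * (g x * \1_(h n @^-1` [set y]) (X x)))%:E))%E.
        rewrite -ge0_integral_fsum//.
        - apply: eq_integral => x _; rewrite fimfunE fsumEFin//; congr EFin.
          rewrite !fsbig_finite//= mulr_sumr; apply: eq_big_seq => y.
          rewrite in_fset_set// inE => -[z _ <-].
          by rewrite ger0_norm// mulrCA.
        - move=> y; apply/measurable_EFinP; apply: measurable_funM => //.
          exact/measurable_EFinP/mI.
        - by move=> y x _; rewrite lee_fin !mulr_ge0.
      apply: eq_fsbigr => y; rewrite inE => -[z _ <-].
      by apply: eq_integral => x _; rewrite ger0_norm.
    apply: eq_fsbigr => y; rewrite inE => -[z _ <-].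
    under eq_integral do rewrite EFinM.
    rewrite ge0_integralZl_EFin//.
    - by move=> x _; rewrite lee_fin mulr_ge0.
    - exact: mI.
  rewrite !key2//; apply: eq_fsbigr => y _; rewrite push_density_set//.
have k1 := key _ _ m1 X1 g1 mX1 mg1 g1_ge0.
have k2 := key _ _ m2 X2 g2 mX2 mg2 g2_ge0.
move: k1; under eq_fun do rewrite keyn; move=> k1.
exact: (cvg_unique _ k1 k2).
Qed.

End PushDensity.

(** * Calculus on the half-line *)

Section RealDerivatives.
Variable R : realType.
Implicit Types (f g : R -> R) (x a b : R).

Lemma is_derive_mul f g x a b : is_derive x 1 f a -> is_derive x 1 g b ->
  is_derive x 1 (fun y => f y * g y) (a * g x + f x * b).
Proof.
move=> Df Dg; have := @is_deriveM R _ f g x 1 a b Df Dg.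
rewrite (_ : f x *: b + g x *: a = a * g x + f x * b)//.
by rewrite /GRing.scale/= addrC [a * _]mulrC.
Qed.

Lemma is_derive_add f g x a b : is_derive x 1 f a -> is_derive x 1 g b ->
  is_derive x 1 (fun y => f y + g y) (a + b).
Proof. by move=> Df Dg; exact: is_deriveD. Qed.

Lemma is_derive_expRM (c x : R) : is_derive x 1 (fun y => expR (c * y)) (c * expR (c * x)).
Proof.
have h : is_derive x 1 (fun y : R => c * y) c.
  have := @is_derive_mul (cst c) id x 0 1 (is_derive_cst _ _ _) (is_derive_id _ _).
  by rewrite mul0r add0r mulr1.
rewrite mulrC; exact: (@is_derive1_comp R expR (fun y => c * y)).
Qed.

Lemma is_derive_continuous f x a : is_derive x 1 f a -> {for x, continuous f}.
Proof.
by move=> Df; apply/differentiable_continuous/derivable1_diffP; exact: ex_derive.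
Qed.

Lemma is_derive_derivative f x a : is_derive x 1 f a -> f^`()%classic x = a.
Proof. by move=> Df; rewrite derive1E; exact: derive_val. Qed.

Lemma antiderivative (S : R -> R) : continuous S ->
  exists F : R -> R, F 0 = 0 /\ forall u : R, 0 <= u -> is_derive u 1 F (S u).
Proof.
(* With base point -1, every u >= 0 is interior to the interval of integration, so the derivative is
   two-sided, also at 0. *)
move=> cS; pose G x := (\int[lebesgue_measure]_(t in `[(-1 : R)%R, x]) (S t))%R.
exists (fun x => G x - G 0); split; first by rewrite subrr.
move=> u u0; rewrite -[S u]addr0.
apply: (@is_derive_add G (cst (- G 0))).
have u1 : u < u + 1 by rewrite ltrDl.
have iS : lebesgue_measure.-integrable `[(-1)%R, u + 1] (EFin \o S).
  apply: continuous_compact_integrable; first exact: segment_compact.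
  exact: continuous_subspaceT.
have [dG GE] := continuous_FTC1_closed u1 iS (lt_le_trans (ltrN10 R) u0) (cS u).
by rewrite -GE derive1E; exact/derivableP.
Qed.

Lemma ge0_derive_le f (f' : R -> R) x : 0 <= x ->
  (forall u : R, 0 <= u -> is_derive u 1 f (f' u)) -> (forall u : R, 0 <= u -> 0 <= f' u) ->
  f 0 <= f x.
Proof.
move=> x0 Df f'0.
apply: (@ger0_derive1_ndecr _ f 0 x) => //.
- move=> u; rewrite in_itv/= => /andP[u0 _]; have ? := Df _ (ltW u0); exact: ex_derive.
- move=> u; rewrite in_itv/= => /andP[u0 _].
  by rewrite (is_derive_derivative (Df _ (ltW u0))) f'0// ltW.
- apply: continuous_in_subspaceT => u; rewrite inE/= in_itv/= => /andP[u0 _].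
  exact: is_derive_continuous (Df _ u0).
Qed.

Lemma derive0_cst f x : 0 <= x -> (forall u : R, 0 <= u -> is_derive u 1 f 0) -> f x = f 0.
Proof.
move=> x0 Df; apply/eqP; rewrite eq_le (@ge0_derive_le f (fun=> 0))// andbT.
rewrite -lerN2; apply: (@ge0_derive_le (fun y => - f y) (fun=> 0)) => //.
move=> u u0; have := @is_derive_mul (cst (-1)) f u 0 0 (is_derive_cst _ _ _) (Df _ u0).
rewrite mul0r mulr0 addr0 (_ : (fun y => _) = (fun y => - f y))//.
by apply/funext => y; rewrite mulN1r.
Qed.

End RealDerivatives.

(** * Fragmentation of a finite set of points *)

(* The partition of a finite set of points by the cells of a tessellation evolves as a
   Markov chain in which a block splits into A and B at rate [kappa A B]. *)
Section Fragmentation.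
Variables (R : realType) (I : finType).
Implicit Types (kappa : {set I} -> {set I} -> R) (f : {set I} -> R)
  (g : R -> {set I} -> R) (A B : {set I}).

Definition splits B : pred {set I} := fun A => (A \proper B) && (A != finset.set0).

(** Generator of the chain, applied to the functional that multiplies f over the blocks of a
    partition, and read off at the partition with the single block B. Blocks fragment independently,
    so the semigroup preserves such functionals and one equation per block suffices. Splits are
    ordered pairs: in the application A is the lower part and [B :\: A] the upper one. *)
Definition frag kappa f B : R :=
  \sum_(A | splits B A) kappa A (B :\: A) * (f A * f (B :\: A) - f B).

Definition split_rate kappa B : R := \sum_(A | splits B A) kappa A (B :\: A).

(** Backward Kolmogorov equation: [g u B] is the expectation of the product of f over the blocks
    into which B has fallen after time u. *)
Definition frag_flow kappa f g : Prop :=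
  g 0 = f /\ forall B (u : R), 0 <= u -> is_derive u 1 (g^~ B) (frag kappa (g u) B).

Lemma splits_cards A B : splits B A -> (#|A| < #|B|)%N /\ (#|B :\: A| < #|B|)%N.
Proof.
move=> /andP[AB A0]; split; first exact: proper_card.
apply: proper_card; rewrite properE subsetDl/=.
apply/negP => /fintype.subsetP BA; case/finset.set0Pn : A0 => x xA.
have xB := fintype.subsetP (proper_sub AB) _ xA.
by have := BA _ xB; rewrite inE xA.
Qed.

Lemma splits_setD A B : splits B A -> splits B (B :\: A).
Proof.
move=> sAB; have [_ c] := splits_cards sAB; apply/andP; split.
  by rewrite properEcard subsetDl.
move: sAB => /andP[/properP[_ [x xB xA]] _]; apply/finset.set0Pn; exists x.
by rewrite inE xA xB.
Qed.

Lemma fragE kappa f B : frag kappa f B =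
  \sum_(A | splits B A) kappa A (B :\: A) * (f A * f (B :\: A)) - split_rate kappa B * f B.
Proof.
rewrite /frag /split_rate mulr_suml -sumrB; apply: eq_bigr => A _.
by rewrite mulrBr.
Qed.

Lemma frag_set0 kappa f : frag kappa f finset.set0 = 0.
Proof.
rewrite /frag big_pred0// => A; rewrite /splits; apply/negP => /andP[].
by rewrite finset.properEneq finset.subset0 => /andP[/negPf ->].
Qed.

Lemma eq_frag kappa f f' B : (forall A, (#|A| <= #|B|)%N -> f A = f' A) ->
  frag kappa f B = frag kappa f' B.
Proof.
move=> ff'; apply: eq_bigr => A /splits_cards[c1 c2].
by rewrite !ff'// ltnW.
Qed.

Lemma is_derive_sumP (P : pred {set I}) (h : {set I} -> R -> R) (h' : {set I} -> R) (x : R) :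
  (forall A, P A -> is_derive x 1 (h A) (h' A)) ->
  is_derive x 1 (fun y => \sum_(A | P A) h A y) (\sum_(A | P A) h' A).
Proof.
move=> H; rewrite [X in is_derive _ _ X _](_ : _ = \sum_(A | P A) h A); last first.
  by apply/funext => y; rewrite fct_sumE.
elim/big_ind2 : _ => //; first exact: is_derive_cst.
by move=> a b c d Ha Hc; exact: is_deriveD.
Qed.

(** Apart from a linear term, [frag] at B involves only blocks smaller than B. The system is
    triangular and is solved by induction on the cardinality; each step is a linear equation, solved
    with an integrating factor of exponent [split_rate kappa B]. *)
Lemma flow_exists kappa f : exists g, frag_flow kappa f g.
Proof.
suff H n : exists g, g 0 = f /\ forall B (u : R), (#|B| <= n)%N -> 0 <= u ->
    is_derive u 1 (g^~ B) (frag kappa (g u) B).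
  have [g [g0 gD]] := H #|I|; exists g; split => // B u u0; apply: gD => //.
  exact: max_card.
elim: n => [|n [g [g0 gD]]].
  exists (fun _ => f); split=> // B u; rewrite leqn0 cards_eq0 => /eqP -> u0.
  by rewrite frag_set0; exact: is_derive_cst.
pose Q B u := \sum_(A | splits B A) kappa A (B :\: A) * (g u A * g u (B :\: A)).
(* The induction hypothesis only speaks of u >= 0. Freezing the source term for negative u makes it
   continuous on the whole line, as [antiderivative] asks. *)
pose S B u := expR (split_rate kappa B * Num.max u 0) * Q B (Num.max u 0).
have cmax : continuous (fun u : R => Num.max u 0).
  move=> u; apply: (@continuous_max R _ id (cst 0)); first exact: cvg_id.
  exact: cvg_cst.
have cS B : (#|B| <= n.+1)%N -> continuous (S B).
  move=> Bn u.
  suff : {for Num.max u 0, continuous (fun v => expR (split_rate kappa B * v) * Q B v)}.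
    by move=> c; apply: (@continuous_comp _ _ _ _ _ _ (cmax u) c).
  have m0 : 0 <= Num.max u 0 by rewrite le_max lexx orbT.
  have DQ : is_derive (Num.max u 0) 1 (Q B) (\sum_(A | splits B A)
     (0 * (g (Num.max u 0) A * g (Num.max u 0) (B :\: A)) + kappa A (B :\: A) *
      (frag kappa (g (Num.max u 0)) A * g (Num.max u 0) (B :\: A) +
       g (Num.max u 0) A * frag kappa (g (Num.max u 0)) (B :\: A)))).
    apply: is_derive_sumP => A /splits_cards[c1 c2].
    apply: (is_derive_mul (f := cst (kappa A (B :\: A)))).
    by apply: is_derive_mul; apply: gD => //; rewrite -ltnS; exact: leq_trans Bn.
  exact: is_derive_continuous (is_derive_mul (is_derive_expRM (split_rate kappa B) _) DQ).
have aF B : exists F : R -> R, (#|B| <= n.+1)%N ->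
    F 0 = 0 /\ forall u : R, 0 <= u -> is_derive u 1 F (S B u).
  have [Bn|_] := boolP (#|B| <= n.+1)%N; last by exists (fun=> 0).
  by have [F HF] := antiderivative (cS B Bn); exists F.
have [F HF] := boolp.choice aF.
pose g' u B := if (#|B| <= n)%N then g u B
  else expR (- split_rate kappa B * u) * (f B + F B u).
pose g'' u B := if (#|B| <= n.+1)%N then g' u B else f B.
have g''E u B : (#|B| <= n)%N -> g'' u B = g u B.
  by move=> Bn; rewrite /g'' /g' (leqW Bn) Bn.
exists g''; split.
  apply/funext => B; rewrite /g'' /g'; case: ifPn => // Bn; case: ifPn => _; first by rewrite g0.
  by rewrite mulr0 expR0 mul1r (HF _ Bn).1 addr0.
move=> B u Bn u0; have [Bn'|Bn'] := boolP (#|B| <= n)%N.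
  rewrite (_ : g''^~ B = g^~ B); last by apply/funext => v; exact: g''E.
  rewrite (@eq_frag _ _ (g u)); first exact: gD.
  by move=> A AB; rewrite g''E// (leq_trans AB).
rewrite fragE (_ : \sum_(A | _) _ = Q B u); last first.
  apply: eq_bigr => A /splits_cards[c1 c2].
  by rewrite !g''E// -ltnS; exact: leq_trans Bn.
rewrite [X in is_derive _ _ X _](_ : _ =
   (fun u => expR (- split_rate kappa B * u) * (f B + F B u))); last first.
  by apply/funext => v; rewrite /g'' Bn /g' (negPf Bn').
have H1 := is_derive_expRM (- split_rate kappa B) u.
have H2 := @is_derive_add _ _ _ _ _ _ (is_derive_cst (f B) u 1) ((HF _ Bn).2 u u0).
have := is_derive_mul H1 H2.
rewrite /g'' Bn /g' (negPf Bn') [X in is_derive _ _ _ X -> _](_ : _ =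
  Q B u - split_rate kappa B * (expR (- split_rate kappa B * u) * (f B + F B u)))//.
have e1 : expR (- split_rate kappa B * u) * expR (split_rate kappa B * u) = 1.
  by rewrite -expRD mulNr addNr expR0.
by rewrite add0r /S max_l// mulrA e1 mul1r addrC mulNr mulNr mulrA.
Qed.

Definition flow kappa f : R -> {set I} -> R := projT1 (cid (flow_exists kappa f)).

Lemma flowP kappa f : frag_flow kappa f (flow kappa f).
Proof. exact: projT2 (cid (flow_exists kappa f)). Qed.

Lemma flow0 kappa f : flow kappa f 0 = f. Proof. by case: (flowP kappa f). Qed.

Lemma is_derive_flow kappa f B (u : R) : 0 <= u ->
  is_derive u 1 ((flow kappa f)^~ B) (frag kappa (flow kappa f u) B).
Proof. by case: (flowP kappa f) => _; exact. Qed.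

Lemma frag_flow_set0 kappa f g (u : R) : frag_flow kappa f g -> 0 <= u ->
  g u finset.set0 = f finset.set0.
Proof.
move=> [g0 gD] u0; transitivity (g 0 finset.set0); last by rewrite g0.
apply: (@derive0_cst _ (g^~ finset.set0)) => // v v0.
by rewrite -(frag_set0 kappa (g v)); exact: gD.
Qed.

(** Same triangular structure: once the smaller blocks agree, the difference at B times the
    integrating factor has derivative 0 and starts from 0. *)
Lemma flow_unique kappa f g g' (u : R) B : frag_flow kappa f g -> frag_flow kappa f g' ->
  0 <= u -> g u B = g' u B.
Proof.
move=> Fg Fg'; have [g0 gD] := Fg; have [g'0 g'D] := Fg'; move: {2}(#|B|) (leqnn #|B|) => n.
elim: n B u => [|n IH] B u Bn u0.
  have -> : B = finset.set0 by apply/eqP; rewrite -cards_eq0 -leqn0.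
  by rewrite (frag_flow_set0 Fg u0) (frag_flow_set0 Fg' u0).
pose l := split_rate kappa B.
pose h v := expR (l * v) * (g v B - g' v B).
have : h u = h 0.
  apply: derive0_cst => // v v0.
  have D1 := is_derive_mul (is_derive_cst (-1 : R) v 1) (g'D B v v0).
  have := is_derive_mul (is_derive_expRM l v) (is_derive_add (gD B v v0) D1).
  rewrite [X in is_derive _ _ X _ -> _](_ : _ = h); last first.
    by apply/funext => w; rewrite /h mulN1r.
  rewrite [X in is_derive _ _ _ X -> _](_ : _ = 0)//.
  rewrite !fragE (_ : \sum_(A | _) _ =
    \sum_(A | splits B A) kappa A (B :\: A) * (g' v A * g' v (B :\: A))); last first.
    apply: eq_bigr => A /splits_cards[c1 c2].
    by rewrite !IH// -ltnS; exact: leq_trans Bn.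
  rewrite -/l mul0r add0r mulN1r /cst; ring.
rewrite /h g0 g'0 subrr mulr0 => /eqP.
by rewrite mulf_eq0 gt_eqF ?expR_gt0//= subr_eq0 => /eqP.
Qed.

(** If the smaller blocks have values in [0, 1], the gain term Q lies between 0 and the split rate
    l. Hence g B and 1 - g B, both multiplied by exp (l u), are nondecreasing in u. *)
Lemma flow_bounds kappa f (u : R) B : (forall A B, 0 <= kappa A B) ->
  (forall B, 0 <= f B <= 1) -> 0 <= u -> 0 <= flow kappa f u B <= 1.
Proof.
move=> k0 f01; move: {2}(#|B|) (leqnn #|B|) => n; elim: n B u => [|n IH] B u Bn u0.
  have -> : B = finset.set0 by apply/eqP; rewrite -cards_eq0 -leqn0.
  by rewrite (frag_flow_set0 (flowP kappa f) u0).
pose l := split_rate kappa B; set g := flow kappa f.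
pose Q v := \sum_(A | splits B A) kappa A (B :\: A) * (g v A * g v (B :\: A)).
have Q0 (v : R) : 0 <= v -> 0 <= Q v <= l.
  move=> v0; rewrite /l /split_rate /Q; apply/andP; split.
    apply: sumr_ge0 => A /splits_cards[c1 c2]; apply: mulr_ge0 => //.
    have /andP[? _] := IH A v (leq_trans c1 Bn) v0.
    have /andP[? _] := IH (B :\: A) v (leq_trans c2 Bn) v0.
    exact: mulr_ge0.
  apply: ler_sum => A /splits_cards[c1 c2]; apply: ler_piMr => //.
  have /andP[? ?] := IH A v (leq_trans c1 Bn) v0.
  have /andP[? ?] := IH (B :\: A) v (leq_trans c2 Bn) v0.
  exact: mulr_ile1.
have D1 (v : R) : 0 <= v -> is_derive v 1 (fun v => expR (l * v) * g v B) (expR (l * v) * Q v).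
  move=> v0; have := is_derive_mul (is_derive_expRM l v) (is_derive_flow kappa f B v0).
  rewrite fragE -/(Q v) -/l -/g [X in is_derive _ _ _ X -> _](_ : _ = expR (l * v) * Q v)//.
  ring.
have D2 (v : R) : 0 <= v -> is_derive v 1 (fun v => expR (l * v) * (1 - g v B))
    (expR (l * v) * (l - Q v)).
  move=> v0.
  have D3 := is_derive_mul (is_derive_cst (-1 : R) v 1) (D1 v v0).
  have := is_derive_add (is_derive_expRM l v) D3.
  rewrite [X in is_derive _ _ X _ -> _](_ : _ = (fun v => expR (l * v) * (1 - g v B))).
    rewrite [X in is_derive _ _ _ X -> _](_ : _ = (expR (l * v) * (l - Q v)))//.
    rewrite /cst; ring.
  by apply/funext => w; rewrite /cst; ring.
have /andP[f0 f1] := f01 B.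
apply/andP; split.
  have := ge0_derive_le u0 D1; rewrite mulr0 expR0 mul1r /g flow0 => H.
  have := le_trans f0 (H _); rewrite pmulr_rge0 ?expR_gt0//; apply => v v0.
  by rewrite mulr_ge0 ?expR_ge0//; have /andP[] := Q0 v v0.
have := ge0_derive_le u0 D2; rewrite mulr0 expR0 mul1r /g flow0 => H.
have f1' : 0 <= 1 - f B by rewrite subr_ge0.
have := le_trans f1' (H _); rewrite pmulr_rge0 ?expR_gt0// subr_ge0; apply => v v0.
by rewrite mulr_ge0 ?expR_ge0// subr_ge0; have /andP[] := Q0 v v0.
Qed.

Lemma flow_set0 kappa f (u : R) : 0 <= u -> flow kappa f u finset.set0 = f finset.set0.
Proof.
by move=> u0; rewrite (frag_flow_set0 (flowP kappa f) u0).
Qed.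

Lemma flow_scale kappa f (c u : R) B : 0 < c -> 0 <= u ->
  flow (fun A B => c * kappa A B) f u B = flow kappa f (c * u) B.
Proof.
move=> c0 u0; apply: (@flow_unique _ _ _ (fun u => flow kappa f (c * u))) => //.
  exact: flowP.
split; first by rewrite mulr0 flow0.
move=> A v v0.
have cv : 0 <= c * v by rewrite mulr_ge0// ltW.
have h : is_derive v 1 (fun y : R => c * y) c.
  have := @is_derive_mul _ (cst c) id v 0 1 (is_derive_cst _ _ _) (is_derive_id _ _).
  by rewrite mul0r add0r mulr1.
have := @is_derive1_comp R ((flow kappa f)^~ A) (fun y => c * y) v _ _
  (is_derive_flow kappa f A cv) h.
rewrite /comp [X in is_derive _ _ _ X -> _](_ : _ = frag (fun A B => c * kappa A B) (flow kappa f (c * v)) A)//.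
by rewrite /frag mulr_suml; apply: eq_bigr => D _; rewrite mulrC mulrA.
Qed.

End Fragmentation.

Lemma measurable_sum_cond (R : realType) d (T : measurableType d) (J : Type) (r : seq J)
    (P : pred J) (h : J -> T -> R) :
  (forall i, P i -> measurable_fun setT (h i)) ->
  measurable_fun setT (fun x => \sum_(i <- r | P i) h i x).
Proof.
move=> mh; elim: r => [|i r IH].
  by under eq_fun do rewrite big_nil; exact: measurable_cst.
have [Pi|/negbTE Pi] := boolP (P i); under eq_fun do rewrite big_cons Pi; last by [].
by apply: measurable_funD => //; exact: mh.
Qed.

(** * Observations at several times *)

Section Value.
Variables (R : realType) (I : finType).
Implicit Types (kappa : {set I} -> {set I} -> R) (f : {set I} -> R)
  (L : seq (R * ({set I} -> R))) (A B : {set I}) (s t u x lam : R).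

(* [value kappa L s B] is the expectation of the product, over the (t, f) in L with
   s <= t, of the products of f over the blocks present at time t, for the fragmentation
   started from the single block B at time s. *)
Fixpoint value kappa L s B : R :=
  if L is p :: L' then
    if s <= p.1 then flow kappa (fun A => p.2 A * value kappa L' p.1 A) (p.1 - s) B
    else value kappa L' s B
  else 1.

(** Factor contributed by one cell with block B, born at s and living for the time x: the
    observations that fall into its life. The interval is half-open, as in [tree_tess]. *)
Definition weight L s x B : R :=
  \prod_(p <- L) (if s <= p.1 < s + x then p.2 B else 1).

(** Expected value just after the death of a cell with block B that is hit at rate lam. Multiplied
    by lam it is the sum of [kappa A (B :\: A)] times the values of both parts, plus lam -
    [split_rate kappa B] times the value of B itself: a hyperplane may divide the cell without
    separating its points. *)
Definition split_value kappa lam L s B : R :=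
  value kappa L s B + lam^-1 * frag kappa (value kappa L s) B.

(** The value 1 at the empty set makes cells that contain none of the points invisible. *)
Definition weights_ok L := forall p, p \in L -> (forall B, 0 <= p.2 B <= 1) /\ p.2 finset.set0 = 1.

Lemma weights_ok_cons p L : weights_ok (p :: L) ->
  [/\ forall B, 0 <= p.2 B <= 1, p.2 finset.set0 = 1 & weights_ok L].
Proof.
move=> w; have [|? ?] := w p; first by rewrite inE eqxx.
by split => // q qL; apply: w; rewrite inE qL orbT.
Qed.

Lemma value_bounds kappa L s B : (forall A B, 0 <= kappa A B) -> weights_ok L ->
  0 <= value kappa L s B <= 1.
Proof.
move=> k0; elim: L s B => [|p L IH] s B; first by rewrite /= ler01 lexx.
move=> /weights_ok_cons[p01 _ wL] /=; case: ifPn => sp; last exact: IH.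
apply: flow_bounds => // [A|]; last by rewrite subr_ge0.
have /andP[? ?] := p01 A; have /andP[? ?] := IH p.1 A wL.
by rewrite mulr_ge0//= mulr_ile1.
Qed.

Lemma value_set0 kappa L s : weights_ok L -> value kappa L s finset.set0 = 1.
Proof.
elim: L s => [//|p L IH] s /weights_ok_cons[_ p0 wL] /=; case: ifPn => sp; last exact: IH.
by rewrite flow_set0 ?subr_ge0// p0 mul1r IH.
Qed.

Lemma value_late kappa L s B : (forall p, p \in L -> p.1 < s) -> value kappa L s B = 1.
Proof.
elim: L => [//|p L IH] H /=; rewrite leNgt H ?inE ?eqxx//=; apply: IH => q qL.
by apply: H; rewrite inE qL orbT.
Qed.

Lemma weight_bounds L s x B : weights_ok L -> 0 <= weight L s x B <= 1.
Proof.
move=> wL; rewrite /weight; elim: L wL => [|p L IH]; first by rewrite big_nil ler01 lexx.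
move=> /weights_ok_cons[p01 _ /IH /andP[? ?]]; rewrite big_cons.
have /andP[? ?] : 0 <= (if s <= p.1 < s + x then p.2 B else 1) <= 1.
  by case: ifP => // _; rewrite ler01 lexx.
by rewrite mulr_ge0//= mulr_ile1.
Qed.

Lemma split_value_ge0 kappa lam L s B : (forall A B, 0 <= kappa A B) -> weights_ok L ->
  0 < lam -> split_rate kappa B <= lam -> 0 <= split_value kappa lam L s B.
Proof.
move=> k0 wL lam0 Blam.
rewrite -(pmulr_rge0 _ lam0) /split_value mulrDr mulrA divff ?gt_eqF// mul1r fragE.
have v0 A : 0 <= value kappa L s A by have /andP[] := value_bounds s A k0 wL.
rewrite addrCA -mulrBl addr_ge0//.
  by apply: sumr_ge0 => A _; rewrite !mulr_ge0.
by rewrite mulr_ge0// subr_ge0.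
Qed.

Lemma measurable_value kappa L B : measurable_fun setT (value kappa L ^~ B).
Proof.
elim: L => [|p L IH] /=; first exact: measurable_cst.
set F := fun A => _.
rewrite (_ : (fun s => _) = (fun s => if s <= p.1 then
   flow kappa F (Num.max (p.1 - s) 0) B else value kappa L s B)); last first.
  by apply/funext => s; case: ifPn => // sp; rewrite max_l// subr_ge0.
apply: measurable_fun_ifT => //.
  by apply: measurable_fun_ler => //; exact: measurable_cst.
apply: continuous_measurable_fun => s.
have m0 : 0 <= Num.max (p.1 - s) 0 by rewrite le_max lexx orbT.
apply: (@continuous_comp _ _ _ (fun s => Num.max (p.1 - s) 0) (fun u => flow kappa F u B)); last first.
  exact: is_derive_continuous (is_derive_flow kappa F B m0).
apply: (@continuous_max R _ (fun s => p.1 - s) (cst 0)); last exact: cvg_cst.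
by apply: cvgB; [exact: cvg_cst|exact: cvg_id].
Qed.

Lemma measurable_weight L B :
  measurable_fun setT (fun z : R * R => weight L z.1 z.2 B).
Proof.
rewrite /weight; elim: L => [|p L IH].
  by under eq_fun do rewrite big_nil; exact: measurable_cst.
under eq_fun do rewrite big_cons; apply: measurable_funM => //.
apply: measurable_fun_ifT => //.
apply: measurable_and.
  by apply: measurable_fun_ler => //; exact: measurable_cst.
by apply: measurable_fun_ltr; [exact: measurable_cst|apply: measurable_funD].
Qed.

Lemma integral_expR_tail (lam x : R) : 0 < lam ->
  (\int[lebesgue_measure]_(t in `]x, +oo[) (lam * expR (- lam * t))%:E)%E =
  (expR (- lam * x))%:E.
Proof.
move=> lam0.
have D (y : R) : is_derive y 1 (fun t => - expR (- lam * t)) (lam * expR (- lam * y)).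
  have := is_derive_mul (is_derive_cst (-1 : R) y 1) (is_derive_expRM (- lam) y).
  rewrite [X in is_derive _ _ X _ -> _](_ : _ = (fun t => - expR (- lam * t))).
    by rewrite mul0r add0r mulN1r mulNr opprK.
  by apply/funext => t; rewrite /cst mulN1r.
have cf : continuous (fun t : R => lam * expR (- lam * t)).
  move=> y; exact: is_derive_continuous (is_derive_mul (is_derive_cst lam y 1)
    (is_derive_expRM (- lam) y)).
rewrite integral_itv_obnd_cbnd; last first.
  apply/measurable_EFinP/measurable_funTS; apply: measurable_funM => //.
  by apply: measurableT_comp => //; apply: measurable_funM.
rewrite (@ge0_continuous_FTC2y R _ (fun t => - expR (- lam * t)) _ 0).
- by rewrite EFinN oppeK add0e.
- by move=> y _; rewrite mulr_ge0 ?expR_ge0// ltW.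
- exact: continuous_subspaceT.
- rewrite -oppr0; apply: cvgN.
  rewrite (_ : (fun t => expR (- lam * t)) =
               (fun z => expR (- z)) \o (fun z => lam * z)); last first.
    by apply: eq_fun => t; rewrite mulNr.
  apply: (@cvg_comp _ _ _ _ _ _ (pinfty_nbhs R)); last exact: cvgr_expR.
  exact: gt0_cvgMry.
- by move=> y _; have ? := D y; exact: ex_derive.
- by apply/cvg_at_right_filter; exact: is_derive_continuous (D x).
- by move=> y _; rewrite (is_derive_derivative (D y)).
Qed.

Lemma measurable_step kappa lam L s x y B : measurable_fun setT (fun t : R =>
  lam * expR (- lam * t) * (weight L (s + x) (t - y) B * split_value kappa lam L (s + t) B)).
Proof.
have mcs : measurable_fun setT (fun t : R => s + t) by apply: measurable_funD.
have mv A : measurable_fun setT (fun t => value kappa L (s + t) A).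
  exact: (measurableT_comp (measurable_value kappa L A) mcs).
apply: measurable_funM; last apply: measurable_funM.
- apply: measurable_funM => //.
  by apply: measurableT_comp => //; apply: measurable_funM.
- apply: (measurableT_comp (f := fun z : R * R => weight L z.1 z.2 B)
    (g := fun t => (s + x, t - y))); first exact: measurable_weight.
  apply: measurable_fun_pair; [exact: measurable_cst|exact: measurable_funB].
- apply: measurable_funD => //; apply: measurable_funM => //; rewrite /frag.
  apply: measurable_sum_cond => A _.
  by apply: measurable_funM => //; apply: measurable_funB => //; apply: measurable_funM.
Qed.

Lemma step_ge0 kappa lam L s x t u B : (forall A B, 0 <= kappa A B) -> weights_ok L ->
  0 < lam -> split_rate kappa B <= lam ->
  0 <= lam * expR t * (weight L s x B * split_value kappa lam L u B).
Proof.
move=> k0 wL lam0 Blam; have /andP[w0 _] := weight_bounds s x B wL.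
by rewrite mulr_ge0 ?(mulr_ge0 (ltW lam0)) ?expR_ge0// mulr_ge0// split_value_ge0.
Qed.

(** Decomposition at the death of the first cell. The lower limit x, a survived age, is what makes
    the induction on L work: past the first observation the integral has the same form for the
    remaining ones, multiplied by the weight of the first. *)
Lemma one_step kappa lam L s x B :
  (forall A B, 0 <= kappa A B) -> weights_ok L -> 0 < lam ->
  split_rate kappa B <= lam -> sorted <=%O (map fst L) ->
  (\int[lebesgue_measure]_(t in `]x, +oo[) (lam * expR (- lam * t) *
     (weight L (s + x) (t - x) B * split_value kappa lam L (s + t) B))%:E)%E =
  (expR (- lam * x) * value kappa L (s + x) B)%:E.
Proof.
move=> k0 wL lam0 Blam; elim: L wL x => [|p L IH] wL x.
  move=> _; rewrite /= mulr1 -integral_expR_tail//; apply: eq_integral => t _.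
  rewrite /weight big_nil /split_value /= (_ : frag _ _ _ = 0) ?mulr0 ?addr0 ?mulr1//.
  by rewrite /frag big1// => A _; rewrite mul1r subrr mulr0.
move=> pL; have [p01 p0 wL'] := weights_ok_cons wL.
have sL : sorted <=%O (map fst L) by exact: path_sorted pL.
have Lp q : q \in L -> p.1 <= q.1.
  move=> qL; have := order_path_min le_trans pL; move/allP => /(_ q.1); apply.
  exact: map_f.
set F := fun A => p.2 A * value kappa L p.1 A.
have [xt|tx] := leP (s + x) p.1; last first.
  rewrite /= leNgt tx/= -IH//; apply: eq_integral => t; rewrite inE/= in_itv/= andbT => xt.
  have pt : p.1 < s + t by rewrite (lt_trans tx)// ltrD2l.
  congr (EFin (_ * (_ * _))); last first.
    by rewrite /split_value /= leNgt pt.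
  by rewrite /weight big_cons leNgt tx/= mul1r.
(* d is the age of the cell at the first observation. Before d nothing is observed, and the
   integrand is the derivative of minus exp (- lam t) times the flow at time d - t; after d, the
   induction hypothesis applies at x = d. *)
set d := p.1 - s; have xd : x <= d by rewrite lerBrDl.
rewrite /= xt.
have splitI : `]x, +oo[%classic = `]x, d] `|` `]d, +oo[ :> set R.
  by rewrite -itv_bndbnd_setU ?bnd_simp.
have mI : measurable_fun `]x, +oo[%classic (fun t => (lam * expR (- lam * t) *
     (weight (p :: L) (s + x) (t - x) B * split_value kappa lam (p :: L) (s + t) B))%:E).
  apply/measurable_EFinP/measurable_funTS.
  exact: measurable_step.
rewrite splitI ge0_integral_setU//=; first last.
- by rewrite disj_set2E; apply/eqP/seteqP; split => // t [] /=;
    rewrite !in_itv/= andbT => /andP[_ td] /(le_lt_trans td); rewrite ltxx.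
- by move=> t _; rewrite lee_fin step_ge0.
- by rewrite -splitI.
have -> : (\int[lebesgue_measure]_(t in `]d, +oo[) (lam * expR (- lam * t) *
     (weight (p :: L) (s + x) (t - x) B * split_value kappa lam (p :: L) (s + t) B))%:E =
   (p.2 B)%:E * \int[lebesgue_measure]_(t in `]d, +oo[) (lam * expR (- lam * t) *
     (weight L (s + d) (t - d) B * split_value kappa lam L (s + t) B))%:E)%E.
  rewrite -ge0_integralZl_EFin//; last 3 first.
  - by move=> t _; rewrite lee_fin step_ge0.
  - apply/measurable_EFinP/measurable_funTS.
    exact: measurable_step.
  - by have /andP[] := p01 B.
  apply: eq_integral => t; rewrite inE/= in_itv/= andbT => dt.
  have pt : p.1 < s + t by rewrite -ltrBlDl.
  rewrite -EFinM; congr EFin.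
  rewrite [in RHS]mulrCA; congr (_ * _); rewrite mulrA; congr (_ * _); last first.
    by rewrite /split_value /= leNgt pt.
  rewrite /weight big_cons xt/= (_ : s + x + (t - x) = s + t); last by ring.
  rewrite pt; congr (_ * _); apply: eq_big_seq => q /Lp pq.
  rewrite (le_trans xt pq)/= (_ : s + d + (t - d) = s + t); last by ring.
  by rewrite (_ : s + d = p.1) ?pq// /d addrC subrK.
rewrite IH// (_ : s + d = p.1); last by rewrite /d addrC subrK.
have DF (t : R) : t <= d -> is_derive t 1 (fun t => - expR (- lam * t) * flow kappa F (d - t) B)
   (lam * expR (- lam * t) * (flow kappa F (d - t) B + lam^-1 * frag kappa (flow kappa F (d - t)) B)).
  move=> td; have dt : 0 <= d - t by rewrite subr_ge0.
  have D1 : is_derive t 1 (fun t => - expR (- lam * t)) (lam * expR (- lam * t)).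
    have := is_derive_mul (is_derive_cst (-1 : R) t 1) (is_derive_expRM (- lam) t).
    rewrite [X in is_derive _ _ X _ -> _](_ : _ = (fun t => - expR (- lam * t))).
      by rewrite mul0r add0r mulN1r mulNr opprK.
    by apply/funext => y; rewrite /cst mulN1r.
  have D2 : is_derive t 1 (fun t => d - t) (-1).
    have := is_derive_add (is_derive_cst d t 1)
      (is_derive_mul (is_derive_cst (-1 : R) t 1) (is_derive_id t 1)).
    rewrite [X in is_derive _ _ X _ -> _](_ : _ = (fun t => d - t)).
      by rewrite mul0r !add0r mulr1.
    by apply/funext => y; rewrite /cst mulN1r.
  have D3 := @is_derive1_comp R ((flow kappa F)^~ B) (fun t => d - t) t _ _
    (is_derive_flow kappa F B dt) D2.
  have := is_derive_mul D1 D3; rewrite /comp => D4.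
  apply: (@is_derive_eq _ _ _ _ _ _ _ _ D4).
  have -> : lam * expR (- lam * t) * (flow kappa F (d - t) B + lam^-1 * frag kappa (flow kappa F (d - t)) B)
    = lam * expR (- lam * t) * flow kappa F (d - t) B + expR (- lam * t) * (lam / lam) * frag kappa (flow kappa F (d - t)) B.
    ring.
  by rewrite divff ?gt_eqF//; ring.
have -> : (\int[lebesgue_measure]_(t in `]x, d]) (lam * expR (- lam * t) *
     (weight (p :: L) (s + x) (t - x) B * split_value kappa lam (p :: L) (s + t) B))%:E =
  (\int[lebesgue_measure]_(t in `]x, d]) (lam * expR (- lam * t) *
     (flow kappa F (d - t) B + lam^-1 * frag kappa (flow kappa F (d - t)) B))%:E))%E.
  apply: eq_integral => t; rewrite inE/= in_itv/= => /andP[xt' td].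
  have tp : s + t <= p.1 by rewrite -lerBrDl.
  have dE : p.1 - (s + t) = d - t by rewrite /d; ring.
  congr (EFin (_ * _)); rewrite (_ : weight _ _ _ _ = 1); last first.
    rewrite /weight big_seq big1// => q; rewrite inE => qL.
    rewrite (_ : s + x + (t - x) = s + t); last by ring.
    have -> : q.1 < s + t = false; last by rewrite andbF.
    apply/negbTE; rewrite -leNgt (le_trans tp)//.
    by case/orP : qL => [/eqP ->//|/Lp].
  by rewrite mul1r /split_value /= tp dE.
have cF : {within `[x, d], continuous (fun t => lam * expR (- lam * t) *
     (flow kappa F (d - t) B + lam^-1 * frag kappa (flow kappa F (d - t)) B))}.
  apply: continuous_in_subspaceT => t; rewrite inE/= in_itv/= => /andP[_ td].
  have dt : 0 <= d - t by rewrite subr_ge0.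
  have cdt : {for t, continuous (fun t => d - t)}.
    by apply: cvgB; [exact: cvg_cst|exact: cvg_id].
  have cA A : {for t, continuous (fun t => flow kappa F (d - t) A)}.
    apply: (@continuous_comp _ _ _ (fun t => d - t) (fun u => flow kappa F u A)) => //.
    exact: is_derive_continuous (is_derive_flow kappa F A dt).
  apply: cvgM.
    exact: is_derive_continuous (is_derive_mul (is_derive_cst lam t 1) (is_derive_expRM (- lam) t)).
  apply: cvgD; first exact: cA.
  apply: cvgM; first exact: cvg_cst.
  rewrite /frag; apply: cvg_big => //; first exact: add_continuous.
  move=> A _; apply: cvgM; first exact: cvg_cst.
  apply: cvgB; last exact: cA.
  by apply: cvgM; exact: cA.
have F0 : flow kappa F 0 B = p.2 B * value kappa L p.1 B by rewrite flow0.
have pxE : p.1 - (s + x) = d - x by rewrite /d; ring.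
move: xd; rewrite le_eqVlt => /predU1P[xd|xd].
  rewrite -xd set_itv_ge ?bnd_simp// integral_set0 add0e -EFinM.
  by congr EFin; rewrite pxE -xd subrr F0 mulrCA.
rewrite integral_itv_obnd_cbnd; last first.
  apply/measurable_EFinP.
  apply: (measurable_funS (E := `[x, d]%classic)) => //; first exact: subset_itv_oc_cc.
  exact: subspace_continuous_measurable_fun.
rewrite (continuous_FTC2 (F := fun t => - expR (- lam * t) * flow kappa F (d - t) B))//.
- rewrite subrr F0 -EFinM -EFinB -EFinD pxE; congr EFin; ring.
- split.
  + by move=> t; rewrite in_itv/= => /andP[_ /ltW td]; have ? := DF _ td; exact: ex_derive.
  + by apply/cvg_at_right_filter; exact: is_derive_continuous (DF _ (ltW xd)).
  + by apply/cvg_at_left_filter; exact: is_derive_continuous (DF _ (lexx d)).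
- by move=> t; rewrite in_itv/= => /andP[_ /ltW td]; rewrite (is_derive_derivative (DF _ td)).
Qed.

Lemma value_scale kappa c L s B : 0 < c ->
  value (fun A B => c * kappa A B) [seq (p.1 / c, p.2) | p <- L] s B =
  value kappa L (c * s) B.
Proof.
move=> c0; elim: L s B => [//|p L IH] s B /=.
rewrite ler_pdivlMr// [s * c]mulrC; case: ifPn => cs; last exact: IH.
have e : c * (p.1 / c) = p.1 by rewrite mulrCA divff ?mulr1// gt_eqF.
rewrite flow_scale//; last by rewrite subr_ge0 ler_pdivlMr// mulrC.
rewrite mulrBr e; congr (flow _ _ _ _); apply/funext => A.
by rewrite IH e.
Qed.

(** If B contains i, exactly one block of any partition of B does, so the product of these
    indicators never changes. For a single point this says that it almost surely lies in the
    interior of a cell ([point_in_cell]). *)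
Lemma flow_avoid kappa (i : I) u B : 0 <= u ->
  flow kappa (fun A => (i \notin A)%:R) u B = (i \notin B)%:R.
Proof.
move=> u0; apply: (@flow_unique _ _ kappa _ _ (fun _ A => (i \notin A)%:R) u B (flowP _ _)) => //.
split => // A v v0.
rewrite (_ : frag _ _ _ = 0); first exact: is_derive_cst.
rewrite /frag big1// => D /andP[/proper_sub/fintype.subsetP DA _].
rewrite inE; have [iD|iD] := boolP (i \in D); first by rewrite DA//= mul0r subrr mulr0.
by rewrite /= mul1r subrr mulr0.
Qed.

Lemma flow_together kappa u : finset.set0 != finset.setT :> {set I} -> 0 <= u ->
  flow kappa (fun B => ((B == finset.set0) || (B == finset.setT))%:R) u finset.setT =
  expR (- split_rate kappa finset.setT * u).
Proof.
move=> I0 u0; pose g (v : R) (B : {set I}) : R := if B == finset.set0 then 1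
  else if B == finset.setT then expR (- split_rate kappa finset.setT * v) else 0.
transitivity (g u finset.setT); last by rewrite /g eq_sym (negPf I0) eqxx.
apply: (@flow_unique _ _ kappa _ _ _ _ _ (flowP _ _)) => //; split.
  apply/funext => B; rewrite /g mulr0 expR0.
  by case: ifPn => //= _; case: ifPn.
move=> B v v0; have gs A : splits B A -> g v A * g v (B :\: A) = 0.
  move=> sA; have /andP[AB A0] := sA; rewrite {1}/g (negPf A0) ifF ?mul0r//.
  by apply/negbTE; apply: contraTneq AB => ->; rewrite properE finset.subsetT andbF.
rewrite /g; have [->|B0] := eqVneq B finset.set0.
  by rewrite frag_set0; exact: is_derive_cst.
have [BT|BT] := eqVneq B finset.setT; last first.
  rewrite (_ : frag _ _ _ = 0); first exact: is_derive_cst.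
  rewrite -/(g v) /frag big1// => A sA; rewrite gs// sub0r /g (negPf B0) (negPf BT).
  by rewrite oppr0 mulr0.
rewrite -/(g v) fragE big1 ?sub0r => [|A sA]; last by rewrite gs ?mulr0.
rewrite /g (negPf B0) BT eqxx -mulNr; exact: is_derive_expRM.
Qed.

End Value.

Section Lumping.
Variables (R : realType) (I J : finType) (iota : J -> I).
Variables (kI : {set I} -> {set I} -> R) (kJ : {set J} -> {set J} -> R).
Hypothesis kIJ : forall (B : {set I}) (A' : {set J}), splits (iota @^-1: B) A' ->
  \sum_(A : {set I} | (A \subset B) && (iota @^-1: A == A')) kI A (B :\: A) =
  kJ A' (iota @^-1: B :\: A').

(** Forgetting points lumps the chain. Splits that do not separate the remaining points contribute
    0, because f is 1 on the empty set; the others add up to the rate [kJ] by [kIJ]. *)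
Lemma flow_lump (f : {set J} -> R) u B : f finset.set0 = 1 -> 0 <= u ->
  flow kI (fun A => f (iota @^-1: A)) u B = flow kJ f u (iota @^-1: B).
Proof.
move=> f0 u0.
apply: (@flow_unique _ _ kI _ _ (fun v A => flow kJ f v (iota @^-1: A)) _ _ (flowP _ _)) => //.
split; first by apply/funext => A; rewrite flow0.
move=> A v v0; rewrite (_ : frag kI _ _ = frag kJ (flow kJ f v) (iota @^-1: A)).
  exact: is_derive_flow.
rewrite /frag (partition_big (fun D : {set I} => iota @^-1: D) predT)//=.
rewrite [RHS]big_mkcond; apply: eq_bigr => D' _; case: ifPn => sD'.
  rewrite -kIJ// mulr_suml; apply: eq_big => D.
    have [DD'|] := eqVneq (iota @^-1: D) D'; rewrite ?andbF// !andbT.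
    rewrite /splits; have [DA|] := boolP (D \subset A); last first.
      by apply: contraNF => /andP[/proper_sub].
    rewrite finset.properEneq DA andbT.
    move: sD' => /andP[/finset.proper_neq D'A D'0]; apply/andP; split.
      by apply: contra D'A => /eqP <-; rewrite DD'.
    by apply: contra D'0 => /eqP D0; rewrite -DD' D0 finset.preimset0.
  by move=> /andP[_ /eqP <-]; rewrite finset.preimsetD.
rewrite big1// => D /andP[/andP[DA D0] /eqP DD'].
have DA' : D' \subset iota @^-1: A by rewrite -DD' finset.preimsetS// proper_sub.
move: sD'; rewrite /splits finset.properEneq DA' andbT negb_and !negbK => /orP[/eqP e|/eqP e].
  rewrite finset.preimsetD DD' e finset.setDv flow_set0// f0 mulr1 subrr mulr0//.
by rewrite finset.preimsetD DD' e finset.setD0 flow_set0// f0 mul1r subrr mulr0.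
Qed.

Lemma value_lump (L : seq (R * ({set J} -> R))) s B : weights_ok L ->
  value kI [seq (p.1, fun A : {set I} => p.2 (iota @^-1: A)) | p <- L] s B =
  value kJ L s (iota @^-1: B).
Proof.
elim: L s B => [//|p L IH] s B wL /=; have [_ p0 wL'] := weights_ok_cons wL.
case: ifPn => sp; last exact: IH.
rewrite -flow_lump ?subr_ge0// ?p0 ?mul1r ?value_set0//.
congr (flow _ _ _ _); apply/funext => A; by rewrite IH.
Qed.

End Lumping.

Lemma continuous_funD (R : realType) (T : topologicalType) (f g : T -> R) :
  continuous f -> continuous g -> continuous (fun x => f x + g x).
Proof. by move=> cf cg x; apply: cvgD; [exact: cf|exact: cg]. Qed.

Lemma continuous_funZ (R : realType) (T : topologicalType) (f : T -> R) (c : R) :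
  continuous f -> continuous (fun x => c * f x).
Proof. by move=> cf x; apply: cvgM; [exact: cvg_cst|exact: cf]. Qed.

Section Dot.
Variables (R : realType) (l : nat).
Local Notation V := 'rV[R]_l.+1.
Implicit Types (u x y : V) (c : R).

Lemma dotDr u x y : dot u (x + y) = dot u x + dot u y.
Proof. by rewrite /dot -big_split/=; apply: eq_bigr => i _; rewrite mxE mulrDr. Qed.

Lemma dotZr u c x : dot u (c *: x) = c * dot u x.
Proof. by rewrite /dot mulr_sumr; apply: eq_bigr => i _; rewrite mxE mulrCA. Qed.

Lemma dotNr u x : dot u (- x) = - dot u x.
Proof. by rewrite -scaleN1r dotZr mulN1r. Qed.

Lemma dotBr u x y : dot u (x - y) = dot u x - dot u y.
Proof. by rewrite dotDr dotNr. Qed.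

Lemma dot0r u : dot u 0 = 0.
Proof. by rewrite -(scale0r 0) dotZr mul0r. Qed.

Lemma dotZl u c x : dot (c *: u) x = c * dot u x.
Proof. by rewrite /dot mulr_sumr; apply: eq_bigr => i _; rewrite mxE mulrA. Qed.

Lemma dot_delta u i : dot u (delta_mx 0 i) = u ord0 i.
Proof.
rewrite /dot (bigD1 i)//= !mxE !eqxx mulr1 big1 ?addr0// => j ji.
by rewrite mxE (negPf ji) andbF mulr0.
Qed.

Lemma dot_continuous u : continuous (dot u).
Proof.
suff cS (r : seq 'I_l.+1) : continuous (fun x : V => \sum_(i <- r) u ord0 i * x ord0 i) by exact: cS.
elim: r => [|i r IH].
  rewrite (_ : (fun _ => _) = fun=> 0); first exact: cst_continuous.
  by apply/funext => x; rewrite big_nil.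
rewrite (_ : (fun _ => _) = (fun x => u ord0 i * x ord0 i + \sum_(j <- r) u ord0 j * x ord0 j)).
  by apply: continuous_funD => //; apply: continuous_funZ; exact: coord_continuous.
by apply/funext => x; rewrite big_cons.
Qed.

End Dot.

(** * Hyperplanes and the driving measure *)

Section NormalForm.
Variables (R : realType) (l : nat).
Local Notation V := 'rV[R]_l.+1.
Local Notation H := (hyperplane R l).
Implicit Types (h : H) (x y : V).

(** Scaling the first nonzero coordinate of the normal vector to 1 makes the equation of h unique
    and fixes the orientation used by [half_space]. *)
Definition normal_form h (p : V * R) : Prop :=
  (exists i : 'I_l.+1, p.1 ord0 i = 1 /\ forall j : 'I_l.+1, (j < i)%N -> p.1 ord0 j = 0) /\
  val h = [set x | dot p.1 x = p.2].

Lemma normal_form_exists h : exists p, normal_form h p.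
Proof.
have /set_mem [u [c u0 hE]] := valP h.
have [i0 ui0] : exists i, u ord0 i != 0.
  apply: contrapT => H; move/eqP: u0; apply; apply/matrixP => i j.
  rewrite ord1 mxE; apply/eqP; apply: contrapT => /negP uj; apply: H; by exists j.
have [i ui imin] := @arg_minnP _ i0 (fun i => u ord0 i != 0) (@nat_of_ord _) ui0.
exists ((u ord0 i)^-1 *: u, (u ord0 i)^-1 * c); split => /=.
  exists i; split; first by rewrite mxE mulVf.
  move=> j ji; rewrite mxE; have [->|uj] := eqVneq (u ord0 j) 0; first by rewrite mulr0.
  by have := imin _ uj; rewrite leqNgt ji.
rewrite hE; apply/seteqP; split => x /=; rewrite dotZl; first by move=> ->.
by move/(congr1 (fun t => u ord0 i * t)); rewrite !mulrA divff// !mul1r.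
Qed.

Definition nform h : V * R := projT1 (cid (normal_form_exists h)).
Lemma nformP h : normal_form h (nform h). Proof. exact: projT2 (cid _). Qed.

Definition dir h x : R := dot (nform h).1 x.
Definition side h x : R := dir h x - (nform h).2.

Lemma on_side h x : val h x <-> side h x = 0.
Proof.
have [_ ->] := nformP h; rewrite /side /dir /=; split=> [->|/eqP]; first by rewrite subrr.
by rewrite subr_eq0 => /eqP.
Qed.

Lemma side_dir h x y : side h x = side h y + dir h (x - y).
Proof. by rewrite /side /dir dotBr; ring. Qed.

Lemma dirE h x : dir h x = side h x - side h 0.
Proof. by rewrite /side /dir dot0r; ring. Qed.

Lemma side_affine h x y (t : R) :
  side h ((1 - t) *: x + t *: y) = (1 - t) * side h x + t * side h y.
Proof. by rewrite /side /dir dotDr !dotZr; ring. Qed.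

Lemma side_continuous h : continuous (side h).
Proof.
by apply: (@continuous_funD R V (dir h) (cst (- (nform h).2)));
  [exact: dot_continuous|exact: cst_continuous].
Qed.

Lemma normal_form_unique h (u : V) (c : R) :
  (exists2 i : 'I_l.+1, 0 < u ord0 i & forall j : 'I_l.+1, (j < i)%N -> u ord0 j = 0) ->
  val h = [set x | dot u x = c] ->
  exists2 k : R, 0 < k & u = k *: (nform h).1 /\ c = k * (nform h).2.
Proof.
move=> [i ui0 uj0] hE; have [[i' [vi1 vj0]] hE'] := nformP h.
set v := (nform h).1 in vi1 vj0 hE' *; set c' := (nform h).2 in hE' *.
pose x0 : V := c' *: delta_mx 0 i'.
have vx0 : dot v x0 = c' by rewrite dotZr dot_delta vi1 mulr1.
have E x : dot u x = c <-> dot v x = c'.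
  by have /= -> := congr1 (fun S : set V => S x) (etrans (esym hE) hE').
have ux0 : dot u x0 = c by apply/E.
have K y : dot v y = 0 -> dot u y = 0.
  move=> vy; have : dot u (x0 + y) = c by apply/E; rewrite dotDr vx0 vy addr0.
  by rewrite dotDr ux0 => /eqP; rewrite -subr_eq0 addrAC subrr add0r => /eqP.
pose k := u ord0 i'.
have uE y : dot u y = k * dot v y.
  have : dot u (y - dot v y *: delta_mx 0 i') = 0.
    by apply: K; rewrite dotBr dotZr dot_delta vi1 mulr1 subrr.
  by rewrite dotBr dotZr dot_delta mulrC => /eqP; rewrite subr_eq0 => /eqP.
have uv : u = k *: v.
  by apply/matrixP => a j; rewrite ord1 -dot_delta uE dot_delta mxE.
have ki : 0 < k.
  have ui : u ord0 i = k * v ord0 i by rewrite uv mxE.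
  have k0 : k != 0 by apply/eqP => k0; move: ui0; rewrite ui k0 mul0r ltxx.
  have [ii|ii|/val_inj ii] := ltngtP i i'.
  - by move: ui0; rewrite ui vj0// mulr0 ltxx.
  - by move: k0; rewrite /k uj0// eqxx.
  - by rewrite /k -ii.
by exists k => //; split => //; rewrite -ux0 uE vx0.
Qed.

Lemma half_spaceE b h :
  half_space b h = [set x | if b then 0 <= side h x else side h x <= 0].
Proof.
apply/seteqP; split => x /=.
  move=> [u [c [uP hE]]]; have [k k0 [-> ->]] := normal_form_unique uP hE.
  rewrite dotZl /side /dir; case: b.
    by rewrite ler_pM2l// subr_ge0.
  by rewrite ler_pM2l// subr_le0.
have [[i [ui1 uj0]] hE] := nformP h; exists (nform h).1, (nform h).2; split => //.
  by exists i => //; rewrite ui1 ltr01.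
by move: H; rewrite /side /dir; case: b; rewrite ?subr_ge0 ?subr_le0.
Qed.

Lemma interior_half_space b h :
  (half_space b h)° = [set x | if b then 0 < side h x else side h x < 0].
Proof.
rewrite half_spaceE; apply/seteqP; split => x /=; last first.
  move=> xh; apply: (@filterS _ _ _ ([set x | if b then 0 < side h x else side h x < 0])).
    by move=> y /=; case: b {xh} => /ltW.
  apply: open_nbhs_nbhs; split => //; case: b {xh}.
    by apply: (@open_comp _ _ (side h) [set t | 0 < t]) => [y _|]; [exact: side_continuous|exact: open_gt].
  by apply: (@open_comp _ _ (side h) [set t | t < 0]) => [y _|]; [exact: side_continuous|exact: open_lt].
move=> xi; have : exists2 e : R, 0 < e & forall s, `|s| < e ->
    if b then 0 <= side h x + s else side h x + s <= 0.
  have [[i [ui1 uj0]] hE] := nformP h.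
  have /nbhs_ballP[e /= e0 He] := xi.
  exists e => // s se.
  have : ball x e (x + s *: delta_mx 0 i).
    split=> // a j; rewrite /ball/= !mxE opprD addrA subrr sub0r normrN normrM.
    rewrite (le_lt_trans _ se)// ler_piMr//.
    by case: (_ && _); rewrite ?normr1 ?normr0.
  move=> /He/=; rewrite (_ : side h _ = side h x + s)//.
  rewrite (side_dir h _ x) [_ - x]addrC addKr /dir dotZr dot_delta ui1 mulr1//.
move=> [e e0 He]; have e20 : 0 < e / 2 by rewrite divr_gt0.
have e2 : `|e / 2| < e by rewrite gtr0_norm// ltr_pdivrMr// ltr_pMr// ltrDl.
have e2' : `|- (e / 2)| < e by rewrite normrN.
by case: b He {xi} => He; [have := He _ e2'|have := He _ e2] => ?; lra.
Qed.

End NormalForm.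

Section FellOpen.
Variables (X : topologicalType) (P : set (set X)).

Let subbase_open (M : set (fell P)) : @fell_subbase X P M -> open M.
Proof.
move=> sM; exists [set M]; last by rewrite bigcup_set1.
move=> _ ->; exists [fset M]%fset.
  by move=> A /fset1P ->; rewrite inE.
apply/seteqP; split => [C|C MC A]; last by move=> /fset1P ->.
by move=> /(_ M); apply; exact/fset1P.
Qed.

Lemma fell_open_miss (K : set X) : compact K -> open [set C : fell P | val C `&` K = set0].
Proof. by move=> cK; apply: subbase_open; left; exists K. Qed.

Lemma fell_open_hit (G : set X) : open G -> open [set C : fell P | val C `&` G !=set0].
Proof. by move=> oG; apply: subbase_open; right; exists G. Qed.

Lemma fell_openE (U : set (fell P)) (A : fell P) : open U -> U A ->
  exists F : {fset set (fell P)}, [/\ forall M, M \in F -> fell_subbase M,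
    (\big[setI/setT]_(M <- F) M) A & \big[setI/setT]_(M <- F) M `<=` U].
Proof.
move=> [S SU <-] [B SB BA]; have [F FS FB] := SU _ SB.
exists F; split => [M /FS|| B' HB']; first by rewrite inE.
  by rewrite -bigcap_fset FB.
by exists B => //; rewrite -FB bigcap_fset.
Qed.

Lemma fell_continuous (T : topologicalType) (f : T -> fell P) :
  (forall K, compact K -> open [set t | val (f t) `&` K = set0]) ->
  (forall G, open G -> open [set t | val (f t) `&` G !=set0]) -> continuous f.
Proof.
move=> fK fG; apply/continuousP => U oU; rewrite openE => t /= Ut.
have [F [Fs Ft FU]] := fell_openE oU Ut.
apply: (@filterS _ _ _ (f @^-1` \big[setI/setT]_(M <- F) M)); first by move=> s /FU.
apply: open_nbhs_nbhs; split => //.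
rewrite -bigcap_fset preimage_bigcap bigcap_fset big_seq.
elim/big_ind : _ => [|X1 X2|M MF]; [exact: openT|exact: openI|].
by have [[K cK <-]|[G oG <-]] := Fs _ MF; [exact: fK|exact: fG].
Qed.

End FellOpen.

Lemma sub_borel (X : ptopologicalType) (A : set X) : open A -> measurable (A : set (borel X)).
Proof. exact: sub_sigma_algebra. Qed.

Section SideMeasurable.
Variables (R : realType) (l : nat).
Local Notation V := 'rV[R]_l.+1.
Local Notation H := (hyperplane R l).
Implicit Types (h : H) (x y p : V).

Lemma nform_eq h (p : V * R) : normal_form h p -> nform h = p.
Proof.
move=> [[i [pi1 pj0]] hE]; have [[i' [ni1 nj0]] hE'] := nformP h.
have [|k k0 [pk ck]] := @normal_form_unique R l h p.1 p.2 _ hE.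
  by exists i => //; rewrite pi1 ltr01.
have pE j : p.1 ord0 j = k * (nform h).1 ord0 j by rewrite {1}pk mxE.
have ii : i = i'.
  have [ii|ii|/val_inj//] := ltngtP i i'.
    by move: (pE i); rewrite pi1 nj0// mulr0 => /eqP; rewrite oner_eq0.
  by move: (pE i'); rewrite pj0// ni1 mulr1 => k0'; move: k0; rewrite -k0' ltxx.
have k1 : k = 1 by move: (pE i); rewrite pi1 ii ni1 mulr1.
by rewrite k1 scale1r mul1r in pk ck; rewrite (surjective_pairing p) pk ck -surjective_pairing.
Qed.

Lemma tr_proof x h : [set y | dot (nform h).1 y = (nform h).2 + dot (nform h).1 x] \in @is_hyperplane R l.
Proof.
rewrite inE; exists (nform h).1, ((nform h).2 + dot (nform h).1 x) => //.
have [[i [ni1 _]] _] := nformP h; apply/eqP => /matrixP/(_ ord0 i).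
by rewrite ni1 mxE => /eqP; rewrite oner_eq0.
Qed.

Definition tr x h : H := exist (fun A : set V => A \in @is_hyperplane R l) _ (tr_proof x h).

Lemma nform_tr x h : nform (tr x h) = ((nform h).1, (nform h).2 + dot (nform h).1 x).
Proof.
by apply: nform_eq; have [nP _] := nformP h; split => //.
Qed.

Lemma dir_tr x h y : dir (tr x h) y = dir h y.
Proof. by rewrite /dir nform_tr. Qed.

Lemma side_tr x h y : side (tr x h) y = side h (y - x).
Proof. by rewrite /side /dir nform_tr /= dotBr; ring. Qed.

Lemma hyperplane_eq h h' : (forall y, side h y = side h' y) -> h = h'.
Proof.
move=> hh; apply: val_inj; apply/seteqP; split => y /on_side hy; apply/on_side.
  by rewrite -hh.
by rewrite hh.
Qed.

Lemma trK x : cancel (tr x) (tr (- x)).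
Proof. by move=> h; apply: hyperplane_eq => y; rewrite !side_tr opprK addrK. Qed.

Lemma measurable_tr x : measurable_fun setT (tr x : borel H -> borel H).
Proof.
suff ct : continuous (tr x : H -> H).
  apply: (@measurability _ _ (borel H) (borel H) setT (tr x) (@open H)) => //.
  move=> _ [U oU <-]; rewrite setTI; apply: sub_borel.
  by apply: open_comp => // h _; exact: ct.
have trK (K : set V) h : (val (tr x h) `&` K !=set0) <-> (val h `&` [set y - x | y in K] !=set0).
  split=> [[y [hy Ky]]|[y [hy [z Kz zy]]]].
    exists (y - x); split; last by exists y.
    by move/on_side: hy; rewrite side_tr => hy; exact/on_side.
  by exists z; split => //; apply/on_side; rewrite side_tr zy; exact/on_side.
have csub : continuous (fun y : V => y - x).
  by move=> y; apply: (@cvgB R V _ (nbhs y)); [exact: cvg_id|exact: cvg_cst].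
apply: fell_continuous => [K cK|G oG].
  rewrite (_ : [set t | _] = [set h : H | val h `&` [set y - x | y in K] = set0]).
    apply: fell_open_miss; apply: continuous_compact => //.
    exact: continuous_subspaceT.
  apply/seteqP; split => h /= h0; apply/eqP; apply: contrapT => /negP/set0P/trK/set0P;
    by rewrite h0 eqxx.
rewrite (_ : [set t | _] = [set h : H | val h `&` [set y - x | y in G] !=set0]).
  apply: fell_open_hit.
  rewrite (_ : [set y - x | y in G] = (fun y => y + x) @^-1` G).
    apply: open_comp => // y _.
    by apply: (@cvgD R V _ (nbhs y)); [exact: cvg_id|exact: cvg_cst].
  apply/seteqP; split => y /=; first by move=> [z Gz <-]; rewrite subrK.
  by move=> Gy; exists (y + x) => //; rewrite addrK.
by apply/seteqP; split => h /= /trK.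
Qed.

Lemma translate_hyperplanesE x (A : set H) :
  translate_hyperplanes x A = [set h | A (tr (- x) h)].
Proof.
have val_tr h : val (tr x h) = [set y + x | y in val h].
  apply/seteqP; split => [y /on_side|_ [y /on_side hy <-]].
    by rewrite side_tr => hy; exists (y - x); [exact/on_side|rewrite subrK].
  by apply/on_side; rewrite side_tr addrK.
apply/seteqP; split => h /=.
  move=> [g Ag hE]; suff -> : h = tr x g by rewrite trK.
  by apply: val_inj; rewrite val_tr.
move=> Ah; exists (tr (- x) h) => //; rewrite -val_tr; congr val.
by apply: hyperplane_eq => y; rewrite !side_tr opprK subrK.
Qed.

Lemma hits_compact (K : set V) : compact K -> measurable (hits K : set (borel H)).
Proof.
move=> cK; rewrite (_ : hits K = ~` [set h : H | val h `&` K = set0]).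
  by apply: measurableC; apply: sub_borel; exact: fell_open_miss.
apply/seteqP; split => h /=; first by move=> /set0P/eqP.
by move=> /eqP/set0P.
Qed.

(** All measurability in h comes from hitting sets of compact segments: along a coordinate segment
    [side h] is affine with slope [nrm i h], so that meeting the segment is a condition on these two
    numbers. *)
Let seg p (i : 'I_l.+1) (a b : R) : set V := [set p + s *: delta_mx 0 i | s in `[a, b]].

Let seg_compact p i a b : compact (seg p i a b).
Proof.
apply: continuous_compact; last exact: segment_compact.
apply: continuous_subspaceT => s.
apply: (@cvgD R V _ (nbhs s)); first exact: cvg_cst.
by apply: (@cvgZr_tmp R V _ (nbhs s)) || apply: (@cvgZl_tmp R V _ (nbhs s)); exact: cvg_id.
Qed.

Let nrm i h : R := (nform h).1 ord0 i.

Let sideZ h p i (s : R) : side h (p + s *: delta_mx 0 i) = side h p + s * nrm i h.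
Proof. by rewrite (side_dir h _ p) [_ - p]addrC addKr /dir dotZr dot_delta. Qed.

Let hits_seg h p i a b : hits (seg p i a b) h <-> exists s, a <= s <= b /\ side h p + s * nrm i h = 0.
Proof.
split=> [[y [/on_side hy [s /=]]]|[s [sab hs]]].
  by rewrite in_itv/= => sab sE; exists s; split => //; rewrite -sideZ sE.
exists (p + s *: delta_mx 0 i); split; first by apply/on_side; rewrite sideZ.
by exists s => //=; rewrite in_itv.
Qed.

Let mseg p i a b : measurable (hits (seg p i a b) : set (borel H)).
Proof. by apply: hits_compact; exact: seg_compact. Qed.

Let measurable_nrm i : measurable ([set h | nrm i h != 0] : set (borel H)).
Proof.
(* A hyperplane not parallel to the i-th axis meets that axis in exactly one point; a parallel one
   either misses it or contains both 0 and the i-th unit vector. *)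
rewrite (_ : [set h | nrm i h != 0] = (\bigcup_n hits (seg 0 i (- n%:R) n%:R)) `\`
   (hits (seg 0 i 0 0) `&` hits (seg 0 i 1 1))).
  apply: measurableD; first by apply: bigcupT_measurable => n; exact: mseg.
  by apply: measurableI; exact: mseg.
apply/seteqP; split => h /=.
  move=> n0; split.
    pose s := - side h 0 / nrm i h; exists (Num.truncn `|s|).+1 => //.
    apply/hits_seg; exists s; split.
      by rewrite -ler_norml ltW// truncnS_gt.
    by rewrite /s mulfVK// subrr.
  move=> [/hits_seg[s [/andP[s1 s2]]] h0 /hits_seg[s' [/andP[s1' s2']]] h1].
  have s0 : s = 0 by apply/eqP; rewrite eq_le s2 s1.
  have s'1 : s' = 1 by apply/eqP; rewrite eq_le s2' s1'.
  move: h0 h1; rewrite s0 s'1 mul0r addr0 => ->; rewrite add0r mul1r => n0'.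
  by rewrite n0' eqxx in n0.
move=> [[n _ /hits_seg[s [sn hs]]] nH]; apply/negP => /eqP n0; apply: nH.
rewrite n0 mulr0 addr0 in hs.
by split; apply/hits_seg; [exists 0|exists 1]; rewrite lexx n0 mulr0 addr0.
Qed.

(** On this class a translation along the i-th axis changes [side] by exactly the amount of the
    translation ([side_delta]). The classes are a finite measurable cover, and null sets of [Lambda]
    are found class by class. *)
Definition hclass (i : 'I_l.+1) : set H :=
  [set h | nrm i h = 1 /\ forall j : 'I_l.+1, (j < i)%N -> nrm j h = 0].

Lemma hclass_cover h : exists i, hclass i h.
Proof. by have [[i [n1 n0]] _] := nformP h; exists i; split. Qed.

Lemma measurable_hclass i : measurable (hclass i : set (borel H)).
Proof.
rewrite (_ : hclass i = [set h | nrm i h != 0] `\`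
    \bigcup_(j in [set j : 'I_l.+1 | (j < i)%N]) [set h | nrm j h != 0]).
  apply: measurableD => //; apply: fin_bigcup_measurable => //.
apply/seteqP; split => h /=.
  move=> [n1 n0]; split; first by rewrite n1 oner_eq0.
  by move=> [j /= ji]; rewrite n0// eqxx.
move=> [n1 n0]; have [i' [n1' n0']] := hclass_cover h.
have nj (j : 'I_l.+1) : (j < i)%N -> nrm j h = 0.
  by move=> ji; apply/eqP; apply: contrapT => nj; apply: n0; exists j => //; exact/negP.
split => //; have [ii|ii|/val_inj -> //] := ltngtP i i'.
  by rewrite n0'// eqxx in n1.
by move: n1'; rewrite nj// => /esym/eqP; rewrite oner_eq0.
Qed.

Lemma side_delta i h p (s : R) : hclass i h -> side h (p + s *: delta_mx 0 i) = side h p + s.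
Proof. by move=> [n1 _]; rewrite sideZ n1 mulr1. Qed.

Lemma tr_hclass i x h : hclass i (tr x h) <-> hclass i h.
Proof. by rewrite /hclass /= /nrm nform_tr. Qed.

Lemma measurable_side p : measurable_fun setT (fun h : borel H => side h p).
Proof.
apply: (measurability (@RGenOInfty.G R) (RGenOInfty.measurableE R)).
move=> _ [_ [r ->]] <-; rewrite setTI.
(* On [hclass i] the point where h meets the line through p along the i-th axis has parameter
   [- side h p]. So [side h p] <= r says that h meets the ray of parameters at least - r, exhausted
   by segments. *)
rewrite (_ : _ @^-1` _ = ~` (\bigcup_(i in [set: 'I_l.+1])
   (hclass i `&` \bigcup_n hits (seg p i (- r) n%:R)))).
  apply: measurableC; apply: fin_bigcup_measurable => // i _.
  apply: measurableI; first exact: measurable_hclass.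
  by apply: bigcupT_measurable => n; exact: mseg.
apply/seteqP; split => h /=; rewrite in_itv/= andbT.
  move=> rh [i _ [hi [n _ /hits_seg[s [/andP[rs sn] hs]]]]].
  by move: hs; rewrite hi.1 mulr1 => /eqP; rewrite addr_eq0 => /eqP hs; lra.
move=> hN; rewrite ltNge; apply/negP => hr; apply: hN.
have [i hi] := hclass_cover h; exists i => //; split => //.
exists (Num.truncn `|side h p|).+1 => //; apply/hits_seg; exists (- side h p).
rewrite hi.1 mulr1 subrr; split => //; rewrite lerN2 hr/=.
by rewrite (le_trans (ler_norm _))// normrN ltW// truncnS_gt.
Qed.

Lemma measurable_dir p : measurable_fun setT (fun h : borel H => dir h p).
Proof.
rewrite (_ : (fun h => _) = (fun h => side h p - side h 0)).
  by apply: measurable_funB; exact: measurable_side.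
by apply/funext => h; rewrite dirE.
Qed.

End SideMeasurable.

Lemma equal_disjoint_null (R : realType) d (T : measurableType d)
    (mu : {measure set T -> \bar R}) (F : nat -> set T) (K : set T) (c : \bar R) :
  (forall n, measurable (F n)) -> trivIset setT F -> (forall n, mu (F n) = c) ->
  measurable K -> (forall n, F n `<=` K) -> (mu K < +oo)%E -> c = 0%E.
Proof.
move=> mF tF Fc mK FK Kfin.
have c0 : (0 <= c)%E by rewrite -(Fc 0%N) measure_ge0.
have cfin : c \is a fin_num.
  rewrite ge0_fin_numE// (le_lt_trans _ Kfin)// -(Fc 0%N) le_measure ?inE//; exact: FK.
have Kf : mu K \is a fin_num by rewrite ge0_fin_numE.
apply/eqP; rewrite eq_le c0 andbT leNgt; apply/negP => cpos.
have H (n : nat) : (c *+ n <= mu K)%E.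
  have -> : (c *+ n)%E = mu (\big[setU/set0]_(i < n) F i).
    rewrite measure_bigsetU//.
    rewrite (eq_bigr (fun=> c)) => [|i _]; last exact: Fc.
    by rewrite big_const_ord iter_addr_0.
  apply: le_measure; rewrite ?inE//; first exact: bigsetU_measurable.
  by elim/big_ind : _ => // A B AK BK x [/AK|/BK].
move: cpos H cfin Kf; case: c {c0 Fc} => // c; case: (mu K) => // k.
rewrite lte_fin => c0 H _ _.
have := H (Num.truncn (k / c)).+1; rewrite -EFin_natmul lee_fin leNgt => /negP; apply.
rewrite -mulr_natl -ltr_pdivrMr//; exact: truncnS_gt.
Qed.

(** Nonnegativity makes f monotone. With k the integer part of n c, the value n f(c) is squeezed
    between k f(1) and (k + 1) f(1), so f(c) and c f(1) differ by at most f(1) / n. *)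
Lemma additive_linear (R : realType) (f : R -> R) :
  (forall c, 0 < c -> 0 <= f c) ->
  (forall c c', 0 < c -> 0 < c' -> f (c + c') = f c + f c') ->
  forall c, 0 < c -> f c = c * f 1.
Proof.
move=> f0 fD.
have fM n c : 0 < c -> f (n.+1%:R * c) = n.+1%:R * f c.
  move=> c0; elim: n => [|n IH]; first by rewrite !mul1r.
  by rewrite -natr1 !mulrDl !mul1r fD ?IH// mulr_gt0.
have fle c c' : 0 < c -> c <= c' -> f c <= f c'.
  move=> c0; rewrite le_eqVlt => /predU1P[->//|cc'].
  have -> : c' = c + (c' - c) by ring.
  by rewrite fD ?subr_gt0// lerDl f0 ?subr_gt0.
have f1 := f0 1 ltr01.
move=> c c0; apply/eqP; rewrite -subr_eq0 -normr_eq0; apply: contrapT => /negP ne.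
have {ne}: 0 < `|f c - c * f 1| by rewrite lt_neqAle eq_sym ne normr_ge0.
set e := `|_| => e0.
pose n := Num.truncn (f 1 / e).
have ne : f 1 < n.+1%:R * e by rewrite -ltr_pdivrMr//; exact: truncnS_gt.
pose k := Num.truncn (n.+1%:R * c).
have nc0 : 0 <= n.+1%:R * c by rewrite mulr_ge0// ltW.
have := truncn_itv nc0; rewrite -/k => /andP[kl ku].
have k1 : f (n.+1%:R * c) <= k.+1%:R * f 1.
  by rewrite -[f 1]/(f 1) -fM// mulr1; apply: fle; rewrite ?mulr_gt0// ltW.
have k2 : k%:R * f 1 <= f (n.+1%:R * c).
  case: k kl {ku k1} => [|k] kl; first by rewrite mul0r f0// mulr_gt0.
  by rewrite -fM// mulr1 fle.
rewrite fM// in k1 k2.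
have : n.+1%:R * e <= f 1.
  rewrite /e -[n.+1%:R]ger0_norm// -normrM ler_norml.
  have kf1 : k.+1%:R * f 1 = k%:R * f 1 + f 1 by rewrite -natr1 mulrDl mul1r.
  have u1 : (n.+1%:R * c) * f 1 <= k.+1%:R * f 1 by rewrite ler_wpM2r// ltW.
  have u2 : k%:R * f 1 <= (n.+1%:R * c) * f 1 by rewrite ler_wpM2r.
  by apply/andP; split; lra.
by rewrite leNgt ne.
Qed.

Lemma null_cover (R : realType) d (T : measurableType d) (mu : {measure set T -> \bar R})
    (I : finType) (A : set T) (N : I -> set T) :
  measurable A -> (forall i, measurable (N i)) -> (forall i, mu (N i) = 0%E) ->
  A `<=` \bigcup_i N i -> mu A = 0%E.
Proof.
move=> mA mN N0 AN; apply/eqP; rewrite eq_le measure_ge0 andbT.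
rewrite (le_trans (content_sub_fsum mu finite_finset _ mA AN))//.
by rewrite fsbig1// => i _; exact: N0.
Qed.

Lemma measure_finType (R : realType) d (T : measurableType d) (mu : {measure set T -> \bar R})
    (I : finType) (F : I -> set T) :
  (forall i, measurable (F i)) -> trivIset setT F ->
  mu (\bigcup_i F i) = (\sum_i mu (F i))%E.
Proof.
move=> mF tF; rewrite measure_fin_bigcup//; last exact: finite_finset.
have -> : [set: I] = [set` enum I] by apply/seteqP; split => i // _ /=; rewrite mem_enum.
by rewrite -fsbig_seq ?enum_uniq// big_enum.
Qed.

Lemma measurable_lt_set (R : realType) d (T : measurableType d) (f g : T -> R) :
  measurable_fun setT f -> measurable_fun setT g -> measurable [set x | f x < g x].
Proof.
move=> mf mg; have := measurable_fun_ltr mf mg => /(_ measurableT [set true] I).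
by rewrite setTI; congr (measurable _); apply/seteqP; split.
Qed.

Lemma measurable_le_set (R : realType) d (T : measurableType d) (f g : T -> R) :
  measurable_fun setT f -> measurable_fun setT g -> measurable [set x | f x <= g x].
Proof.
move=> mf mg; have := measurable_fun_ler mf mg => /(_ measurableT [set true] I).
by rewrite setTI; congr (measurable _); apply/seteqP; split.
Qed.

Lemma measurable_eq_set (R : realType) d (T : measurableType d) (f g : T -> R) :
  measurable_fun setT f -> measurable_fun setT g -> measurable [set x | f x = g x].
Proof.
move=> mf mg; rewrite (_ : [set x | _] = [set x | f x <= g x] `&` [set x | g x <= f x]).
  by apply: measurableI; exact: measurable_le_set.
apply/seteqP; split => x /=; first by move=> ->.
by move=> [? ?]; apply/eqP; rewrite eq_le; apply/andP.
Qed.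

Section LambdaFacts.
Variables (R : realType) (l : nat).
Local Notation V := 'rV[R]_l.+1.
Local Notation H := (hyperplane R l).
Variable Lambda : {measure set (borel H) -> \bar R}.
Hypothesis hL : driving_measure Lambda.
Implicit Types (x y p : V).

Definition cball (r : R) : set V := [set x | `|x| <= r].

Hypothesis Lfin : forall r : R, (Lambda (hits (cball r)) < +oo)%E.

Lemma cball_compact r : compact (cball r).
Proof.
apply: bounded_closed_compact.
  exists r; split; first exact: num_real.
  by move=> M rM x /= xr; rewrite (le_trans xr)// ltW.
rewrite /cball (_ : [set x | _] = (fun x : V => `|x|) @^-1` [set t | t <= r])//.
apply: preimage_closed; last exact: closed_le.
by move=> x _; exact: norm_continuous.
Qed.

Lemma Lambda_tr x (A : set (borel H)) : measurable A -> Lambda [set h | A (tr x h)] = Lambda A.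
Proof.
move=> mA; rewrite -(driving_invariant hL (- x) mA) translate_hyperplanesE opprK//.
Qed.

Lemma hits_cball_finite (A : set (borel H)) r : measurable A -> A `<=` hits (cball r) ->
  (Lambda A < +oo)%E.
Proof.
move=> mA AB; rewrite (le_lt_trans _ (Lfin r))// le_measure ?inE//.
by apply: hits_compact; exact: cball_compact.
Qed.

Local Notation e_ i := (delta_mx 0 i : V).

Lemma norm_delta i : `|e_ i| <= 1.
Proof.
rewrite [leLHS]/Num.norm/= mx_normrE; apply: bigmax_le; first exact: ler01.
by move=> j _; rewrite mxE; case: (_ && _); rewrite ?normr1 ?normr0.
Qed.

(** Within one class, the sets of hyperplanes through p + e_i / (n + 1) are disjoint, are translates
    of one another, and all hit one ball, whose hitting set has finite measure. *)
Lemma Lambda_on_null p : Lambda [set h | side h p = 0] = 0%E.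
Proof.
have mS q : measurable [set h : borel H | side h q = 0].
  by apply: measurable_eq_set; [exact: measurable_side|exact: measurable_cst].
pose N i q : set (borel H) := @hclass R l i `&` [set h | side h q = 0].
have mN i q : measurable (N i q) by apply: measurableI => //; exact: measurable_hclass.
apply: (@null_cover _ _ _ Lambda 'I_l.+1 _ (fun i => N i p)) => //; last first.
  by move=> h /= hp; have [i hi] := hclass_cover h; exists i.
move=> i; pose s (n : nat) : R := n.+1%:R^-1.
have s01 n : 0 <= s n <= 1.
  by rewrite invr_ge0 ler0n/= invf_le1 ?ltr0n// ler1n.
apply: (@equal_disjoint_null R _ _ Lambda (fun n => N i (p + s n *: e_ i)) (hits (cball (`|p| + 1)))).
- by move=> n; exact: mN.
- apply/trivIsetP => m n _ _ mn; apply/seteqP; split => // h [[hi /= hm] [_ /= hn]].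
  move: hm hn; rewrite !side_delta// => hm hn; move/eqP: mn; apply.
  have : s m = s n by lra.
  by move/invr_inj/eqP; rewrite eqr_nat => /eqP[].
- move=> n; rewrite -(Lambda_tr (- (s n *: e_ i)) (mN i p)); congr (Lambda _).
  apply/seteqP; split => h [hi hs]; split.
  + exact/tr_hclass.
  + by rewrite /= side_tr opprK.
  + by move/tr_hclass : hi.
  + by move: hs; rewrite /= side_tr opprK.
- by apply: hits_compact; exact: cball_compact.
- move=> n h [_ /= hs]; exists (p + s n *: e_ i); split; first exact/on_side.
  rewrite /cball/= (le_trans (ler_normD _ _))// lerD2l normrZ.
  have /andP[s0 s1] := s01 n.
  by rewrite ger0_norm// mulr_ile1// norm_delta.
- exact: Lfin.
Qed.

(** The rational points, enumerated through their codes; numbers that code no point give the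
    origin. *)
Definition dseq (n : nat) : V :=
  map_mx ratr (odflt 0 (@choice.unpickle 'rV[rat]_l.+1 n)).

Lemma dseq_dense (U : set V) : open U -> U !=set0 -> exists n, U (dseq n).
Proof.
move=> oU [x Ux]; have /nbhs_ballP[e /= e0 xeU] : nbhs x U by exact: open_nbhs_nbhs.
have Hq (j : 'I_l.+1) : exists q : rat, x ord0 j < ratr q < x ord0 j + e.
  have xe : x ord0 j < x ord0 j + e by rewrite ltrDl.
  by have [q] := rat_in_itvoo xe; rewrite in_itv/=; exists q.
have [q qP] := boolp.choice Hq.
exists (choice.pickle (\row_j q j : 'rV[rat]_l.+1)); apply: xeU.
rewrite /dseq choice.pickleK/=; split => // i j; rewrite ord1 /ball/= !mxE.
have /andP[q1 q2] := qP j.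
by rewrite distrC ltr_norml; apply/andP; split; lra.
Qed.

(** Hyperplanes that strictly separate two points of the dense sequence interior to C. For a
    polytope this loses only a null set of [hits C] ([Lambda_tangent_null]). Being a countable
    union, it is jointly measurable in h and in a random cell, and its members leave interior points
    on both sides. *)
Definition qhits (C : set V) : set H :=
  \bigcup_(n in [set n | C° (dseq n)]) \bigcup_(m in [set m | C° (dseq m)])
    [set h | side h (dseq n) < 0 < side h (dseq m)].

Lemma measurable_sep p q : measurable ([set h | side h p < 0 < side h q] : set (borel H)).
Proof.
rewrite (_ : [set h | _] = [set h | side h p < 0] `&` [set h | 0 < side h q]).
  by apply: measurableI; apply: measurable_lt_set => //; exact: measurable_side.
by apply/seteqP; split => h /=; [move=> /andP|move=> /andP].
Qed.

Lemma measurable_qhits C : measurable (qhits C : set (borel H)).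
Proof.
by apply: bigcup_measurable => n _; apply: bigcup_measurable => m _; exact: measurable_sep.
Qed.

Lemma shift_delta_norm (C : set V) r i p (s : R) : C `<=` cball r -> C p -> 0 <= s <= 1 ->
  cball (r + 1) (p + s *: e_ i).
Proof.
move=> Cr /Cr pr /andP[s0 s1]; rewrite /cball/= (le_trans (ler_normD _ _))// lerD// normrZ.
by rewrite ger0_norm// mulr_ile1// norm_delta.
Qed.

(* The translates along e_i of the set of hyperplanes touching C without crossing its
   interior are disjoint. *)
Lemma Lambda_tangent_null (C : set V) r : compact C -> C `<=` cball r ->
  C `<=` closure C° -> Lambda (hits C `\` qhits C) = 0%E.
Proof.
move=> cC Cr CQ.
have mC : measurable (hits C : set (borel H)) by exact: hits_compact.
have mM : measurable (hits C `\` qhits C : set (borel H)).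
  by apply: measurableD => //; exact: measurable_qhits.
have seps h p q : C° p -> C° q -> side h p < 0 -> 0 < side h q -> qhits C h.
  move=> Cp Cq hp hq.
  have [n [Cn hn]] : exists n, (C° `&` [set x | side h x < 0]) (dseq n).
    apply: dseq_dense; last by exists p.
    apply: openI; first exact: open_interior.
    by apply: (@open_comp _ _ (side h) [set t | t < 0]) => [y _|]; [exact: side_continuous|exact: open_lt].
  have [m [Cm hm]] : exists m, (C° `&` [set x | 0 < side h x]) (dseq m).
    apply: dseq_dense; last by exists q.
    apply: openI; first exact: open_interior.
    by apply: (@open_comp _ _ (side h) [set t | 0 < t]) => [y _|]; [exact: side_continuous|exact: open_gt].
  exists n; first exact: Cn.
  exists m; first exact: Cm.
  by apply/andP; split.
pose sg (b : bool) : R := if b then 1 else -1.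
pose N (ib : 'I_l.+1 * bool) : set (borel H) := @hclass R l ib.1 `&` (hits C `&`
  [set h | forall x, C x -> 0 <= sg ib.2 * side h x]).
have mN ib : measurable (N ib).
  rewrite (_ : N ib = hclass (R := R) (l := l) ib.1 `&` (hits C `&`
    \bigcap_(n in [set n | C° (dseq n)]) [set h | 0 <= sg ib.2 * side h (dseq n)])).
    apply: measurableI; first exact: measurable_hclass.
    apply: measurableI => //; apply: bigcap_measurableType => n _.
    apply: measurable_le_set; first exact: measurable_cst.
    by apply: measurable_funM => //; exact: measurable_side.
  congr (_ `&` (_ `&` _)); apply/seteqP; split => h /= H1.
    by move=> n Cn; apply: H1; exact: interior_subset.
  move=> x Cx; rewrite leNgt; apply/negP => hx.
  have oU : open [set y | sg ib.2 * side h y < 0].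
    apply: (@open_comp _ _ (fun y => sg ib.2 * side h y) [set t | t < 0]); last exact: open_lt.
    by move=> y _; apply: (continuous_funZ _); exact: side_continuous.
  have [y [Cy hy]] := CQ x Cx _ (open_nbhs_nbhs (conj oU hx)).
  have [n [Cn hn]] : exists n, (C° `&` [set y | sg ib.2 * side h y < 0]) (dseq n).
    by apply: dseq_dense; [apply: openI => //; exact: open_interior|exists y].
  by have := H1 n Cn; rewrite /= leNgt hn.
apply: (@null_cover _ _ _ Lambda ('I_l.+1 * bool)%type _ N) => //; last first.
  move=> h [hC hq]; have [i hi] := hclass_cover h.
  have [Hpos|/existsNP[p /not_implyP[Cp /negP]]] := pselect (forall x, C° x -> 0 <= side h x).
    exists (i, true) => //; split => //; split => // x Cx; rewrite /= mul1r leNgt; apply/negP => hx.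
    have oU : open [set y | side h y < 0].
      by apply: (@open_comp _ _ (side h) [set t | t < 0]) => [y _|]; [exact: side_continuous|exact: open_lt].
    have [y [Cy /= hy]] := CQ x Cx _ (open_nbhs_nbhs (conj oU hx)).
    by have := Hpos _ Cy; rewrite leNgt hy.
  rewrite -ltNge => hp; exists (i, false) => //; split => //; split => // x Cx.
  rewrite /= mulN1r oppr_ge0 leNgt; apply/negP => hx.
  have oU : open [set y | 0 < side h y].
    by apply: (@open_comp _ _ (side h) [set t | 0 < t]) => [y _|]; [exact: side_continuous|exact: open_gt].
  have [y [Cy /= hy]] := CQ x Cx _ (open_nbhs_nbhs (conj oU hx)).
  by apply: hq; exact: seps Cp Cy hp hy.
move=> [i b]; pose s (n : nat) : R := n.+1%:R^-1.
have s01 n : 0 <= s n <= 1 by rewrite invr_ge0 ler0n/= invf_le1 ?ltr0n// ler1n.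
have s_inj m n : s m = s n -> m = n.
  by move/invr_inj/eqP; rewrite eqr_nat => /eqP[].
pose F n : set (borel H) := [set h | N (i, b) (tr (- s n *: e_ i) h)].
have sideF h n x : @hclass R l i h -> side (tr (- s n *: e_ i) h) x = side h x + s n.
  by move=> hi; rewrite side_tr scaleNr opprK side_delta.
have mF n : measurable (F n).
  by have := measurable_tr (- s n *: e_ i) measurableT (mN (i, b)); rewrite setTI.
apply: (@equal_disjoint_null R _ _ Lambda F (hits (cball (r + 1)))) => //.
- apply/trivIsetP => m n _ _ mn; apply/seteqP; split => // h.
  move=> [[/tr_hclass hi [hC hm]] [_ [hC' hn]]]; move/eqP: mn; apply; apply: s_inj.
  have [x [/on_side hx Cx]] := hC; have [x' [/on_side hx' Cx']] := hC'.
  have := hm _ Cx'; have := hn _ Cx; rewrite !sideF//= in hx hx' *.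
  by rewrite /sg; case: (b) => /=; lra.
- by move=> n; exact: Lambda_tr.
- by apply: hits_compact; exact: cball_compact.
- move=> n h [/tr_hclass hi [[x [/on_side hx Cx]] _]]; exists (x + s n *: e_ i).
  split; first by apply/on_side; rewrite side_delta// -(sideF h n x hi).
  exact: (@shift_delta_norm C r i x (s n) Cr Cx (s01 n)).
Qed.

(** C contains a ball, so countably many translates of C meet every hyperplane; if [hits C] were
    null, the whole space of hyperplanes would be null. *)
Lemma Lambda_hits_gt0 (C : set V) r : compact C -> C `<=` cball r -> C° !=set0 ->
  (0 < Lambda (hits C))%E.
Proof.
move=> cC Cr [x /nbhs_ballP[e /= e0 xC]].
have mC : measurable (hits C : set (borel H)) by exact: hits_compact.
rewrite lt_neqAle measure_ge0 andbT eq_sym; apply/eqP => C0.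
have := driving_neq0 hL; apply/negP; rewrite negbK; apply/eqP.
pose F n : set (borel H) := [set h | hits C (tr (x - dseq n) h)].
have F0 n : Lambda (F n) = 0%E by rewrite -C0; exact: Lambda_tr.
have mF n : measurable (F n).
  by have := measurable_tr (x - dseq n) measurableT mC; rewrite setTI.
have cover : setT = \bigcup_n F n.
  apply/seteqP; split => // h _.
  have [y hy] : exists y, val h y.
    have [i hi] := hclass_cover h; exists (0 + (- side h 0) *: e_ i).
    by apply/on_side; rewrite side_delta// subrr.
  have [n yn] : exists n, ball y e (dseq n).
    by apply: dseq_dense; [exact: ball_open|exists y; exact: ballxx].
  exists n => //; exists (y + (x - dseq n)); split.
    by apply/on_side; rewrite side_tr addrK; exact/on_side.
  apply: xC; rewrite (_ : y + (x - dseq n) = x - (dseq n - y)); last first.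
    by rewrite opprB addrCA addrC.
  move: yn; rewrite -!ball_normE/= => yn.
  by rewrite opprB addrC subrK distrC.
apply/eqP; rewrite eq_le measure_ge0 andbT cover.
have mU : measurable (\bigcup_n F n) by exact: bigcupT_measurable.
have := measure_sigma_subadditive Lambda mF mU (@subset_refl _ _).
by rewrite eseries0// => n _ _; exact: F0.
Qed.

Section Homogeneity.
Definition sep_seq (lo up : seq V) : set H :=
  [set h | (forall p, p \in lo -> side h p < 0) /\ (forall p, p \in up -> 0 < side h p)].

Lemma measurable_sep_seq lo up : measurable (sep_seq lo up : set (borel H)).
Proof.
rewrite (_ : sep_seq lo up = \big[setI/setT]_(p <- lo) [set h | side h p < 0] `&`
   \big[setI/setT]_(p <- up) [set h | 0 < side h p]).
  apply: measurableI; apply: bigsetI_measurable => p _; apply: measurable_lt_set => //;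
   exact: measurable_side.
rewrite -!bigcap_seq; by apply/seteqP; split => h [].
Qed.

(** Translation invariant conditions on h, that is, conditions on its direction. The induction in
    [Lambda_sep_seq_scale] accumulates them to record which of two points is the extreme one. *)
Definition direction_set (D : set (borel H)) : Prop :=
  measurable D /\ forall x h, D (tr x h) <-> D h.

Lemma direction_setI D D' : direction_set D -> direction_set D' -> direction_set (D `&` D').
Proof.
move=> [mD tD] [mD' tD']; split; first exact: measurableI.
by move=> x h; split=> -[/tD ? /tD' ?].
Qed.

Lemma direction_le p q : direction_set [set h | dir h p <= dir h q].
Proof.
split; first by apply: measurable_le_set; exact: measurable_dir.
by move=> x h /=; rewrite !dir_tr.
Qed.

Lemma dirZ h (c : R) p : dir h (c *: p) = c * dir h p.
Proof. by rewrite /dir dotZr. Qed.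

Lemma sep_bounded p q : [set h : H | side h p < 0 < side h q] `<=` hits (cball (`|p| + `|q|)).
Proof.
move=> h /= /andP[hp hq].
pose t := side h p / (side h p - side h q).
have d0 : side h p - side h q < 0 by lra.
have t01 : 0 <= t <= 1.
  rewrite /t; apply/andP; split; first by rewrite nmulr_lge0 ?invr_lt0// ltW.
  by rewrite ler_ndivrMr// mul1r; lra.
exists ((1 - t) *: p + t *: q); split.
  by apply/on_side; rewrite side_affine /t; field; rewrite lt_eqF.
move: t01 => /andP[t0 t1].
have t1' : 0 <= 1 - t by rewrite subr_ge0.
have e1 : `|(1 - t) *: p| = (1 - t) * `|p| by rewrite normrZ ger0_norm.
have e2 : `|t *: q| = t * `|q| by rewrite normrZ ger0_norm.
rewrite /cball/= (le_trans (ler_normD _ _))// e1 e2.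
by rewrite lerD// ler_piMl// gerBl.
Qed.

(** By translation invariance it is enough to consider the pairs (0, t x) with x = q - p. Cutting
    the segment at an intermediate point, off the null set of hyperplanes through that point, makes
    the measure additive in t; [additive_linear] concludes. *)
Lemma Lambda_sep_scale D p q (c : R) : direction_set D -> 0 < c ->
  (Lambda (D `&` [set h | side h (c *: p) < 0 < side h (c *: q)]%R) =
   c%:E * Lambda (D `&` [set h | side h p < 0 < side h q]%R))%E.
Proof.
move=> [mD tD] c0; pose x := q - p.
pose S (y z : V) : set (borel H) := D `&` [set h | side h y < 0 < side h z].
have mS y z : measurable (S y z) by apply: measurableI => //; exact: measurable_sep.
have finS y z : Lambda (S y z) \is a fin_num.
  rewrite ge0_fin_numE//; apply: (@hits_cball_finite _ (`|y| + `|z|) (mS y z)).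
  by move=> h [_]; exact: sep_bounded.
have trS w y z : Lambda (S (y + w) (z + w)) = Lambda (S y z).
  rewrite -(Lambda_tr (- w) (mS y z)); congr (Lambda _).
  apply/seteqP; split => h [Dh hs]; split.
  - exact/tD.
  - by rewrite /= !side_tr !opprK.
  - by move/tD : Dh.
  - by move: hs; rewrite /= !side_tr !opprK.
pose f (t : R) := fine (Lambda (S 0 (t *: x))).
have fE t : Lambda (S (t *: p) (t *: q)) = (f t)%:E.
  rewrite /f fineK// -(trS (t *: p) 0) add0r; congr (Lambda (S _ _)).
  by rewrite -scalerDr /x subrK.
rewrite -/(S p q) -/(S (c *: p) (c *: q)) fE.
have -> : Lambda (S p q) = (f 1)%:E by rewrite -fE !scale1r.
rewrite -EFinM; congr EFin; apply: additive_linear => //.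
  by move=> t _; rewrite fine_ge0.
move=> t t' t0 t'0.
pose M : set (borel H) := S 0 ((t + t') *: x) `&` [set h | side h (t *: x) = 0].
have mM : measurable M.
  apply: measurableI => //; apply: measurable_eq_set; first exact: measurable_side.
  exact: measurable_cst.
have M0 : Lambda M = 0%E.
  apply/eqP; rewrite eq_le measure_ge0 andbT -(Lambda_on_null (t *: x)) le_measure ?inE//; last by move=> h [].
  by apply: measurable_eq_set; [exact: measurable_side|exact: measurable_cst].
have dd h u : dir h (u *: x) = u * dir h x by exact: dirZ.
have ss h u : side h (u *: x) = side h 0 + u * dir h x by rewrite (side_dir h _ 0) subr0 dd.
have SE : S 0 ((t + t') *: x) = (S 0 (t *: x) `|` S (t *: x) ((t + t') *: x)) `|` M.
  apply/seteqP; split => h.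
    move=> [Dh /=]; rewrite ss => /andP[h0 h1].
    have [ht|ht|ht] := ltgtP (side h (t *: x)) 0.
    - by left; right; split => //=; rewrite ht ss h1.
    - by left; left; split => //=; rewrite h0 ht.
    - by right; split => //; split => //=; rewrite ss h0 h1.
  move=> [[|]|[]//] [Dh /=]; rewrite !ss => /andP[h0 h1]; split => //=; rewrite ss.
    have d0 : 0 < dir h x by rewrite -(pmulr_rgt0 _ t0); lra.
    rewrite h0/=; have : 0 < t' * dir h x by rewrite mulr_gt0.
    by lra.
  rewrite h1 andbT.
  have d0 : 0 < dir h x by rewrite -(pmulr_rgt0 _ t'0); lra.
  have : 0 < t * dir h x by rewrite mulr_gt0.
  by lra.
have S2 : Lambda (S (t *: x) ((t + t') *: x)) = Lambda (S 0 (t' *: x)).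
  by rewrite -(trS (t *: x) 0) add0r scalerDl addrC.
have LE : Lambda (S 0 ((t + t') *: x)) = (Lambda (S 0%R (t *: x)) + Lambda (S 0%R (t' *: x)))%E.
  rewrite SE measureU0//; last exact: measurableU.
  rewrite measureU//; last first.
    apply/seteqP; split => // h [[_ /= /andP[_ h1]] [_ /= /andP[h2 _]]].
    by move: (lt_trans h1 h2); rewrite ltxx.
  by congr (_ + _)%E; exact: S2.
by rewrite /f LE fineD.
Qed.

Lemma measure_split (D A S S1 S2 : set (borel H)) : measurable D -> measurable A ->
  measurable S -> S `&` A = S1 `&` A -> S `\` A = S2 `\` A ->
  Lambda (D `&` S) = (Lambda (D `&` A `&` S1) + Lambda (D `&` ~` A `&` S2))%E.
Proof.
move=> mD mA mS SA SA'; rewrite (@measureDI _ _ _ _ (D `&` S) A)//; last exact: measurableI.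
rewrite addeC; congr (Lambda _ + Lambda _)%E.
  transitivity (D `&` (S `&` A)); first by rewrite setIA.
  by rewrite SA -setIA [A `&` S1]setIC.
transitivity (D `&` (S `\` A)); first by rewrite !setDE setIA.
by rewrite SA' setDE -setIA [~` A `&` S2]setIC.
Qed.

Lemma sep_seq_cons_lo p p' lo up : sep_seq [:: p, p' & lo] up `&` [set h | dir h p' <= dir h p] =
  sep_seq (p :: lo) up `&` [set h | dir h p' <= dir h p].
Proof.
apply/seteqP; split => h [[h1 h2] /= pp']; split => //; split => // w ws.
  by apply: h1; move: ws; rewrite !inE => /orP[->|->]//; rewrite !orbT.
move: ws; rewrite !inE => /or3P[/eqP ->|/eqP ->|ws]; last by apply: h1; rewrite inE ws orbT.
  by apply: h1; rewrite inE eqxx.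
have : side h p < 0 by apply: h1; rewrite inE eqxx.
by move: pp'; rewrite !dirE => ? ?; lra.
Qed.

Lemma sep_seq_cons_up lo p p' up : sep_seq lo [:: p, p' & up] `&` [set h | dir h p <= dir h p'] =
  sep_seq lo (p :: up) `&` [set h | dir h p <= dir h p'].
Proof.
apply/seteqP; split => h [[h1 h2] /= pp']; split => //; split => // w ws.
  by apply: h2; move: ws; rewrite !inE => /orP[->|->]//; rewrite !orbT.
move: ws; rewrite !inE => /or3P[/eqP ->|/eqP ->|ws]; last by apply: h2; rewrite inE ws orbT.
  by apply: h2; rewrite inE eqxx.
have : 0 < side h p by apply: h2; rewrite inE eqxx.
by move: pp'; rewrite !dirE => ? ?; lra.
Qed.

Lemma sep_seq_perm lo lo' up up' : lo =i lo' -> up =i up' -> sep_seq lo up = sep_seq lo' up'.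
Proof.
by move=> e e'; apply/seteqP; split => h [h1 h2]; split => w;
  rewrite ?e ?e' -?e -?e' => ?; (apply: h1 || apply: h2); rewrite ?e ?e' -?e -?e'.
Qed.

Lemma Lambda_sep_seq_lo D p p' lo up : direction_set D ->
  (Lambda (D `&` sep_seq [:: p, p' & lo] up) =
   Lambda (D `&` [set h | dir h p' <= dir h p]%R `&` sep_seq (p :: lo) up) +
   Lambda (D `&` ~` [set h | dir h p' <= dir h p]%R `&` sep_seq (p' :: lo) up))%E.
Proof.
move=> [mD _]; have [mA _] := direction_le p' p.
apply: measure_split => //; first exact: measurable_sep_seq.
  exact: sep_seq_cons_lo.
have -> : sep_seq [:: p, p' & lo] up = sep_seq [:: p', p & lo] up.
  by apply: sep_seq_perm => // w; rewrite !inE orbCA.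
have sub : ~` [set h : H | dir h p' <= dir h p] = [set h | dir h p <= dir h p'] `&` ~` [set h | dir h p' <= dir h p].
  by rewrite setIidr// => h /= /negP; rewrite -ltNge => /ltW.
by rewrite !setDE sub !setIA sep_seq_cons_lo.
Qed.

Lemma Lambda_sep_seq_up D p p' lo up : direction_set D ->
  (Lambda (D `&` sep_seq lo [:: p, p' & up]) =
   Lambda (D `&` [set h | dir h p <= dir h p']%R `&` sep_seq lo (p :: up)) +
   Lambda (D `&` ~` [set h | dir h p <= dir h p']%R `&` sep_seq lo (p' :: up)))%E.
Proof.
move=> [mD _]; have [mA _] := direction_le p p'.
apply: measure_split => //; first exact: measurable_sep_seq.
  exact: sep_seq_cons_up.
have -> : sep_seq lo [:: p, p' & up] = sep_seq lo [:: p', p & up].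
  by apply: sep_seq_perm => // w; rewrite !inE orbCA.
have sub : ~` [set h : H | dir h p <= dir h p'] = [set h | dir h p' <= dir h p] `&` ~` [set h | dir h p <= dir h p'].
  by rewrite setIidr// => h /= /negP; rewrite -ltNge => /ltW.
by rewrite !setDE sub !setIA sep_seq_cons_up.
Qed.

Lemma direction_setC D : direction_set D -> direction_set (~` D).
Proof.
move=> [mD tD]; split; first exact: measurableC.
by move=> x h; have [i1 i2] := tD x h; split => H1 H2; apply: H1; [exact: i2|exact: i1].
Qed.

(** With two points on one side, split according to which of them is extreme in the direction of h
    and drop the other one. The splitting condition does not change under scaling ([lec]), and the
    induction ends with one point on each side, where [Lambda_sep_scale] applies. *)
Lemma Lambda_sep_seq_scale lo up D (c : R) : direction_set D -> 0 < c ->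
  lo != [::] -> up != [::] ->
  (Lambda (D `&` sep_seq [seq c *: p | p <- lo] [seq c *: p | p <- up]) =
   c%:E * Lambda (D `&` sep_seq lo up))%E.
Proof.
move=> + c0; move: {2}(size lo + size up)%N (leqnn (size lo + size up)) => n.
elim: n lo up D => [|n IH] lo up D; first by case: lo; case: up.
have lec y z : [set h : H | dir h (c *: y) <= dir h (c *: z)] = [set h | dir h y <= dir h z].
  by apply/seteqP; split => h /=; rewrite !dirZ ler_pM2l.
case: lo => // p [|p' lo]; case: up => // q [|q' up] sn dD _ _.
- have e y z : sep_seq [:: y] [:: z] = [set h | side h y < 0 < side h z].
    apply/seteqP; split => h /=.
      by move=> [h1 h2]; rewrite h1 ?h2 ?inE.
    by move=> /andP[h1 h2]; split => w; rewrite inE => /eqP ->.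
  by rewrite !e; exact: Lambda_sep_scale.
- rewrite [in RHS]Lambda_sep_seq_up// ge0_muleDr// [LHS]Lambda_sep_seq_up// lec.
  have d1 := direction_setI dD (direction_le q q').
  have d2 := direction_setI dD (direction_setC (direction_le q q')).
  rewrite -(IH [:: p] (q :: up))// -(IH [:: p] (q' :: up))//.
- rewrite [in RHS]Lambda_sep_seq_lo// ge0_muleDr// [LHS]Lambda_sep_seq_lo// lec.
  have d1 := direction_setI dD (direction_le p' p).
  have d2 := direction_setI dD (direction_setC (direction_le p' p)).
  rewrite -(IH (p :: lo) [:: q])// -(IH (p' :: lo) [:: q])//.
- rewrite [in RHS]Lambda_sep_seq_lo// ge0_muleDr// [LHS]Lambda_sep_seq_lo// lec.
  have d1 := direction_setI dD (direction_le p' p).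
  have d2 := direction_setI dD (direction_setC (direction_le p' p)).
  rewrite -(IH (p :: lo) [:: q, q' & up])// -(IH (p' :: lo) [:: q, q' & up])//.
Qed.

End Homogeneity.

Section Kappa.
Variables (I : finType).
Implicit Types (b : I -> V) (A B : {set I}).

Definition sep_type b A B : set H :=
  [set h | (forall i, i \in A -> side h (b i) < 0) /\ (forall i, i \in B -> 0 < side h (b i))].

Definition kappa b A B : R := fine (Lambda (sep_type b A B)).

Lemma sep_typeE b A B : sep_type b A B = sep_seq [seq b i | i in A] [seq b i | i in B].
Proof.
apply/seteqP; split => h [h1 h2]; split.
- by move=> _ /fintype.imageP[i iA ->]; exact: h1.
- by move=> _ /fintype.imageP[i iA ->]; exact: h2.
- by move=> i iA; apply: h1; exact: fintype.image_f.
- by move=> i iA; apply: h2; exact: fintype.image_f.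
Qed.

Lemma measurable_sep_type b A B : measurable (sep_type b A B : set (borel H)).
Proof. by rewrite sep_typeE; exact: measurable_sep_seq. Qed.

Lemma kappa_ge0 b A B : 0 <= kappa b A B.
Proof. by rewrite /kappa fine_ge0. Qed.

Lemma sep_type_bounded b A B r : (forall i, cball r (b i)) -> A != finset.set0 ->
  B != finset.set0 -> sep_type b A B `<=` hits (cball (r + r)).
Proof.
move=> br /finset.set0Pn[i iA] /finset.set0Pn[j jB] h [h1 h2].
have [x [hx xr]] : hits (cball (`|b i| + `|b j|)) h.
  by apply: sep_bounded => /=; rewrite h1// h2.
by exists x; split => //; rewrite /cball/= (le_trans xr)// lerD//; exact: br.
Qed.

Lemma exists_cball b : exists r, forall i, cball r (b i).
Proof.
exists (\sum_i `|b i|) => i; rewrite /cball/= (bigD1 i)//= lerDl sumr_ge0//.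
Qed.

Lemma kappaK b A B : A != finset.set0 -> B != finset.set0 ->
  (kappa b A B)%:E = Lambda (sep_type b A B).
Proof.
move=> A0 B0; have [r br] := exists_cball b; rewrite /kappa fineK// ge0_fin_numE//.
exact: (hits_cball_finite (measurable_sep_type b A B) (sep_type_bounded br A0 B0)).
Qed.

Lemma kappa_scale b A B (c : R) : 0 < c -> A != finset.set0 -> B != finset.set0 ->
  kappa (fun i => c *: b i) A B = c * kappa b A B.
Proof.
move=> c0 A0 B0; apply: EFin_inj; rewrite EFinM !kappaK// !sep_typeE.
have ne (D : {set I}) (f : I -> V) : D != finset.set0 -> [seq f i | i in D] != [::].
  by move=> /finset.set0Pn[i iD]; apply/eqP => e; have := fintype.image_f f iD; rewrite e.
have dT : direction_set setT by split.
have := Lambda_sep_seq_scale dT c0 (ne A b A0) (ne B b B0); rewrite !setTI => <-.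
by rewrite -!map_comp.
Qed.

(** Off the null set of hyperplanes through one of the points, every h has exactly one type, the set
    of points of B below it. *)
Lemma measure_by_type b (S : set (borel H)) (B : {set I}) : measurable S ->
  (Lambda S = \sum_(A : {set I} | A \subset B) Lambda (S `&` sep_type b A (B :\: A)))%E.
Proof.
move=> mS; pose N : set (borel H) := \bigcup_(i in [set i : I | i \in B]) [set h | side h (b i) = 0].
have mN : measurable N.
  apply: fin_bigcup_measurable => // i _; apply: measurable_eq_set; first exact: measurable_side.
  exact: measurable_cst.
have N0 : Lambda N = 0%E.
  apply: (@null_cover _ _ _ Lambda I _ (fun i => [set h | side h (b i) = 0])) => //.
  - by move=> i; apply: measurable_eq_set; [exact: measurable_side|exact: measurable_cst].
  - by move=> i; exact: Lambda_on_null.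
  - by move=> h [i _ hi]; exists i.
pose F (A : {set I}) : set (borel H) := if A \subset B then S `&` sep_type b A (B :\: A) else set0.
have mF A : measurable (F A).
  by rewrite /F; case: ifP => // _; apply: measurableI => //; exact: measurable_sep_type.
have tF : trivIset setT F.
  apply/trivIsetP => A A' _ _ AA'; apply/seteqP; split => // h; rewrite /F.
  case: ifPn => AB; last by case.
  case: ifPn => A'B; last by case.
  move=> [[_ [h1 h2]] [_ [h1' h2']]]; move/eqP: AA'; apply; apply/setP => i.
  have [iB|iB] := boolP (i \in B); last first.
    by rewrite (negbTE (contra (fintype.subsetP AB i) iB)) (negbTE (contra (fintype.subsetP A'B i) iB)).
  have [iA|iA] := boolP (i \in A); have [iA'|iA'] := boolP (i \in A') => //.
    have hp : 0 < side h (b i) by apply: h2'; rewrite inE iA' iB.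
    by have := lt_trans (h1 i iA) hp; rewrite ltxx.
  have hp : 0 < side h (b i) by apply: h2; rewrite inE iA iB.
  by have := lt_trans (h1' i iA') hp; rewrite ltxx.
have E : S = (\bigcup_(A in setT) F A) `|` (S `&` N).
  apply/seteqP; split => h; last first.
    by move=> [[A _]|[]//]; rewrite /F; case: ifP => // _ [].
  move=> Sh; have [hN|hN] := pselect (N h); first by right.
  left; exists [set i in B | side h (b i) < 0] => //; rewrite /F ifT; last first.
    by apply/fintype.subsetP => i; rewrite inE => /andP[].
  split => //; split => i; rewrite !inE; first by move=> /andP[].
  move=> /andP[+ iB]; rewrite iB/= -leNgt => h0; rewrite lt_neqAle h0 andbT.
  by apply/eqP => e; apply: hN; exists i.
rewrite {1}E measureU0//; last 3 first.
- by apply: fin_bigcup_measurable.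
- exact: measurableI.
- by apply/eqP; rewrite eq_le measure_ge0 andbT -N0 le_measure ?inE//; exact: measurableI.
rewrite measure_finType// [RHS]big_mkcond; apply: eq_bigr => A _.
by rewrite /F; case: ifP => // _; rewrite measure0.
Qed.

End Kappa.

(** This is the lumping hypothesis [kIJ] for the rates [kappa]: the hyperplanes of a given type on J
    are sorted by their type on B. *)
Lemma kappa_lump (I J : finType) (iota : J -> I) (b : I -> V) (B : {set I}) (A' : {set J}) :
  splits (iota @^-1: B) A' ->
  \sum_(A : {set I} | (A \subset B) && (iota @^-1: A == A')) kappa b A (B :\: A) =
  kappa (b \o iota) A' (iota @^-1: B :\: A').
Proof.
move=> sA; have /andP[/proper_sub A'B A'0] := sA.
have /andP[_ B'0] := splits_setD sA.
have ne (A : {set I}) : iota @^-1: A = A' -> (A != finset.set0) /\ (A \subset B -> B :\: A != finset.set0).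
  move=> e; split; first by apply: contra A'0 => /eqP A0; rewrite -e A0 finset.preimset0.
  move=> _; apply: contra B'0 => /eqP A0.
  by rewrite -e -finset.preimsetD A0 finset.preimset0.
apply: EFin_inj; rewrite kappaK// -sumEFin.
rewrite (measure_by_type b B (measurable_sep_type _ _ _)).
rewrite big_mkcondr/=; apply: eq_bigr => A AB; case: ifPn => [/eqP e|/eqP e].
  have [n1 n2] := ne A e; rewrite kappaK//; last exact: n2.
  congr (Lambda _); apply/seteqP; split => h; last by case.
  move=> [h1 h2]; split => //; split => j; rewrite -?e ?inE; first exact: h1.
  by move=> jA; apply: h2; rewrite inE.
rewrite (_ : _ `&` _ = set0) ?measure0//; apply/seteqP; split => // h [[h1 h2] [h1' h2']].
apply: e; apply/setP => j; rewrite inE.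
have [jB|jB] := boolP (iota j \in B); last first.
  rewrite (negbTE (contra (fintype.subsetP AB _) jB)); apply/esym/negbTE.
  by apply: contra jB => /(fintype.subsetP A'B); rewrite inE.
have [jA|jA] := boolP (iota j \in A); have [jA'|jA'] := boolP (j \in A') => //.
  have hp : 0 < side h (b (iota j)) by apply: h2; rewrite !inE jA' jB.
  by have := lt_trans (h1' _ jA) hp; rewrite ltxx.
have hp : 0 < side h (b (iota j)) by apply: h2'; rewrite inE jA jB.
by have := lt_trans (h1 _ jA') hp; rewrite ltxx.
Qed.

End LambdaFacts.

(** * Convex polytopes *)

Section Convex.
Variables (R : realType) (l : nat).
Local Notation V := 'rV[R]_l.+1.
Implicit Types (s : seq V) (C D : set V) (x y : V).

Definition convex C : Prop :=
  forall x y (t : R), C x -> C y -> 0 <= t <= 1 -> C (t *: x + (1 - t) *: y).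

Lemma convexI C D : convex C -> convex D -> convex (C `&` D).
Proof. by move=> cC cD x y t [Cx Dx] [Cy Dy] t01; split; [exact: cC|exact: cD]. Qed.

(** Membership is asked only where the weight is nonzero: in [conv_hull_lower] some indices carry
    the weight 0 and a meaningless point. *)
Lemma convex_sum_ord C n (w : 'I_n -> R) (x : 'I_n -> V) : convex C ->
  (forall i, 0 <= w i) -> \sum_i w i = 1 -> (forall i, w i != 0 -> C (x i)) ->
  C (\sum_i w i *: x i).
Proof.
move=> cC; elim: n w x => [|n IH] w x w0 w1 Cx.
  by move: w1; rewrite big_ord0 => /eqP; rewrite eq_sym oner_eq0.
move: w1; rewrite !big_ord_recl => w1.
set a := w ord0 in w1 *; set S := \sum_(i < n) w (lift ord0 i) in w1.
have S0 : 0 <= S by apply: sumr_ge0.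
have SE : S = 1 - a by rewrite -w1 addrC addKr.
have [S00|Sn0] := eqVneq S 0.
  have wi i : w (lift ord0 i) = 0.
    by have/eqP := S00; rewrite psumr_eq0// => /allP/(_ i); rewrite mem_index_enum => /(_ isT)/eqP.
  rewrite big1 => [|i _]; last by rewrite wi scale0r.
  have a1 : a = 1 by rewrite -w1 S00 addr0.
  by rewrite a1 scale1r addr0; apply: Cx; rewrite -/a a1 oner_eq0.
have E : \sum_(i < n) w (lift ord0 i) *: x (lift ord0 i) =
    S *: \sum_(i < n) (w (lift ord0 i) / S) *: x (lift ord0 i).
  rewrite scaler_sumr; apply: eq_bigr => i _.
  by rewrite scalerA mulrC divfK.
have CS : C (\sum_(i < n) (w (lift ord0 i) / S) *: x (lift ord0 i)).
  apply: IH.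
  - by move=> i; rewrite divr_ge0.
  - by rewrite -mulr_suml divff.
  - move=> i h; apply: Cx; apply: contra h => /eqP ->; by rewrite mul0r.
rewrite E; have [a0|an0] := eqVneq a 0.
  have S1 : S = 1 by rewrite SE a0 subr0.
  by rewrite a0 scale0r add0r {1}S1 scale1r.
rewrite {1}SE; by apply: cC => //; [apply: Cx|rewrite (w0 ord0)/= -subr_ge0 -SE].
Qed.

Lemma convex_sum C (I : finType) (w : I -> R) (x : I -> V) : convex C ->
  (forall i, 0 <= w i) -> \sum_i w i = 1 -> (forall i, w i != 0 -> C (x i)) ->
  C (\sum_i w i *: x i).
Proof.
move=> cC w0 w1 Cx; rewrite (reindex (@enum_val I predT)) /=; last first.
  by apply: onW_bij; exact: enum_val_bij.
apply: convex_sum_ord => // [|i]; last exact: Cx.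
by rewrite -w1 [RHS](reindex (@enum_val I predT)) //; apply: onW_bij; exact: enum_val_bij.
Qed.

Lemma conv_hull_convex s : convex (conv_hull s).
Proof.
move=> x y t [w [w0 w1 ->]] [v [v0 v1 ->]] /andP[t0 t1].
exists (t *: w + (1 - t) *: v); split.
- by move=> i; rewrite !mxE addr_ge0// mulr_ge0// subr_ge0.
- under eq_bigr do rewrite !mxE.
  by rewrite big_split/= -!mulr_sumr w1 v1 !mulr1 addrC subrK.
- rewrite !scaler_sumr -big_split/=; apply: eq_bigr => i _.
  by rewrite !mxE [RHS]scalerDl !scalerA.
Qed.

Lemma mem_conv_hull s x : x \in s -> conv_hull s x.
Proof.
move=> xs; have xi : (index x s < size s)%N by rewrite index_mem.
exists (delta_mx 0 (Ordinal xi)); split.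
- by move=> i; rewrite mxE eqxx/= ler0n.
- rewrite (bigD1 (Ordinal xi))//= mxE !eqxx/= big1 ?addr0// => i /negbTE ni.
  by rewrite mxE eqxx/= ni.
- rewrite (bigD1 (Ordinal xi))//= mxE !eqxx/= scale1r nth_index// big1 ?addr0// => i /negbTE ni.
  by rewrite mxE eqxx/= ni scale0r.
Qed.

Lemma conv_hull_min s C : convex C -> (forall x, x \in s -> C x) -> conv_hull s `<=` C.
Proof.
move=> cC sC x [w [w0 w1 ->]]; apply: convex_sum_ord => // i _.
exact/sC/mem_nth.
Qed.

Lemma conv_hull_sub s s' : {subset s <= s'} -> conv_hull s `<=` conv_hull s'.
Proof.
move=> ss; apply: conv_hull_min; first exact: conv_hull_convex.
by move=> x /ss; exact: mem_conv_hull.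
Qed.

Lemma cball_convex r : convex (@cball R l r).
Proof.
move=> x y t xr yr /andP[t0 t1]; rewrite /cball/= (le_trans (ler_normD _ _))//.
rewrite !normrZ (ger0_norm t0) ger0_norm ?subr_ge0//.
rewrite (le_trans (lerD (ler_wpM2l t0 xr) (ler_wpM2l _ yr))) ?subr_ge0//.
by rewrite -mulrDl addrC subrK mul1r.
Qed.

Lemma conv_hull_bounded s : exists r, conv_hull s `<=` cball r.
Proof.
exists (\sum_(x <- s) `|x|); apply: conv_hull_min; first exact: cball_convex.
by move=> x xs; rewrite /cball/= (big_rem x)//= lerDl sumr_ge0.
Qed.

Lemma conv_hull_compact s : compact (conv_hull s).
Proof.
have [r sr] := conv_hull_bounded s.
exact: (subclosed_compact (@conv_hull_closed R l s) (@cball_compact R l r) sr).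
Qed.

Lemma conv_hull_affine (f g : V -> V) s : (forall x y t, f (t *: x + (1 - t) *: y) = t *: f x + (1 - t) *: f y) ->
  cancel g f -> conv_hull (map f s) = f @` conv_hull s.
Proof.
move=> af gf; apply/seteqP; split.
  apply: conv_hull_min => [x y t [x' hx <-] [y' hy <-] t01|x /mapP[y ys ->]].
    by exists (t *: x' + (1 - t) *: y') => //; exact: conv_hull_convex.
  by exists y => //; exact: mem_conv_hull.
move=> _ [x hx <-]; move: x hx; apply: conv_hull_min => [x y t hx hy t01|x xs].
  by rewrite af; exact: conv_hull_convex.
by apply: mem_conv_hull; exact: map_f.
Qed.

Lemma dot_sum u (I : finType) (w : I -> R) (x : I -> V) :
  dot u (\sum_i w i *: x i) = \sum_i w i * dot u (x i).
Proof.
apply: (big_ind2 (fun a b => dot u a = b)); first exact: dot0r.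
- by move=> a b c e; rewrite dotDr => <- <-.
- by move=> i _; rewrite dotZr.
Qed.

Lemma lower_convex u (c : R) : convex [set x | dot u x <= c].
Proof.
move=> x y t /= hx hy /andP[t0 t1]; rewrite dotDr !dotZr.
have h1 := ler_wpM2l t0 hx; have t1' : 0 <= 1 - t by rewrite subr_ge0.
by have h2 := ler_wpM2l t1' hy; lra.
Qed.

(* Writing [x = \sum_i w_i s_i] with [f = dot u - c], [N = \sum_(f s_i <= 0) - w_i f(s_i)]
   and [P = \sum_(f s_j > 0) w_j f(s_j) <= N], the point [x] is the combination of the [s_i]
   with weights [w_i (1 - P / N)] and of the crossings [z_ij] of [[s_i, s_j]] with weights
   [w_i w_j (f s_j - f s_i) / N]. *)
Lemma conv_hull_lower s u (c : R) : exists s',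
  conv_hull s `&` [set x | dot u x <= c] = conv_hull s'.
Proof.
pose f x := dot u x - c.
pose z x y := (f y - f x)^-1 *: (f y *: x - f x *: y).
exists ([seq x <- s | f x <= 0] ++ [seq z x y | x <- [seq x <- s | f x <= 0], y <- [seq x <- s | 0 < f x]]).
set s' := _ ++ _.
apply/seteqP; split; last first.
  apply: conv_hull_min.
    by apply: convexI; [exact: conv_hull_convex|exact: lower_convex].
  move=> x; rewrite mem_cat => /orP[|/allpairsP[[y1 y2]/=[]]].
    rewrite mem_filter subr_le0 => /andP[fx xs]; split => //; exact: mem_conv_hull.
  rewrite !mem_filter => /andP[f1 s1] /andP[f2 s2] ->.
  have d0 : 0 < f y2 - f y1 by rewrite subr_gt0 (le_lt_trans f1).
  split.
    have := @conv_hull_convex s y1 y2 (f y2 / (f y2 - f y1)).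
    rewrite (_ : _ + _ = z y1 y2); last first.
      rewrite /z scalerBr !scalerA (mulrC _ (f y2)) -scaleNr; congr (_ + _ *: _).
      by field; rewrite gt_eqF.
    apply; [exact: mem_conv_hull|exact: mem_conv_hull|].
    rewrite divr_ge0 ?(ltW d0) ?(ltW f2)//= ler_pdivrMr// mul1r lerDl oppr_ge0//.
  rewrite /= -subr_le0 -/(f _) /f /z dotZr dotBr !dotZr.
  rewrite (_ : _ - c = 0)//.
  have : f y2 - f y1 != 0 by rewrite gt_eqF.
  rewrite /f => d; field; move: d; apply: contraNneq; lra.
move=> x [[w [w0 w1 xE]] /= ux].
pose n := size s; pose p (i : 'I_n) := s`_i.
have fx : \sum_i w ord0 i * f (p i) <= 0.
  rewrite /f; under eq_bigr do rewrite mulrBr.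
  by rewrite sumrB -mulr_suml w1 mul1r -dot_sum subr_le0 -xE.
pose lo i := f (p i) <= 0.
have hi i : ~~ lo i -> 0 < f (p i) by rewrite /lo -ltNge.
pose N := \sum_(i | lo i) w ord0 i * (- f (p i)).
pose P := \sum_(i | ~~ lo i) w ord0 i * f (p i).
have P0 : 0 <= P by apply: sumr_ge0 => i /hi/ltW h; rewrite mulr_ge0.
have PN : P <= N.
  move: fx; rewrite (bigID lo)/= -/P => h.
  have -> : N = - \sum_(i | lo i) w ord0 i * f (p i).
    by rewrite /N -sumrN; apply: eq_bigr => i _; rewrite mulrN.
  lra.
have in_lo i : lo i -> conv_hull s' (p i).
  move=> li; apply: mem_conv_hull; rewrite mem_cat mem_filter.
  by rewrite (_ : f (p i) <= 0)//= mem_nth.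
have in_z i j : lo i -> ~~ lo j -> conv_hull s' (z (p i) (p j)).
  move=> li lj; apply: mem_conv_hull; rewrite mem_cat; apply/orP; right.
  apply: allpairs_f; rewrite mem_filter; first by rewrite (_ : f (p i) <= 0)//= mem_nth.
  by rewrite hi//= mem_nth.
have [Pz|Pn0] := eqVneq P 0.
  have wz i : ~~ lo i -> w ord0 i = 0.
    move=> li; have/eqP := Pz; rewrite psumr_eq0 => [|j /hi/ltW h]; last by rewrite mulr_ge0.
    move=> /allP/(_ i); rewrite mem_index_enum => /(_ isT)/implyP/(_ li).
    by rewrite mulf_eq0 (gt_eqF (hi _ li)) orbF => /eqP.
  rewrite xE; apply: (convex_sum (@conv_hull_convex s')) => // i wi; apply: in_lo.
  by apply: contraT => /wz e; rewrite e eqxx in wi.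
have N0 : 0 < N by apply: lt_le_trans PN; rewrite lt_def Pn0.
pose W (k : 'I_n + 'I_n * 'I_n) : R := match k with
  | inl i => if lo i then w ord0 i * (1 - P / N) else 0
  | inr (i, j) => if lo i && ~~ lo j then w ord0 i * w ord0 j * (f (p j) - f (p i)) / N else 0 end.
pose X (k : 'I_n + 'I_n * 'I_n) : V := match k with
  | inl i => p i | inr (i, j) => z (p i) (p j) end.
have sumE (M : lmodType R) (g : 'I_n -> M) : \sum_i w ord0 i *: g i =
   (1 - P / N) *: (\sum_(i | lo i) w ord0 i *: g i) +
   \sum_(i | lo i) \sum_(j | ~~ lo j) ((w ord0 i * w ord0 j * f (p j) / N) *: g i
                                      - (w ord0 i * w ord0 j * f (p i) / N) *: g j).
  under [X in _ = _ + X]eq_bigr do rewrite sumrB.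
  rewrite sumrB (_ : \sum_(i | lo i) \sum_(j | ~~ lo j) _ = (P / N) *: (\sum_(i | lo i) w ord0 i *: g i)); last first.
    rewrite scaler_sumr; apply: eq_bigr => i _; rewrite -scaler_suml scalerA; congr (_ *: _).
    by rewrite /P -!mulr_suml [RHS]mulrC mulrA mulr_sumr; congr (_ / _); apply: eq_bigr => j _; rewrite mulrA.
  rewrite exchange_big/= (_ : \sum_(j | ~~ lo j) _ = - \sum_(j | ~~ lo j) w ord0 j *: g j); last first.
    rewrite -sumrN; apply: eq_bigr => j _; rewrite -scaler_suml -scaleNr; congr (_ *: _).
    rewrite -mulr_suml (_ : \sum_(i | lo i) _ = - N * w ord0 j); first by field; rewrite gt_eqF.
    by rewrite /N -sumrN mulr_suml; apply: eq_bigr => i _; ring.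
  by rewrite (bigID lo)/= opprK addrA -scalerDl subrK scale1r.
have sumW (M : lmodType R) (g : 'I_n -> M) (Y : 'I_n + 'I_n * 'I_n -> M) :
    (forall i, Y (inl i) = g i) ->
    (forall i j, lo i -> ~~ lo j -> (f (p j) - f (p i)) *: Y (inr (i, j)) = f (p j) *: g i - f (p i) *: g j) ->
    \sum_k W k *: Y k = \sum_i w ord0 i *: g i.
  move=> Yl Yr; rewrite sumE big_sumType/=; congr (_ + _).
    rewrite scaler_sumr [RHS]big_mkcond; apply: eq_bigr => i _; rewrite Yl.
    by case: ifP; rewrite ?scale0r// scalerA mulrC.
  transitivity (\sum_i \sum_j W (inr (i, j)) *: Y (inr (i, j))).
    by rewrite pair_bigA; apply: eq_bigr => -[i j] _.
  rewrite [RHS]big_mkcond.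
  apply: eq_bigr => i _; case: ifPn => li; last first.
    by apply: big1 => j _; rewrite /= (negbTE li) scale0r.
  rewrite [RHS]big_mkcond; apply: eq_bigr => j _; rewrite /= li/=.
  case: ifPn => lj; last by rewrite scale0r.
  transitivity ((w ord0 i * w ord0 j / N) *: ((f (p j) - f (p i)) *: Y (inr (i, j)))).
    by rewrite scalerA; congr (_ *: _); ring.
  by rewrite Yr// scalerBr !scalerA; congr (_ *: _ - _ *: _); ring.
rewrite xE -/n -(sumW _ p X) //; last first.
  move=> i j li lj; rewrite /= /z scalerA divff ?scale1r//.
  by rewrite gt_eqF// subr_gt0 (le_lt_trans li) ?hi.
apply: convex_sum; first exact: conv_hull_convex.
- move=> [i|[i j]]/=; case: ifPn => //.
    by move=> _; rewrite mulr_ge0// subr_ge0 ler_pdivrMr// mul1r.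
  move=> /andP[li lj]; rewrite !mulr_ge0// ?invr_ge0 ?(ltW N0)// subr_ge0.
  by rewrite (le_trans li)// ltW// hi.
- have := sumW R^o (fun=> 1) (fun=> 1); rewrite /GRing.scale/=.
  have -> : \sum_(i < size s) w ord0 i * 1 = 1 by rewrite -mulr_suml w1 mul1r.
  have -> : \sum_k W k * 1 = \sum_k W k by rewrite -mulr_suml mulr1.
  by apply => // i j _ _; rewrite !mulr1.
- move=> [i|[i j]]/=; case: ifPn; rewrite ?eqxx//; first by move=> /in_lo.
  by move=> /andP[li lj] _; exact: in_z.
Qed.

Definition polyhedron (L : seq (V * R)) : set V := [set x | forall p, p \in L -> dot p.1 x <= p.2].

Lemma conv_hullI_polyhedron s L : exists s', conv_hull s `&` polyhedron L = conv_hull s'.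
Proof.
elim: L s => [|[u c] L IH] s; first by exists s; apply/seteqP; split => // x [].
have [s1 e1] := conv_hull_lower s u c; have [s2 e2] := IH s1; exists s2.
rewrite -e2 -e1; apply/seteqP; split => x.
  move=> [xs xL]; split; last by move=> p pL; apply: xL; rewrite inE pL orbT.
  by split => //; apply: (xL (u, c)); rewrite mem_head.
move=> [[xs xu] xL]; split => // p; rewrite inE => /orP[/eqP -> //|]; exact: xL.
Qed.

(** Rows with [p.2] < 0 bound t from above and rows with [p.2] > 0 from below; a solution t exists
    iff every lower bound is at most every upper bound, and the best choice is the largest lower
    bound. The row ((0, 0), 1) added in [L0] encodes 0 <= t and ensures that there is a lower
    bound. *)
Lemma fourier_motzkin (L : seq (V * R * R)) : exists M, forall x,
  polyhedron M x <-> exists2 t, 0 <= t & forall p, p \in L -> dot p.1.1 x - p.1.2 <= t * p.2.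
Proof.
pose L0 := ((0, 0), 1) :: L.
pose e (p : V * R * R) x := dot p.1.1 x - p.1.2.
exists ([seq p.1 | p <- [seq p <- L0 | p.2 == 0]] ++
  [seq (q.2 *: p.1.1 - p.2 *: q.1.1, q.2 * p.1.2 - p.2 * q.1.2) |
      p <- [seq p <- L0 | p.2 < 0], q <- [seq q <- L0 | 0 < q.2]]) => x.
have dot0l : dot 0 x = 0 by rewrite -(scale0r (0 : V)) dotZl mul0r.
have comb (p q : V * R * R) : (dot (q.2 *: p.1.1 - p.2 *: q.1.1) x <= q.2 * p.1.2 - p.2 * q.1.2) =
    (q.2 * e p x <= p.2 * e q x).
  rewrite /e /dot; under eq_bigr do rewrite !mxE mulrBl -!mulrA.
  by rewrite sumrB -!mulr_sumr; apply/idP/idP; lra.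
split.
  move=> h; pose lows := [seq e q x / q.2 | q <- [seq q <- L0 | 0 < q.2]].
  have [t tl tmax] : exists2 t, t \in lows & forall r, r \in lows -> r <= t.
    have : lows != [::] by rewrite /lows/= ltr01.
    elim: lows => //= r [|r' lo] IH _; first by exists r; [rewrite mem_head|move=> y; rewrite inE => /eqP ->].
    have [//|t tl tm] := IH; exists (Num.max r t).
      by rewrite /Num.max; case: ifP => _; rewrite inE ?tl ?eqxx ?orbT.
    by move=> y; rewrite inE => /orP[/eqP ->|/tm yt]; rewrite le_max ?lexx// yt orbT.
  exists t.
    apply: tmax; apply/mapP; exists ((0, 0), 1); first by rewrite mem_filter/= ltr01 mem_head.
    by rewrite /e/= dot0l subr0 mul0r.
  move=> p pL; have pL0 : p \in L0 by rewrite inE pL orbT.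
  have [p2|p2|p2] := ltgtP p.2 0.
  - have /mapP[q] := tl; rewrite mem_filter => /andP[q2 qL] ->.
    have : (q.2 * e p x <= p.2 * e q x).
      rewrite -comb; apply: (h (_, _)); rewrite mem_cat; apply/orP; right.
      by apply: allpairs_f; rewrite mem_filter ?p2 ?q2.
    by rewrite -/(e p x) -ler_pdivlMl// => /le_trans; apply; rewrite le_eqVlt; apply/orP; left; apply/eqP; field; rewrite gt_eqF.
  - rewrite -/(e p x) -ler_pdivrMr//; apply: tmax; apply/mapP; exists p => //.
    by rewrite mem_filter p2.
  - rewrite p2 mulr0 subr_le0; apply: h; rewrite mem_cat map_f// mem_filter p2 eqxx//.
move=> [t t0 ht] p; rewrite mem_cat => /orP[/mapP[q]|/allpairsP[[q1 q2] []]].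
  rewrite mem_filter inE => /andP[/eqP q2 /orP[/eqP ->|qL]] ->/=; first by rewrite dot0l.
  by have := ht q qL; rewrite q2 mulr0 subr_le0.
rewrite !mem_filter !inE => /andP[/= q12 /orP[/eqP e1|q1L]]; first by rewrite e1/= ltNge ler01 in q12.
move=> /andP[/= q22 q2L] ->/=; rewrite comb.
have h1 : e q1 x <= t * q1.2 by exact: ht.
have h2 : e q2 x <= t * q2.2.
  by case/orP: q2L => [/eqP ->|/ht//]; rewrite /e/= dot0l subr0 mulr1.
have := ler_wpM2l (ltW q22) h1; have := ler_wnM2l (ltW q12) h2; lra.
Qed.

Lemma conv_hull_cons x0 s : s != [::] -> conv_hull (x0 :: s) =
  [set x | exists k t, [/\ conv_hull s k, 0 <= t <= 1 & x = (1 - t) *: x0 + t *: k]].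
Proof.
move=> s0; apply/seteqP; split; last first.
  move=> _ [k [t [ks t01 ->]]]; rewrite addrC; apply: conv_hull_convex => //.
    by apply: conv_hull_sub ks => y; rewrite inE orbC => ->.
  by apply: mem_conv_hull; rewrite mem_head.
case: s s0 => // y0 s _; apply: conv_hull_min; last first.
  move=> x; rewrite inE => /orP[/eqP ->|xs].
    exists y0, 0; split; rewrite ?lexx ?ler01//; last by rewrite subr0 scale1r scale0r addr0.
    by apply: mem_conv_hull; rewrite mem_head.
  exists x, 1; split; rewrite ?lexx ?ler01//; last by rewrite subrr scale1r scale0r add0r.
  exact: mem_conv_hull.
move=> _ _ t [k [a [hk /andP[a0 a1] ->]]] [k' [a' [hk' /andP[a'0 a'1] ->]]] /andP[t0 t1].
pose b := t * a + (1 - t) * a'.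
have b0 : 0 <= b by rewrite addr_ge0// mulr_ge0// subr_ge0.
have b1 : b <= 1 by rewrite /b; nra.
have [bz|bn] := eqVneq b 0.
  have/andP[/eqP ta /eqP ta'] : (t * a == 0) && ((1 - t) * a' == 0).
    by rewrite -paddr_eq0 ?mulr_ge0 ?subr_ge0//; apply/eqP.
  exists k, 0; split; rewrite ?lexx ?ler01//.
  rewrite !scalerDr !scalerA ta ta' !scale0r !addr0 -scalerDl; congr (_ *: _).
  by rewrite !mulrBr ta ta'; ring.
exists ((t * a / b) *: k + (1 - t * a / b) *: k'), b; split; rewrite ?b0//.
  apply: conv_hull_convex => //; rewrite !mulr_ge0 ?invr_ge0//= ler_pdivrMr ?lt_def ?bn// mul1r lerDl.
  by rewrite mulr_ge0// subr_ge0.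
rewrite !scalerDr !scalerA addrACA -scalerDl; congr (_ *: _ + _).
  by rewrite /b; ring.
by congr (_ *: _ + _ *: _); rewrite /b; field; rewrite -/b.
Qed.

(** Half-space description of a convex hull, needed to intersect two of them. A point x lies in the
    hull of x0 and K iff x - x0 is in t (K - x0) for some t in [0, 1]. Given inequalities for K,
    this becomes linear in the pair (x, t), up to the case t = 0, and elimination removes t. *)
Lemma conv_hull_polyhedron s : exists L, conv_hull s = polyhedron L.
Proof.
elim: s => [|x0 s [L LE]].
  (* The empty hull is described by the infeasible inequality 0 <= -1. *)
  exists [:: (0, -1)]; apply/seteqP; split => x.
    by move=> [w [_ + _]]; rewrite big_ord0 => /eqP; rewrite eq_sym oner_eq0.
  move=> /(_ (0, -1)); rewrite mem_head => /(_ isT)/=.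
  by rewrite -(scale0r (0 : V)) dotZl mul0r oppr_ge0 leNgt ltr01.
have [->|s0] := eqVneq s [::].
  exists ([seq (delta_mx 0 i, x0 ord0 i) | i <- index_enum 'I_l.+1] ++
          [seq (- delta_mx 0 i, - x0 ord0 i) | i <- index_enum 'I_l.+1]).
  have dd i x : dot (delta_mx 0 i) x = x ord0 i.
    by rewrite -dot_delta /dot; apply: eq_bigr => j _; rewrite mulrC.
  have ddN i x : dot (- delta_mx 0 i) x = - x ord0 i by rewrite -scaleN1r dotZl dd mulN1r.
  apply/seteqP; split => x.
    move=> xs; have -> : x = x0.
      apply: (@conv_hull_min [:: x0] [set x0]) xs.
        by move=> _ _ t -> -> _ /=; rewrite -scalerDl addrC subrK scale1r.
      by move=> y; rewrite inE => /eqP.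
    by move=> p; rewrite mem_cat => /orP[|] /mapP[i _ ->]/=; rewrite ?dd ?ddN.
  move=> h; have -> : x = x0.
    apply/rowP => i; apply/eqP; rewrite eq_le; apply/andP; split.
      by rewrite -dd; apply: (h (_, _)); rewrite mem_cat map_f// mem_index_enum.
    rewrite -lerN2 -ddN; apply: (h (_, _)); rewrite mem_cat; apply/orP; right.
    by apply/mapP; exists i => //; rewrite mem_index_enum.
  by apply: mem_conv_hull; rewrite mem_head.
(* The first row encodes t <= 1. *)
have [M ME] := fourier_motzkin ((0, 1, -1) :: [seq ((p.1, dot p.1 x0), p.2 - dot p.1 x0) | p <- L]).
exists M; rewrite conv_hull_cons//; apply/seteqP; split => x.
  move=> [k [t [ks /andP[t0 t1] ->]]]; apply/ME; exists t => // p.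
  rewrite inE => /orP[/eqP ->/=|/mapP[q qL ->]/=].
    by rewrite -(scale0r (0 : V)) dotZl mul0r; lra.
  have kq : dot q.1 k <= q.2 by move: ks; rewrite LE; exact.
  by rewrite dotDr !dotZr; have := ler_wpM2l t0 kq; lra.
move=> /ME[t t0 ht].
have t1 : t <= 1.
  have := ht _ (mem_head _ _); rewrite /= -(scale0r (0 : V)) dotZl mul0r; lra.
have hq q : q \in L -> dot q.1 (x - x0) <= t * (q.2 - dot q.1 x0).
  by move=> qL; rewrite dotBr; apply: (ht ((_, _), _)); rewrite inE (map_f (fun p => ((p.1, dot p.1 x0), p.2 - dot p.1 x0)) qL) orbT.
have [tz|tn] := eqVneq t 0; last first.
  exists (x0 + t^-1 *: (x - x0)), t; split; rewrite ?t0//.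
    rewrite LE => q qL; rewrite dotDr dotZr -lerBrDl ler_pdivrMl ?lt_def ?tn//.
    exact: hq.
  by rewrite scalerDr scalerA divff// scale1r addrA -scalerDl subrK scale1r addrC subrK.
(* For t = 0 the inequalities only say that x - x0 is a recession direction of the hull of s. This
   hull is bounded, so x = x0: otherwise k + m (x - x0), with m chosen below, would leave the ball
   of radius r. *)
have [k ks] : conv_hull s !=set0.
  by case: s s0 {LE M ME ht hq} => // y s _; exists y; apply: mem_conv_hull; rewrite mem_head.
have [r sr] := conv_hull_bounded s.
suff -> : x = x0.
  by exists k, 0; split; rewrite ?lexx ?ler01// subr0 scale1r scale0r addr0.
apply/eqP; rewrite -subr_eq0 -normr_eq0; apply/negPn/negP => x0n.
have xp : 0 < `|x - x0| by rewrite lt_def x0n normr_ge0.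
have r0 : 0 <= r by apply: le_trans (sr _ ks).
pose m := (r + `|k| + 1) / `|x - x0|.
have m0 : 0 <= m by rewrite divr_ge0// !addr_ge0.
have : cball r (k + m *: (x - x0)).
  apply: sr; rewrite LE => q qL; rewrite dotDr dotZr.
  have kq : dot q.1 k <= q.2 by move: ks; rewrite LE; exact.
  by have := ler_wpM2l m0 (hq q qL); rewrite tz mul0r mulr0; lra.
rewrite /cball/= => h; have : `|m *: (x - x0)| <= r + `|k|.
  by rewrite -[m *: _](addKr k) addrC (le_trans (ler_normB _ _))// lerD2r.
rewrite normrZ ger0_norm// /m divfK ?gt_eqF//; lra.
Qed.

Lemma conv_hullI s s' : exists s'', conv_hull s `&` conv_hull s' = conv_hull s''.
Proof. by have [L ->] := conv_hull_polyhedron s'; exact: conv_hullI_polyhedron. Qed.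

Lemma polytopeI C D : polytope C -> polytope D -> (C `&` D)° !=set0 -> polytope (C `&` D).
Proof. by move=> [[s ->] _] [[s' ->] _] h; split => //; exact: conv_hullI. Qed.

Lemma polytope_compact C : polytope C -> compact C.
Proof. by move=> [[s ->] _]; exact: conv_hull_compact. Qed.

Lemma polytope_closed C : polytope C -> closed C.
Proof. by move=> [[s ->] _]; exact: conv_hull_closed. Qed.

Lemma polytope_convex C : polytope C -> convex C.
Proof. by move=> [[s ->] _]; exact: conv_hull_convex. Qed.

Lemma polytope_bounded C : polytope C -> exists r, C `<=` cball r.
Proof. by move=> [[s ->] _]; exact: conv_hull_bounded. Qed.

Lemma convex_interior C x y (t : R) : convex C -> C° x -> C y -> 0 < t <= 1 ->
  C° (t *: x + (1 - t) *: y).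
Proof.
move=> cC /nbhs_ballP[e /= e0 xe] Cy /andP[t0 t1]; apply/nbhs_ballP.
exists (t * e) => /=; first by rewrite mulr_gt0.
move=> z; rewrite -ball_normE/= => zb.
have -> : z = t *: (x + t^-1 *: (z - (t *: x + (1 - t) *: y))) + (1 - t) *: y.
  by rewrite scalerDr scalerA divff ?gt_eqF// scale1r addrAC addrC subrK.
apply: cC => //; last by rewrite (ltW t0).
apply: xe; rewrite -ball_normE/= opprD addrA subrr sub0r normrN normrZ.
by rewrite gtr0_norm ?invr_gt0// ltr_pdivrMl// distrC.
Qed.

Lemma convex_regular C : convex C -> C° !=set0 -> C `<=` closure C°.
Proof.
move=> cC [x Cx] y Cy B /nbhs_ballP[e /= e0 yB].
pose t := Num.min 1 (e / (`|x - y| + 1) / 2).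
have d0 : 0 < `|x - y| + 1 by rewrite ltr_pwDr.
have t0 : 0 < t by rewrite lt_min ltr01 !divr_gt0.
exists (t *: x + (1 - t) *: y); split.
  by apply: convex_interior => //; rewrite t0 ge_min lexx.
apply: yB; rewrite -ball_normE/= (_ : y - _ = - (t *: (x - y))); last first.
  by apply/rowP => i; rewrite !mxE; ring.
rewrite normrN normrZ gtr0_norm//.
have : t <= e / (`|x - y| + 1) / 2 by rewrite ge_min lexx orbT.
rewrite -(ler_pM2r d0) => h; have e2 : e / (`|x - y| + 1) / 2 * (`|x - y| + 1) = e / 2 by field; rewrite gt_eqF.
rewrite e2 in h; have := normr_ge0 (x - y) => n0; nra.
Qed.

Lemma interior_convex C : convex C -> convex C°.
Proof.
move=> cC x y t Cx Cy /andP[t0 t1]; have [->|tn] := eqVneq t 0.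
  by rewrite scale0r add0r subr0 scale1r.
by apply: convex_interior => //; [exact: interior_subset|rewrite lt_def tn t0].
Qed.

Lemma polytope_affine (f g : V -> V) C : (forall x y t, f (t *: x + (1 - t) *: y) = t *: f x + (1 - t) *: f y) ->
  cancel g f -> cancel f g -> continuous g -> polytope C -> polytope (f @` C).
Proof.
move=> af gf fg cg [[s CE] [x Cx]]; split; first by exists (map f s); rewrite (conv_hull_affine _ af gf) CE.
exists (f x); have h : nbhs (g (f x)) C by rewrite fg.
have h' : nbhs (f x) (g @^-1` C) by exact: (cg _ _ h).
by apply: (@filterS _ (nbhs (f x)) _ _ _ _ h') => y Cy; exists (g y).
Qed.

Lemma polytope_dilate C (c : R) v : c != 0 -> polytope C -> polytope [set c *: x + v | x in C].
Proof.
move=> c0; apply: (@polytope_affine _ (fun y => c^-1 *: (y - v))).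
- move=> x y t; apply/rowP => i; rewrite !mxE; ring.
- by move=> y; rewrite scalerA divff// scale1r subrK.
- by move=> y; rewrite addrK scalerA mulVf// scale1r.
- move=> y; apply: (@cvgZl_tmp R V _ (nbhs y)).
  by apply: (@cvgB R V _ (nbhs y)); [exact: cvg_id|exact: cvg_cst].
Qed.

(** A dilated copy of W, translated so that an interior point of W goes to the origin. The factor c
    turns the radius e of an inscribed ball into |r| + 1. *)
Lemma window_cball (W : window R l) (r : R) : exists W' : window R l, cball r `<=` W'.
Proof.
have [[s Ws] [p Wp]] := windowP W; have /nbhs_ballP[e /= e0 pe] := Wp.
pose c := (`|r| + 1) / e; have c0 : 0 < c by rewrite divr_gt0// ltr_pwDr.
have P := polytope_dilate (- (c *: p)) (lt0r_neq0 c0) (windowP W).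
exists (Window P) => x xr /=; exists (p + c^-1 *: x); last first.
  by rewrite scalerDr scalerA divff ?gt_eqF// scale1r addrC addKr.
apply: pe; rewrite -ball_normE/= opprD addrA subrr sub0r normrN normrZ gtr0_norm ?invr_gt0//.
rewrite ltr_pdivrMl// /c divfK ?gt_eqF//; apply: le_lt_trans xr _.
by rewrite (le_lt_trans (ler_norm _))// ltrDl.
Qed.

Lemma window_bound (Lambda : {measure set (borel (hyperplane R l)) -> \bar R}) (W : window R l) :
  driving_measure Lambda -> forall r : R, (Lambda (hits (cball r)) < +oo)%E.
Proof.
move=> hL r; have [W' rW] := window_cball W r.
apply: le_lt_trans (driving_windows hL W'); apply: le_measure; rewrite ?inE.
- by apply: hits_compact; exact: cball_compact.
- by apply: hits_compact; apply: polytope_compact; exact: windowP.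
- by move=> h [x [hx /rW]]; exists x.
Qed.

End Convex.

(** Takes the place of choosing a finite subcover. If Q K fails, the sets K minus U with Q U
    generate a proper filter, and a cluster point of it in K contradicts the local hypothesis. *)
Lemma compact_induction (X : topologicalType) (K : set X) (Q : set X -> Prop) :
  compact K -> Q set0 -> (forall U U', Q U' -> U `<=` U' -> Q U) ->
  (forall U U', Q U -> Q U' -> Q (U `|` U')) ->
  (forall x, K x -> exists2 U, nbhs x U & Q U) -> Q K.
Proof.
move=> cK Q0 Qm QU Ql; apply: contrapT => nQ.
pose F : set_system X := [set A | exists2 U, Q U & K `\` U `<=` A].
have FF : Filter F.
  split.
  - by exists set0.
  - move=> A A' [U QA UA] [U' QA' UA']; exists (U `|` U'); first exact: QU.
    by move=> x [Kx nU]; split; [apply: UA|apply: UA']; split => // h; apply: nU; [left|right].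
  - by move=> A A' AA' [U QA UA]; exists U => //; exact: subset_trans AA'.
have PF : ProperFilter F.
  split=> //; move=> [U qU KU]; apply: nQ; apply: Qm qU _ => x Kx.
  by apply: contrapT => nU; exact: (KU x).
have [|x [Kx cx]] := cK F PF; first by exists set0 => // x [].
have [U nU qU] := Ql x Kx.
have [|y []] := cx (K `\` U) U _ nU; first by exists U.
by case.
Qed.

(** Unlike the members of a subbase, those of a network need not be open. This leaves room for
    missing an open set, as in [fell_base_network], and for infinitely many simultaneous conditions,
    as in [itinerary_set]. A countable network still suffices for Borel measurability. *)
Definition network (X : topologicalType) (I : Type) (N : I -> set X) : Prop :=
  forall U x, open U -> U x -> exists s : seq I,
    (forall i, List.In i s -> N i x) /\ (forall y, (forall i, List.In i s -> N i y) -> U y).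

Lemma network_measurable d (T : measurableType d) (X : ptopologicalType) (I : countType)
    (N : I -> set X) (f : T -> X) : network N ->
  (forall i, measurable (f @^-1` N i)) -> measurable_fun setT (f : T -> borel X).
Proof.
move=> nN mN; apply: (@measurability _ _ _ (borel X) _ _ (@open X)) => // _ [U oU <-].
rewrite setTI (_ : _ @^-1` _ = \bigcup_(s in [set s : seq I | forall y, (forall i, List.In i s -> N i y) -> U y])
    \big[setI/setT]_(i <- s) (f @^-1` N i)).
  rewrite bigcup_mkcond; apply: countable_bigcupT_measurable; first exact: countableP.
  move=> s; case: ifP => _ //.
  by elim: s => [|i s IH]; rewrite ?big_nil ?big_cons//; exact: measurableI.
have inE s x : (\big[setI/setT]_(i <- s) (f @^-1` N i)) x <-> (forall i, List.In i s -> N i (f x)).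
  elim: s => [|i s IH]; first by rewrite big_nil.
  rewrite big_cons; split; first by move=> [h /IH h'] j [<-|/h'].
  by move=> h; split; [apply: h; left|apply/IH => j js; apply: h; right].
apply/seteqP; split => x.
  by move=> /(nN _ _ oU)[s [h1 h2]]; exists s => //; apply/inE.
by move=> [s h /inE]; exact: h.
Qed.

Lemma fell_networkP (X : topologicalType) (P : set (set X)) (I : Type) (N : I -> set (fell P)) :
  (forall M A, fell_subbase M -> M A -> exists s : seq I,
    (forall i, List.In i s -> N i A) /\ (forall B, (forall i, List.In i s -> N i B) -> M B)) ->
  network N.
Proof.
move=> h U A oU UA; have [F [Fs FA FU]] := fell_openE oU UA.
suff [s [s1 s2]] : exists s : seq I, (forall i, List.In i s -> N i A) /\
    (forall B, (forall i, List.In i s -> N i B) -> (\big[setI/setT]_(M <- F) M) B).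
  by exists s; split => // B /s2/FU.
have {}Fs : forall M, M \in (finmap.enum_fset F : seq (set (fell P))) -> fell_subbase M := Fs.
move: Fs FA {FU}; move: (finmap.enum_fset F : seq (set (fell P))) => L.
elim: L => [|M L IH] hs; first by rewrite big_nil => _; exists nil; split => // B _; rewrite big_nil.
rewrite big_cons => -[MA /IH[|s [s1 s2]]]; first by move=> M' ML; apply: hs; rewrite inE ML orbT.
have [s' [s1' s2']] := h M A (hs M (mem_head _ _)) MA.
exists (List.app s' s); split => [i /List.in_app_iff[/s1'|/s1]//|B hB].
by split; [apply: s2'|apply: s2] => i js; apply: hB; apply/List.in_app_iff; [left|right].
Qed.

(** A closed set that misses a compact K misses finitely many base sets covering K, since its
    complement is open; conversely, any set missing these base sets misses K. So conditions on
    compact sets are replaced by conditions on countably many open ones. *)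
Lemma fell_base_network (X : topologicalType) (P : set (set X)) (J : Type) (G : J -> set X) :
  (forall C, P C -> closed C) -> (forall j, open (G j)) ->
  (forall U x, open U -> U x -> exists2 j, G j x & G j `<=` U) ->
  network (fun i : bool * J => [set A : fell P | if i.1 then val A `&` G i.2 !=set0 else val A `&` G i.2 = set0]).
Proof.
move=> Pc oG bG; apply: fell_networkP => M A [[K cK <-]|[U oU <-]] /= hA.
  have cA : open (~` val A) by rewrite openC; apply: Pc; exact: (set_mem (valP A)).
  suff [s [s1 s2]] : exists s : seq J, (forall j, List.In j s -> val A `&` G j = set0) /\
      (forall B : fell P, (forall j, List.In j s -> val B `&` G j = set0) -> val B `&` K = set0).
    exists (map (fun j => (false, j)) s); split => [i|B hB].
      by move=> /List.in_map_iff[j [<- js]]; exact: s1.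
    by apply: s2 => j js; apply: (hB (false, j)); apply/List.in_map_iff; exists j.
  pose Q (K : set X) := exists s : seq J, (forall j, List.In j s -> val A `&` G j = set0) /\
      (forall B : fell P, (forall j, List.In j s -> val B `&` G j = set0) -> val B `&` K = set0).
  have Qm (U U' : set X) : Q U' -> U `<=` U' -> Q U.
    move=> [s [s1 s2]] UU'; exists s; split => // B /s2 h.
    by apply/seteqP; split => // x [Bx /UU' Ux]; rewrite -h.
  apply: (@compact_induction X K Q) => //.
  - by exists nil; split => // B _; rewrite setI0.
  - move=> U U' [s [s1 s2]] [s' [s1' s2']]; exists (List.app s s'); split.
      by move=> j /List.in_app_iff[/s1|/s1'].
    move=> B hB; rewrite setIUr s2 ?s2' ?setU0// => j js; apply: hB; apply/List.in_app_iff; by [left|right].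
  - move=> x Kx; have nA : (~` val A) x by move=> Ax; have : (val A `&` K) x by []; rewrite hA.
    have [j jx jA] := bG _ _ cA nA; exists (G j); first exact: open_nbhs_nbhs.
    exists [:: j]; split => [_ [<-|//]|B]; last by apply; left.
    by apply/seteqP; split => // y [Ay /jA].
have [x [Ax Ux]] := hA; have [j jx jU] := bG _ _ oU Ux.
exists [:: (true, j)]; split => [_ [<-|//]|B /(_ _ (or_introl erefl))/=[y [By /jU Uy]]]; first by exists x.
by exists y.
Qed.

(** * Countable networks and measurability in the Fell topology *)

Section FellSpaces.
Variables (R : realType) (l : nat).
Local Notation V := 'rV[R]_l.+1.

(** L collects the points all of whose neighbourhoods are hit by F-almost every set, and is the
    candidate for the limit. It may fail to satisfy P, for instance by being empty; each application
    has to exclude this. *)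
Lemma fell_ultra (X : topologicalType) (P : set (set X)) (F : set_system (fell P)) :
  UltraFilter F ->
  let L := [set x | forall G, open G -> G x -> F [set C | val C `&` G !=set0]] in
  closed L /\ forall A : fell P, val A = L -> F --> A.
Proof.
move=> UF L; split.
  move=> x cx G oG Gx; have [y [Ly Gy]] := cx G (open_nbhs_nbhs (conj oG Gx)).
  exact: Ly.
move=> A AL; have sub M : fell_subbase M -> M A -> F M.
  case=> [[K cK <-]|[G oG <-]] /=; rewrite AL; last by move=> [x [Lx Gx]]; exact: Lx.
  move=> KL; pose Q (U : set X) := F [set C | val C `&` U = set0].
  apply: (@compact_induction X K Q) => //; rewrite /Q.
  - by apply: (filterS _ filterT) => C _ /=; rewrite setI0.
  - move=> U U' FU' UU'; apply: filterS FU' => C /= e.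
    by apply/seteqP; split => // y [Cy /UU' Uy]; rewrite -e.
  - move=> U U' FU FU'; apply: filterS2 FU FU' => C /= e e'.
    by rewrite setIUr e e' setU0.
  - move=> x Kx; have : ~ L x by move=> Lx; have : (L `&` K) x by []; rewrite KL.
    move=> /existsNP[G /not_implyP[oG /not_implyP[Gx nF]]].
    exists G; first exact: open_nbhs_nbhs.
    have [//|] := in_ultra_setVsetC [set C : fell P | val C `&` G !=set0] UF.
    by apply: filterS => C /= /nonemptyPn.
move=> U; rewrite nbhsE => -[U' [oU' U'A] U'U].
have [FF [Fs FA FU]] := fell_openE oU' U'A.
apply: filterS U'U _; apply: filterS FU _.
have {}Fs : forall M, M \in (finmap.enum_fset FF : seq (set (fell P))) -> fell_subbase M := Fs.
move: Fs FA; move: (finmap.enum_fset FF : seq (set (fell P))) => s.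
elim: s => [|M s IH] hs; first by rewrite !big_nil => _; exact: filterT.
rewrite !big_cons => -[MA sA]; apply: filterI.
  by apply: sub => //; apply: hs; rewrite mem_head.
by apply: IH => // M' M's; apply: hs; rewrite inE M's orbT.
Qed.

Section Closed.
Variable B : set V.
Hypothesis cB : closed B.

Lemma Fne_mem (L : set V) : closed L -> L !=set0 -> L `<=` B ->
  L \in [set A : set V | [/\ closed A, A !=set0 & A `<=` B]].
Proof. by move=> *; rewrite inE. Qed.

(** The common point x keeps the limit set nonempty. Without it, sets could escape to infinity when
    B is unbounded. *)
Lemma Fne_point_compact (x : V) : compact [set C : Fne B | val C x].
Proof.
rewrite compact_ultra => F UF Fx.
have [cL LA] := fell_ultra UF; set L := [set x | _] in cL LA.
have Lx : L x by move=> G oG Gx; apply: filterS Fx => C /= Cx; exists x.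
have LB : L `<=` B.
  move=> y Ly; apply: contrapT => nB.
  have := Ly (~` B) _ nB; rewrite openC => /(_ cB) h.
  have [C [z [Cz]]] := filter_ex h; apply.
  by have /set_mem[_ _] := valP C; exact.
pose A : Fne B := exist (fun A => A \in _) L (Fne_mem cL (ex_intro _ x Lx) LB).
by exists A; split => //; exact: LA.
Qed.

Lemma Fne_mem_closed (x : V) : closed [set C : Fne B | val C x].
Proof.
rewrite -openC (_ : ~` _ = [set C : Fne B | val C `&` [set x] = set0]); first exact: open_miss.
apply/seteqP; split => C /=.
  by move=> nC; apply/seteqP; split => // y [Cy e]; apply: nC; rewrite -e.
by move=> e Cx; have : (val C `&` [set x]) x by []; rewrite e.
Qed.

Lemma Fne_sup_compact (D : set V) : D !=set0 -> compact [set C : Fne B | D `<=` val C].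
Proof.
move=> [x Dx]; apply: (@subclosed_compact _ _ [set C : Fne B | val C x]); last 2 first.
- exact: Fne_point_compact.
- by move=> C /=; exact.
rewrite (_ : [set _ | _] = \bigcap_(y in D) [set C : Fne B | val C y]).
  by apply: closed_bigI => y _; exact: Fne_mem_closed.
by apply/seteqP; split.
Qed.

Lemma Fne_closed1 (C : Fne B) : closed [set C].
Proof.
rewrite (_ : [set C] = \bigcap_(x in val C) [set D : Fne B | val D x] `&`
     [set D : Fne B | val D `<=` val C]).
  apply: closedI; first by apply: closed_bigI => y _; exact: Fne_mem_closed.
  rewrite -openC (_ : ~` _ = [set D : Fne B | val D `&` ~` val C !=set0]).
    by apply: fell_open_hit; rewrite openC; have /set_mem[] := valP C.
  apply/seteqP; split => D /=; first by move=> /existsNP[x /not_implyP[Dx Cx]]; exists x.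
  by move=> [x [Dx Cx]] /(_ x Dx).
apply/seteqP; split => D; first by move=> ->; split => // x.
by move=> [h1 h2]; apply/val_inj/seteqP; split => // x /h1.
Qed.

Lemma Fne_finite_closed (S : set (Fne B)) : finite_set S -> closed S.
Proof.
move=> fS; rewrite (_ : S = \bigcup_(C in S) [set C]); last by rewrite bigcup_imset1 image_id.
by apply: closed_bigcup => // C _; exact: Fne_closed1.
Qed.

Definition together (S : set (set V)) (p q : V) : Prop := exists2 C, S C & C° p /\ C° q.

(** p and q are interior to a common cell iff, for some n, a cell contains the balls of radius 1 /
    (n + 1) around both. The closed sets containing these balls form a compact subset of [Fne B],
    and missing a compact set is an open condition on T. *)
Lemma measurable_together p q :
  measurable ([set T | together (cells T) p q] : set (borel (FF B))).
Proof.
pose D n : set V := ball p n.+1%:R^-1 `|` ball q n.+1%:R^-1.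
pose K n := [set C : Fne B | D n `<=` val C].
rewrite (_ : [set _ | _] = \bigcup_n ~` [set T : FF B | val T `&` K n = set0]).
  apply: bigcup_measurable => n _; apply: measurableC; apply: sub_borel.
  apply: fell_open_miss; apply: Fne_sup_compact; exists p; left; by apply: ballxx; rewrite invr_gt0.
apply/seteqP; split => T.
  move=> [_ [C TC <-]] [/nbhs_ballP[e/= e0 pe] /nbhs_ballP[e'/= e'0 qe']].
  have m0 : 0 < Num.min e e' by rewrite lt_min e0.
  exists (Num.truncn (Num.min e e')^-1) => // h; have : (val T `&` K (Num.truncn (Num.min e e')^-1)) C; last by rewrite h.
  have le1 : (Num.truncn (Num.min e e')^-1).+1%:R^-1 <= Num.min e e'.
    by rewrite -[leRHS]invrK lef_pV2 ?posrE ?invr_gt0// ltW// truncnS_gt.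
  split => // x [|] /= bx; [apply: pe|apply: qe']; apply: le_ball bx; apply: le_trans le1 _;
    by rewrite ge_min lexx ?orbT.
move=> [n _ /eqP/set0P[C [TC KC]]]; exists (val C); first by exists C.
by split; apply/nbhs_ballP; exists n.+1%:R^-1 => //= x xb; apply: KC; [left|right].
Qed.

End Closed.

Lemma Fne_compact (W : window R l) : compact [set: Fne W].
Proof.
have cW := polytope_closed (windowP W).
rewrite compact_ultra => F UF _.
have [cL LA] := fell_ultra UF; set L := [set x | _] in cL LA.
have LB : L `<=` W.
  move=> y Ly; apply: contrapT => nB.
  have := Ly (~` (W : set V)) _ nB; rewrite openC => /(_ cW) h.
  have [C [z [Cz]]] := filter_ex h; apply.
  by have /set_mem[_ _] := valP C; exact.
suff L0 : L !=set0.
  pose A : Fne W := exist (fun A => A \in _) L (Fne_mem cL L0 LB).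
  by exists A; split => //; exact: LA.
apply: contrapT => /nonemptyPn L0.
pose Q (U : set V) := F [set C : Fne W | val C `&` U = set0].
have : Q W.
  apply: (@compact_induction V W Q); rewrite /Q.
  - exact: polytope_compact (windowP W).
  - by apply: (filterS _ filterT) => C _ /=; rewrite setI0.
  - move=> U U' FU' UU'; apply: filterS FU' => C /= e.
    by apply/seteqP; split => // y [Cy /UU' Uy]; rewrite -e.
  - move=> U U' FU FU'; apply: filterS2 FU FU' => C /= e e'.
    by rewrite setIUr e e' setU0.
  - move=> x Kx; have : ~ L x by rewrite L0.
    move=> /existsNP[G /not_implyP[oG /not_implyP[Gx nF]]].
    exists G; first exact: open_nbhs_nbhs.
    have [//|] := in_ultra_setVsetC [set C : Fne W | val C `&` G !=set0] UF.
    by apply: filterS => C /= /nonemptyPn.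
move=> h; have [C /= e] := @filter_ex _ F _ _ h; have /set_mem[_ [x Cx] CW] := valP C.
have h' : (sval C `&` W) x by split => //; exact: CW.
by rewrite e in h'.
Qed.

Definition rball (i : nat * nat) : set V := ball (dseq R l i.1) i.2.+1%:R^-1.
Definition rcball (i : nat * nat) : set V := [set y | `|dseq R l i.1 - y| <= i.2.+1%:R^-1].

Lemma rball_base (U : set V) x : open U -> U x -> exists i, rball i x /\ rcball i `<=` U.
Proof.
rewrite openE => oU /oU/nbhs_ballP[e /= e0 xe].
pose m := Num.truncn (2 / e); have m0 : m.+1%:R^-1 < e / 2.
  by rewrite -[ltRHS]invrK ltf_pV2 ?posrE ?invr_gt0 ?divr_gt0// invf_div truncnS_gt.
have mp : 0 < (m.+1%:R : R)^-1 by rewrite invr_gt0.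
have [n /= hn] := @dseq_dense R l (ball x m.+1%:R^-1) (ball_open x _) (ex_intro _ x (ballxx x mp)).
exists (n, m); split; first exact: ball_sym.
move=> y /= yn; apply: xe; rewrite -ball_normE/=.
rewrite -ball_normE/= in hn; rewrite (_ : x - y = (x - dseq R l n) + (dseq R l n - y)); last by rewrite addrA subrK.
move: yn; rewrite /rcball/= => yn; apply: le_lt_trans (ler_normD _ _) _; rewrite [ltRHS]splitr.
by apply: ltrD; [exact: lt_trans hn m0|exact: le_lt_trans yn m0].
Qed.

Lemma rcball_compact i : compact (rcball i).
Proof.
case: i => n m; apply: (@subclosed_compact _ _ (cball (`|dseq R l n| + m.+1%:R^-1))).
- rewrite (_ : rcball _ = (fun y => `|dseq R l n - y|) @^-1` [set r | r <= m.+1%:R^-1])//.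
  apply: preimage_closed; last exact: closed_le.
  move=> y _; apply: (@cvg_norm R V _ (nbhs y)).
  by apply: (@cvgB R V _ (nbhs y)); [exact: cvg_cst|exact: cvg_id].
- exact: cball_compact.
- move=> y /= h; rewrite /cball/= -[y](subKr (dseq R l n)) (le_trans (ler_normB _ _))//.
  by rewrite lerD2l.
Qed.

(** Hitting an open rational ball and missing a closed one are both open conditions, so their finite
    conjunctions are a base, to which [fell_base_network] is applied one level up. *)
Definition Fne_base (B : set V) (i : bool * (nat * nat)) : set (Fne B) :=
  [set C | if i.1 then val C `&` rball i.2 !=set0 else val C `&` rcball i.2 = set0].

Lemma Fne_base_open B i : open (@Fne_base B i).
Proof.
case: i => -[] i; [apply: fell_open_hit; exact: ball_open|apply: fell_open_miss; exact: rcball_compact].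
Qed.

Lemma Fne_base_network B : network (@Fne_base B).
Proof.
apply: fell_networkP => M A [[K cK <-]|[U oU <-]] /= hA.
  have cA : open (~` val A) by rewrite openC; have /set_mem[] := valP A.
  pose Q (K : set V) := exists s : seq (bool * (nat * nat)), (forall i, List.In i s -> Fne_base i A) /\
      (forall B0 : Fne B, (forall i, List.In i s -> Fne_base i B0) -> val B0 `&` K = set0).
  apply: (@compact_induction V K Q) => //.
  - by exists nil; split => // B0 _; rewrite setI0.
  - move=> U U' [s [s1 s2]] UU'; exists s; split => // B0 /s2 h.
    by apply/seteqP; split => // x [Bx /UU' Ux]; rewrite -h.
  - move=> U U' [s [s1 s2]] [s' [s1' s2']]; exists (List.app s s'); split.
      by move=> j /List.in_app_iff[/s1|/s1'].
    move=> B0 hB; rewrite setIUr s2 ?s2' ?setU0// => j js; apply: hB; apply/List.in_app_iff; by [left|right].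
  - move=> x Kx; have nA : (~` val A) x by move=> Ax; have : (val A `&` K) x by []; rewrite hA.
    have [j [jx jA]] := rball_base cA nA; exists (rball j); first by apply: open_nbhs_nbhs; split => //; exact: ball_open.
    exists [:: (false, j)]; split => [_ [<-|//]|B0].
      by apply/seteqP; split => // y [Ay /jA].
    move=> /(_ _ (or_introl erefl)) /= e; apply/seteqP; split => // y [By yj].
    by rewrite -e; split => //; move: yj; rewrite /rball /rcball -ball_normE/= => /ltW.
have [x [Ax Ux]] := hA; have [j [jx jU]] := rball_base oU Ux.
exists [:: (true, j)]; split => [_ [<-|//]|B0 /(_ _ (or_introl erefl))/=[y [By yj]]]; first by exists x.
exists y; split => //; apply: jU; by move: yj; rewrite /rball /rcball -ball_normE/= => /ltW.
Qed.

Definition FF_network (B : set V) (i : bool * seq (bool * (nat * nat))) : set (FF B) :=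
  [set T | if i.1 then exists2 C : Fne B, val T C & forall j, List.In j i.2 -> Fne_base j C
           else ~ exists2 C : Fne B, val T C & forall j, List.In j i.2 -> Fne_base j C].

Lemma FF_network_network B : network (@FF_network B).
Proof.
pose G (s : seq (bool * (nat * nat))) := \big[setI/setT]_(j <- s) @Fne_base B j.
have GE s C : G s C <-> forall j, List.In j s -> Fne_base j C.
  rewrite /G; elim: s => [|i s IH]; first by rewrite big_nil.
  rewrite big_cons; split; first by move=> [h /IH h'] j [<-|/h'].
  by move=> h; split; [apply: h; left|apply/IH => j js; apply: h; right].
have oG s : open (G s).
  rewrite /G; elim/big_ind : _ => [|X Y|i _]; [exact: openT|exact: openI|exact: Fne_base_open].
have bG (U : set (Fne B)) C : open U -> U C -> exists2 s, G s C & G s `<=` U.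
  move=> oU UC; have [s [h1 h2]] := Fne_base_network oU UC.
  by exists s; [apply/GE|move=> D /GE; exact: h2].
have clP (C : set (Fne B)) : [set T : set (Fne B) | closed T] C -> closed C by [].
have := fell_base_network clP oG bG.
suff -> : (fun i : bool * seq (bool * (nat * nat)) => [set A : fell [set T : set (Fne B) | closed T] |
   if i.1 then val A `&` G i.2 !=set0 else val A `&` G i.2 = set0]) = @FF_network B by [].
apply/funext => -[b s]; apply/seteqP; split => T; case: b => /=.
- by move=> [C [TC /GE]]; exists C.
- by move=> e [C TC /GE Cs]; have : (val T `&` G s) C by []; rewrite e.
- by move=> [C TC /GE Cs]; exists C.
- by move=> h; apply/seteqP; split => // C [TC /GE Cs]; apply: h; exists C.
Qed.

End FellSpaces.

(** * Restriction and dilation of tessellations *)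

Section Tess.
Variables (R : realType) (l : nat).
Local Notation V := 'rV[R]_l.+1.

(** Finite form of Baire's theorem: if U is not contained in the first set A, continue with the
    nonempty open set U minus A; otherwise U lies in the interior of A. *)
Lemma finite_cover_interior (S : set (set V)) (U : set V) : finite_set S ->
  (forall C, S C -> closed C) -> open U -> U !=set0 -> U `<=` \bigcup_(C in S) C ->
  exists2 C, S C & (U `&` C°) !=set0.
Proof.
move=> /finite_seqP[s ->]; elim: s U => [|A s IH] U cS oU [x Ux] US.
  by have [C] := US x Ux.
have cA : closed A by apply: cS; rewrite /= mem_head.
have [h|/nonemptyPn h] := pselect ((U `&` ~` A) !=set0).
  have [|||C Cs CU] := IH (U `&` ~` A) _ _ h.
  - by move=> C Cs; apply: cS; rewrite /= inE; move: Cs => /= ->; rewrite orbT.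
  - by apply: openI => //; rewrite openC.
  - move=> y [Uy Ay]; have [C /=] := US y Uy; rewrite inE => /orP[/eqP -> //|Cs] Cy.
    by exists C.
  - exists C; first by rewrite /= inE; move: Cs => /= ->; rewrite orbT.
    by move: CU => [y [[Uy _] Cy]]; exists y.
exists A; first by rewrite /= mem_head.
exists x; split => //; apply: (@filterS _ _ _ U); last exact: open_nbhs_nbhs.
by move=> y Uy; apply: contrapT => Ay; have : (U `&` ~` A) y by []; rewrite h.
Qed.

Lemma divides_sub (B : set V) S C : divides_into_polytopes B S -> S C -> C `<=` B.
Proof. by move=> [_ _ <-] SC x Cx; exists C. Qed.

Lemma tess_with_cellsP (W : window R l) (S : set (set V)) : finite_set S ->
  divides_into_polytopes W S -> cells (val (tess_with_cells W S)) = S.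
Proof.
move=> fS dS; have [pS _ _] := dS.
have mS C : S C -> C \in [set A : set V | [/\ closed A, A !=set0 & A `<=` W]].
  move=> SC; rewrite inE; split; [exact: polytope_closed (pS _ SC)| |exact: divides_sub SC].
  by have [_ [x Cx]] := pS _ SC; exists x; exact: interior_subset.
pose T0 : set (Fne W) := [set C : Fne W | S (val C)].
have cE : [set val C | C in T0] = S.
  apply/seteqP; split => [_ [C SC <-] //|C SC].
  by exists (exist (fun A => A \in _) C (mS C SC)).
have fT0 : finite_set T0.
  have := @finite_preimage (Fne W) (set V) S val _ fS; apply => C D _ _; exact: val_inj.
have cT0 : T0 \in [set T : set (Fne W) | closed T] by rewrite inE; exact: Fne_finite_closed.
pose T1 : FF W := exist (fun A => A \in _) T0 cT0.
have mT1 : T1 \in @tessellation_of R l W by rewrite inE; split; rewrite /cells /= cE.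
pose T2 : TW W := exist (fun A => A \in _) T1 mT1.
apply: (@xgetPex _ (whole W) [set T : TW W | cells (val T) = S]).
by exists T2.
Qed.

Lemma TW_divides (W : window R l) (T : TW W) :
  finite_set (cells (val T)) /\ divides_into_polytopes W (cells (val T)).
Proof. exact: (set_mem (valP T)). Qed.

Lemma restrict_cells (W : window R l) (T : FF [set: V]) : tessellation T ->
  cells (val (restrict_tess W T)) =
  [set C `&` W | C in [set C | cells T C /\ (C `&` W)° !=set0]].
Proof.
move=> [_ lT [pT dT uT]]; have pW := windowP W; apply: tess_with_cellsP.
  apply: finite_image; apply: sub_finite_set (lT W (polytope_compact pW)).
  by move=> C [TC [x /interior_subset Cx]]; split => //; exists x.
split.
- by move=> _ [C [TC CW] <-]; apply: polytopeI => //; exact: pT.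
- move=> _ _ [C [TC CW] <-] [D [TD DW] <-] ne.
  have CD : C <> D by move=> e; apply: ne; rewrite e.
  rewrite !interiorI; apply/seteqP; split => // x [[Cx _] [Dx _]].
  by rewrite -(dT _ _ TC TD CD).
- apply/seteqP; split => [x [_ [C _ <-] []] //|x Wx].
  (* The kept traces must cover W although flat traces are discarded. Their union D is closed; if it
     missed a point of W, an open part of the interior of W would be covered by finitely many cells,
     and one of them would have interior points there and would have been kept. *)
  set D := \bigcup_(C in _) C; apply: contrapT => nD.
  pose S' := [set C | cells T C /\ C `&` W !=set0].
  have fS' : finite_set S' by exact: (lT W (polytope_compact pW)).
  have cD : closed D.
    rewrite /D bigcup_image; apply: closed_bigcup.
      apply: sub_finite_set fS' => C [TC [y /interior_subset Cy]]; by split => //; exists y.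
    by move=> C [TC _]; apply: closedI; [exact: polytope_closed (pT _ TC)|exact: polytope_closed pW].
  have oD : open (~` D) by rewrite openC.
  have [y [Wy Dy]] := convex_regular (polytope_convex pW) (proj2 pW) Wx (open_nbhs_nbhs (conj oD nD)).
  have [||||C [TC _] [z [[Wz Dz] Cz]]] := @finite_cover_interior S' (W° `&` ~` D) fS'.
  - by move=> C [TC _]; exact: polytope_closed (pT _ TC).
  - by apply: openI => //; exact: open_interior.
  - by exists y.
  - move=> z [/interior_subset Wz _]; have : [set: V] z by [].
    by rewrite -uT => -[C TC Cz]; exists C => //; split => //; exists z.
  - apply: Dz; exists (C `&` W); last by split; exact: interior_subset.
    by exists C => //; split => //; exists z; rewrite interiorI.
Qed.

Lemma together_restrict (W : window R l) (T : FF [set: V]) p q : tessellation T ->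
  W° p -> W° q -> together (cells (val (restrict_tess W T))) p q <-> together (cells T) p q.
Proof.
move=> tT Wp Wq; rewrite restrict_cells//; split.
  by move=> [_ [C [TC _] <-]]; rewrite interiorI => -[[Cp _] [Cq _]]; exists C.
move=> [C TC [Cp Cq]]; exists (C `&` W); last by rewrite interiorI.
by exists C => //; split => //; exists p; rewrite interiorI.
Qed.

Definition disjoint_cells (S : set (set V)) : Prop :=
  forall C D, S C -> S D -> C <> D -> C° `&` D° = set0.

Lemma disjoint_cells_eq (S : set (set V)) C D p : disjoint_cells S -> S C -> S D ->
  C° p -> D° p -> C = D.
Proof.
move=> dS SC SD Cp Dp; apply: contrapT => ne.
by have : (C° `&` D°) p by []; rewrite (dS _ _ SC SD ne).
Qed.

Definition dil (c : R) (C : set V) : set V := [set c *: x | x in C].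

Lemma dilE c C x : c != 0 -> dil c C x <-> C (c^-1 *: x).
Proof.
move=> c0; split => [[y Cy <-]|Cx]; first by rewrite scalerA mulVf// scale1r.
by exists (c^-1 *: x) => //; rewrite scalerA divff// scale1r.
Qed.

Lemma scale_continuous (c : R) : continuous (fun x : V => c *: x).
Proof. by move=> y; apply: (@cvgZl_tmp R V _ (nbhs y)); exact: cvg_id. Qed.

Lemma dil_preimage c C : c != 0 -> dil c C = (fun x => c^-1 *: x) @^-1` C.
Proof. by move=> c0; apply/seteqP; split => x /(dilE _ _ c0). Qed.

Lemma dilK c C : c != 0 -> dil c^-1 (dil c C) = C.
Proof.
move=> c0; apply/seteqP; split => x; rewrite dilE ?invr_eq0// dilE// invrK scalerA mulVf// scale1r//.
Qed.

Lemma dil_interior c C : c != 0 -> (dil c C)° = dil c C°.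
Proof.
move=> c0; have sub d D : d != 0 -> dil d D° `<=` (dil d D)°.
  move=> d0 x /(dilE _ _ d0) h; rewrite dil_preimage//; exact: (@scale_continuous d^-1 x _ h).
apply/seteqP; split; last exact: sub.
move=> x h; apply/dilE => //.
have /(dilE _ _ (invr_neq0 c0)) : dil c^-1 (dil c C)° (c^-1 *: x) by apply/dilE; rewrite ?invr_eq0// invrK scalerA divff// scale1r.
move=> h'; have := sub c^-1 (dil c C) (invr_neq0 c0) (c^-1 *: x); rewrite dilK//; apply.
by apply/dilE; rewrite ?invr_eq0.
Qed.

Lemma dil_polytope c C : c != 0 -> polytope C -> polytope (dil c C).
Proof.
move=> c0 pC; rewrite (_ : dil c C = [set c *: x + 0 | x in C]); first exact: polytope_dilate.
by apply: eq_imagel => x _; rewrite addr0.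
Qed.

Lemma dil_compact c (K : set V) : compact K -> compact (dil c K).
Proof.
by move=> cK; apply: continuous_compact => //; apply: continuous_subspaceT; exact: scale_continuous.
Qed.

Lemma dilI c (A B : set V) : c != 0 -> dil c A `&` B = dil c (A `&` dil c^-1 B).
Proof.
move=> c0; apply/seteqP; split => x.
  move=> [/(dilE _ _ c0) Ax Bx]; apply/dilE => //; split => //.
  by apply/dilE; rewrite ?invr_eq0// invrK scalerA divff// scale1r.
move=> /(dilE _ _ c0)[Ax /dilE]; rewrite invr_eq0 c0 invrK scalerA divff// scale1r => /(_ isT) Bx.
by split => //; apply/dilE.
Qed.

Lemma dil_neq0 c (A : set V) : dil c A !=set0 <-> A !=set0.
Proof. by split => [[_ [x Ax _]]|[x Ax]]; [exists x|exists (c *: x), x]. Qed.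

(** The dilated family has to be closed in [Fne setT]: it is the preimage of T under the dilation by
    the inverse of c, which is continuous in the Fell topology. *)
Lemma scale_tess_cells (c : R) (T : FF [set: V]) : c != 0 ->
  cells (scale_tess c T) = [set dil c C | C in cells T].
Proof.
move=> c0; apply: (@xgetPex _ T [set T' | cells T' = [set [set c *: x | x in C] | C in cells T]]).
pose P := [set A : set V | [/\ closed A, A !=set0 & A `<=` setT]].
have dP d (C : Fne [set: V]) : d != 0 -> dil d (val C) \in P.
  move=> d0; have /set_mem[cC C0 _] := valP C; rewrite inE; split => //; last by apply/dil_neq0.
  by rewrite dil_preimage//; apply: preimage_closed => // x _; exact: scale_continuous.
pose f d (d0 : d != 0) (C : Fne [set: V]) : Fne [set: V] :=
  exist (fun A => A \in _) (dil d (val C)) (dP d C d0).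
have cf d d0 : continuous (@f d d0).
  apply: fell_continuous => [K cK|G oG].
    rewrite (_ : [set _ | _] = [set C : Fne setT | val C `&` dil d^-1 K = set0]).
      by apply: fell_open_miss; exact: dil_compact.
    apply/seteqP; split => C /= h; apply/eqP; apply/negPn/negP => /set0P.
      by move=> /(dil_neq0 d); rewrite -dilI// h => -[].
    by rewrite dilI// => /dil_neq0; rewrite h => -[].
  rewrite (_ : [set _ | _] = [set C : Fne setT | val C `&` dil d^-1 G !=set0]).
    apply: fell_open_hit; rewrite dil_preimage ?invr_eq0// invrK.
    by apply: open_comp => // x _; exact: scale_continuous.
  by apply/seteqP; split => C /=; rewrite dilI// => /dil_neq0.
have ci : c^-1 != 0 by rewrite invr_eq0.
have cT : (f _ ci @^-1` val T) \in [set T : set (Fne [set: V]) | closed T].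
  rewrite inE; apply: preimage_closed; last exact: (set_mem (valP T)).
  by move=> x _; exact: cf.
exists (exist (fun A => A \in _) _ cT : FF setT) => /=.
apply/seteqP; split => C.
  move=> [D /= TD <-]; exists (val (f _ ci D)); first by exists (f _ ci D).
  by have := dilK (val D) ci; rewrite invrK.
move=> [_ [D TD <-] <-]; exists (f _ c0 D) => //=.
rewrite (_ : f _ ci (f _ c0 D) = D)//.
by apply: val_inj => /=; rewrite dilK.
Qed.

Lemma scale_tessellation (c : R) (T : FF [set: V]) : c != 0 -> tessellation T ->
  tessellation (scale_tess c T).
Proof.
move=> c0 [kT lT [pT dT uT]]; rewrite /tessellation/= scale_tess_cells//; split.
- exact: card_le_trans (card_image_le _ _) kT.
- move=> K cK; apply: (@sub_finite_set _ _ (dil c @` [set C | cells T C /\ C `&` dil c^-1 K !=set0])).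
    move=> _ [[C TC <-]]; rewrite dilI// => /dil_neq0 h; by exists C.
  by apply: finite_image; apply: lT; exact: dil_compact.
- split.
  + by move=> _ [C TC <-]; apply: dil_polytope => //; exact: pT.
  + move=> _ _ [C TC <-] [D TD <-] ne; rewrite !dil_interior//.
    apply/seteqP; split => // x [/(dilE _ _ c0) Cx /(dilE _ _ c0) Dx].
    have CD : C <> D by move=> e; apply: ne; rewrite e.
    have : (C° `&` D°) (c^-1 *: x) by [].
    by rewrite (dT _ _ TC TD CD).
  + apply/seteqP; split => // x _.
    have [C TC Cx] : (\bigcup_(C in cells T) C) (c^-1 *: x) by rewrite uT.
    by exists (dil c C); [exists C|apply/dilE].
Qed.

Lemma together_scale (c : R) (T : FF [set: V]) p q : c != 0 ->
  together (cells (scale_tess c T)) p q <-> together (cells T) (c^-1 *: p) (c^-1 *: q).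
Proof.
move=> c0; rewrite scale_tess_cells//; split.
  by move=> [_ [C TC <-]]; rewrite dil_interior// => -[/(dilE _ _ c0) Cp /(dilE _ _ c0) Cq]; exists C.
move=> [C TC [Cp Cq]]; exists (dil c C); first by exists C.
by rewrite dil_interior//; split; apply/dilE.
Qed.

Lemma tessellation_disjoint (T : FF [set: V]) : tessellation T -> disjoint_cells (cells T).
Proof. by move=> [_ _ []]. Qed.

Lemma TW_disjoint (W : window R l) (T : TW W) : disjoint_cells (cells (val T)).
Proof. by have [_ []] := TW_divides T. Qed.

Lemma continuous_borel (X Y : ptopologicalType) (f : X -> Y) : continuous f ->
  measurable_fun setT (f : borel X -> borel Y).
Proof.
move=> cf; apply: (@measurability _ _ _ (borel Y) _ _ (@open Y)) => // _ [U oU <-].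
by rewrite setTI; apply: sub_borel; apply: open_comp => // x _; exact: cf.
Qed.

Lemma TW_val_continuous (W : window R l) : continuous (val : TW W -> FF W).
Proof. exact: initial_continuous. Qed.

Lemma TW_openE (W : window R l) (U : set (TW W)) : open U ->
  exists2 A : set (FF W), open A & U = val @^-1` A.
Proof. by move=> [A oA <-]; exists A. Qed.

Lemma TW_network (W : window R l) : network (fun i => [set T : TW W | FF_network i (val T)]).
Proof.
move=> U T /TW_openE[A oA ->] AT; have [s [s1 s2]] := FF_network_network oA AT.
by exists s; split => // y hy; apply: s2.
Qed.

Lemma measurable_TW_together (W : window R l) p q :
  measurable ([set T : TW W | together (cells (val T)) p q] : set (borel (TW W))).
Proof.
rewrite -[X in measurable X]setTI.
exact: (continuous_borel (@TW_val_continuous W) measurableT (measurable_together (polytope_closed (windowP W)) p q)).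
Qed.

(** Points of the dense sequence detect whether a cell meets an open ball. Missing a closed ball is
    therefore expressed as missing some larger open one. *)
Lemma rcball_miss (C : set V) i : compact C -> C `&` rcball i = set0 ->
  exists m : nat, C `&` ball (dseq R l i.1) (i.2.+1%:R^-1 + m.+1%:R^-1) = set0.
Proof.
case: i => n k /= cC h; pose r := (k.+1%:R : R)^-1.
pose Q (U : set V) := exists m : nat, (C `&` U) `&` ball (dseq R l n) (r + m.+1%:R^-1) = set0.
suff [m] : Q C by rewrite setIid => hm; exists m.
have mono (U : set V) m m' : (m <= m')%N -> U `&` ball (dseq R l n) (r + m.+1%:R^-1) = set0 ->
    U `&` ball (dseq R l n) (r + m'.+1%:R^-1) = set0.
  move=> mm' e; apply/seteqP; split => // x [Ux bx]; rewrite -e; split => //.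
  by apply: le_ball bx; rewrite lerD2l lef_pV2 ?posrE// ler_nat.
apply: (@compact_induction V C Q cC).
- by exists 0%N; rewrite setI0 set0I.
- move=> U U' [m e] UU'; exists m; apply/seteqP; split => // x [[Cx /UU' Ux] bx].
  by rewrite -e.
- move=> U U' [m e] [m' e']; exists (maxn m m').
  by rewrite setIUr setIUl (mono _ _ _ (leq_maxl _ _) e) (mono _ _ _ (leq_maxr _ _) e') setU0.
- move=> x Cx; have xr : r < `|dseq R l n - x|.
    by rewrite ltNge; apply/negP => xr; have : (C `&` rcball (n, k)) x by []; rewrite h.
  pose e := `|dseq R l n - x| - r; have e0 : 0 < e by rewrite subr_gt0.
  exists (ball x (e / 2)); first by apply: nbhsx_ballx; rewrite divr_gt0.
  exists (Num.truncn (2 / e)); apply/seteqP; split => // y [[Cy]].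
  rewrite -!ball_normE/= => xy by_.
  have m0 : (Num.truncn (2 / e)).+1%:R^-1 < e / 2.
    by rewrite -[ltRHS]invrK ltf_pV2 ?posrE ?invr_gt0 ?divr_gt0// invf_div truncnS_gt.
  have := ler_distD y (dseq R l n) x; rewrite (distrC y x) => tri.
  have : `|dseq R l n - x| < r + e / 2 + e / 2.
    apply: le_lt_trans tri _; apply: ltrD => //; apply: lt_trans by_ _; by rewrite ltrD2l.
  by rewrite -addrA -splitr /e addrC subrK ltxx.
Qed.

(* A cell is recovered from the points of the countable dense set in its interior. *)
Lemma measurable_TW (W : window R l) d (X : measurableType d) (f : X -> TW W) :
  (forall n m, W° (dseq R l n) -> W° (dseq R l m) ->
     measurable (f @^-1` [set T | together (cells (val T)) (dseq R l n) (dseq R l m)])) ->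
  measurable_fun setT (f : X -> borel (TW W)).
Proof.
move=> mf; pose Q := [set n | W° (dseq R l n)].
pose tg q n := if pselect (Q q /\ Q n) is left _ then
  f @^-1` [set T | together (cells (val T)) (dseq R l q) (dseq R l n)] else set0.
have mtg q n : measurable (tg q n).
  by rewrite /tg; case: pselect => [[Qq Qn]|_]; [exact: (mf q n Qq Qn)|exact: measurable0].
have tgE q n x : tg q n x <-> together (cells (val (f x))) (dseq R l q) (dseq R l n).
  rewrite /tg; case: pselect => [[Qq Qn] //|nQ]; split => //=.
  move=> [C TC [Cq Cn]]; have [_ dT] := TW_divides (f x).
  by apply: nQ; split; [move: Cq|move: Cn]; apply: interiorS; exact: divides_sub TC.
pose hitb q (i : nat * nat) (e : R) := \bigcup_(n in [set n | ball (dseq R l i.1) e (dseq R l n)]) tg q n.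
have mhit q i e : measurable (hitb q i e) by apply: bigcup_measurable.
have hitE q i e x C : cells (val (f x)) C -> C° (dseq R l q) ->
    hitb q i e x <-> C `&` ball (dseq R l i.1) e !=set0.
  move=> TC Cq; have [_ [pT _ _]] := TW_divides (f x).
  split.
    move=> [n bn /tgE[D TD [Dq Dn]]]; exists (dseq R l n); split => //.
    by rewrite (disjoint_cells_eq (@TW_disjoint _ (f x)) TC TD Cq Dq); exact: interior_subset.
  move=> [y [Cy by_]]; have [_ C0] := pT _ TC.
  have [z [Cz bz]] := convex_regular (polytope_convex (pT _ TC)) C0 Cy (open_nbhs_nbhs (conj (ball_open _ _) by_)).
  have [n [Cn bn]] := dseq_dense (openI (@open_interior _ C) (ball_open (dseq R l i.1) e)) (ex_intro _ z (conj Cz bz)).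
  by exists n => //; apply/tgE; exists C.
pose Hb q (j : bool * (nat * nat)) : set X :=
  if j.1 then hitb q j.2 j.2.2.+1%:R^-1 else \bigcup_m ~` hitb q j.2 (j.2.2.+1%:R^-1 + m.+1%:R^-1).
have mHb q j : measurable (Hb q j).
  by rewrite /Hb; case: ifP => // _; apply: bigcup_measurable => m _; exact: measurableC.
have HbE q j x (C : Fne W) : cells (val (f x)) (val C) -> (val C)° (dseq R l q) -> Hb q j x <-> Fne_base j C.
  move=> TC Cq; case: j => -[] i; rewrite /Hb/=; first exact: hitE.
  split.
    move=> [m _] /= nh; apply/seteqP; split => // y [Cy /= yi]; apply: nh.
    apply/(hitE q i _ x (val C)) => //; exists y; split => //.
    rewrite -ball_normE/=; apply: le_lt_trans yi _; by rewrite ltrDl invr_gt0.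
  move=> h; have [_ [pT _ _]] := TW_divides (f x).
  have [m hm] := rcball_miss (polytope_compact (pT _ TC)) h.
  by exists m => //= /(hitE q i _ x (val C) TC Cq); rewrite hm => -[].
pose E (s : seq (bool * (nat * nat))) := \bigcup_q (tg q q `&` \big[setI/setT]_(j <- s) Hb q j).
have mE s : measurable (E s).
  apply: bigcup_measurable => q _; apply: measurableI => //.
  by elim: s => [|j s IH]; rewrite ?big_nil ?big_cons//; exact: measurableI.
have EE s x : E s x <-> exists2 C : Fne W, (val (val (f x))) C & forall j, List.In j s -> Fne_base j C.
  have bigE q (C : Fne W) : cells (val (f x)) (val C) -> (val C)° (dseq R l q) ->
      (\big[setI/setT]_(j <- s) Hb q j) x <-> forall j, List.In j s -> Fne_base j C.
    move=> TC Cq; elim: s => [|j s IH]; first by rewrite big_nil.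
    rewrite big_cons; split; first by move=> [/(HbE _ _ _ _ TC Cq) h /IH h'] i [<-|/h'].
    by move=> h; split; [apply/(HbE _ _ _ _ TC Cq); apply: h; left|apply/IH => i js; apply: h; right].
  split.
    move=> [q _ [/tgE[_ [C TC <-] [Cq _]] h]]; exists C => //.
    by apply/(bigE q C) => //; exists C.
  move=> [C TC h]; have [_ [pT _ _]] := TW_divides (f x).
  have TC' : cells (val (f x)) (val C) by exists C.
  have [_ C0] := pT _ TC'.
  have [q Cq] := dseq_dense (@open_interior _ (val C)) C0.
  by exists q => //; split; [apply/tgE; exists (val C)|apply/(bigE q C)].
apply: (network_measurable (@TW_network W)) => -[b s].
rewrite (_ : _ @^-1` _ = if b then E s else ~` E s); first by case: b => //; exact: measurableC.
by apply/seteqP; split => x; case: b => /=; rewrite /FF_network/= => h; try apply/EE; rewrite // /setC/= => /EE.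
Qed.

End Tess.

Lemma measurable_prod_generated d1 d2 (T1 : measurableType d1) (T2 : measurableType d2)
    (C1 : set (set T1)) (C2 : set (set T2)) :
  @measurable _ T1 = <<s C1 >> -> C1 setT -> @measurable _ T2 = <<s C2 >> -> C2 setT ->
  @measurable _ (T1 * T2)%type = <<s [set A `*` B | A in C1 & B in C2] >>.
Proof.
move=> e1 c1 e2 c2; set G := [set A `*` B | A in C1 & B in C2].
have sG : sigma_algebra setT <<s G >> := smallest_sigma_algebra setT G.
rewrite measurable_prod_measurableType; apply/seteqP; split.
  apply: smallest_sub => // _ [A mA] [B mB] <-.
  have h1 : image_set_system setT fst <<s G >> A.
    have : <<s C1 >> A by rewrite -e1.
    apply: smallest_sub; first exact: sigma_algebra_image.
    move=> A' CA'; rewrite /image_set_system/= setTI; apply: sub_sigma_algebra.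
    by exists A' => //; exists setT => //; apply/seteqP; split => x //= [].
  have h2 : image_set_system setT snd <<s G >> B.
    have : <<s C2 >> B by rewrite -e2.
    apply: smallest_sub; first exact: sigma_algebra_image.
    move=> A' CA'; rewrite /image_set_system/= setTI; apply: sub_sigma_algebra.
    by exists setT => //; exists A' => //; apply/seteqP; split => x //= [].
  rewrite (_ : A `*` B = (setT `&` fst @^-1` A) `&` (setT `&` snd @^-1` B)).
    exact: (@measurableI _ (g_sigma_algebraType G) _ _ h1 h2).
  by rewrite !setTI.
apply: smallest_sub; first exact: smallest_sigma_algebra.
move=> _ [A CA] [B CB] <-; apply: sub_sigma_algebra; exists A; first by rewrite e1; exact: sub_sigma_algebra.
by exists B => //; rewrite e2; exact: sub_sigma_algebra.
Qed.

Lemma measurable_indic_comp (R : realType) d1 d2 (T1 : measurableType d1) (T2 : measurableType d2)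
    (X : T1 -> T2) (A : set T2) : measurable_fun setT X -> measurable A ->
  measurable_fun setT (fun x => \1_A (X x) : R).
Proof.
move=> mX mA; rewrite (_ : (fun _ => _) = \1_(X @^-1` A)); last by apply/funext => x; rewrite !indicE.
by apply: measurable_indic; rewrite -[X in measurable X]setTI; exact: mX.
Qed.

(** * The division tree and its finite-dimensional laws *)

Section ProductMeasure.
Context (R : realType) d1 (T1 : measurableType d1) d2 (T2 : measurableType d2).
Variables (m1 : {sigma_finite_measure set T1 -> \bar R}) (m2 : {sigma_finite_measure set T2 -> \bar R}).

(** A named copy of the product, to which a sigma-finite structure is attached so that it can itself
    be a factor of a product. *)
Definition prod_measure : set (T1 * T2) -> \bar R := (m1 \x m2)%E.
HB.instance Definition _ := Measure.on prod_measure.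

Let prod_measure_sigma_finite : sigma_finite setT prod_measure.
Proof.
have /sigma_finiteP[F [TF ndF Foo]] := sigma_finiteT m1.
have /sigma_finiteP[G [TG ndG Goo]] := sigma_finiteT m2.
exists (fun n => F n `*` G n).
  rewrite -setXTT TF TG; apply/seteqP; split => [[x y] [/= [n _ Fnx] [k _ Gky]]|[x y] [n _ [? ?]]]; last by split; exists n.
  exists (maxn n k) => //; split => /=.
    by move: x Fnx; exact/subsetPset/ndF/leq_maxl.
  by move: y Gky; exact/subsetPset/ndG/leq_maxr.
move=> k; have [? ?] := Foo k; have [? ?] := Goo k; split; first exact: measurableX.
by rewrite /prod_measure product_measure1E// lte_mul_pinfty// ge0_fin_numE.
Qed.

HB.instance Definition _ := Measure_isSigmaFinite.Build _ _ _ prod_measure prod_measure_sigma_finite.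

End ProductMeasure.

Section ConditionalLaw.
Context (R : realType) d (T : measurableType d) (P : probability T R) (Gen : set (set T)).
Hypothesis GenM : Gen `<=` measurable.
Context dh (Hy : measurableType dh) (m : {finite_measure set Hy -> \bar R}).
Let Hn := g_sigma_algebraType Gen.
Let Rt := measurableTypeR R.
Variables (tau : T -> Rt) (h : T -> Hy) (g1 g2 : T -> R) (K : set (Hn * Hy)).
Hypotheses (mtau : measurable_fun setT tau) (mh : measurable_fun setT h).
Hypotheses (mg1 : measurable_fun setT g1) (mg2 : measurable_fun setT g2).
Hypotheses (g1_01 : forall w, 0 <= g1 w <= 1) (g2_01 : forall w, 0 <= g2 w <= 1).
Hypothesis mK : measurable K.

Definition hit_rate (w : Hn) : R := fine (m (xsection K w)).

Hypothesis g2_rate : forall w, g2 w != 0 -> 0 < hit_rate w.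
Hypothesis g1_tau : forall w, g1 w != 0 -> 0 < tau w.
Hypothesis law : forall G (t : R) (A : set Hy), <<s Gen >> G -> 0 <= t -> measurable A ->
  (\int[P]_w (g1 w * (\1_G w * (\1_[set w | t < tau w] w * \1_A (h w))))%:E =
   \int[P]_w (g2 w * (\1_G w * (expR (- (hit_rate w * t)) *
      (fine (m (A `&` xsection K w)) / hit_rate w))))%:E)%E.

Lemma measurable_id_history : measurable_fun setT (id : T -> Hn).
Proof.
move=> _ B mB; rewrite setTI; move: mB; apply: smallest_sub; last by [].
exact: sigma_algebra_measurable.
Qed.

Lemma measurable_hit_rate : measurable_fun setT hit_rate.
Proof.
apply: (measurableT_comp (fine_measurable measurableT)).
exact: (measurable_fun_xsection m mK).
Qed.

Let mlam : measurable_fun setT (hit_rate : T -> R) :=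
  measurableT_comp measurable_hit_rate measurable_id_history.

(** Conditional density of lifetime and hyperplane with respect to Lebesgue measure times m. The
    factor [hit_rate] of the exponential density and the factor 1 / [hit_rate] of the hitting law
    cancel. *)
Let k (z : T * (Rt * Hy)) : R :=
  \1_`]0, +oo[%classic z.2.1 * (expR (- (hit_rate z.1 * z.2.1)) * \1_K (z.1, z.2.2)).

Let mX2 : measurable_fun setT (fun z : T * (Rt * Hy) => (z.1, z.2) : Hn * (Rt * Hy)).
Proof.
apply: measurable_fun_pair; last exact: measurable_snd.
exact: (measurableT_comp measurable_id_history (measurable_fst : measurable_fun setT (fst : T * (Rt * Hy) -> T))).
Qed.

Let mk : measurable_fun setT k.
Proof.
have m2 : measurable_fun setT (fun z : T * (Rt * Hy) => z.2.1).
  exact: (measurableT_comp measurable_fst measurable_snd).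
have mi : measurable_fun setT (\1_`]0%R, +oo[%classic : Rt -> R) by apply: measurable_indic; exact: measurable_itv.
apply: measurable_funM; first exact: (measurableT_comp mi m2).
apply: measurable_funM.
  apply: measurableT_comp; first exact: measurable_expR.
  apply: measurableT_comp => //; apply: measurable_funM => //.
  exact: (measurableT_comp mlam measurable_fst).
apply: measurable_indic_comp => //; apply: measurable_fun_pair.
  exact: (measurableT_comp measurable_id_history (measurable_fst : measurable_fun setT (fst : T * (Rt * Hy) -> T))).
exact: (measurableT_comp measurable_snd measurable_snd).
Qed.

Let k_ge0 z : 0 <= k z.
Proof. by rewrite !mulr_ge0// expR_ge0. Qed.

Let leb : {sigma_finite_measure set Rt -> \bar R} := @lebesgue_measure R.
Let m2 := prod_measure leb m.

Lemma iterated_kernel (J : Hn * (Rt * Hy) -> R) : measurable_fun setT J -> (forall z, 0 <= J z) ->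
  (\int[P \x m2]_z (g2 z.1 * k z * J (z.1, z.2))%:E =
   \int[P]_w ((g2 w)%:E * \int[leb]_(t in `]0%R, +oo[) ((expR (- (hit_rate w * t)))%:E *
       \int[m]_(y in xsection K w) (J (w, (t, y)))%:E)))%E.
Proof.
move=> mJ J0.
have mJ2 : measurable_fun setT (fun z : T * (Rt * Hy) => J (z.1, z.2)) by exact: (measurableT_comp mJ mX2).
have mF : measurable_fun setT (fun z : T * (Rt * Hy) => (g2 z.1 * k z * J (z.1, z.2))%:E).
  apply/measurable_EFinP; apply: measurable_funM => //; apply: measurable_funM => //.
  exact: (measurableT_comp mg2 measurable_fst).
have F0 (z : T * (Rt * Hy)) : (0 <= (g2 z.1 * k z * J (z.1, z.2))%:E)%E.
  by rewrite lee_fin !mulr_ge0//; have /andP[] := g2_01 z.1.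
rewrite fubini_tonelli1//; apply: eq_integral => w _; rewrite /fubini_F/=.
have mJw : measurable_fun setT (fun p : Rt * Hy => J (w, p)).
  by apply: (measurableT_comp mJ); apply: measurable_fun_pair.
have mkw : measurable_fun setT (fun p : Rt * Hy => k (w, p)).
  by apply: (measurableT_comp mk); apply: measurable_fun_pair.
under eq_integral do rewrite -mulrA EFinM.
have m1 : measurable_fun setT (fun p : Rt * Hy => (k (w, p) * J (w, p))%:E).
  by apply/measurable_EFinP; exact: measurable_funM.
rewrite ge0_integralZl_EFin//; last 2 first.
- by move=> p _; rewrite lee_fin mulr_ge0.
- by have /andP[] := g2_01 w.
congr (_ * _)%E; rewrite fubini_tonelli1//; last by move=> p; rewrite lee_fin mulr_ge0.
rewrite [RHS]integral_mkcond/=; apply: eq_integral => t _; rewrite /fubini_F /patch.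
rewrite /k/= indicE; case: ifPn => [tp|/negbTE tp]; last first.
  by apply: integral0_eq => y _; rewrite !mul0r.
under eq_integral do rewrite mul1r -mulrA EFinM.
have mJt : measurable_fun setT (fun y : Hy => J (w, (t, y))).
  by apply: (measurableT_comp mJ); apply: measurable_fun_pair => //; apply: measurable_fun_pair.
have mKw : measurable (xsection K w) by exact: measurable_xsection.
rewrite ge0_integralZl_EFin ?expR_ge0//.
- congr (_ * _)%E; rewrite [RHS]integral_mkcond; apply: eq_integral => y _.
  rewrite /patch indicE; have [h1|h1] := boolP ((w, y) \in K).
    by rewrite ifT ?mul1r//; apply/mem_set/xsectionP/set_mem.
  rewrite ifF ?mul0r//; apply/negbTE; apply: contra h1 => /set_mem/xsectionP h1; exact: mem_set.
- by move=> y _; rewrite lee_fin mulr_ge0.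
- apply/measurable_EFinP; apply: measurable_funM => //.
  by apply: measurable_indic_comp => //; exact: measurable_fun_pair.
Qed.

Lemma integral_exp_hit (w : Hn) (s : R) : 0 < hit_rate w -> 0 <= s ->
  (\int[leb]_(t in `]s, +oo[) (expR (- (hit_rate w * t)))%:E =
   (expR (- (hit_rate w * s)) / hit_rate w)%:E)%E.
Proof.
move=> l0 s0; have := integral_expR_tail s l0.
have mE : measurable_fun setT (fun t : R => expR (- (hit_rate w * t))).
  apply: measurableT_comp; first exact: measurable_expR.
  by apply: measurableT_comp => //; exact: measurable_funM.
rewrite (_ : (fun t => _) = (fun t : R => (hit_rate w)%:E * (expR (- (hit_rate w * t)))%:E)%E); last first.
  by apply/funext => t; rewrite EFinM mulNr.
rewrite ge0_integralZl_EFin ?(ltW l0)//.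
- move=> e; rewrite mulNr in e; move/(congr1 (fun x => ((hit_rate w)^-1%:E * x)%E)): e.
  rewrite muleA -EFinM mulVf ?gt_eqF// mul1e => ->.
  by rewrite -EFinM mulrC.
- by apply: measurable_funTS; exact/measurable_EFinP.
Qed.

Let Cs : set (set (Hn * (Rt * Hy))) :=
  [set G `*` I | G in (@measurable _ Hn) & I in
     [set I `*` A | I in [set I : set Rt | I = setT \/ exists x, I = `]x, +oo[%classic] & A in @measurable _ Hy]].

(** The hypothesis [law] only knows past events and the events tau > t and h in A. Boxes made of
    these generate, and both sides are weighted images of measures, so [push_density] extends the
    identity to all nonnegative J. The weights [g1] and [g2] stand for the other cells of the
    generation, before and after averaging. *)
Lemma conditional_law (J : Hn * (Rt * Hy) -> R) : measurable_fun setT J -> (forall z, 0 <= J z) ->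
  (\int[P]_w (g1 w * J (w, (tau w, h w)))%:E =
   \int[P]_w ((g2 w)%:E * \int[leb]_(t in `]0%R, +oo[) ((expR (- (hit_rate w * t)))%:E *
       \int[m]_(y in xsection K w) (J (w, (t, y)))%:E)))%E.
Proof.
move=> mJ J0; rewrite -iterated_kernel//.
pose X1 w : Hn * (Rt * Hy) := (w, (tau w, h w)).
pose X2 (z : T * (Rt * Hy)) : Hn * (Rt * Hy) := (z.1, z.2).
have key (D : set (Hn * (Rt * Hy))) : Cs D -> (\int[P]_x (g1 x * \1_D (X1 x))%:E = \int[P \x m2]_x (g2 x.1 * k x * \1_D (X2 x))%:E)%E.
  move=> [G mG] [_ [I hI] [A mA] <-] <-.
  have mI : measurable I by case: hI => [->//|[x ->]]; exact: measurable_itv.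
  have mD : measurable (G `*` (I `*` A) : set (Hn * (Rt * Hy))) by apply: measurableX => //; exact: measurableX.
  have mI1 : measurable_fun setT (\1_(G `*` (I `*` A)) : Hn * (Rt * Hy) -> R) by exact: measurable_indic.
  rewrite (iterated_kernel mI1)//.
  have [t [t0 It]] : exists t : R, 0 <= t /\ forall s, 0 < s -> (I s <-> t < s).
    case: hI => [->|[x ->]]; first by exists 0.
    (* Lifetimes are positive where [g1] is nonzero, so a negative threshold may be replaced by 0,
       as [law] requires. *)
    exists (Num.max x 0); split; first by rewrite le_max lexx orbT.
    by move=> s s0; rewrite /= in_itv/= andbT gt_max s0 andbT.
  have indX (a : Hn) (b : R) (c : Hy) : \1_(G `*` (I `*` A)) (a, (b, c)) = \1_G a * (\1_I b * \1_A c) :> R.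
    by rewrite !indicE !in_setX/= -!natrM !mulnb.
  transitivity (\int[P]_w (g1 w * (\1_G w * (\1_[set w | t < tau w] w * \1_A (h w))))%:E)%E.
    apply: eq_integral => w _; rewrite /X1 indX.
    have [->|/g1_tau tw] := eqVneq (g1 w) 0; first by rewrite !mul0r.
    rewrite (_ : \1_I (tau w) = \1_[set w | t < tau w] w)// !indicE.
    suff -> : (tau w \in I) = (w \in [set w | t < tau w]) by [].
    by apply/idP/idP => /set_mem h1; apply/mem_set; exact/It.
  rewrite law//; apply: eq_integral => w _.
  have [->|/g2_rate lw] := eqVneq (g2 w) 0; first by rewrite mul0r mul0e.
  rewrite EFinM; congr (_ * _)%E.
  have mKw : measurable (xsection K w) by exact: measurable_xsection.
  transitivity (\int[leb]_(t0 in `]t, +oo[) ((\1_G w * fine (m (A `&` xsection K w)))%:E * (expR (- (hit_rate w * t0)))%:E))%E.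
    rewrite ge0_integralZl_EFin//.
    - by rewrite integral_exp_hit// -EFinM; congr (_%:E); field; rewrite gt_eqF.
    - apply: measurable_funTS; apply/measurable_EFinP; apply: measurableT_comp; first exact: measurable_expR.
      by apply: measurableT_comp => //; exact: measurable_funM.
    - by rewrite mulr_ge0// fine_ge0.
  rewrite [LHS]integral_mkcond [RHS]integral_mkcond/=; apply: eq_integral => s _.
  rewrite /patch !mem_setE !in_itv/= !andbT.
  have [ts|ts] := ltP t s.
    rewrite (le_lt_trans t0 ts) muleC; congr (_ * _)%E.
    under eq_integral do rewrite indX EFinM.
    rewrite ge0_integralZl_EFin//; last by apply: measurable_funTS; apply/measurable_EFinP; apply: measurable_funM => //; exact: measurable_indic.
    rewrite EFinM; congr (_ * _)%E; rewrite indicE (mem_set (proj2 (It _ (le_lt_trans t0 ts)) ts)).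
    under eq_integral do rewrite mul1r.
    rewrite integral_indic// fineK// ge0_fin_numE//.
    by rewrite -ge0_fin_numE// fin_num_measure//; exact: measurableI.
  case: ifPn => // s0; rewrite integral0_eq ?mule0// => y _; rewrite indX.
  have -> : \1_I s = 0 :> R by rewrite indicE memNset//; move/(proj1 (It _ s0)); rewrite ltNge ts.
  by rewrite mul0r mulr0.
have CT : Cs setT.
  exists setT => //; exists setT; last by apply/seteqP; split.
  by exists setT; [left|exists setT => //; apply/seteqP; split].
have gT : (\int[P]_x (g1 x)%:E = \int[P \x m2]_x (g2 x.1 * k x)%:E)%E.
  have := key setT CT; under eq_integral do rewrite indicT mulr1.
  by under [in RHS]eq_integral do rewrite indicT mulr1.
apply: (@push_density R _ _ _ _ _ _ P (P \x m2)%E X1 X2 g1 (fun z => g2 z.1 * k z) _ _ _ _ _ _ Cs) => //.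
- apply: measurable_fun_pair; first exact: measurable_id_history.
  exact: measurable_fun_pair.
- apply: measurable_funM => //; exact: (measurableT_comp mg2 measurable_fst).
- by move=> w; have /andP[] := g1_01 w.
- by move=> z; rewrite mulr_ge0//; have /andP[] := g2_01 z.1.
- apply: measurable_prod_generated => //.
  + rewrite eqEsubset; split; [exact: sub_sigma_algebra|apply: smallest_sub => //; exact: sigma_algebra_measurable].
  + apply: measurable_prod_generated => //.
    * rewrite eqEsubset; split.
        rewrite -/Rt (_ : @measurable _ Rt = <<s @RGenOInfty.G R >>); last exact: RGenOInfty.measurableE.
        apply: smallest_sub; first exact: smallest_sigma_algebra.
        by move=> _ [x ->]; apply: sub_sigma_algebra; right; exists x.
      apply: smallest_sub; first exact: sigma_algebra_measurable.
      by move=> I [->//|[x ->]]; exact: measurable_itv.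
    * by left.
    * rewrite eqEsubset; split; [exact: sub_sigma_algebra|apply: smallest_sub => //; exact: sigma_algebra_measurable].
  + by exists setT; [left|exists setT => //; apply/seteqP; split].
- move=> _ _ [G mG] [_ [I hI] [A mA <-] <-] [G' mG'] [_ [I' hI'] [A' mA' <-] <-].
  exists (G `&` G'); first exact: measurableI.
  exists ((I `&` I') `*` (A `&` A')); last by apply/seteqP; split => -[a [b c]] /=; tauto.
  exists (I `&` I'); last by exists (A `&` A') => //; exact: measurableI.
  case: hI hI' => [->|[x ->]] [->|[x' ->]]; rewrite ?setTI ?setIT; [by left|by right; exists x'|by right; exists x|].
  right; exists (Num.max x x'); apply/seteqP; split => y /=; rewrite !in_itv/= !andbT gt_max.
    by move=> [-> ->].
  by move=> /andP.
- apply: (@le_lt_trans _ _ (\int[P]_w 1%:E)%E); last by rewrite integral_cst// mul1e; apply: (le_lt_trans (probability_le1 P measurableT)); exact: ltry.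
  apply: ge0_le_integral => //.
  + by move=> w _; rewrite lee_fin; have /andP[] := g1_01 w.
  + exact/measurable_EFinP.
  + by move=> w _; rewrite lee_fin; have /andP[] := g1_01 w.
Qed.

End ConditionalLaw.

(** * The binary tree of cells *)

Section Words.
Fixpoint gen_words (n : nat) : seq (seq bool) :=
  if n is n'.+1 then flatten [seq [:: rcons v false; rcons v true] | v <- gen_words n'] else [:: [::]].

Fixpoint words (n : nat) : seq (seq bool) :=
  if n is n'.+1 then words n' ++ gen_words n' else [::].

Lemma mem_gen_words n v : (v \in gen_words n) = (size v == n).
Proof.
elim: n v => [|n IH] v; first by rewrite /= inE size_eq0.
apply/idP/idP => /=.
  move=> /flattenP[_ /mapP[u un ->]]; rewrite !inE => /orP[] /eqP ->;
  by rewrite size_rcons eqSS -IH.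
case/lastP: v => [//|v c]; rewrite size_rcons eqSS -IH => vn.
apply/flattenP; exists [:: rcons v false; rcons v true]; first by apply/mapP; exists v.
by rewrite !inE; case: c; rewrite eqxx ?orbT.
Qed.

Lemma uniq_gen_words n : uniq (gen_words n).
Proof.
elim: n => [//|n IH] /=; elim: (gen_words n) IH => [//|v s IHs] /= /andP[vs us].
rewrite IHs// andbT inE negb_or eqseq_rcons andbF/=.
have H c : rcons v c \notin flatten [seq [:: rcons u false; rcons u true] | u <- s].
  apply/negP => /flattenP[_ /mapP[u un ->]]; rewrite !inE !eqseq_rcons.
  by move=> /orP[] /andP[/eqP vu _]; rewrite vu un in vs.
by rewrite !H.
Qed.

Lemma mem_words n v : (v \in words n) = (size v < n)%N.
Proof.
elim: n => [//|n IH] /=; rewrite mem_cat IH mem_gen_words ltnS [RHS]leq_eqVlt orbC//.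
Qed.

Lemma uniq_words n : uniq (words n).
Proof.
elim: n => [//|n IH] /=; rewrite cat_uniq IH uniq_gen_words andbT/=.
by apply/hasPn => v; rewrite mem_gen_words mem_words => /eqP ->; rewrite ltnn.
Qed.

Lemma big_gen_wordsS (R : comNzRingType) (F : seq bool -> R) n :
  \prod_(v <- gen_words n.+1) F v = \prod_(v <- gen_words n) (F (rcons v false) * F (rcons v true)).
Proof.
rewrite /= big_flatten/= big_map; apply: eq_bigr => v _.
by rewrite !big_cons big_nil mulr1.
Qed.

Lemma sum_gen_wordsS (R : nzRingType) (F : seq bool -> R) n :
  \sum_(v <- gen_words n.+1) F v = \sum_(v <- gen_words n) (F (rcons v false) + F (rcons v true)).
Proof.
rewrite /= big_flatten/= big_map; apply: eq_bigr => v _.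
by rewrite !big_cons big_nil addr0.
Qed.

Lemma prod_tuple_words (R : comNzRingType) (F : seq bool -> R) n :
  \prod_(v : n.-tuple bool) F v = \prod_(v <- gen_words n) F v.
Proof.
rewrite -big_enum/= -(big_map (fun v : n.-tuple bool => val v) xpredT F).
apply: perm_big; apply: uniq_perm; first by rewrite map_inj_uniq ?enum_uniq//; exact: val_inj.
  exact: uniq_gen_words.
move=> v; rewrite mem_gen_words; apply/mapP/eqP => [[u _ ->]|vn]; first by rewrite size_tuple.
by exists (Tuple (introT eqP vn)); rewrite ?mem_enum.
Qed.

Lemma prefix_or_branch (v v' : seq bool) :
  [\/ exists s, v' = v ++ s, exists s, v = v' ++ s |
      exists i, [/\ (i < size v)%N, (i < size v')%N, take i v = take i v' & nth false v i <> nth false v' i]].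
Proof.
elim: v v' => [|c v IH] [|c' v']; first by constructor 1; exists [::].
- by constructor 1; exists (c' :: v').
- by constructor 2; exists (c :: v).
have [<-|cc] := eqVneq c c'; last by constructor 3; exists 0%N; split => //=; exact/eqP.
have [[s ->]|[s ->]|[i [i1 i2 ti ni]]] := IH v'.
- by constructor 1; exists s.
- by constructor 2; exists s.
- by constructor 3; exists i.+1; split => //=; rewrite ti.
Qed.

End Words.

Section Cells.
Variables (R : realType) (l : nat).
Local Notation V := 'rV[R]_l.+1.
Local Notation H := (hyperplane R l).
Variables (W : window R l) (tau : seq bool -> R) (h : seq bool -> H).
Implicit Types v : seq bool.

Lemma birth_rcons v c : birth tau (rcons v c) = birth tau v + tau v.
Proof.
rewrite /birth size_rcons big_ord_recr/= -cats1 take_size_cat//; congr (_ + _).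
by apply: eq_bigr => i _; rewrite takel_cat// ltnW.
Qed.

Lemma cell_nil : cell W h [::] = W.
Proof. by rewrite /cell; apply/seteqP; split => [x []//|x Wx]; split. Qed.

Lemma cell_rcons v c : cell W h (rcons v c) = cell W h v `&` half_space c (h v).
Proof.
rewrite /cell size_rcons; apply/seteqP; split => [x [Wx hx]|x [[Wx hx] hc]].
  split; last by have := hx (size v) (ltnSn _); rewrite nth_rcons ltnn eqxx -cats1 take_size_cat.
  split => // i iv; have := hx i (leqW iv); rewrite nth_rcons iv -cats1 takel_cat//; exact: ltnW.
split => // i; rewrite ltnS leq_eqVlt => /orP[/eqP ->|iv].
  by rewrite nth_rcons ltnn eqxx -cats1 take_size_cat.
by rewrite nth_rcons iv -cats1 takel_cat; [exact: hx|exact: ltnW].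
Qed.

Lemma cell_conv_hull v : exists s, cell W h v = conv_hull s.
Proof.
elim/last_ind: v => [|v c [s sE]]; first by rewrite cell_nil; exact: (proj1 (windowP W)).
rewrite cell_rcons sE half_spaceE.
pose u := (nform (h v)).1; pose a := (nform (h v)).2.
have [s' s'E] := conv_hullI_polyhedron s [:: if c then (- u, - a) else (u, a)].
exists s'; rewrite -s'E; congr (_ `&` _); apply/seteqP; split => x /=.
  move=> hx p; rewrite inE => /eqP ->; case: c hx s'E; rewrite /side /dir/= -/u -/a => hx _.
    by rewrite -scaleN1r dotZl mulN1r; lra.
  by lra.
move=> /(_ _ (mem_head _ _)); rewrite /side /dir -/u -/a; case: (c) => /=.
  by rewrite -scaleN1r dotZl mulN1r => ?; lra.
by move=> ?; lra.
Qed.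

Lemma cell_compact v : compact (cell W h v).
Proof. by have [s ->] := cell_conv_hull v; exact: conv_hull_compact. Qed.

Lemma cell_convex v : convex (cell W h v).
Proof. by have [s ->] := cell_conv_hull v; exact: conv_hull_convex. Qed.

Lemma cell_polytope v : (cell W h v)° !=set0 -> polytope (cell W h v).
Proof. by move=> ?; split => //; exact: cell_conv_hull. Qed.

Lemma interior_cell_rcons v c : (cell W h (rcons v c))° =
  (cell W h v)° `&` [set x | if c then 0 < side (h v) x else side (h v) x < 0].
Proof. by rewrite cell_rcons interiorI interior_half_space. Qed.

Lemma interior_cellE v p : (cell W h v)° p <-> (W : set V)° p /\ forall i, (i < size v)%N ->
  if nth false v i then 0 < side (h (take i v)) p else side (h (take i v)) p < 0.
Proof.
elim/last_ind: v => [|v c IH]; first by rewrite cell_nil; split => [|[]].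
rewrite interior_cell_rcons size_rcons; split.
  move=> [/IH[Wp hp] hc]; split => // i; rewrite ltnS leq_eqVlt => /orP[/eqP ->|iv].
    by rewrite nth_rcons ltnn eqxx -cats1 take_size_cat.
  by rewrite nth_rcons iv -cats1 takel_cat; [exact: hp|exact: ltnW].
move=> [Wp hp]; split; last by have := hp (size v) (ltnSn _); rewrite nth_rcons ltnn eqxx -cats1 take_size_cat.
apply/IH; split => // i iv; have := hp i (leqW iv).
by rewrite nth_rcons iv -cats1 takel_cat//; exact: ltnW.
Qed.

Lemma branch_disjoint v v' i p : (i < size v)%N -> (i < size v')%N -> take i v = take i v' ->
  nth false v i <> nth false v' i -> (cell W h v)° p -> (cell W h v')° p -> False.
Proof.
move=> iv iv' e ne /interior_cellE[_ /(_ i iv) h1] /interior_cellE[_ /(_ i iv') h2].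
move: h1 h2 ne; rewrite e; case: (nth false v i); case: (nth false v' i) => // h1 h2 _;
by have := lt_trans h1 h2; rewrite ltxx.
Qed.

Definition alive (t : R) v := birth tau v <= t < birth tau v + tau v.

Section Positive.
Hypothesis tau_gt0 : forall v, 0 < tau v.

Lemma birth_cat v s : birth tau v <= birth tau (v ++ s).
Proof.
elim/last_ind: s => [|s c IH]; first by rewrite cats0.
by rewrite -rcons_cat birth_rcons (le_trans IH)// lerDl ltW.
Qed.

Lemma birth_cat_lt v c s : birth tau v + tau v <= birth tau (v ++ c :: s).
Proof. by rewrite -cat_rcons -(birth_rcons v c) birth_cat. Qed.

(** Two words either branch, and then their cells lie on different sides of one hyperplane, or one
    extends the other, and then the lifetimes do not overlap. *)
Lemma alive_disjoint t v v' p : alive t v -> alive t v' -> (cell W h v)° p -> (cell W h v')° p -> v = v'.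
Proof.
move=> /andP[a1 a2] /andP[a1' a2'] Cv Cv'.
have [[s e]|[s e]|[i [i1 i2 ti ni]]] := prefix_or_branch v v'; last by case: (branch_disjoint i1 i2 ti ni Cv Cv').
- case: s e => [|c s] e; first by rewrite e cats0.
  have h1 := birth_cat_lt v c s; rewrite -e in h1.
  by have := le_lt_trans (le_trans h1 a1') a2; rewrite ltxx.
- case: s e => [|c s] e; first by rewrite e cats0.
  have h1 := birth_cat_lt v' c s; rewrite -e in h1.
  by have := le_lt_trans (le_trans h1 a1) a2'; rewrite ltxx.
Qed.

(** Descends from W along cells that contain x and are born by time t. Once generation n is born
    after t, this shows that the living cells cover W. *)
Lemma greedy t x n : 0 <= t -> (W : set V) x ->
  (exists v, [/\ (size v < n)%N, alive t v & cell W h v x]) \/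
  (exists v, [/\ size v = n, birth tau v <= t & cell W h v x]).
Proof.
move=> t0 Wx; elim: n => [|n [[v [vn av Cv]]|[v [vn bv Cv]]]].
- by right; exists [::]; rewrite cell_nil /birth big_ord0.
- by left; exists v; split => //; exact: leqW.
have [tv|tv] := ltP t (birth tau v + tau v).
  by left; exists v; split => //; [rewrite vn|rewrite /alive bv].
right; pose c := 0 <= side (h v) x; exists (rcons v c); rewrite size_rcons vn birth_rcons; split => //.
rewrite cell_rcons; split => //; rewrite half_spaceE/= /c; case: ifP => // /negbT.
by rewrite -ltNge => /ltW.
Qed.

Variables (t : R) (n : nat).
Hypotheses (t0 : 0 <= t) (good : forall v, (cell W h v)° !=set0)
  (late : forall v, size v = n -> t < birth tau v).

Lemma alive_size v : alive t v -> (size v < n)%N.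
Proof.
move=> /andP[bv _]; rewrite ltnNge; apply/negP => nv.
have st : size (take n v) = n by rewrite size_takel.
have := lt_le_trans (late st) (birth_cat (take n v) (drop n v)).
by rewrite cat_take_drop ltNge bv.
Qed.

Lemma tree_tess_cells : cells (val (tree_tess W tau h t)) = [set cell W h v | v in [set v | alive t v]].
Proof.
apply: tess_with_cellsP.
  apply: finite_image; apply: (@sub_finite_set _ _ [set` words n]); last exact: finite_seq.
  by move=> v /alive_size; rewrite /= mem_words.
split.
- by move=> _ [v _ <-]; exact: cell_polytope.
- move=> _ _ [v av <-] [v' av' <-] ne; apply/seteqP; split => // p [Cv Cv'].
  by apply: ne; rewrite (alive_disjoint av av' Cv Cv').
- apply/seteqP; split => [x [_ [v _ <-]] []//|x Wx].
  have [[v [_ av Cv]]|[v [vn bv _]]] := greedy n t0 Wx; first by exists (cell W h v) => //; exists v.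
  by have := late vn; rewrite ltNge bv.
Qed.

End Positive.
End Cells.

(** * Blocks of marked points in the cells of a tessellation *)

Section Patterns.
Variables (R : realType) (l : nat) (I : finType) (b : I -> 'rV[R]_l.+1).
Local Notation V := 'rV[R]_l.+1.

Definition blk (C : set V) : {set I} := [set i | `[< C° (b i) >]].

Lemma in_blk C i : (i \in blk C) <-> C° (b i).
Proof. by rewrite inE; split => /asboolP. Qed.

Definition occurs (S : set (set V)) (B : {set I}) : Prop := exists2 C, S C & blk C = B.

(** The product runs over the nonempty blocks that occur and not over the cells: a tessellation of
    the whole space has infinitely many cells, all but finitely many of them without marked
    points. *)
Definition Phi (f : {set I} -> R) (S : set (set V)) : R :=
  \prod_(B : {set I} | (B != finset.set0) && `[< occurs S B >]) f B.

Lemma Phi_bounds f S : (forall B, 0 <= f B <= 1) -> 0 <= Phi f S <= 1.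
Proof.
move=> f01; rewrite /Phi; elim/big_ind : _ => [|x y /andP[x0 x1] /andP[y0 y1]|B _ //].
  by rewrite ler01 lexx.
by rewrite mulr_ge0//= mulr_ile1.
Qed.

Lemma Phi_tree (W : window R l) tau (h : seq bool -> hyperplane R l) t n f :
  (forall v, 0 < tau v) -> 0 <= t -> (forall v, (cell W h v)° !=set0) ->
  (forall v, size v = n -> t < birth tau v) -> f finset.set0 = 1 ->
  Phi f (cells (val (tree_tess W tau h t))) =
  \prod_(v <- words n) (if birth tau v <= t < birth tau v + tau v then f (blk (cell W h v)) else 1).
Proof.
move=> tau0 t0 good late f0; rewrite (tree_tess_cells tau0 t0 good late).
rewrite -big_mkcond (partition_big (fun v => blk (cell W h v)) xpredT)//= /Phi big_mkcond.
apply: eq_bigr => B _; have [->|B0] := eqVneq B finset.set0.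
  by rewrite big1// => v /andP[_ /eqP ->].
case: asboolP => /= [[_ [v av <-] vB]|nB]; last first.
  by rewrite big1// => v /andP[av /eqP vB]; exfalso; apply: nB; exists (cell W h v) => //; exists v.
have vw : v \in words n by rewrite mem_words; exact: (alive_size tau0 late av).
have av' : birth tau v <= t < birth tau v + tau v := av.
rewrite big_mkcond (bigD1_seq v vw (uniq_words n))/= av' vB eqxx/= {av'}.
rewrite big1 ?mulr1// => v' ne; case: ifP => // /andP[av' /eqP vB']; exfalso; move/eqP: ne; apply.
have /finset.set0Pn[i iB] := B0.
apply: (@alive_disjoint _ _ W tau h tau0 t v' v (b i) av' av); apply/in_blk; by rewrite ?vB ?vB'.
Qed.

Lemma prod_Phi_tree (W : window R l) tau (h : seq bool -> hyperplane R l) n (L : seq (R * ({set I} -> R))) :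
  (forall v, 0 < tau v) -> (forall v, (cell W h v)° !=set0) -> weights_ok L ->
  (forall p v, p \in L -> size v = n -> p.1 < birth tau v) -> (forall p, p \in L -> 0 <= p.1) ->
  \prod_(p <- L) Phi p.2 (cells (val (tree_tess W tau h p.1))) =
  \prod_(v <- words n) weight L (birth tau v) (tau v) (blk (cell W h v)).
Proof.
move=> tau0 good wL late L0; rewrite /weight exchange_big/= big_seq [RHS]big_seq.
apply: eq_bigr => p pL; have [_ p0] := wL p pL.
by apply: Phi_tree => //; [exact: L0|move=> v; exact: late].
Qed.

End Patterns.

Lemma measurable_prod_seq (R : realType) d (T : measurableType d) (J : eqType) (r : seq J) (F : J -> T -> R) :
  (forall j, j \in r -> measurable_fun setT (F j)) -> measurable_fun setT (fun x => \prod_(j <- r) F j x).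
Proof.
elim: r => [|j r IH] mF; first by under eq_fun do rewrite big_nil; exact: measurable_cst.
under eq_fun do rewrite big_cons; apply: measurable_funM; first by apply: mF; rewrite mem_head.
by apply: IH => k kr; apply: mF; rewrite inE kr orbT.
Qed.

Lemma prod_seq01 (R : realType) (J : eqType) (r : seq J) (F : J -> R) :
  (forall j, j \in r -> 0 <= F j <= 1) -> 0 <= \prod_(j <- r) F j <= 1.
Proof.
elim: r => [|j r IH] F01; first by rewrite big_nil ler01 lexx.
rewrite big_cons; have /andP[a0 a1] := F01 j (mem_head _ _).
have /andP[b0 b1] : 0 <= \prod_(j <- r) F j <= 1 by apply: IH => k kr; apply: F01; rewrite inE kr orbT.
by rewrite mulr_ge0//= mulr_ile1.
Qed.

Lemma indic01 (R : realType) (T : Type) (A : set T) x : 0 <= (\1_A x : R) <= 1.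
Proof. by rewrite indicE; case: (_ \in _); rewrite /= ?lexx ler01. Qed.

Lemma mul01 (R : realType) (x y : R) : 0 <= x <= 1 -> 0 <= y <= 1 -> 0 <= x * y <= 1.
Proof. by move=> /andP[x0 x1] /andP[y0 y1]; rewrite mulr_ge0//= mulr_ile1. Qed.

Lemma qhits_sub (R : realType) (l : nat) (C : set 'rV[R]_l.+1) : convex C -> qhits C `<=` hits C.
Proof.
move=> cC h [n Cn [m Cm /= /andP[hn hm]]].
set a := side h (dseq R l n) in hn; set c := side h (dseq R l m) in hm.
pose t := - a / (c - a); have ca : 0 < c - a by rewrite subr_gt0 (lt_trans hn).
have na : 0 < - a by rewrite oppr_gt0.
exists ((1 - t) *: dseq R l n + t *: dseq R l m); split.
  by apply/on_side; rewrite side_affine -/a -/c /t; field; rewrite gt_eqF.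
have t0 : 0 <= t by rewrite divr_ge0 ?(ltW na) ?(ltW ca).
have t1 : t <= 1 by rewrite ler_pdivrMr// mul1r lerDr ltW.
have := cC (dseq R l n) (dseq R l m) (1 - t) (interior_subset Cn) (interior_subset Cm).
by rewrite subKr; apply; lra.
Qed.

Section Tree.
Context (R : realType) (l : nat) (Lambda : {measure set (borel (hyperplane R l)) -> \bar R})
  (hL : driving_measure Lambda) (W : window R l) d (T : measurableType d) (P : probability T R)
  (tau : seq bool -> T -> R) (h : seq bool -> T -> borel (hyperplane R l))
  (hD : division_tree Lambda P W tau h).
Local Notation V := 'rV[R]_l.+1.
Local Notation H := (borel (hyperplane R l)).
Local Notation C v w := (cell W (h^~ w) v).
Let Lfin := window_bound W hL.

Definition tree_gen n : set (set T) := [set E | exists2 v : seq bool, (size v < n)%N &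
   (exists2 B : set R, measurable B & E = tau v @^-1` B) \/
   (exists2 B : set H, measurable B & E = h v @^-1` B)].
(** The sample space with the sigma-field of the generations below n. Giving a function the domain
    [Hist n] is how its measurability with respect to the past is expressed. *)
Definition Hist n := g_sigma_algebraType (tree_gen n).

Lemma tree_gen_measurable n : tree_gen n `<=` measurable.
Proof.
move=> _ [v _ [[B mB ->]|[B mB ->]]]; rewrite -[X in measurable X]setTI.
  exact: (tree_lifetime hD).
exact: (tree_hyperplane hD).
Qed.

Lemma history_tau n v : (size v < n)%N -> measurable_fun setT (tau v : Hist n -> R).
Proof. by move=> vn _ B mB; rewrite setTI; apply: sub_sigma_algebra; exists v => //; left; exists B. Qed.

Lemma history_h n v : (size v < n)%N -> measurable_fun setT (h v : Hist n -> H).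
Proof. by move=> vn _ B mB; rewrite setTI; apply: sub_sigma_algebra; exists v => //; right; exists B. Qed.

Lemma from_history n d' (E : measurableType d') (f : T -> E) :
  measurable_fun setT (f : Hist n -> E) -> measurable_fun setT f.
Proof. by move=> mf; exact: (measurableT_comp mf (measurable_id_history (@tree_gen_measurable n))). Qed.

Lemma history_birth n v : (size v <= n)%N -> measurable_fun setT ((fun w => birth (tau^~ w) v) : Hist n -> R).
Proof.
move=> vn; rewrite /birth; apply: measurable_sum => i; apply: history_tau.
by rewrite size_take ltn_ord (leq_trans _ vn).
Qed.

Lemma history_interior n v p : (size v <= n)%N -> measurable ([set w | (C v w)° p] : set (Hist n)).
Proof.
move=> vn; have mS i : (i < size v)%N -> measurable ([set w | if nth false v i then 0 < side (h (take i v) w) p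
    else side (h (take i v) w) p < 0] : set (Hist n)).
  move=> iv; have mh : measurable_fun setT ((fun w => side (h (take i v) w) p) : Hist n -> R).
    apply: (measurableT_comp (measurable_side p)); apply: history_h.
    by rewrite size_take iv (leq_trans iv).
  by case: nth; apply: measurable_lt_set.
have [Wp|Wp] := pselect ((W : set V)° p); last first.
  by rewrite (_ : [set _ | _] = set0)//; apply/seteqP; split => // w /interior_cellE[].
rewrite (_ : [set _ | _] = \bigcap_(i in [set i | (i < size v)%N])
   [set w | if nth false v i then 0 < side (h (take i v) w) p else side (h (take i v) w) p < 0]).
  by apply: (@fin_bigcap_measurable _ (Hist n)); [exact: finite_II|move=> i; exact: mS].
by apply/seteqP; split => w; [move=> /interior_cellE[]|move=> hw; apply/interior_cellE].
Qed.

Definition good_gen n : set T := [set w | forall v, size v = n -> (C v w)° !=set0].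

Lemma history_good n : measurable (good_gen n : set (Hist n)).
Proof.
rewrite (_ : good_gen n = \bigcap_(v in [set v | v \in gen_words n]) \bigcup_m [set w | (C v w)° (dseq R l m)]).
  apply: fin_bigcap_measurable; first exact: finite_seq.
  move=> v; rewrite /= mem_gen_words => /eqP vn; apply: bigcup_measurable => m _.
  by apply: history_interior; rewrite vn.
apply/seteqP; split => w /=.
  move=> g v /=; rewrite mem_gen_words => /eqP/g h1.
  by have [m hm] := dseq_dense (@open_interior _ (C v w)) h1; exists m.
move=> g v vn; have [] := g v; first by rewrite /= mem_gen_words vn.
by move=> m _ hm; exists (dseq R l m).
Qed.

(** The random set of dividing hyperplanes of the cell v as one subset of past times hyperplanes.
    Thanks to [qhits] it is a countable union of measurable rectangles. *)
Definition hit_set n v : set (Hist n * H) := [set z | qhits (C v z.1) z.2].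

Arguments hit_set : clear implicits.

Lemma measurable_hit_set n v : (size v <= n)%N -> measurable (hit_set n v).
Proof.
move=> vn; rewrite (_ : hit_set n v = \bigcup_i \bigcup_j
   (([set w | (C v w)° (dseq R l i)] `&` [set w | (C v w)° (dseq R l j)]) `*`
     [set g | side g (dseq R l i) < 0 < side g (dseq R l j)])).
  apply: bigcup_measurable => i _; apply: bigcup_measurable => j _; apply: measurableX.
    by apply: (@measurableI _ (Hist n)); exact: history_interior.
  exact: measurable_sep.
apply/seteqP; split => -[w g] /=.
  move=> [i Ci [j Cj gij]].
  exact: (ex_intro2 _ _ i I (ex_intro2 _ _ j I (conj (conj Ci Cj) gij))).
move=> [i _ [j _ [[Ci Cj] gij]]]; exists i; first exact: Ci.
by exists j; first exact: Cj.
Qed.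

Let mhW : measurable (hits W : set H).
Proof. by apply: hits_compact; apply: polytope_compact; exact: windowP. Qed.

(** All cells lie in W, so Lambda can be cut down to the finite measure that [conditional_law]
    expects. *)
Definition LambdaW : {finite_measure set H -> \bar R} := mfrestr mhW (driving_windows hL W).

Lemma LambdaWE A : A `<=` hits W -> LambdaW A = Lambda A.
Proof. by move=> AW; rewrite /LambdaW /= /mfrestr /mrestr setIidl. Qed.

Definition crate n v : Hist n -> R := hit_rate LambdaW (hit_set n v).
Arguments crate : clear implicits.

Lemma crateE n v (w : Hist n) : crate n v w = (hit_rate LambdaW (hit_set n v) : Hist n -> R) w.
Proof. by []. Qed.

Lemma hit_setE n v w : xsection (hit_set n v) w = qhits (C v w).
Proof. by apply/seteqP; split => g; [move=> /xsectionP|move=> ?; apply/xsectionP]. Qed.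

Lemma hits_cell_sub v w : hits (C v w) `<=` hits W.
Proof. by move=> g [x [gx [Wx _]]]; exists x. Qed.

Lemma qhits_cell_sub v w : qhits (C v w) `<=` hits W.
Proof. exact: subset_trans (qhits_sub (@cell_convex _ _ _ _ _)) (@hits_cell_sub v w). Qed.

Section GoodCell.
Variables (n : nat) (v : seq bool) (w : T).
Hypothesis good : (C v w)° !=set0.

Let mq : measurable (qhits (C v w) : set H). Proof. exact: measurable_qhits. Qed.
Let mh : measurable (hits (C v w) : set H).
Proof. by apply: hits_compact; exact: cell_compact. Qed.

Lemma Lambda_qhits (A : set H) : measurable A -> Lambda (A `&` hits (C v w)) = LambdaW (A `&` qhits (C v w)).
Proof.
move=> mA; have pC := cell_polytope good; have [r Cr] := polytope_bounded pC.
have N : Lambda (hits (C v w) `\` qhits (C v w)) = 0%E.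
  apply: (Lambda_tangent_null hL Lfin _ Cr); first exact: polytope_compact.
  by apply: convex_regular => //; exact: cell_convex.
rewrite LambdaWE; last by move=> g [_ /qhits_cell_sub].
rewrite (_ : A `&` hits (C v w) = (A `&` qhits (C v w)) `|` (A `&` (hits (C v w) `\` qhits (C v w)))).
  rewrite measureU0//; [exact: measurableI|by apply: measurableI => //; exact: measurableD|].
  apply/eqP; rewrite eq_le measure_ge0 andbT -N le_measure ?inE//.
    by apply: measurableI => //; exact: measurableD.
  exact: measurableD.
apply/seteqP; split => g; last by move=> [[Ag /(qhits_sub (@cell_convex _ _ _ _ _))]|[Ag []]].
by move=> [Ag hg]; have [q|q] := pselect (qhits (C v w) g); [left|right].
Qed.

Lemma crate_rate : rate Lambda (C v w) = crate n v w.
Proof. by rewrite /rate /crate /hit_rate hit_setE -(setTI (hits _)) Lambda_qhits// setTI. Qed.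

Lemma hit_lawE (A : set H) : measurable A ->
  hit_law Lambda (C v w) A = fine (LambdaW (A `&` xsection (hit_set n v) w)) / crate n v w.
Proof. by move=> mA; rewrite /hit_law Lambda_qhits// crate_rate hit_setE. Qed.

Lemma crate_gt0 : 0 < crate n v w.
Proof.
rewrite -crate_rate /rate; have pC := cell_polytope good; have [r Cr] := polytope_bounded pC.
rewrite fine_gt0// (Lambda_hits_gt0 hL (polytope_compact pC) Cr good)/=.
apply: le_lt_trans (driving_windows hL W); rewrite le_measure ?inE//; exact: hits_cell_sub.
Qed.

End GoodCell.

Lemma fine_LambdaW_div01 n v w (A : set H) : (size v <= n)%N -> measurable A ->
  0 <= fine (LambdaW (A `&` xsection (hit_set n v) w)) / crate n v w <= 1.
Proof.
move=> vn mA; rewrite divr_ge0 ?fine_ge0//=.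
have mx : measurable (xsection (hit_set n v) w) by apply: measurable_xsection; exact: measurable_hit_set.
have le1 : fine (LambdaW (A `&` xsection (hit_set n v) w)) <= crate n v w.
  rewrite /crate /hit_rate fine_le ?fin_num_measure//; first exact: measurableI.
  by rewrite le_measure ?inE//; exact: measurableI.
have [->|c0] := eqVneq (crate n v w) 0; first by rewrite invr0 mulr0 ler01.
by rewrite ler_pdivrMr ?mul1r// lt_def c0 fine_ge0.
Qed.

Section OneGeneration.
Variable n : nat.

Let mgood : measurable (good_gen n : set T).
Proof. by have := measurable_id_history (@tree_gen_measurable n) measurableT (@history_good n); rewrite setTI. Qed.

Let mG (G : set T) : history tau h n G -> measurable G.
Proof. by move=> hG; have := measurable_id_history (@tree_gen_measurable n) measurableT hG; rewrite setTI. Qed.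

Variables (J : seq bool -> Hist n * (measurableTypeR R * H) -> R) (Jh : seq bool -> Hist n -> R).
Hypothesis mJ : forall v, size v = n -> measurable_fun setT (J v).
Hypothesis mJh : forall v, size v = n -> measurable_fun setT (Jh v).
Hypothesis J01 : forall v z, 0 <= J v z <= 1.
Hypothesis Jh01 : forall v w, 0 <= Jh v w <= 1.
Hypothesis J_pos : forall v w (t : R) g, t <= 0 -> J v (w, (t, g)) = 0.
Hypothesis J_law : forall v w, size v = n -> good_gen n w ->
  (\int[lebesgue_measure]_(t in `]0%R, +oo[) ((expR (- (crate n v w * t)))%:E *
     \int[LambdaW]_(y in qhits (C v w)) (J v (w, (t, y)))%:E) = (Jh v w)%:E)%E.

(** D lists the words at which the general test J has already replaced the elementary test on
    lifetime and hyperplane. [F2] is the counterpart after averaging. *)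
Let F1 (D : seq (seq bool)) (t : seq bool -> R) (A : seq bool -> set H) v w : R :=
  if v \in D then J v (w, (tau v w, h v w)) else \1_[set w | t v < tau v w] w * \1_(A v) (h v w).
Let F2 (D : seq (seq bool)) (t : seq bool -> R) (A : seq bool -> set H) v w : R :=
  if v \in D then Jh v w else
    expR (- (crate n v w * t v)) * (fine (LambdaW (A v `&` xsection (hit_set n v) w)) / crate n v w).

Let mF1 D t A v : size v = n -> measurable (A v) -> measurable_fun setT (F1 D t A v).
Proof.
move=> vn mA; rewrite /F1; have [vD|vD] := boolP (v \in D); last first.
  apply: measurable_funM; last by apply: measurable_indic_comp => //; exact: (tree_hyperplane hD).
  apply: measurable_indic; apply: measurable_lt_set => //; exact: (tree_lifetime hD).
apply: (measurableT_comp (mJ vn)); apply: measurable_fun_pair; first exact: measurable_id_history (@tree_gen_measurable n).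
apply: measurable_fun_pair; [exact: (tree_lifetime hD)|exact: (tree_hyperplane hD)].
Qed.

Let mF2 D t A v : size v = n -> measurable (A v) -> measurable_fun setT (F2 D t A v : Hist n -> R).
Proof.
move=> vn mA; have mK : measurable (hit_set n v) by apply: measurable_hit_set; rewrite vn.
have mc : measurable_fun setT (crate n v) by exact: measurable_hit_rate.
rewrite /F2; have [vD|vD] := boolP (v \in D); first exact: mJh.
apply: measurable_funM.
  apply: measurableT_comp; first exact: measurable_expR.
  by apply: measurableT_comp => //; exact: measurable_funM.
apply: measurable_funM; last first.
  rewrite (_ : (fun w => _) = (fun w => crate n v w `^ (-1))).
    by apply: (measurableT_comp (measurable_powR _)).
  by apply/funext => w; rewrite powR_inv1// fine_ge0.
apply: (measurableT_comp (fine_measurable measurableT)).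
rewrite (_ : (fun w => _) = (fun w => LambdaW (xsection (hit_set n v `&` (setT `*` A v)) w))).
  apply: measurable_fun_xsection; apply: measurableI => //; exact: measurableX.
apply/funext => w; congr (LambdaW _); apply/seteqP; split => g.
  by move=> [Ag /xsectionP K]; apply/xsectionP.
by move=> /xsectionP[K [_ Ag]]; split => //; apply/xsectionP.
Qed.

Let F1_01 D t A v w : 0 <= F1 D t A v w <= 1.
Proof. by rewrite /F1; case: ifP => _ //; apply: mul01; exact: indic01. Qed.

Let F2_01 D t A v w : size v = n -> 0 <= t v -> measurable (A v) -> 0 <= F2 D t A v w <= 1.
Proof.
move=> vn t0 mA; rewrite /F2; case: ifP => _ //; apply: mul01; last by apply: fine_LambdaW_div01; rewrite ?vn.
by rewrite expR_ge0/= -expR0 ler_expR oppr_le0 mulr_ge0// fine_ge0.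
Qed.

Lemma tree_law_indic (G : set T) t A : history tau h n G -> (forall v, 0 <= t v) -> (forall v, measurable (A v)) ->
  (\int[P]_w (\1_G w * (\1_(good_gen n) w * \prod_(v <- gen_words n) F1 [::] t A v w))%:E =
   \int[P]_w (\1_G w * (\1_(good_gen n) w * \prod_(v <- gen_words n) F2 [::] t A v w))%:E)%E.
Proof.
move=> hG t0 mA; have hGg : history tau h n (G `&` good_gen n).
  by apply: (@measurableI _ (Hist n)) => //; exact: history_good.
have := tree_law hD hGg t0 mA.
set S := [set w | _]; have mS : measurable S.
  rewrite (_ : S = \bigcap_(v in [set v | v \in gen_words n]) ([set w | t v < tau v w] `&` h v @^-1` A v)).
    apply: fin_bigcap_measurable => [|v _]; first exact: finite_seq.
    apply: measurableI; first by apply: measurable_lt_set => //; exact: (tree_lifetime hD).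
    by rewrite -[X in measurable X]setTI; exact: (tree_hyperplane hD).
  apply/seteqP; split => w hw v; first by rewrite /= mem_gen_words => /eqP; exact: hw.
  by move=> vn; apply: hw; rewrite /= mem_gen_words vn.
have SE w : \1_S w = \prod_(v <- gen_words n) F1 [::] t A v w :> R.
  rewrite indicE; case: (boolP (w \in S)) => [/set_mem hw|hw].
    rewrite big_seq big1// => v; rewrite mem_gen_words => /eqP/hw[h1 h2].
    by rewrite /F1/= !indicE !mem_set// mulr1.
  have /existsNP[v /not_implyP[vn nv]] : ~ S w by move=> hS; rewrite mem_set in hw.
  have vg : v \in gen_words n by rewrite mem_gen_words vn.
  rewrite (bigD1_seq v vg (uniq_gen_words n))/= {1}/F1/= !indicE.
  have [h1|h1] := boolP (w \in [set w | t v < tau v w]); last by rewrite !mul0r.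
  by rewrite (memNset (A := A v)) ?mulr0 ?mul0r// => h2; apply: nv; split => //; exact: set_mem h1.
move=> law; transitivity (P (G `&` good_gen n `&` S)).
  rewrite (_ : P _ = \int[P]_w (\1_(G `&` good_gen n `&` S) w)%:E)%E; last first.
    by rewrite integral_indic ?setIT//; apply: measurableI => //; exact: mG.
  apply: eq_integral => w _; rewrite -SE !indicE !in_setI.
  by rewrite -!natrM !mulnb andbA.
rewrite law integral_mkcond; apply: eq_integral => w _.
rewrite /patch in_setI !indicE; case: (boolP (w \in G)) => [wG|]; last by rewrite mul0r.
case: (boolP (w \in good_gen n)) => [/set_mem wg|]; last by rewrite mul0r mulr0.
rewrite /= !mul1r (prod_tuple_words (fun v => expR (- (rate Lambda (C v w) * t v)) * hit_law Lambda (C v w) (A v))).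
congr EFin; rewrite big_seq [RHS]big_seq; apply: eq_bigr => v.
rewrite mem_gen_words => /eqP vn; by rewrite /F2 in_nil (crate_rate n (wg v vn)) (hit_lawE n (wg v vn)).
Qed.

(** Words enter D one at a time: [conditional_law] is applied to the cell v, all other factors being
    frozen in the weights. Its hypothesis [law] is the induction hypothesis for D, with a varying
    elementary test at v. *)
Lemma tree_law_words (D : seq (seq bool)) : uniq D -> {subset D <= gen_words n} ->
  forall (G : set T) t A, history tau h n G -> (forall v, 0 <= t v) -> (forall v, measurable (A v)) ->
  (\int[P]_w (\1_G w * (\1_(good_gen n) w * \prod_(v <- gen_words n) F1 D t A v w))%:E =
   \int[P]_w (\1_G w * (\1_(good_gen n) w * \prod_(v <- gen_words n) F2 D t A v w))%:E)%E.
Proof.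
elim: D => [_ _|v D IH] /=; first exact: tree_law_indic.
move=> /andP[vD uD] sD G t A hG t0 mA.
have vg : v \in gen_words n by apply: sD; rewrite mem_head.
have vn : size v = n by move: vg; rewrite mem_gen_words => /eqP.
have {}IH := IH uD (fun u (uD' : u \in D) => sD u (@mem_behead _ (v :: D) u uD')).
have mK : measurable (hit_set n v) by apply: measurable_hit_set; rewrite vn.
(* The indicator of a positive lifetime supplies the hypothesis [g1_tau]; it changes nothing in the
   end, as J vanishes at nonpositive lifetimes. *)
pose g1 w := \1_[set w | 0 < tau v w] w * (\1_G w * (\1_(good_gen n) w *
   \prod_(u <- gen_words n | u != v) F1 D t A u w)).
pose g2 w := \1_G w * (\1_(good_gen n) w * \prod_(u <- gen_words n | u != v) F2 D t A u w).
have un u : u \in [seq u <- gen_words n | u != v] -> size u = n.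
  by rewrite mem_filter mem_gen_words => /andP[_ /eqP].
have mg (F : seq bool -> T -> R) : (forall u, size u = n -> measurable_fun setT (F u)) ->
    measurable_fun setT (fun w => \1_G w * (\1_(good_gen n) w * \prod_(u <- gen_words n | u != v) F u w) : R).
  move=> mF; apply: measurable_funM; first by apply: measurable_indic; exact: mG.
  apply: measurable_funM; first exact: measurable_indic.
  under eq_fun do rewrite -big_filter; apply: measurable_prod_seq => u /un; exact: mF.
have g01 (F : seq bool -> T -> R) w : (forall u, size u = n -> 0 <= F u w <= 1) ->
    0 <= \1_G w * (\1_(good_gen n) w * \prod_(u <- gen_words n | u != v) F u w) <= 1.
  move=> F01; do 2 (apply: mul01; first exact: indic01).
  by rewrite -big_filter; apply: prod_seq01 => u /un; exact: F01.
have mtau : measurable_fun setT (tau v) := tree_lifetime hD v.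
have mg1 : measurable_fun setT g1.
  apply: measurable_funM; first by apply: measurable_indic; exact: measurable_lt_set.
  by apply: mg => u u_n; exact: mF1.
have mg2 : measurable_fun setT g2.
  by apply: (mg (F2 D t A)) => u u_n; apply: (@from_history n); exact: mF2.
have split1 (a : R) (F : seq bool -> R) (w : T) : \1_G w * (\1_(good_gen n) w * \prod_(u <- gen_words n) F u) =
    F v * (\1_G w * (\1_(good_gen n) w * \prod_(u <- gen_words n | u != v) F u)).
  by rewrite (bigD1_seq v vg (uniq_gen_words n))/=; ring.
have eD (F F' : seq bool -> R) : (forall u, u != v -> F u = F' u) ->
    \prod_(u <- gen_words n | u != v) F u = \prod_(u <- gen_words n | u != v) F' u.
  by move=> e; apply: eq_bigr.
have := @conditional_law R _ T P (tree_gen n) (@tree_gen_measurable n) _ H LambdaW (tau v) (h v) g1 g2 (hit_set n v)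
   mtau (tree_hyperplane hD v) mg1 mg2.
have h1 : forall w, 0 <= g1 w <= 1.
  by move=> w; apply: mul01; [exact: indic01|apply: g01 => u _; exact: F1_01].
have h2 : forall w, 0 <= g2 w <= 1 by move=> w; apply: g01 => u u_n; exact: F2_01.
have g2g w : g2 w != 0 -> good_gen n w.
  rewrite /g2 !mulf_eq0 !negb_or => /and3P[_ + _]; rewrite indicE.
  by case: (boolP (w \in good_gen n)) => [/set_mem//|]; rewrite eqxx.
move=> /(_ h1 h2 mK) CL; have {}CL := CL _ _ _ _ (mJ vn) _.
have E1 : (\int[P]_w (g1 w * J v (w, (tau v w, h v w)))%:E =
   \int[P]_w (\1_G w * (\1_(good_gen n) w * \prod_(u <- gen_words n) F1 (v :: D) t A u w))%:E)%E.
  apply: eq_integral => w _; congr EFin; rewrite (split1 0 (fun u => F1 (v :: D) t A u w)).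
  rewrite {1}/F1 mem_head /g1 indicE; case: (boolP (w \in _)) => [_|tw]; last first.
    rewrite J_pos ?mulr0 ?mul0r// leNgt; apply: contra tw => tw; exact/mem_set.
  rewrite mul1r mulrC; congr (_ * (_ * (_ * _))); apply: eD => u uv.
  by rewrite /F1 inE (negbTE uv).
rewrite -E1 CL; first last.
- by move=> z; have /andP[] := J01 v z.
(* The hypothesis [law]: the induction hypothesis for the past event G and G', the test at v being
   changed to lifetime above s and hyperplane in B. *)
- move=> G' s B hG' s0 mB; pose t' u := if u == v then s else t u; pose A' u := if u == v then B else A u.
  have t'0 u : 0 <= t' u by rewrite /t'; case: ifP.
  have mA' u : measurable (A' u) by rewrite /A'; case: ifP.
  have hGG' : history tau h n (G `&` G') by exact: (@measurableI _ (Hist n)).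
  have := IH _ t' A' hGG' t'0 mA'.
  have indI w : \1_(G `&` G') w = \1_G w * \1_G' w :> R by rewrite !indicE in_setI -natrM mulnb.
  have pv (Fq : seq (seq bool) -> (seq bool -> R) -> (seq bool -> set H) -> seq bool -> T -> R) w :
      (forall u, u != v -> Fq D t' A' u w = Fq D t A u w) ->
      \1_(G `&` G') w * (\1_(good_gen n) w * \prod_(u <- gen_words n) Fq D t' A' u w) =
      (\1_G w * (\1_(good_gen n) w * \prod_(u <- gen_words n | u != v) Fq D t A u w)) * (\1_G' w * Fq D t' A' v w).
    move=> e; rewrite (bigD1_seq v vg (uniq_gen_words n))/= indI.
    rewrite (eD (fun u => Fq D t' A' u w) (fun u => Fq D t A u w))//; ring.
  move=> e; transitivity (\int[P]_w (\1_(G `&` G') w * (\1_(good_gen n) w * \prod_(u <- gen_words n) F1 D t' A' u w))%:E)%E.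
    apply: eq_integral => w _; congr EFin; rewrite (pv F1); last first.
      by move=> u uv; rewrite /F1 /t' /A' (negbTE uv).
    rewrite {2}/F1 (negbTE vD) /t' /A' eqxx /g1 [in LHS]indicE.
    case: (boolP (w \in [set w | 0 < tau v w])) => [_|tw]; first by rewrite mul1r.
    rewrite !mul0r (_ : \1_[set w | s < tau v w] w = 0) ?mul0r ?mulr0//.
    rewrite indicE memNset//= => /(le_lt_trans s0) tw'; move/negP: tw; apply; exact/mem_set.
  rewrite e; apply: eq_integral => w _; congr EFin; rewrite (pv F2).
    by rewrite {2}/F2 (negbTE vD) /t' /A' eqxx.
  by move=> u uv; rewrite /F2 /t' /A' (negbTE uv).
- move=> w; rewrite /g1 indicE; case: (boolP (w \in _)) => [/set_mem//|_].
  by rewrite mul0r eqxx.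
- by move=> w /g2g gw; apply: crate_gt0; exact: gw.
apply: eq_integral => w _; rewrite (split1 0 (fun u => F2 (v :: D) t A u w)) {1}/F2 mem_head.
have -> : \prod_(u <- gen_words n | u != v) F2 (v :: D) t A u w = \prod_(u <- gen_words n | u != v) F2 D t A u w.
  by apply: eD => u uv; rewrite /F2 inE (negbTE uv).
rewrite -/(g2 w); have [g20|/g2g gw] := eqVneq (g2 w) 0; first by rewrite g20 mulr0 mul0e.
by rewrite hit_setE J_law// -EFinM mulrC.
Qed.

Lemma tree_expectation (G : set T) : history tau h n G ->
  (\int[P]_w (\1_G w * (\1_(good_gen n) w * \prod_(v <- gen_words n) J v (w, (tau v w, h v w))))%:E =
   \int[P]_w (\1_G w * (\1_(good_gen n) w * \prod_(v <- gen_words n) Jh v w))%:E)%E.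
Proof.
move=> hG; have := @tree_law_words (gen_words n) (uniq_gen_words n) (fun u => id) G (fun=> 0) (fun=> setT) hG
  (fun=> lexx 0) (fun=> measurableT).
have e (F F' : seq bool -> R) : (forall u, u \in gen_words n -> F u = F' u) ->
    \prod_(u <- gen_words n) F u = \prod_(u <- gen_words n) F' u.
  by move=> E; rewrite big_seq [RHS]big_seq; apply: eq_bigr.
move=> E; transitivity (\int[P]_w (\1_G w * (\1_(good_gen n) w * \prod_(v <- gen_words n) F1 (gen_words n) (fun=> 0) (fun=> setT) v w))%:E)%E.
  by apply: eq_integral => w _; congr (_ * (_ * _))%:E; apply: e => u ug; rewrite /F1 ug.
by rewrite E; apply: eq_integral => w _; congr (_ * (_ * _))%:E; apply: e => u ug; rewrite /F2 ug.
Qed.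

End OneGeneration.
End Tree.

Lemma measurable_finite_choice (R : realType) d (T : measurableType d) (J : finType) (xi : T -> J) (F : J -> T -> R) :
  (forall j, measurable [set x | xi x = j]) -> (forall j, measurable_fun setT (F j)) ->
  measurable_fun setT (fun x => F (xi x) x).
Proof.
move=> mxi mF; rewrite (_ : (fun x => _) = (fun x => \sum_(j : J) \1_[set x | xi x = j] x * F j x)).
  by apply: measurable_sum => j; apply: measurable_funM => //; exact: measurable_indic.
apply/funext => x; rewrite (bigD1 (xi x))//= indicE mem_set// mul1r big1 ?addr0// => j ne.
by rewrite indicE memNset ?mul0r//= => e; rewrite e eqxx in ne.
Qed.

Section Unit.
Context (R : realType) d (T : measurableType d) (P : probability T R).
Implicit Types X Y : T -> R.

Lemma integral01_fin X : measurable_fun setT X -> (forall w, 0 <= X w <= 1) ->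
  (\int[P]_w (X w)%:E)%E \is a fin_num.
Proof.
move=> mX X01; rewrite ge0_fin_numE; last by apply: integral_ge0 => w _; rewrite lee_fin; case/andP: (X01 w).
apply: (@le_lt_trans _ _ (\int[P]_w 1%:E)%E); last first.
  by rewrite integral_cst// mul1e; apply: (le_lt_trans (probability_le1 P measurableT)); exact: ltry.
apply: ge0_le_integral => //; first by move=> w _; rewrite lee_fin; case/andP: (X01 w).
  exact/measurable_EFinP.
by move=> w _; rewrite lee_fin; case/andP: (X01 w).
Qed.

Lemma integral_one : (\int[P]_w 1%:E = 1)%E.
Proof. by rewrite integral_cst// mul1e; exact: probability_setT. Qed.

Lemma ae_one X : measurable_fun setT X -> (forall w, 0 <= X w <= 1) ->
  (\int[P]_w (X w)%:E = 1)%E -> {ae P, forall w, X w = 1}.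
Proof.
move=> mX X01 X1; have m1 : measurable_fun setT (fun w => (1 - X w)%:E).
  by apply/measurable_EFinP; apply: measurable_funB.
have i0 : (\int[P]_w `|(1 - X w)%:E| = 0)%E.
  have e : (\int[P]_w (1 - X w)%:E + \int[P]_w (X w)%:E = 1)%E.
    rewrite -ge0_integralD//; last 3 first.
    - by move=> w _; rewrite lee_fin subr_ge0; case/andP: (X01 w).
    - by move=> w _; rewrite lee_fin; case/andP: (X01 w).
    - exact/measurable_EFinP.
    by under eq_integral do rewrite -EFinD subrK; exact: integral_one.
  rewrite X1 in e; under eq_integral => w _.
    rewrite abse_EFin ger0_norm; last by rewrite subr_ge0; case/andP: (X01 w).
    over.
  apply: (@adde_cancel R 1%E) => //; by rewrite addeC e adde0.
have := (ae_eq_integral_abs P measurableT m1).1 i0.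
apply: filterS => w /(_ I) [] /eqP; rewrite subr_eq0 => /eqP <- //.
Qed.

Lemma prod_seq_one (J : eqType) (r : seq J) (F : J -> R) : (forall j, j \in r -> 0 <= F j <= 1) ->
  \prod_(j <- r) F j = 1 -> forall j, j \in r -> F j = 1.
Proof.
elim: r => [//|j r IH] F01; rewrite big_cons => e.
have /andP[a0 a1] := F01 j (mem_head _ _).
have F01' k : k \in r -> 0 <= F k <= 1 by move=> kr; apply: F01; rewrite inE kr orbT.
have /andP[b0 b1] := prod_seq01 F01'.
have Fj : F j = 1 by apply/eqP; rewrite eq_le a1 -[leLHS]e ler_piMr.
move=> k; rewrite inE => /orP[/eqP -> //|]; apply: IH => //.
by move: e; rewrite Fj mul1r.
Qed.

Lemma ae_integral X Y : measurable_fun setT X -> measurable_fun setT Y ->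
  {ae P, forall w, X w = Y w} -> (\int[P]_w (X w)%:E = \int[P]_w (Y w)%:E)%E.
Proof.
move=> mX mY XY; apply: ae_eq_integral => //; [exact/measurable_EFinP|exact/measurable_EFinP|].
by apply: filterS XY => w -> _.
Qed.

End Unit.

(** * Nondegenerate cells and absence of explosion *)

Section TreeLimit.
Context (R : realType) (l : nat) (Lambda : {measure set (borel (hyperplane R l)) -> \bar R})
  (hL : driving_measure Lambda) (W : window R l) d (T : measurableType d) (P : probability T R)
  (tau : seq bool -> T -> R) (h : seq bool -> T -> borel (hyperplane R l))
  (hD : division_tree Lambda P W tau h).
Local Notation V := 'rV[R]_l.+1.
Local Notation H := (borel (hyperplane R l)).
Local Notation C v w := (cell W (h^~ w) v).
Local Notation Hist n := (Hist tau h n).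
Local Notation Rt := (measurableTypeR R).
Local Notation crate n v := (@crate R l Lambda hL W d T tau h n v).
Local Notation good_gen n := (good_gen W h n).
Local Notation LW := (LambdaW hL W).

Let hist n (E : Type) (f : T -> E) : Hist n -> E := f.

Lemma law_const n v w (q : R -> R) : good_gen n w -> size v = n ->
  (forall t, 0 < t -> 0 <= q t) ->
  (\int[lebesgue_measure]_(t in `]0%R, +oo[) ((expR (- (crate n v w * t)))%:E *
     \int[LW]_(y in qhits (C v w)) (q t)%:E) =
  \int[lebesgue_measure]_(t in `]0%R, +oo[) (crate n v w * expR (- crate n v w * t) * q t)%:E)%E.
Proof.
move=> gw vn q0; apply: eq_integral => t; rewrite inE/= in_itv/= andbT => t0.
have mq : measurable (qhits (C v w) : set H) by exact: measurable_qhits.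
have E : LW (qhits (C v w)) = (crate n v w)%:E by rewrite crateE /hit_rate hit_setE fineK// fin_num_measure.
transitivity ((expR (- (crate n v w * t)))%:E * ((q t)%:E * LW (qhits (C v w))))%E.
  by congr (_ * _)%E; exact: integral_cst.
by rewrite E -!EFinM mulNr; congr EFin; ring.
Qed.

Lemma integral_expR_rate (c : R) : 0 < c ->
  (\int[lebesgue_measure]_(t in `]0%R, +oo[) (c * expR (- c * t) * 1)%:E = 1)%E.
Proof.
by move=> c0; under eq_integral do rewrite mulr1; rewrite integral_expR_tail// mulr0 expR0.
Qed.

Let pos_indic : Rt -> R := \1_`]0%R, +oo[%classic.
Let mpos : measurable_fun setT pos_indic.
Proof. by apply: measurable_indic; exact: measurable_itv. Qed.
Let pos_indic1 t : 0 < t -> pos_indic t = 1.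
Proof. by move=> t0; rewrite /pos_indic indicE mem_set//= in_itv/= t0. Qed.
Let pos_indic0 t : t <= 0 -> pos_indic t = 0.
Proof. by move=> t0; rewrite /pos_indic indicE memNset//= in_itv/= andbT => /(le_lt_trans t0); rewrite ltxx. Qed.

Let mz1 n : measurable_fun setT (fun z : Hist n * (Rt * H) => z.2.1).
Proof. exact: (measurableT_comp measurable_fst measurable_snd). Qed.
Let mz2 n : measurable_fun setT (fun z : Hist n * (Rt * H) => z.2.2).
Proof. exact: (measurableT_comp measurable_snd measurable_snd). Qed.

Let mgood n : measurable (good_gen n : set T).
Proof.
have := measurable_id_history (@tree_gen_measurable _ _ _ _ _ _ _ _ _ hD n) measurableT (@history_good _ _ W _ _ tau h n).
by rewrite setTI.
Qed.

Let hit_indic n v (z : Hist n * (Rt * H)) : R := pos_indic z.2.1 * \1_(hit_set W v) (z.1, z.2.2).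

(** Given a good past, the test that all lifetimes of generation n are positive and all its
    hyperplanes are in [qhits] averages to 1. A test with values in [0, 1] and expectation 1 holds
    almost surely. *)
Lemma ae_generation n : {ae P, forall w, good_gen n w} ->
  {ae P, forall w, forall v, size v = n -> 0 < tau v w /\ qhits (C v w) (h v w)}.
Proof.
move=> aeg; have e0 : (\int[P]_w (\1_(good_gen n) w)%:E = 1)%E.
  rewrite (@ae_integral _ _ _ P _ (fun=> 1)) ?integral_one//.
  by apply: filterS aeg => w gw; rewrite indicE mem_set.
have mJ v : size v = n -> measurable_fun setT (@hit_indic n v).
  move=> vn; apply: measurable_funM; first exact: (measurableT_comp mpos (@mz1 n)).
  apply: measurable_indic_comp; last by apply: measurable_hit_set; rewrite vn.
  apply: measurable_fun_pair => //; exact: mz2.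
have mc1 : forall v : seq bool, size v = n -> measurable_fun setT ((fun=> 1) : Hist n -> R).
  by move=> v _; exact: measurable_cst.
have := @tree_expectation R l Lambda hL W d T P tau h hD n (@hit_indic n) (fun _ _ => 1) mJ mc1.
have h1 (v : seq bool) (z : Hist n * (Rt * H)) : 0 <= hit_indic v z <= 1 by apply: mul01; exact: indic01.
have h2 (v : seq bool) (w : Hist n) : 0 <= (1 : R) <= 1 by rewrite ler01 lexx.
have h3 (v : seq bool) (w : Hist n) (t : R) g : t <= 0 -> hit_indic v (w, (t, g)) = 0.
  by move=> t0; rewrite /hit_indic pos_indic0// mul0r.
have Jl v w : size v = n -> good_gen n w ->
    (\int[lebesgue_measure]_(t in `]0%R, +oo[) ((expR (- (crate n v w * t)))%:E *
     \int[LW]_(y in qhits (C v w)) (hit_indic v (w : Hist n, (t, y)))%:E) = (1 : R)%:E)%E.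
  move=> vn gw; rewrite -(@integral_expR_rate (crate n v w)); last by apply: crate_gt0; exact: gw.
  rewrite -(@law_const n v w (fun=> 1))//; apply: eq_integral => t; rewrite inE/= in_itv/= andbT => t0.
  congr (_ * _)%E; apply: eq_integral => y /set_mem qy.
  by rewrite /hit_indic/= pos_indic1// mul1r indicE mem_set.
move=> /(_ h1 h2 h3 Jl setT (@measurableT _ (Hist n))) E; have {}E : (\int[P]_w (\1_(good_gen n) w * \prod_(v <- gen_words n) hit_indic v (w : Hist n, (tau v w, h v w)))%:E = 1)%E.
  rewrite -e0; transitivity (\int[P]_w (\1_setT w * (\1_(good_gen n) w * \prod_(v <- gen_words n) hit_indic v (w : Hist n, (tau v w, h v w))))%:E)%E.
    by apply: eq_integral => w _; rewrite indicT mul1r.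
  by rewrite E; apply: eq_integral => w _; rewrite indicT mul1r big1// mulr1.
have Z01 w v : v \in gen_words n -> 0 <= hit_indic v (w : Hist n, (tau v w, h v w)) <= 1 by move=> _; exact: h1.
have : {ae P, forall w, \1_(good_gen n) w * \prod_(v <- gen_words n) hit_indic v (w : Hist n, (tau v w, h v w)) = 1}.
  apply: ae_one => //.
    apply: measurable_funM; first exact: measurable_indic.
    apply: measurable_prod_seq => v; rewrite mem_gen_words => /eqP vn.
    apply: (measurableT_comp (mJ v vn)); apply: measurable_fun_pair.
      exact: measurable_id_history (@tree_gen_measurable _ _ _ _ _ _ _ _ _ hD n).
    by apply: measurable_fun_pair; [exact: (tree_lifetime hD)|exact: (tree_hyperplane hD)].
  by move=> w; apply: mul01; [exact: indic01|apply: prod_seq01 => v; exact: Z01].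
apply: filterS => w e v vn.
have i01 := @indic01 R T (good_gen n) w; have p01 := prod_seq01 (Z01 w).
have gp : \prod_(v <- gen_words n) hit_indic v (w : Hist n, (tau v w, h v w)) = 1.
  case/andP: i01 => i0 i1; case/andP: p01 => p0 p1.
  by apply/eqP; rewrite eq_le p1 -[leLHS]e ler_piMl.
have := prod_seq_one (Z01 w) gp; move=> /(_ v); rewrite mem_gen_words vn eqxx => /(_ isT).
rewrite /hit_indic/=; have [t0|t0] := leP (tau v w) 0.
  by rewrite pos_indic0// mul0r => /eqP; rewrite eq_sym oner_eq0.
rewrite pos_indic1// mul1r indicE; case: (boolP (_ \in _)) => [/set_mem//|_ /eqP].
by rewrite eq_sym oner_eq0.
Qed.

(** A hyperplane in [qhits] strictly separates two interior points of the cell, so both parts have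
    interior points again. *)
Lemma ae_good_gen n : {ae P, forall w, good_gen n w}.
Proof.
elim: n => [|n IH].
  apply: aeW => w v /eqP; rewrite size_eq0 => /eqP ->; rewrite cell_nil; exact: (proj2 (windowP W)).
have := ae_generation IH; apply: filterS => w hw v; case/lastP: v => [//|v c]; rewrite size_rcons => -[vn].
have [_ [i Ci [j Cj /= /andP[ij1 ij2]]]] := hw v vn.
rewrite interior_cell_rcons; case: c.
  exact: (ex_intro _ (dseq R l j) (conj Cj ij2)).
exact: (ex_intro _ (dseq R l i) (conj Ci ij1)).
Qed.

Lemma ae_good : {ae P, forall w, forall v, 0 < tau v w /\ (C v w)° !=set0}.
Proof.
have := ae_foralln (fun n => ae_generation (ae_good_gen n)).
apply: filterS2 (ae_foralln ae_good_gen) => w g hw v.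
by split; [have [] := hw (size v) v erefl|exact: (g (size v) v erefl)].
Qed.

Lemma tree_step n (g : Hist n -> R) (J : seq bool -> Hist n * (Rt * H) -> R) (Jh : seq bool -> Hist n -> R) :
  measurable_fun setT g -> (forall w, 0 <= g w <= 1) ->
  (forall v, size v = n -> measurable_fun setT (J v)) ->
  (forall v, size v = n -> measurable_fun setT (Jh v)) ->
  (forall v z, 0 <= J v z <= 1) -> (forall v w, 0 <= Jh v w <= 1) ->
  (forall v w (t : R) y, t <= 0 -> J v (w, (t, y)) = 0) ->
  (forall v w, size v = n -> good_gen n w ->
    (\int[lebesgue_measure]_(t in `]0%R, +oo[) ((expR (- (crate n v w * t)))%:E *
     \int[LW]_(y in qhits (C v w)) (J v (w, (t, y)))%:E) = (Jh v w)%:E)%E) ->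
  (\int[P]_w (g w * \prod_(v <- gen_words n) J v (w, (tau v w, h v w)))%:E =
   \int[P]_w (g w * \prod_(v <- gen_words n) Jh v w)%:E)%E.
Proof.
move=> mg g01 mJ mJh J01 Jh01 J0 Jlaw; pose v0 := nseq n false.
have v0n : v0 \in gen_words n by rewrite mem_gen_words size_nseq.
(* [tree_expectation] only handles products over the words of generation n; the weight g of the past
   is hidden in the factor of the single word [v0]. *)
pose a v w : R := if v == v0 then g w else 1.
have a01 v w : 0 <= a v w <= 1 by rewrite /a; case: ifP => _ //; rewrite ler01 lexx.
have ma v : measurable_fun setT (a v) by rewrite /a; case: (v == v0) => //; exact: measurable_cst.
have prodE (F : seq bool -> R) w : \prod_(v <- gen_words n) (a v w * F v) = g w * \prod_(v <- gen_words n) F v.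
  rewrite big_split/=; congr (_ * _); rewrite (bigD1_seq v0 v0n (uniq_gen_words n))/= /a eqxx big1 ?mulr1//.
  by move=> v /negbTE ->.
have mid := measurable_id_history (@tree_gen_measurable _ _ _ _ _ _ _ _ _ hD n).
have mgT : measurable_fun setT (g : T -> R) := measurableT_comp mg mid.
have dropg (F : seq bool -> T -> R) : (forall v, size v = n -> measurable_fun setT (F v)) ->
    (\int[P]_w (\1_setT w * (\1_(good_gen n) w * \prod_(v <- gen_words n) (a v w * F v w)))%:E =
     \int[P]_w (g w * \prod_(v <- gen_words n) F v w)%:E)%E.
  move=> mF; have mp : measurable_fun setT (fun w => \prod_(v <- gen_words n) F v w).
    by apply: measurable_prod_seq => v; rewrite mem_gen_words => /eqP; exact: mF.
  apply: ae_integral.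
  - apply: measurable_funM; first exact: measurable_indic.
    apply: measurable_funM; first exact: measurable_indic.
    under eq_fun do rewrite prodE; exact: measurable_funM.
  - exact: measurable_funM.
  - by apply: filterS (ae_good_gen n) => w gw; rewrite prodE indicT mul1r indicE mem_set// mul1r.
have E := @tree_expectation R l Lambda hL W d T P tau h hD n (fun v z => a v z.1 * J v z) (fun v w => a v w * Jh v w)
  (fun v vn => measurable_funM (measurableT_comp (ma v) measurable_fst) (mJ v vn))
  (fun v vn => measurable_funM (ma v) (mJh v vn))
  (fun v z => mul01 (a01 v z.1) (J01 v z)) (fun v w => mul01 (a01 v w) (Jh01 v w)).
rewrite -(dropg (fun v w => J v (w, (tau v w, h v w)))); last first.
  move=> v vn; apply: (measurableT_comp (mJ v vn)); apply: measurable_fun_pair => //.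
  by apply: measurable_fun_pair; [exact: (tree_lifetime hD)|exact: (tree_hyperplane hD)].
rewrite -(dropg Jh); last by move=> v vn; exact: (measurableT_comp (mJh v vn) mid).
apply: (E _ _ setT) => [v w t y t0|v w vn gw|]; last exact: (@measurableT _ (Hist n)).
  by rewrite J0// mulr0.
rewrite EFinM -Jlaw//; have /andP[aw0 _] := a01 v w.
have mJw : measurable_fun setT (fun p : Rt * H => (J v (w, p))%:E).
  apply/measurable_EFinP; apply: (measurableT_comp (mJ v vn)); exact: measurable_fun_pair.
have mq : measurable (qhits (C v w) : set H) by exact: measurable_qhits.
rewrite -ge0_integralZl_EFin//.
- apply: eq_integral => t _; rewrite muleCA; congr (_ * _)%E.
  rewrite -ge0_integralZl_EFin//; first by move=> y _; rewrite lee_fin; case/andP: (J01 v (w, (t, y))).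
  apply: measurable_funTS; apply: (measurableT_comp mJw); exact: measurable_fun_pair.
- by move=> t _; apply: mule_ge0; [rewrite lee_fin expR_ge0|apply: integral_ge0 => y _; rewrite lee_fin; case/andP: (J01 v (w, (t, y)))].
- apply: measurable_funTS; apply: emeasurable_funM.
    apply/measurable_EFinP; apply: measurableT_comp; first exact: measurable_expR.
    by apply: measurableT_comp => //; exact: measurable_funM.
  under eq_fun do rewrite integral_mkcond.
  pose Fw (p : Rt * H) : \bar R := ((J v (w, p))%:E * (\1_(qhits (C v w)) p.2)%:E)%E.
  have mFw : measurable_fun setT Fw.
    by apply: emeasurable_funM => //; apply/measurable_EFinP; apply: measurable_indic_comp.
  have Fw0 p : (0 <= Fw p)%E.
    by apply: mule_ge0; rewrite lee_fin; [case/andP: (J01 v (w, p))|case/andP: (indic01 R (qhits (C v w)) p.2)].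
  have := @measurable_fun_fubini_tonelli_F _ _ _ _ _ LW Fw mFw Fw0.
  apply: eq_measurable_fun => t _; apply: eq_integral => y _.
  by rewrite /Fw/patch indicE/=; case: ifP => _; rewrite ?mule1 ?mule0.
Qed.

Definition total_rate : R := rate Lambda W.

Lemma crate_le n v w : crate n v w <= total_rate.
Proof.
have mW : measurable (hits W : set H) by apply: hits_compact; apply: polytope_compact; exact: windowP.
have mq : measurable (qhits (C v w) : set H) by exact: measurable_qhits.
rewrite crateE /hit_rate hit_setE /total_rate /rate fine_le ?fin_num_measure//.
  by rewrite ge0_fin_numE//; exact: (driving_windows hL).
by rewrite LambdaWE ?le_measure ?inE//; exact: qhits_cell_sub.
Qed.

Lemma total_rate_gt0 : 0 < total_rate.
Proof.
have pW := windowP W; have [r Wr] := polytope_bounded pW.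
rewrite fine_gt0// (Lambda_hits_gt0 hL (polytope_compact pW) Wr (proj2 pW))/=.
exact: (driving_windows hL).
Qed.

(** An exponential lifetime tau of rate c <= [total_rate] has E exp (- theta tau) = c / (c + theta)
    <= 1 / 4. The factor 1 / 4 beats the doubling of the number of cells per generation. *)
Let theta := 3 * total_rate.
Let theta0 : 0 < theta. Proof. by rewrite mulr_gt0// total_rate_gt0. Qed.
(** The maximum with 0 keeps the discount at most 1 everywhere: births are nonnegative only almost
    surely. *)
Definition discount v w : R := expR (- theta * Num.max (birth (tau^~ w) v) 0).

Lemma discount01 v w : 0 <= discount v w <= 1.
Proof.
by rewrite expR_ge0/= -expR0 ler_expR mulNr oppr_le0 mulr_ge0 ?(ltW theta0)// le_max lexx orbT.
Qed.

Lemma measurable_birth v : measurable_fun setT (fun w => birth (tau^~ w) v).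
Proof. by rewrite /birth; apply: measurable_sum => i; exact: (tree_lifetime hD). Qed.

Lemma history_discount n v : (size v <= n)%N -> measurable_fun setT (discount v : Hist n -> R).
Proof.
move=> vn; apply: measurableT_comp; first exact: measurable_expR.
apply: measurable_funM => //; apply: measurable_maxr => //.
exact: history_birth.
Qed.

Lemma measurable_discount v : measurable_fun setT (discount v).
Proof.
apply: measurableT_comp; first exact: measurable_expR.
apply: measurable_funM => //; apply: measurable_maxr => //.
exact: measurable_birth.
Qed.

Lemma discount_rcons v c :
  (\int[P]_w (discount (rcons v c) w)%:E <= (4^-1)%:E * \int[P]_w (discount v w)%:E)%E.
Proof.
pose n := size v.
pose q u (t : R) : R := if u == v then expR (- theta * t) else 1.
pose J u (z : Hist n * (Rt * H)) : R := pos_indic z.2.1 * q u z.2.1.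
pose Jh u (w : Hist n) : R := if u == v then crate n v w * (crate n v w + theta) `^ (-1) else 1.
have c0 u w : 0 <= crate n u w by exact: fine_ge0.
have ct0 u w : 0 < crate n u w + theta by rewrite ltr_wpDl.
have q01 u t : 0 < t -> 0 <= q u t <= 1.
  move=> t0; rewrite /q; case: ifP => _; last by rewrite ler01 lexx.
  by rewrite expR_ge0/= -expR0 ler_expR mulNr oppr_le0 mulr_ge0// ltW.
have mq u : measurable_fun setT (q u : Rt -> R).
  rewrite /q; case: (u == v); last exact: measurable_cst.
  by apply: measurableT_comp; [exact: measurable_expR|exact: measurable_funM].
have E := @tree_step n (discount v) J Jh (@history_discount n v (leqnn _)) (@discount01 v).
have {}E : (\int[P]_w (discount v w * \prod_(u <- gen_words n) J u (w, (tau u w, h u w)))%:E =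
   \int[P]_w (discount v w * \prod_(u <- gen_words n) Jh u w)%:E)%E.
  apply: E.
  - move=> u _; apply: measurable_funM; first exact: (measurableT_comp mpos (@mz1 n)).
    exact: (measurableT_comp (mq u) (@mz1 n)).
  - move=> u un; rewrite /Jh; case: (u == v); last exact: measurable_cst.
    have mc : measurable_fun setT (crate n v) by apply: measurable_hit_rate; exact: measurable_hit_set.
    apply: measurable_funM => //.
    by apply: (measurableT_comp (measurable_powR _)); exact: measurable_funD.
  - move=> u [w [t y]]; rewrite /J/=; have [t0|t0] := leP t 0; first by rewrite pos_indic0// mul0r lexx ler01.
    by rewrite pos_indic1// mul1r; exact: q01.
  - move=> u w; rewrite /Jh; case: ifP => _; last by rewrite ler01 lexx.
    rewrite powR_inv1 ?(ltW (ct0 _ _))// divr_ge0 ?(ltW (ct0 _ _))//= ler_pdivrMr// mul1r lerDl ltW//.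
  - by move=> u w t y t0; rewrite /J pos_indic0// mul0r.
  - move=> u w un gw; have cu : 0 < crate n u w by apply: crate_gt0; exact: gw.
    transitivity (\int[lebesgue_measure]_(t in `]0%R, +oo[) ((expR (- (crate n u w * t)))%:E *
     \int[LW]_(y in qhits (C u w)) (q u t)%:E))%E.
      apply: eq_integral => t; rewrite inE/= in_itv/= andbT => t0; congr (_ * _)%E.
      by apply: eq_integral => y _; rewrite /J/= pos_indic1// mul1r.
    rewrite (@law_const n u w (q u))//; last by move=> t t0; case/andP: (q01 u t t0).
    rewrite /q /Jh; have [uv|uv] := eqVneq u v; last by exact: integral_expR_rate.
    rewrite -uv powR_inv1 ?(ltW (ct0 _ _))//.
    transitivity (\int[lebesgue_measure]_(t in `]0%R, +oo[) ((crate n u w / (crate n u w + theta))%:E *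
       ((crate n u w + theta) * expR (- (crate n u w + theta) * t))%:E))%E.
      apply: eq_integral => t _; rewrite -EFinM; congr EFin.
      rewrite -mulrA -expRD mulrA divfK ?gt_eqF//; congr (_ * expR _); ring.
    rewrite ge0_integralZl_EFin//.
    + by rewrite integral_expR_tail// mulr0 expR0 mule1.
    + by move=> t _; rewrite lee_fin mulr_ge0 ?expR_ge0// ltW.
    + apply: measurable_funTS; apply/measurable_EFinP; apply: measurable_funM => //.
      by apply: measurableT_comp; [exact: measurable_expR|exact: measurable_funM].
    + by rewrite divr_ge0 ?(ltW (ct0 _ _)).
have vw : v \in gen_words n by rewrite mem_gen_words.
have mg := measurable_discount v.
have -> : (\int[P]_w (discount (rcons v c) w)%:E =
   \int[P]_w (discount v w * \prod_(u <- gen_words n) J u (w : Hist n, (tau u w, h u w)))%:E)%E.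
  apply: ae_integral; first exact: measurable_discount.
    apply: measurable_funM => //; apply: measurable_prod_seq => u _; apply: measurable_funM.
      exact: (measurableT_comp mpos (tree_lifetime hD u)).
    exact: (measurableT_comp (mq u) (tree_lifetime hD u)).
  apply: filterS ae_good => w gw; have tp u : 0 < tau u w by have [] := gw u.
  have b0 u : 0 <= birth (tau^~ w) u by apply: sumr_ge0 => i _; apply: ltW.
  rewrite (bigD1_seq v vw (uniq_gen_words n))/= big1 ?mulr1; last first.
    by move=> u uv; rewrite /J/= pos_indic1// /q (negbTE uv) mul1r.
  rewrite /J/= pos_indic1// /q eqxx mul1r /discount !max_l// birth_rcons -expRD mulrDr//.
rewrite E -ge0_integralZl_EFin//; last 2 first.
- by move=> w _; rewrite lee_fin; case/andP: (discount01 v w).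
- exact/measurable_EFinP.
have mc : measurable_fun setT (crate n v : T -> R).
  by apply: (from_history hD); apply: measurable_hit_rate; exact: measurable_hit_set.
apply: ge0_le_integral => //.
- move=> w _; rewrite lee_fin mulr_ge0//; first by case/andP: (discount01 v w).
  apply: prodr_ge0 => u _; rewrite /Jh; case: ifP => // _; by rewrite mulr_ge0// powR_ge0.
- apply/measurable_EFinP; apply: measurable_funM => //; apply: measurable_prod_seq => u _.
  rewrite /Jh; case: (u == v); last exact: measurable_cst.
  apply: measurable_funM => //; apply: (measurableT_comp (measurable_powR _)); exact: measurable_funD.
- by apply/measurable_EFinP; apply: measurable_funM.
- move=> w _; rewrite -EFinM lee_fin mulrC ler_wpM2r//; first by case/andP: (discount01 v w).
  rewrite (bigD1_seq v vw (uniq_gen_words n))/= big1 ?mulr1; last by move=> u /negbTE uv; rewrite /Jh uv.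
  rewrite /Jh eqxx powR_inv1 ?(ltW (ct0 _ _))// ler_pdivrMr//.
  have := @crate_le n v w; rewrite /theta; lra.
Qed.

Definition total_discount n w : R := \sum_(v <- gen_words n) discount v w.

Lemma measurable_total_discount n : measurable_fun setT (total_discount n).
Proof. by apply: measurable_sum => v; exact: measurable_discount. Qed.

(** Each child has on average at most a quarter of the discount of its parent, and there are two
    children. The geometric decay bounds the chance that some cell of generation n is born before a
    given time. *)
Lemma integral_total_discount n : (\int[P]_w (total_discount n w)%:E <= ((2^-1) ^+ n)%:E)%E.
Proof.
have intE m : (\int[P]_w (total_discount m w)%:E = \sum_(v <- gen_words m) \int[P]_w (discount v w)%:E)%E.
  under eq_integral do rewrite /total_discount -sumEFin.
  rewrite ge0_integral_sum//; last by move=> v w _; rewrite lee_fin; case/andP: (discount01 v w).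
  by move=> v; apply/measurable_EFinP; exact: measurable_discount.
have fin v : (\int[P]_w (discount v w)%:E)%E \is a fin_num.
  by apply: integral01_fin; [exact: measurable_discount|exact: discount01].
elim: n => [|n IH].
  rewrite intE big_seq1 expr0 -(integral_one P); apply: ge0_le_integral => //.
  - by move=> w _; rewrite lee_fin; case/andP: (discount01 [::] w).
  - by apply/measurable_EFinP; exact: measurable_discount.
  - by move=> w _; rewrite lee_fin; case/andP: (discount01 [::] w).
pose e v : R := fine (\int[P]_w (discount v w)%:E)%E.
have eE v : (\int[P]_w (discount v w)%:E = (e v)%:E)%E by rewrite fineK.
have intE' m : (\int[P]_w (total_discount m w)%:E = (\sum_(v <- gen_words m) e v)%:E)%E.
  by rewrite intE -sumEFin; apply: eq_bigr => v _; rewrite eE.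
move: IH; rewrite !intE' !lee_fin sum_gen_wordsS exprS => IH.
apply: (@le_trans _ _ (\sum_(v <- gen_words n) 2^-1 * e v)); last by rewrite -mulr_sumr ler_pM2l.
apply: ler_sum => v _; have h1 := discount_rcons v false; have h2 := discount_rcons v true.
rewrite !eE -!EFinM !lee_fin in h1 h2.
have -> : 2^-1 * e v = 4^-1 * e v + 4^-1 * e v by field.
exact: lerD.
Qed.

End TreeLimit.

Section Occurs.
Variables (R : realType) (l : nat) (I : finType) (b : I -> 'rV[R]_l.+1).
Local Notation V := 'rV[R]_l.+1.

(** Expresses the occurrence of a block through finitely many relations [together], for which
    measurability is known. *)
Lemma occursP (S : set (set V)) (B : {set I}) (i0 : I) : disjoint_cells S -> i0 \in B ->
  occurs b S B <-> forall j, together S (b i0) (b j) <-> j \in B.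
Proof.
move=> dS i0B; split.
  move=> [C SC CB] j; have Ci0 : C° (b i0) by apply/in_blk; rewrite CB.
  split; last by move=> jB; refine (ex_intro2 _ _ C SC (conj Ci0 _)); apply/in_blk; rewrite CB.
  move=> [D SD [Di Dj]]; rewrite -CB; apply/in_blk.
  by rewrite (disjoint_cells_eq dS SC SD Ci0 Di).
move=> h; have [C SC [Ci _]] := (h i0).2 i0B; exists C => //.
apply/setP => j; apply/idP/idP => [/in_blk Cj|/h[D SD [Di Dj]]].
  by apply/h; exists C.
by apply/in_blk; rewrite (disjoint_cells_eq dS SC SD Ci Di).
Qed.

Lemma measurable_Phi d (X : measurableType d) (S : X -> set (set V)) f :
  (forall x, disjoint_cells (S x)) ->
  (forall i j, measurable [set x | together (S x) (b i) (b j)]) ->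
  measurable_fun setT (fun x => Phi b f (S x)).
Proof.
move=> dS mS; rewrite (_ : (fun x => _) = (fun x => \prod_(B <- enum {set I})
   (if (B != finset.set0) && `[< occurs b (S x) B >] then f B else 1))); last first.
  by apply/funext => T; rewrite /Phi big_mkcond big_enum.
apply: measurable_prod_seq => B _.
have [->|B0] := eqVneq B finset.set0; first by rewrite /= ?eqxx/=; exact: measurable_cst.
have /finset.set0Pn[i iB] := B0.
have mO : measurable [set x | occurs b (S x) B].
  rewrite (_ : [set _ | _] = \bigcap_(j in [set: I]) (if j \in B then [set x | together (S x) (b i) (b j)]
       else ~` [set x | together (S x) (b i) (b j)])).
    by apply: fin_bigcap_measurable => // j _; case: ifP => _ //; exact: measurableC.
  apply/seteqP; split => x.
    move=> /(occursP (dS x) iB) h j _; case: ifPn => [/h//|jB]; move/h; exact/negP.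
  move=> h; apply/(occursP (dS x) iB) => j; have := h j Logic.I; case: ifPn => // jB nt.
apply: (@measurable_finite_choice _ _ _ bool (fun x => `[< occurs b (S x) B >])
   (fun c _ => if true && c then f B else 1)); last by move=> c; exact: measurable_cst.
case.
  rewrite (_ : [set _ | _] = [set x | occurs b (S x) B])//.
  by apply/seteqP; split => T /=; [move/asboolP|move=> ?; apply/asboolP].
rewrite (_ : [set _ | _] = ~` [set x | occurs b (S x) B]); first exact: measurableC.
by apply/seteqP; split => T /=; [move/negbT/asboolPn|move=> ?; apply/negbTE/asboolPn].
Qed.

Lemma measurable_TW_Phi (W : window R l) f :
  measurable_fun setT (fun T : borel (TW W) => Phi b f (cells (val (T : TW W)))).
Proof. by apply: measurable_Phi => [T|i j]; [exact: TW_disjoint|exact: measurable_TW_together]. Qed.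

End Occurs.

Lemma eq_Phi (R : realType) (l : nat) (I : finType) (b b' : I -> 'rV[R]_l.+1) (S S' : set (set 'rV[R]_l.+1)) f :
  disjoint_cells S -> disjoint_cells S' ->
  (forall i j, together S (b i) (b j) <-> together S' (b' i) (b' j)) ->
  Phi b f S = Phi b' f S'.
Proof.
move=> dS dS' e; apply: eq_bigl => B; have [->|/finset.set0Pn[i iB]] := eqVneq B finset.set0; first by rewrite ?eqxx.
congr (_ && _); apply/asboolP/asboolP => [/(occursP b dS iB) h|/(occursP b' dS' iB) h].
  by apply/(occursP b' dS' iB) => j; rewrite -h; split => /e.
by apply/(occursP b dS iB) => j; rewrite -h; split => /e.
Qed.

(** * The martingale of the division tree *)

Section TreeLaw.
Context (R : realType) (l : nat) (Lambda : {measure set (borel (hyperplane R l)) -> \bar R})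
  (hL : driving_measure Lambda) (W : window R l) d (T : measurableType d) (P : probability T R)
  (tau : seq bool -> T -> R) (h : seq bool -> T -> borel (hyperplane R l))
  (hD : division_tree Lambda P W tau h).
Context (I : finType) (b : I -> 'rV[R]_l.+1) (bW : forall i, (W : set _)° (b i)).
Local Notation V := 'rV[R]_l.+1.
Local Notation H := (borel (hyperplane R l)).
Local Notation C v w := (cell W (h^~ w) v).
Local Notation Hist n := (Hist tau h n).
Local Notation Rt := (measurableTypeR R).
Local Notation crate n v := (@crate R l Lambda hL W d T tau h n v).
Local Notation good_gen n := (good_gen W h n).
Local Notation LW := (LambdaW hL W).
Local Notation kap := (kappa Lambda b).
Local Notation blk := (blk b).
Let Lfin := window_bound W hL.

Definition below (B : {set I}) (y : H) : {set I} := [set i in B | side y (b i) < 0].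
Definition above (B : {set I}) (y : H) : {set I} := [set i in B | 0 < side y (b i)].

Lemma blk_child v w c : blk (C (rcons v c) w) =
  if c then above (blk (C v w)) (h v w) else below (blk (C v w)) (h v w).
Proof.
apply/setP => i; apply/idP/idP.
  move=> /in_blk; rewrite interior_cell_rcons => -[/in_blk Ci].
  by case: c => hi; rewrite inE Ci.
move=> hi; apply/in_blk; rewrite interior_cell_rcons.
by case: c hi; rewrite inE => /andP[/in_blk].
Qed.

Lemma measurable_below B A : measurable ([set y | below B y = A] : set H).
Proof.
rewrite (_ : [set y | _] = \bigcap_(i in [set: I]) [set y | ((i \in B) && (side y (b i) < 0)) = (i \in A)]).
  apply: fin_bigcap_measurable => // i _; case: (i \in B) => /=.
    have m1 : measurable ([set y | side y (b i) < 0] : set H) by apply: measurable_lt_set; [exact: measurable_side|exact: measurable_cst].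
    case: (i \in A) => //.
    rewrite (_ : [set _ | _] = ~` [set y | side y (b i) < 0]); first exact: measurableC.
    by apply/seteqP; split => y /=; [move=> ->|move/negP/negbTE].
  case: (i \in A); last by rewrite (_ : [set _ | _] = setT)//; apply/seteqP; split.
  by rewrite (_ : [set _ | _] = set0)//; apply/seteqP; split.
apply/seteqP; split => y /=; first by move=> <- i _ /=; rewrite inE.
by move=> e; apply/setP => i; rewrite inE; exact: (e i Logic.I).
Qed.

Lemma measurable_above B A : measurable ([set y | above B y = A] : set H).
Proof.
rewrite (_ : [set y | _] = \bigcap_(i in [set: I]) [set y | ((i \in B) && (0 < side y (b i))) = (i \in A)]).
  apply: fin_bigcap_measurable => // i _; case: (i \in B) => /=.
    have m1 : measurable ([set y | 0 < side y (b i)] : set H) by apply: measurable_lt_set; [exact: measurable_cst|exact: measurable_side].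
    case: (i \in A) => //.
    rewrite (_ : [set _ | _] = ~` [set y | 0 < side y (b i)]); first exact: measurableC.
    by apply/seteqP; split => y /=; [move=> ->|move/negP/negbTE].
  case: (i \in A); last by rewrite (_ : [set _ | _] = setT)//; apply/seteqP; split.
  by rewrite (_ : [set _ | _] = set0)//; apply/seteqP; split.
apply/seteqP; split => y /=; first by move=> <- i _ /=; rewrite inE.
by move=> e; apply/setP => i; rewrite inE; exact: (e i Logic.I).
Qed.

Lemma history_blk n v B : (size v <= n)%N -> measurable ([set w | blk (C v w) = B] : set (Hist n)).
Proof.
move=> vn; rewrite (_ : [set w | _] = \bigcap_(i in [set: I]) (if i \in B then [set w | (C v w)° (b i)] else ~` [set w | (C v w)° (b i)])).
  apply: (@fin_bigcap_measurable _ (Hist n)) => // i _; have m1 := @history_interior _ _ W _ _ tau h n v (b i) vn.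
  by case: ifP => _ //; exact: (@measurableC _ (Hist n)).
apply/seteqP; split => w /=; first by move=> <- i _; case: ifPn => [/in_blk//|/negP ni /in_blk].
move=> e; apply/setP => i; have := e i Logic.I; case: ifPn => [_ Ci|_ Ci]; apply/idP; first exact/in_blk.
by move=> /in_blk.
Qed.

Lemma sep_hits (S : set V) p q y : convex S -> S p -> S q -> side y p < 0 -> 0 < side y q -> hits S y.
Proof.
move=> cS Sp Sq sp sq; set a := side y p in sp; set c := side y q in sq.
pose t := - a / (c - a); have ca : 0 < c - a by rewrite subr_gt0 (lt_trans sp).
have na : 0 < - a by rewrite oppr_gt0.
exists ((1 - t) *: p + t *: q); split.
  by apply/on_side; rewrite side_affine -/a -/c /t; field; rewrite gt_eqF.
have t0 : 0 <= t by rewrite divr_ge0 ?(ltW na) ?(ltW ca).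
have t1 : t <= 1 by rewrite ler_pdivrMr// mul1r lerDr ltW.
by have := cS p q (1 - t) Sp Sq; rewrite subKr; apply; lra.
Qed.

Section ByType.
Variables (S : set H) (B : {set I}) (c : {set I} -> {set I} -> R).
Hypotheses (mS : measurable S) (SW : S `<=` hits W) (c0 : forall A A', 0 <= c A A').

Definition type_mass A : R := fine (LW (S `&` sep_type b A (B :\: A))).

Let mSA A : measurable (S `&` sep_type b A (B :\: A) : set H).
Proof. by apply: measurableI => //; exact: measurable_sep_type. Qed.

Lemma type_massE A : LW (S `&` sep_type b A (B :\: A)) = (type_mass A)%:E.
Proof. by rewrite /type_mass fineK// fin_num_measure. Qed.

Lemma sum_type_mass : fine (LW S) = \sum_(A : {set I} | A \subset B) type_mass A.
Proof.
apply: EFin_inj; rewrite fineK ?fin_num_measure// LambdaWE// (measure_by_type hL Lfin b B mS) -sumEFin.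
by apply: eq_bigr => A _; rewrite -type_massE LambdaWE// => y [/SW].
Qed.

(** Almost every hyperplane passes through none of the points; then [above B y] is the complement of
    [below B y] in B, and the integrand only depends on the type of y. *)
Lemma integral_by_type :
  (\int[LW]_(y in S) (c (below B y) (above B y))%:E =
   (\sum_(A : {set I} | A \subset B) c A (B :\: A) * type_mass A)%:E)%E.
Proof.
pose F (y : H) := c (below B y) (above B y).
have mF : measurable_fun setT F.
  apply: (@measurable_finite_choice _ _ _ ({set I} * {set I})%type (fun y => (below B y, above B y)) (fun p _ => c p.1 p.2)).
    move=> [A A']; rewrite (_ : [set _ | _] = [set y | below B y = A] `&` [set y | above B y = A']).
      by apply: measurableI; [exact: measurable_below|exact: measurable_above].
    by apply/seteqP; split => y /= [-> ->].
  by move=> p; exact: measurable_cst.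
pose G (y : H) := \sum_(A : {set I} | A \subset B) c A (B :\: A) * \1_(S `&` sep_type b A (B :\: A)) y.
have mG : measurable_fun setT G.
  apply: measurable_sum_cond => A _; apply: measurable_funM => //; exact: measurable_indic.
transitivity (\int[LW]_y (G y)%:E)%E; last first.
  under eq_integral do rewrite /G -sumEFin -big_filter.
  rewrite -sumEFin -[in RHS]big_filter ge0_integral_sum//.
  - apply: eq_bigr => A _; under eq_integral do rewrite EFinM.
    rewrite ge0_integralZl_EFin//; last by apply/measurable_EFinP; exact: measurable_indic.
    rewrite integral_indic// setIT EFinM; congr (_ * _)%E; exact: type_massE.
  - by move=> A; apply/measurable_EFinP; apply: measurable_funM => //; exact: measurable_indic.
  - by move=> A y _; rewrite lee_fin mulr_ge0.
rewrite integral_mkcond; apply: ae_eq_integral => //.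
- by apply/(measurable_restrictT _ mS); apply: measurable_funTS; exact/measurable_EFinP.
- exact/measurable_EFinP.
pose N : set H := \bigcup_(i in [set: I]) [set y | side y (b i) = 0].
have mN i : measurable ([set y | side y (b i) = 0] : set H).
  by apply: measurable_eq_set; [exact: measurable_side|exact: measurable_cst].
have mNN : measurable N by apply: fin_bigcup_measurable.
have N0 : Lambda N = 0%E.
  apply: (@null_cover _ _ _ Lambda I _ (fun i => [set y | side y (b i) = 0])) => //.
    by move=> i; exact: (Lambda_on_null hL Lfin).
exists N; split => //.
  apply/eqP; rewrite eq_le measure_ge0 andbT -N0 /LambdaW/= /mfrestr /mrestr le_measure ?inE//.
  by apply: measurableI => //; apply: hits_compact; exact: polytope_compact (windowP W).
move=> y /= /not_implyP[_ ne]; apply: contrapT => nN; apply: ne.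
have ns i : side y (b i) != 0 by apply/eqP => e; apply: nN; exists i.
rewrite /patch; have [Sy|Sy] := boolP (y \in S); last first.
  by rewrite /G big1// => A _; rewrite indicE in_setI (negbTE Sy) mulr0.
have bB : below B y \subset B by apply/fintype.subsetP => i; rewrite inE => /andP[].
have aE : above B y = B :\: below B y.
  apply/setP => i; rewrite !inE negb_and -leNgt; case: (i \in B); rewrite /= ?andbF ?andbT//.
  by rewrite lt_neqAle eq_sym ns.
rewrite /G (bigD1 (below B y))//= big1 ?addr0.
  rewrite aE indicE in_setI Sy/= mem_set ?mulr1//; split => i; rewrite -?aE inE => /andP[] //.
move=> A /andP[AB Ane]; rewrite indicE memNset ?mulr0//= => -[_ [h1 h2]].
move/eqP: Ane; apply; apply/setP => i; rewrite inE; have [iB|iB] := boolP (i \in B); last first.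
  by rewrite (negbTE (contra (fintype.subsetP AB i) iB)).
have [iA|iA] := boolP (i \in A); first by rewrite (h1 i iA).
by apply/esym/negbTE; rewrite -leNgt ltW// h2// inE iA.
Qed.

End ByType.

Variable L : seq (R * ({set I} -> R)).
Hypotheses (wL : weights_ok L) (sL : sorted <=%O (map fst L)) (L0 : forall p, p \in L -> 0 <= p.1).

Let k0 A B : 0 <= kap A B. Proof. exact: kappa_ge0. Qed.

Section CellSplit.
Variables (n : nat) (v : seq bool) (w : T).
Hypotheses (vn : size v = n) (gw : good_gen n w).
Let B := blk (C v w).
Let S : set H := qhits (C v w).

(** Hyperplanes that separate two points of a convex cell cross it, so for a proper split the
    restriction to hyperplanes of the cell loses nothing. *)
Let mass_kappa A : splits B A -> type_mass S B A = kap A (B :\: A).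
Proof.
move=> sA; have /andP[_ /finset.set0Pn[i iA]] := sA.
have /andP[_ /finset.set0Pn[j jA]] := splits_setD sA.
have AB : A \subset B by have /andP[/proper_sub] := sA.
rewrite /type_mass setIC -(Lambda_qhits hL (gw vn)); last exact: measurable_sep_type.
rewrite setIidl// => y [h1 h2]; apply: (@sep_hits _ (b i) (b j)); first exact: cell_convex.
- by apply: interior_subset; apply/in_blk; exact: (fintype.subsetP AB).
- by apply: interior_subset; apply/in_blk; move: jA; rewrite inE => /andP[].
- exact: h1.
- exact: h2.
Qed.

Let massB : \sum_(A : {set I} | A \subset B) type_mass S B A = crate n v w.
Proof.
rewrite -sum_type_mass; [|exact: measurable_qhits|exact: qhits_cell_sub].
by rewrite crateE /hit_rate hit_setE.
Qed.

Lemma split_rate_le : split_rate kap B <= crate n v w.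
Proof.
rewrite -massB /split_rate [leRHS](bigID (splits B))/=.
rewrite [X in _ <= X + _](_ : _ = \sum_(A | splits B A) kap A (B :\: A)); last first.
  apply: eq_big => [A|A /andP[_ /mass_kappa]//].
  by rewrite andb_idl// => /andP[/proper_sub].
by rewrite lerDl sumr_ge0// => A _; exact: fine_ge0.
Qed.

(** The trivial types, with all points of the cell on one side, carry the mass left over by the
    proper splits. They leave the value of B unchanged, as the empty part has value 1. *)
Lemma split_valueE s : \sum_(A : {set I} | A \subset B) (value kap L s A * value kap L s (B :\: A)) * type_mass S B A =
  crate n v w * split_value kap (crate n v w) L s B.
Proof.
have c0 : 0 < crate n v w by apply: crate_gt0; exact: (gw vn).
rewrite /split_value mulrDr mulrA divff ?gt_eqF// mul1r -[in X in _ = X + _]massB mulr_suml.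
rewrite /frag; apply/eqP; rewrite addrC -subr_eq -sumrB; apply/eqP.
rewrite (bigID (splits B))/= [X in _ + X]big1 ?addr0; last first.
  move=> A /andP[AB nsA]; have : (A == B) || (A == finset.set0).
    move: nsA; rewrite /splits finset.properEneq AB andbT negb_and !negbK.
    by case/orP => [/eqP ->|/eqP ->]; rewrite eqxx ?orbT.
  case/orP => /eqP ->; first by rewrite finset.setDv (value_set0 _ _ wL); ring.
  by rewrite finset.setD0 (value_set0 _ _ wL); ring.
apply: eq_big => [A|A /andP[_ sA]]; first by rewrite andb_idl// => /andP[/proper_sub].
by rewrite mass_kappa//; ring.
Qed.

End CellSplit.

Let pos_indic : Rt -> R := \1_`]0%R, +oo[%classic.
Let mpos : measurable_fun setT pos_indic.
Proof. by apply: measurable_indic; exact: measurable_itv. Qed.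
Let pos_indic1 t : 0 < t -> pos_indic t = 1.
Proof. by move=> t0; rewrite /pos_indic indicE mem_set//= in_itv/= t0. Qed.
Let pos_indic0 t : t <= 0 -> pos_indic t = 0.
Proof. by move=> t0; rewrite /pos_indic indicE memNset//= in_itv/= andbT => /(le_lt_trans t0); rewrite ltxx. Qed.

(** What the cell v contributes during its life, times what its two children are expected to
    contribute. By [one_step] with x = 0, its average over lifetime and hyperplane is the value of v
    at birth. *)
Let J n v (z : Hist n * (Rt * H)) : R :=
  let s := birth (tau^~ z.1) v in let B := blk (C v z.1) in
  pos_indic z.2.1 * (weight L s z.2.1 B *
    (value kap L (s + z.2.1) (below B z.2.2) * value kap L (s + z.2.1) (above B z.2.2))).

Let Jh n v (w : Hist n) : R := value kap L (birth (tau^~ w) v) (blk (C v w)).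

Let J_law n v w : size v = n -> good_gen n w ->
  (\int[lebesgue_measure]_(t in `]0%R, +oo[) ((expR (- (crate n v w * t)))%:E *
     \int[LW]_(y in qhits (C v w)) (@J n v (w, (t, y)))%:E) = (@Jh n v w)%:E)%E.
Proof.
move=> vn gw; set c := crate n v w; have c0 : 0 < c by apply: crate_gt0; exact: (gw v vn).
set s := birth (tau^~ w) v; set B := blk (C v w).
have := @one_step _ _ kap c L s 0 B k0 wL c0 (split_rate_le vn gw) sL.
rewrite mulr0 expR0 mul1r addr0 => <-; apply: eq_integral => t; rewrite inE/= in_itv/= andbT => t0.
rewrite subr0 -mulrA EFinM; rewrite -[X in (_ = X * _)%E](_ : 1%:E * c%:E = c%:E)%E ?mul1e//.
transitivity ((expR (- (c * t)))%:E * (weight L s t B * (c * split_value kap c L (s + t) B))%:E)%E.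
  congr (_ * _)%E; rewrite -(split_valueE vn gw) mulr_sumr.
  under [in RHS]eq_bigr do rewrite mulrA.
  rewrite -(@integral_by_type (qhits (C v w)) B (fun A A' => weight L s t B * (value kap L (s + t) A * value kap L (s + t) A'))).
  - by apply: eq_integral => y _; rewrite /J/= pos_indic1// mul1r.
  - exact: measurable_qhits.
  - move=> A A'; have /andP[? _] := weight_bounds s t B wL.
    have /andP[? _] := value_bounds (s + t) A k0 wL; have /andP[? _] := value_bounds (s + t) A' k0 wL.
    by rewrite !mulr_ge0.
by rewrite -!EFinM mulNr; congr EFin; ring.
Qed.

Let mJ n v : size v = n -> measurable_fun setT (@J n v).
Proof.
move=> vn; have mb : measurable_fun setT (fun z : Hist n * (Rt * H) => birth (tau^~ z.1) v).
  by apply: (measurableT_comp (@history_birth _ _ _ _ tau h n v _) measurable_fst); rewrite vn.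
have mt : measurable_fun setT (fun z : Hist n * (Rt * H) => z.2.1 : R) by exact: (measurableT_comp measurable_fst measurable_snd).
have my : measurable_fun setT (fun z : Hist n * (Rt * H) => z.2.2) by exact: (measurableT_comp measurable_snd measurable_snd).
apply: measurable_funM; first exact: (measurableT_comp mpos mt).
apply: (@measurable_finite_choice _ _ _ ({set I} * ({set I} * {set I}))%type
  (fun z : Hist n * (Rt * H) => (blk (C v z.1), (below (blk (C v z.1)) z.2.2, above (blk (C v z.1)) z.2.2)))
  (fun p z => weight L (birth (tau^~ z.1) v) z.2.1 p.1 *
    (value kap L (birth (tau^~ z.1) v + z.2.1) p.2.1 * value kap L (birth (tau^~ z.1) v + z.2.1) p.2.2))).
  move=> [B [A A']]; rewrite (_ : [set _ | _] = (fst @^-1` [set w | blk (C v w) = B]) `&`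
     ((fun z : Hist n * (Rt * H) => z.2.2) @^-1` ([set y | below B y = A] `&` [set y | above B y = A']))).
    apply: measurableI.
      rewrite -[X in measurable X]setTI; apply: measurable_fst => //; apply: history_blk; by rewrite vn.
    rewrite -[X in measurable X]setTI; apply: my => //.
    by apply: measurableI; [exact: measurable_below|exact: measurable_above].
  by apply/seteqP; split => z /=; [move=> [-> -> ->]|move=> [-> [-> ->]]].
move=> [B [A A']] /=; apply: measurable_funM.
  exact: (measurableT_comp (measurable_weight L B) (measurable_fun_pair mb mt)).
have ms := measurable_funD mb mt.
by apply: measurable_funM; [exact: (measurableT_comp (measurable_value kap L A) ms)|exact: (measurableT_comp (measurable_value kap L A') ms)].
Qed.

Let mJh n v : (size v <= n)%N -> measurable_fun setT (@Jh n v).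
Proof.
move=> vn; apply: (@measurable_finite_choice _ _ _ {set I} (fun w : Hist n => blk (C v w))
  (fun B w => value kap L (birth (tau^~ w) v) B)); first by move=> B; exact: history_blk.
by move=> B; apply: (measurableT_comp (measurable_value kap L B)); exact: history_birth.
Qed.

Definition cell_weight v w : R := weight L (birth (tau^~ w) v) (tau v w) (blk (C v w)).
Definition cell_value v w : R := value kap L (birth (tau^~ w) v) (blk (C v w)).
(** The observed product with generations from n on replaced by their expectation: cells of the
    generations below n contribute their weights, each cell of generation n contributes the value of
    its block at its birth. Only the constancy of the expectation in n is used. *)
Definition martingale n w : R :=
  \prod_(v <- words n) cell_weight v w * \prod_(v <- gen_words n) cell_value v w.

Lemma cell_weight01 v w : 0 <= cell_weight v w <= 1. Proof. exact: weight_bounds. Qed.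
Lemma cell_value01 v w : 0 <= cell_value v w <= 1. Proof. exact: value_bounds. Qed.
Lemma martingale01 n w : 0 <= martingale n w <= 1.
Proof. by apply: mul01; apply: prod_seq01 => v _; [exact: cell_weight01|exact: cell_value01]. Qed.

Let history_weight n v : (size v < n)%N -> measurable_fun setT (cell_weight v : Hist n -> R).
Proof.
move=> vn; apply: (@measurable_finite_choice _ _ _ {set I} (fun w : Hist n => blk (C v w))
  (fun B w => weight L (birth (tau^~ w) v) (tau v w) B)); first by move=> B; apply: history_blk; exact: ltnW.
move=> B; exact: (measurableT_comp (measurable_weight L B)
  (measurable_fun_pair (@history_birth _ _ _ _ tau h n v (ltnW vn)) (@history_tau _ _ _ _ tau h n v vn))).
Qed.

Lemma measurable_martingale n : measurable_fun setT (martingale n).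
Proof.
apply: (from_history hD (n := n)); apply: measurable_funM; apply: measurable_prod_seq => v.
  by rewrite mem_words; exact: history_weight.
by rewrite mem_gen_words => /eqP <-; exact: mJh.
Qed.

Lemma martingale_step n : (\int[P]_w (martingale n.+1 w)%:E = \int[P]_w (martingale n w)%:E)%E.
Proof.
have mg : measurable_fun setT (fun w : Hist n => \prod_(v <- words n) cell_weight v w).
  by apply: measurable_prod_seq => v; rewrite mem_words; exact: history_weight.
have E := @tree_step R l Lambda hL W d T P tau h hD n _ (@J n) (@Jh n) mg
  (fun w => prod_seq01 (fun v _ => cell_weight01 v w)) (@mJ n)
  (fun v vn => mJh (eq_leq vn)).
rewrite -{2}/(martingale n) -E; first last.
- exact: J_law.
- by move=> v w t y t0; rewrite /J/= pos_indic0// mul0r.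
- by move=> v w; exact: value_bounds.
- by move=> v z; rewrite /J; apply: mul01; [exact: indic01|apply: mul01; [exact: weight_bounds|apply: mul01; exact: value_bounds]].
have mid := measurable_id_history (@tree_gen_measurable _ _ _ _ _ _ _ _ _ hD n).
apply: ae_integral; first exact: measurable_martingale.
  apply: measurable_funM; first exact: (measurableT_comp mg mid).
  apply: measurable_prod_seq => v; rewrite mem_gen_words => /eqP vn.
  apply: (measurableT_comp (mJ vn)); apply: measurable_fun_pair => //.
  by apply: measurable_fun_pair; [exact: (tree_lifetime hD)|exact: (tree_hyperplane hD)].
apply: filterS (ae_good hL hD) => w gw.
rewrite /martingale big_gen_wordsS [words n.+1]/= big_cat/= -mulrA -big_split/=; congr (_ * _).
apply: eq_bigr => v _; rewrite /J/= pos_indic1 ?mul1r; last by have [] := gw v.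
by rewrite /cell_value !birth_rcons !blk_child.
Qed.

Lemma integral_martingale n : (\int[P]_w (martingale n w)%:E = (value kap L 0 finset.setT)%:E)%E.
Proof.
elim: n => [|n IH]; last by rewrite martingale_step.
rewrite (_ : martingale 0 = cst (value kap L 0 finset.setT)).
  have e := integral_cst P measurableT (value kap L 0 finset.setT)%:E.
  transitivity ((value kap L 0 finset.setT)%:E * P setT)%E; first by rewrite -e; exact: eq_integral.
  by rewrite -[RHS]mule1; congr (_ * _)%E; exact: probability_setT.
apply/funext => w; rewrite /martingale big_nil mul1r big_seq1 /cell_value /birth big_ord0; congr (value _ _ _ _).
by apply/setP => i; rewrite finset.in_setT; apply/in_blk; rewrite cell_nil.
Qed.

Theorem tree_value :
  (\int[P]_w (\prod_(p <- L) Phi b p.2 (cells (val (tree_tess W (tau^~ w) (h^~ w) p.1))))%:E =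
   (value kap L 0 finset.setT)%:E)%E.
Proof.
pose Y w := \prod_(p <- L) Phi b p.2 (cells (val (tree_tess W (tau^~ w) (h^~ w) p.1))).
have Y01 w : 0 <= Y w <= 1.
  by apply: prod_seq01 => p pL; apply: Phi_bounds => B; have [] := wL pL.
have mY : measurable_fun setT Y.
  apply: measurable_prod_seq => p pL.
  exact: (measurableT_comp (@measurable_TW_Phi _ _ _ b W p.2) (tree_measurable hD (L0 pL))).
pose Tm := \sum_(p <- L) p.1.
have LT p : p \in L -> p.1 <= Tm.
  move=> pL; rewrite /Tm (big_rem p)//= lerDl big_seq sumr_ge0// => q /mem_rem; exact: L0.
have Tm0 : 0 <= Tm by rewrite /Tm big_seq sumr_ge0.
pose th := 3 * total_rate Lambda W; have th0 : 0 < th by rewrite mulr_gt0// total_rate_gt0.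
pose K := expR (th * Tm); have K0 : 0 < K by exact: expR_gt0.
(* If generation n is born after [Tm], a bound for all observation times, then Y equals
   [martingale n]. Otherwise they differ by at most 1, and a cell of generation n born by [Tm] makes
   D n at least 1; this is the purpose of the factor K. *)
pose D n w := K * total_discount Lambda W tau n w.
have D0 n w : 0 <= D n w.
  rewrite mulr_ge0 ?(ltW K0)//; apply: sumr_ge0 => v _; by case/andP: (discount01 hL W tau v w).
have mD n : measurable_fun setT (D n) by apply: measurable_funM => //; exact: (measurable_total_discount hD n).
have bound n : {ae P, forall w, `|Y w - martingale n w| <= D n w}.
  apply: filterS (ae_good hL hD) => w gw; have tp v : 0 < tau v w by have [] := gw v.
  have gd v : (C v w)° !=set0 by have [] := gw v.
  have [late|] := pselect (forall v, size v = n -> Tm < birth (tau^~ w) v).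
    have -> : Y w = martingale n w.
      rewrite /Y (@prod_Phi_tree _ _ _ b W (tau^~ w) (h^~ w) n L tp gd wL _ L0); last first.
        by move=> p v pL vn; apply: le_lt_trans (late v vn); exact: LT.
      rewrite /martingale [X in _ = _ * X]big_seq [X in _ = _ * X]big1 ?mulr1// => v.
      rewrite mem_gen_words => /eqP vn; rewrite /cell_value value_late// => p pL.
      by apply: le_lt_trans (late v vn); exact: LT.
    by rewrite subrr normr0.
  move=> /existsNP[v /not_implyP[vn /negP]]; rewrite -leNgt => bv.
  have vw : v \in gen_words n by rewrite mem_gen_words vn.
  have D1 : 1 <= D n w.
    rewrite /D /total_discount (bigD1_seq v vw (uniq_gen_words n))/= mulrDr.
    apply: (@le_trans _ _ (K * discount Lambda W tau v w)); last first.
      by rewrite lerDl mulr_ge0 ?(ltW K0)// sumr_ge0// => u _; case/andP: (discount01 hL W tau u w).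
    have mT : Num.max (birth (tau^~ w) v) 0 <= Tm by rewrite ge_max bv Tm0.
    rewrite (_ : discount _ _ _ _ _ = expR (- (th * Num.max (birth (tau^~ w) v) 0))); last by rewrite /discount mulNr.
    by rewrite /K -expRD -expR0 ler_expR subr_ge0; exact: ler_wpM2l (ltW th0) _ _ mT.
  apply: le_trans D1; have /andP[y0 y1] := Y01 w; have /andP[x0 x1] := martingale01 n w.
  by rewrite ler_norml; lra.
have fY := integral01_fin P mY Y01.
pose y := fine (\int[P]_w (Y w)%:E); pose x := value kap L 0 finset.setT.
have yE : (\int[P]_w (Y w)%:E = y%:E)%E by rewrite fineK.
have intD n : (\int[P]_w (D n w)%:E <= (K * (2^-1) ^+ n)%:E)%E.
  under eq_integral do rewrite EFinM.
  rewrite ge0_integralZl_EFin ?(ltW K0)//.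
  - by rewrite EFinM; apply: lee_wpmul2l; [rewrite lee_fin ltW|exact: (integral_total_discount hL hD n)].
  - by move=> w _; rewrite lee_fin; have := D0 n w; rewrite pmulr_rge0.
  - apply/measurable_EFinP; exact: (measurable_total_discount hD n).
have key (X Z : T -> R) n : measurable_fun setT X -> measurable_fun setT Z -> (forall w, 0 <= X w) -> (forall w, 0 <= Z w) ->
    {ae P, forall w, X w <= Z w + D n w} ->
    (\int[P]_w (X w)%:E <= \int[P]_w (Z w)%:E + (K * (2^-1) ^+ n)%:E)%E.
  move=> mX mZ X0 Z0 XZ; apply: (@le_trans _ _ (\int[P]_w (Z w + D n w)%:E)%E).
    apply: ae_ge0_le_integral => //.
    - by move=> w _; rewrite lee_fin.
    - exact/measurable_EFinP.
    - by move=> w _; rewrite lee_fin addr_ge0.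
    - by apply/measurable_EFinP; exact: measurable_funD.
    - by apply: filterS XZ => w h1 _; rewrite lee_fin.
  under eq_integral do rewrite EFinD.
  rewrite ge0_integralD//.
  - by rewrite leeD2l.
  - by move=> w _; rewrite lee_fin.
  - exact/measurable_EFinP.
  - by move=> w _; rewrite lee_fin.
  - exact/measurable_EFinP.
have mM n := measurable_martingale n.
have yx n : `|y - x| <= K * (2^-1) ^+ n.
  have h1 := key Y (martingale n) n mY (mM n) (fun w => proj1 (andP (Y01 w))) (fun w => proj1 (andP (martingale01 n w))).
  have h2 := key (martingale n) Y n (mM n) mY (fun w => proj1 (andP (martingale01 n w))) (fun w => proj1 (andP (Y01 w))).
  have {}h1 : (y%:E <= x%:E + (K * (2^-1) ^+ n)%:E)%E.
    by rewrite -yE -(integral_martingale n); apply: h1; apply: filterS (bound n) => w; rewrite ler_norml; lra.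
  have {}h2 : (x%:E <= y%:E + (K * (2^-1) ^+ n)%:E)%E.
    by rewrite -yE -(integral_martingale n); apply: h2; apply: filterS (bound n) => w; rewrite ler_norml; lra.
  by move: h1 h2; rewrite -!EFinD !lee_fin ler_norml; lra.
rewrite -/(Y) yE; congr EFin; apply/eqP; rewrite -subr_eq0 -normr_le0.
have c0 : (K * (2^-1) ^+ n : R) @[n --> \oo] --> (0 : R).
  rewrite -[X in _ --> X](mulr0 K); apply: cvgMr; apply: cvg_expr.
  by rewrite ger0_norm// invf_lt1// ltr1n.
rewrite -[leRHS](cvg_lim _ c0)//; apply: limr_ge; first by apply/cvg_ex; exists 0.
by near=> n; exact: yx.
Unshelve. all: by end_near.
Qed.

End TreeLaw.

Lemma integral_finite (R : realType) d (T : measurableType d) (P : {measure set T -> \bar R})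
    (F : finType) (Z : T -> F) (g : F -> R) :
  (forall z, measurable (Z @^-1` [set z])) -> (forall z, 0 <= g z) ->
  (\int[P]_w (g (Z w))%:E = \sum_z (g z)%:E * P (Z @^-1` [set z]))%E.
Proof.
move=> mZ g0; transitivity (\int[P]_w (\sum_z (g z)%:E * (\1_(Z @^-1` [set z]) w)%:E))%E.
  apply: eq_integral => w _; rewrite (bigD1 (Z w))//= indicE mem_set// mule1 big1 ?adde0// => z zw.
  by rewrite indicE memNset ?mule0//= => /eqP; rewrite eq_sym (negbTE zw).
rewrite ge0_integral_sum//.
- apply: eq_bigr => z _; rewrite ge0_integralZl_EFin//.
    by rewrite integral_indic// setIT.
  by apply/measurable_EFinP; exact: measurable_indic.
- by move=> z; apply: measurable_funeM; apply/measurable_EFinP; exact: measurable_indic.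
- by move=> z w _; rewrite mule_ge0// lee_fin.
Qed.

(** * From the division tree to the STIT process *)

Section StitLaw.
Context (R : realType) (l : nat) (Lambda : {measure set (borel (hyperplane R l)) -> \bar R})
  (hL : driving_measure Lambda) d (Omega : measurableType d) (P : probability Omega R)
  (Y : R -> Omega -> borel (FF [set: 'rV[R]_l.+1])) (hY : stit_process P Lambda Y).
Local Notation V := 'rV[R]_l.+1.

Lemma window_interior_cball (W : window R l) (r : R) :
  exists W' : window R l, forall x, `|x| <= r -> (W' : set V)° x.
Proof.
have [W' mW'] := window_cball W (r + 1); exists W' => x xr.
rewrite /interior; apply/nbhs_ballP; exists 1 => //= y; rewrite -ball_normE/= => xy; apply: mW'.
rewrite /cball/= -[y](subrK x) (le_trans (ler_normD _ _))// addrC lerD//.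
by rewrite distrC ltW.
Qed.

Lemma interior_window (I : finType) (b : I -> V) (W : window R l) :
  exists W' : window R l, forall i, (W' : set V)° (b i).
Proof.
by have [r rb] := exists_cball b; have [W' h] := window_interior_cball W r; exists W' => i; exact: (h _ (rb i)).
Qed.

Section Patterns.
Variables (I : finType) (b : I -> V) (W : window R l).

Definition pattern (T : TW W) : {ffun I * I -> bool} :=
  [ffun p => `[< together (cells (val T)) (b p.1) (b p.2) >]].

Lemma measurable_pattern z : measurable ([set T | pattern T = z] : set (borel (TW W))).
Proof.
rewrite (_ : [set _ | _] = \bigcap_(p in [set: I * I]) (if z p then [set T : TW W | together (cells (val T)) (b p.1) (b p.2)]
       else ~` [set T | together (cells (val T)) (b p.1) (b p.2)])).
  apply: fin_bigcap_measurable => // p _; case: ifP => _; first exact: measurable_TW_together.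
  by apply: measurableC; exact: measurable_TW_together.
apply/seteqP; split => [T /= <- p _|T /= h].
  by rewrite ffunE; case: ifPn => [/asboolP|/asboolPn].
apply/ffunP => p; rewrite ffunE; have := h p Logic.I; case: ifPn => _ ?; first exact/asboolP.
exact/asboolPn.
Qed.

Definition pattern_Phi f z : R :=
  if pselect (exists T, pattern T = z) is left e then Phi b f (cells (val (projT1 (cid e)))) else 0.

Lemma pattern_PhiE f T : pattern_Phi f (pattern T) = Phi b f (cells (val T)).
Proof.
rewrite /pattern_Phi; case: pselect => [e|[]]; last by exists T.
apply: eq_Phi => [||i j]; [exact: TW_disjoint|exact: TW_disjoint|].
have := congr1 (fun z : {ffun _ -> _} => z (i, j)) (projT2 (cid e)).
by rewrite !ffunE/= => h; split => t; apply/asboolP; [rewrite -h|rewrite h]; apply/asboolP.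
Qed.

Lemma pattern_Phi_ge0 f z : (forall B, 0 <= f B <= 1) -> 0 <= pattern_Phi f z.
Proof.
by move=> f0; rewrite /pattern_Phi; case: pselect => // e; case/andP: (@Phi_bounds _ _ _ b f (cells (val (projT1 (cid e)))) f0).
Qed.

End Patterns.

(** Equality of finite-dimensional distributions concerns events. As [Phi] depends only on the
    pattern of the tessellation, which takes finitely many values, both expectations are finite sums
    over probabilities of such events. *)
Lemma fdd_expectation (I : finType) (b : I -> V) (W : window R l) d1 (T1 : measurableType d1) (P1 : probability T1 R)
    d2 (T2 : measurableType d2) (P2 : probability T2 R) (y1 : R -> T1 -> TW W) (y2 : R -> T2 -> TW W)
    (L : seq (R * ({set I} -> R))) :
  weights_ok L -> (forall p, p \in L -> 0 <= p.1) ->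
  (forall t, 0 <= t -> measurable_fun setT (y1 t : T1 -> borel (TW W))) ->
  (forall t, 0 <= t -> measurable_fun setT (y2 t : T2 -> borel (TW W))) ->
  (forall n (t : 'I_n -> R) (A : 'I_n -> set (borel (TW W))),
      (forall i, 0 <= t i) -> (forall i, measurable (A i)) ->
      P1 [set w | forall i, A i (y1 (t i) w)] = P2 [set w | forall i, A i (y2 (t i) w)]) ->
  (\int[P1]_w (\prod_(p <- L) Phi b p.2 (cells (val (y1 p.1 w))))%:E =
   \int[P2]_w (\prod_(p <- L) Phi b p.2 (cells (val (y2 p.1 w))))%:E)%E.
Proof.
move=> wL L0 m1 m2 fdd; pose n := size L; pose t k : R * _ := tnth (in_tuple L) k.
have tL k : t k \in L by exact: mem_tnth.
pose G (z : {ffun 'I_n -> {ffun I * I -> bool}}) : R := \prod_k @pattern_Phi I b W (t k).2 (z k).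
have G0 z : 0 <= G z.
  by apply: prodr_ge0 => k _; apply: pattern_Phi_ge0 => B; have [] := wL _ (tL k).
have E d' (T' : measurableType d') (P' : probability T' R) (y : R -> T' -> TW W) :
   (forall t, 0 <= t -> measurable_fun setT (y t : T' -> borel (TW W))) ->
   (\int[P']_w (\prod_(p <- L) Phi b p.2 (cells (val (y p.1 w))))%:E =
    \sum_z (G z)%:E * P' [set w | forall k, [set T | pattern b T = z k] (y (t k).1 w)])%E.
  move=> my; transitivity (\int[P']_w (G [ffun k => pattern b (y (t k).1 w)])%:E)%E.
    apply: eq_integral => w _; congr EFin; rewrite big_tnth; apply: eq_bigr => k _.
    by rewrite ffunE pattern_PhiE.
  rewrite integral_finite//.
    apply: eq_bigr => z _; congr (_ * P' _)%E; apply/seteqP; split => [w <- k /=|w h /=]; first by rewrite ffunE.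
    by apply/ffunP => k; rewrite ffunE; exact: h.
  move=> z; rewrite (_ : _ @^-1` _ = \bigcap_(k in [set: 'I_n]) ((y (t k).1) @^-1` [set T | pattern b T = z k])).
    apply: fin_bigcap_measurable => // k _; rewrite -[X in measurable X]setTI.
    by apply: my => //; [exact: L0|exact: measurable_pattern].
  apply/seteqP; split => [w <- k _ /=|w h /=]; first by rewrite ffunE.
  by apply/ffunP => k; rewrite ffunE; exact: h.
rewrite (E _ _ _ _ m1) (E _ _ _ _ m2); apply: eq_bigr => z _; congr (_ * _)%E.
by apply: (fdd n (fun k => (t k).1) (fun k => [set T | pattern b T = z k])) => k; [exact: L0|exact: measurable_pattern].
Qed.

Lemma stit_disjoint t w : 0 < t -> disjoint_cells (cells (Y t w)).
Proof. by move=> t0; apply: tessellation_disjoint; exact: stit_tessellation hY _ _ t0. Qed.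

Lemma stit_together t p q : 0 < t -> measurable [set w | together (cells (Y t w)) p q].
Proof.
move=> t0; have [mY _] := stit_markov hY; rewrite -[X in measurable X]setTI.
apply: (mY t t0 measurableT [set T | together (cells T) p q]).
by apply: measurable_together; exact: closedT.
Qed.

Lemma measurable_stit_Phi (I : finType) (b : I -> V) t f : 0 < t ->
  measurable_fun setT (fun w => Phi b f (cells (Y t w))).
Proof. by move=> t0; apply: measurable_Phi => [w|i j]; [exact: stit_disjoint|exact: stit_together]. Qed.

Lemma measurable_restrict (W : window R l) t : 0 < t ->
  measurable_fun setT (fun w => restrict_tess W (Y t w) : borel (TW W)).
Proof.
move=> t0; apply: measurable_TW => n m nW mW.
rewrite (_ : _ @^-1` _ = [set w | together (cells (Y t w)) (dseq R l n) (dseq R l m)]); first exact: stit_together.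
by apply/seteqP; split => w /= /(together_restrict (stit_tessellation hY w t0) nW mW).
Qed.

(** The points are enclosed in the interior of a larger window, for which [stit_window] provides a
    division tree with the same finite-dimensional distributions. Restricting to that window does
    not change which of the points are together. *)
Theorem stit_value (W : window R l) (I : finType) (b : I -> V) (L : seq (R * ({set I} -> R))) :
  weights_ok L -> sorted <=%O (map fst L) -> (forall p, p \in L -> 0 < p.1) ->
  (\int[P]_w (\prod_(p <- L) Phi b p.2 (cells (Y p.1 w)))%:E =
   (value (kappa Lambda b) L 0 finset.setT)%:E)%E.
Proof.
move=> wL sL L0; have [W' bW'] := interior_window b W.
have L0' p : p \in L -> 0 <= p.1 by move=> /L0/ltW.
have [_ [d' [T' [P' [tau [h [hD fdd]]]]]]] := stit_window hY W'.
rewrite -(tree_value hL hD bW' wL sL L0').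
pose y t w := if 0 < t then restrict_tess W' (Y t w) else whole W'.
transitivity (\int[P]_w (\prod_(p <- L) Phi b p.2 (cells (val (y p.1 w))))%:E)%E; last first.
  apply: (@fdd_expectation I b W' _ _ P _ _ P' _ _ L wL L0' _ (tree_measurable hD) fdd) => t _.
  have [t0|t0] := boolP (0 < t).
    rewrite (_ : y t = fun w => restrict_tess W' (Y t w)); first exact: measurable_restrict.
    by apply/funext => w; rewrite /y t0.
  rewrite (_ : y t = cst (whole W')); first exact: measurable_cst.
  by apply/funext => w; rewrite /y (negbTE t0).
apply: eq_integral => w _; congr EFin; rewrite !big_seq; apply: eq_bigr => p /L0 p0; rewrite /y p0.
apply: eq_Phi => [||i j]; [exact: stit_disjoint|exact: TW_disjoint|].
by rewrite (together_restrict (stit_tessellation hY w p0)).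
Qed.

End StitLaw.

Section Semigroup.
Variables (R : realType) (I : finType) (kap : {set I} -> {set I} -> R).
Implicit Types (L : seq (R * ({set I} -> R))) (f : {set I} -> R).

Lemma flow_semigroup f u v B : 0 <= u -> 0 <= v ->
  flow kap f (u + v) B = flow kap (flow kap f v) u B.
Proof.
move=> u0 v0; have h : frag_flow kap (flow kap f v) (fun x => flow kap f (x + v)).
  split; first by rewrite add0r.
  move=> C x x0; have D1 := is_derive_flow kap f C (addr_ge0 x0 v0).
  have D2 : is_derive x 1 (fun y => y + v) 1.
    by have := is_derive_add (is_derive_id x 1) (is_derive_cst v x 1); rewrite addr0.
  have := @is_derive1_comp _ (fun z => flow kap f z C) (fun y => y + v) x _ _ D1 D2.
  by rewrite mulr1.
exact: flow_unique h (flowP _ _) u0.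
Qed.

Lemma flow_cst1 u B : 0 <= u -> flow kap (fun=> 1) u B = 1.
Proof.
move=> u0; have h : frag_flow kap (fun=> 1) (fun=> fun=> 1).
  split => // C x _; rewrite /frag big1; first exact: is_derive_cst.
  by move=> A _; rewrite mulr1 subrr mulr0.
by rewrite (flow_unique B (flowP _ _) h u0).
Qed.

Lemma value_from L s r B : s <= r -> (forall p, p \in L -> r <= p.1) ->
  value kap L s B = flow kap (value kap L r) (r - s) B.
Proof.
case: L => [|p L] sr Lr /=.
  by rewrite -[RHS]/(flow kap (fun=> 1) (r - s) B) flow_cst1// subr_ge0.
have rp := Lr p (mem_head _ _); rewrite (le_trans sr rp) rp.
rewrite (_ : p.1 - s = (r - s) + (p.1 - r)); last by ring.
by rewrite flow_semigroup// subr_ge0.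
Qed.

(** The Markov property at time r, at the level of the equations: by the semigroup law, all
    observations from r on act like a single observation at r, with weight [value kap L2 r]. *)
Lemma value_cat L1 L2 r s B : s <= r -> (forall p, p \in L1 -> p.1 <= r) ->
  (forall p, p \in L2 -> r <= p.1) ->
  value kap (L1 ++ L2) s B = value kap (L1 ++ [:: (r, value kap L2 r)]) s B.
Proof.
move=> + + L2r; elim: L1 s B => [|p L1 IH] s B sr L1r /=.
  rewrite sr (value_from B sr L2r); congr (flow _ _ _ B); apply/funext => A.
  by rewrite mulr1.
have pr := L1r p (mem_head _ _); have L1r' q : q \in L1 -> q.1 <= r.
  by move=> qL; apply: L1r; rewrite inE qL orbT.
case: ifP => sp; last exact: IH.
by congr (flow _ _ _ B); apply/funext => A; rewrite IH.
Qed.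

End Semigroup.

Definition lift_weights (R : realType) (I J : finType) (iota : J -> I) (L : seq (R * ({set J} -> R))) :
    seq (R * ({set I} -> R)) := [seq (p.1, fun A : {set I} => p.2 (iota @^-1: A)) | p <- L].

Section Lift.
Variables (R : realType) (l : nat) (I J : finType) (iota : J -> I) (b : I -> 'rV[R]_l.+1).
Local Notation V := 'rV[R]_l.+1.

Lemma blk_comp C : blk (b \o iota) C = iota @^-1: blk b C.
Proof. by apply/setP => j; rewrite [RHS]inE; apply/idP/idP => /in_blk h; exact/in_blk. Qed.

Lemma Phi_lift f (S : set (set V)) : f finset.set0 = 1 -> disjoint_cells S ->
  Phi b (fun A => f (iota @^-1: A)) S = Phi (b \o iota) f S.
Proof.
move=> f1 dS; rewrite /Phi (bigID (fun B : {set I} => iota @^-1: B == finset.set0))/= big1 ?mul1r; last first.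
  by move=> B /andP[_ /eqP ->].
rewrite (partition_big (fun B : {set I} => iota @^-1: B)
  (fun B' : {set J} => (B' != finset.set0) && `[< occurs (b \o iota) S B' >]))/=.
  apply: eq_bigr => B' /andP[B'0 /asboolP[C SC CB']].
  have B'E : iota @^-1: blk b C = B' by rewrite -blk_comp.
  rewrite (big_pred1 (blk b C)) ?B'E// => B /=; apply/idP/eqP.
    move=> /andP[/andP[/andP[_ /asboolP[D SD DB]] _] /eqP BB'].
    have /finset.set0Pn[j jB'] := B'0.
    have Dj : D° (b (iota j)) by apply/in_blk; rewrite DB; move: jB'; rewrite -BB' inE.
    have Cj : C° (b (iota j)) by apply/in_blk; move: jB'; rewrite -B'E inE.
    by rewrite -DB (disjoint_cells_eq dS SC SD Cj Dj).
  move=> ->; rewrite B'E eqxx B'0 !andbT; apply/andP; split; last by apply/asboolP; exists C.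
  have /finset.set0Pn[j jB'] := B'0; apply/finset.set0Pn; exists (iota j).
  by move: jB'; rewrite -B'E inE.
move=> B /andP[/andP[_ /asboolP[C SC CB]] ->] /=; apply/asboolP; exists C => //.
by rewrite blk_comp CB.
Qed.

Lemma weights_ok_lift (L : seq (R * ({set J} -> R))) : weights_ok L -> weights_ok (lift_weights iota L).
Proof.
by move=> wL _ /mapP[p /wL[p01 p0] ->]; split => //=; rewrite finset.preimset0.
Qed.

End Lift.

Lemma map_fst_lift (R : realType) (I J : finType) (iota : J -> I) (L : seq (R * ({set J} -> R))) :
  map fst (lift_weights iota L) = map fst L.
Proof. by rewrite -map_comp. Qed.

(** Its product over the blocks is the indicator that i and j are not together. Finite conjunctions
    of such conditions are products again, so that [stit_value] gives their probability; this is why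
    pairs are tested for being apart. *)
Definition pair_weight (R : realType) (I : finType) (ij : I * I) (B : {set I}) : R :=
  (~~ ((ij.1 \in B) && (ij.2 \in B)))%:R.

Definition pair_weights (R : realType) (I : finType) (K : seq (R * (I * I))) : seq (R * ({set I} -> R)) :=
  [seq (k.1, pair_weight R k.2) | k <- K].

Lemma pair_weights_ok (R : realType) (I : finType) (K : seq (R * (I * I))) : weights_ok (pair_weights K).
Proof.
move=> _ /mapP[k _ ->]; rewrite /= /pair_weight; split; last by rewrite finset.in_set0.
by move=> B; rewrite ler0n lern1 leq_b1.
Qed.

Lemma Phi_pair (R : realType) (l : nat) (I : finType) (b : I -> 'rV[R]_l.+1) i j (S : set (set 'rV[R]_l.+1)) :
  Phi b (pair_weight R (i, j)) S = (~~ `[< together S (b i) (b j) >])%:R.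
Proof.
case: asboolP => /= [[C SC [Ci Cj]]|nt].
  have iC : i \in blk b C by exact/in_blk.
  rewrite /Phi (bigD1 (blk b C))/=.
    by rewrite /pair_weight/= iC (_ : j \in blk b C) ?mul0r//; exact/in_blk.
  apply/andP; split; first by apply/finset.set0Pn; exists i.
  by apply/asboolP; exists C.
rewrite /Phi big1// => B /andP[_ /asboolP[C SC CB]]; rewrite /pair_weight/=.
case: andP => // -[iB jB]; exfalso; apply: nt; exists C => //.
by split; apply/in_blk; rewrite CB.
Qed.

Section EventLaws.
Context (R : realType) (l : nat) (Lambda : {measure set (borel (hyperplane R l)) -> \bar R})
  (hL : driving_measure Lambda) d (Omega : measurableType d) (P : probability Omega R)
  (Y : R -> Omega -> borel (FF [set: 'rV[R]_l.+1])) (hY : stit_process P Lambda Y) (W : window R l).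
Local Notation V := 'rV[R]_l.+1.
Let Lfin := window_bound W hL.

Definition avoid (K : seq (R * (V * V))) : set Omega :=
  [set w | forall k, k \in K -> ~ together (cells (Y k.1 w)) k.2.1 k.2.2].

Definition at_points (I : finType) (b : I -> V) (K : seq (R * (I * I))) : seq (R * (V * V)) :=
  [seq (k.1, (b k.2.1, b k.2.2)) | k <- K].

Lemma measurable_avoid K : (forall k, k \in K -> 0 < k.1) -> measurable (avoid K).
Proof.
elim: K => [|k K IH] K0; first by rewrite (_ : avoid _ = setT)//; apply/seteqP; split.
rewrite (_ : avoid _ = ~` [set w | together (cells (Y k.1 w)) k.2.1 k.2.2] `&` avoid K).
  apply: measurableI; first by apply/measurableC/(stit_together hY)/K0; rewrite mem_head.
  by apply: IH => q qK; apply: K0; rewrite inE qK orbT.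
apply/seteqP; split => [w h|w [h1 h2] q].
  by split => [|q qK]; apply: h; rewrite inE ?eqxx ?qK ?orbT.
by rewrite inE => /orP[/eqP ->|/h2].
Qed.

Lemma prod_pair (I : finType) (b : I -> V) K w :
  \prod_(p <- pair_weights K) Phi b p.2 (cells (Y p.1 w)) = \1_(avoid (at_points b K)) w.
Proof.
elim: K => [|[t [i j]] K IH]; first by rewrite big_nil indicE mem_set.
rewrite big_cons IH/= Phi_pair !indicE; case: asboolP => /= t1.
  by rewrite mul0r memNset// => /(_ (t, (b i, b j)) (mem_head _ _)).
rewrite mul1r; congr (nat_of_bool _)%:R; apply/idP/idP => /set_mem h; apply/mem_set => q.
  by rewrite inE => /orP[/eqP ->//|/h].
by move=> qK; apply: h; rewrite inE qK orbT.
Qed.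

Lemma map_fst_pair (I : finType) (K : seq (R * (I * I))) : map fst (pair_weights K) = map fst K.
Proof. by rewrite -map_comp. Qed.

Lemma prod_lift (I J : finType) (iota : J -> I) (b : I -> V) (L : seq (R * ({set J} -> R))) w :
  weights_ok L -> (forall p, p \in L -> 0 < p.1) ->
  \prod_(p <- lift_weights iota L) Phi b p.2 (cells (Y p.1 w)) =
  \prod_(p <- L) Phi (b \o iota) p.2 (cells (Y p.1 w)).
Proof.
move=> wL L0; rewrite big_map; apply: eq_big_seq => p pL.
have [_ p1] := wL _ pL; rewrite /= Phi_lift//; exact: (stit_disjoint hY (L0 _ pL)).
Qed.

(* The points observed after time [r] only matter through the blocks they form at time [r]. *)
Theorem expectation_future (I J : finType) (bI : I -> V) (bJ : J -> V) (K : seq (R * (I * I)))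
    (L : seq (R * ({set J} -> R))) r : 0 < r ->
  sorted <=%O (map fst K) -> (forall k, k \in K -> 0 < k.1 <= r) ->
  weights_ok L -> sorted <=%O (map fst L) -> (forall p, p \in L -> r <= p.1) ->
  (\int[P]_w (\1_(avoid (at_points bI K)) w * \prod_(p <- L) Phi bJ p.2 (cells (Y p.1 w)))%:E =
   \int[P]_w (\1_(avoid (at_points bI K)) w * Phi bJ (value (kappa Lambda bJ) L r) (cells (Y r w)))%:E)%E.
Proof.
move=> r0 sK Kr wL sL Lr; set kJ := kappa Lambda bJ.
(* Both families of points are observed jointly, so that [stit_value] computes either side;
   [value_cat] and [value_lump] then compress the observations of [bJ] into one at time r. *)
pose b (x : I + J) : V := match x with inl i => bI i | inr j => bJ j end.
have kJ0 A B : 0 <= kJ A B by exact: kappa_ge0.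
have wG : weights_ok [:: (r, value kJ L r)].
  by move=> p; rewrite inE => /eqP -> /=; split=> [B|]; [exact: value_bounds|rewrite value_set0].
pose M1 := lift_weights (inl : I -> I + J) (pair_weights K).
have M1r p : p \in M1 -> 0 < p.1 <= r.
  by move=> /mapP[q /mapP[k kK ->] ->] /=; exact: Kr.
have E (L' : seq (R * ({set J} -> R))) : weights_ok L' -> sorted <=%O (map fst L') -> (forall p, p \in L' -> r <= p.1) ->
    (\int[P]_w (\1_(avoid (at_points bI K)) w * \prod_(p <- L') Phi bJ p.2 (cells (Y p.1 w)))%:E =
     (value (kappa Lambda b) (M1 ++ lift_weights inr L') 0 finset.setT)%:E)%E.
  move=> wL' sL' Lr'; rewrite -(stit_value hL hY W).
  - apply: eq_integral => w _; congr EFin; rewrite big_cat/=; congr (_ * _).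
      rewrite (prod_lift inl b); [by rewrite -prod_pair|exact: pair_weights_ok|].
      by move=> p /mapP[k /Kr/andP[k0 _] ->].
    by rewrite (prod_lift inr b)// => p /Lr'; exact: lt_le_trans.
  - move=> p; rewrite mem_cat => /orP[|] pM; first exact: (weights_ok_lift (@pair_weights_ok _ _ K)) pM.
    exact: (weights_ok_lift wL') pM.
  - rewrite map_cat !map_fst_lift map_fst_pair; move: sK sL'.
    rewrite !(sorted_pairwise le_trans) pairwise_cat => -> ->; rewrite !andbT.
    by apply/allrelP => _ _ /mapP[k /Kr/andP[_ kr] ->] /mapP[p /Lr' rp ->]; exact: le_trans kr rp.
  - move=> p; rewrite mem_cat => /orP[/M1r/andP[]//|/mapP[q /Lr' rq ->]/=].
    exact: lt_le_trans r0 rq.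
rewrite E//; transitivity (\int[P]_w (\1_(avoid (at_points bI K)) w *
    \prod_(p <- [:: (r, value kJ L r)]) Phi bJ p.2 (cells (Y p.1 w)))%:E)%E; last first.
  by apply: eq_integral => w _; rewrite big_seq1.
rewrite E//; last by move=> p; rewrite inE => /eqP ->.
congr EFin; rewrite (@value_cat _ _ _ M1 (lift_weights inr L) r)//; last first.
- by move=> p /mapP[q /Lr rq ->].
- by move=> p /M1r/andP[].
- exact: ltW.
congr (value _ (_ ++ [:: (r, _)]) _ _); apply/funext => A /=.
rewrite (value_lump (kJ := kJ))// => B A' sA.
exact: kappa_lump.
Qed.

End EventLaws.

Lemma expectation_close (R : realType) d (T : measurableType d) (P : probability T R) (X Z D : T -> R) (x z e : R) :
  measurable_fun setT X -> measurable_fun setT Z -> measurable_fun setT D ->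
  (forall w, 0 <= X w) -> (forall w, 0 <= Z w) -> (forall w, `|X w - Z w| <= D w) ->
  (\int[P]_w (X w)%:E = x%:E)%E -> (\int[P]_w (Z w)%:E = z%:E)%E -> (\int[P]_w (D w)%:E = e%:E)%E ->
  `|x - z| <= e.
Proof.
move=> mX mZ mD X0 Z0 XZ iX iZ iD.
have D0 w : 0 <= D w by exact: le_trans (normr_ge0 _) (XZ w).
have half (A B : T -> R) (u v : R) : measurable_fun setT A -> measurable_fun setT B -> (forall w, 0 <= A w) -> (forall w, 0 <= B w) ->
    (forall w, A w <= B w + D w) -> (\int[P]_w (A w)%:E = u%:E)%E -> (\int[P]_w (B w)%:E = v%:E)%E -> u <= v + e.
  move=> mA mB A0 B0 AB iA iB; rewrite -lee_fin EFinD -iA -iB -iD -ge0_integralD//.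
  - apply: ge0_le_integral => //.
    + by move=> w _; rewrite lee_fin.
    + exact/measurable_EFinP.
    + by apply: emeasurable_funD; exact/measurable_EFinP.
    + by move=> w _; rewrite -EFinD lee_fin.
  - by move=> w _; rewrite lee_fin.
  - exact/measurable_EFinP.
  - by move=> w _; rewrite lee_fin.
  - exact/measurable_EFinP.
have h1 : x <= z + e by apply: (half X Z) => // w; have := XZ w; rewrite ler_norml; lra.
have h2 : z <= x + e by apply: (half Z X) => // w; have := XZ w; rewrite ler_norml; lra.
by rewrite ler_norml; lra.
Qed.

Lemma integral_indicR (R : realType) d (T : measurableType d) (P : {measure set T -> \bar R}) (A : set T) :
  measurable A -> (\int[P]_w (\1_A w)%:E = P A)%E.
Proof. by move=> mA; rewrite integral_indic// setIT. Qed.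

(** * Asymptotic independence of distant times *)

Section FlowFacts.
Variables (R : realType) (I : finType).
Implicit Types (f : {set I} -> R).

Lemma flow_one kap f (B : {set I}) u : (forall A : {set I}, A \subset B -> f A = 1) -> 0 <= u -> flow kap f u B = 1.
Proof.
move: {2}(#|B|) (leqnn #|B|) => n; elim: n B u => [|n IH] B u Bn fB u0.
  have -> : B = finset.set0 by apply/eqP; rewrite -cards_eq0 -leqn0.
  by rewrite flow_set0// fB// finset.sub0set.
pose lam := split_rate kap B.
have D (v : R) : 0 <= v -> is_derive v 1 (fun v => expR (lam * v) * (flow kap f v B - 1)) 0.
  move=> v0; have D1 := is_derive_add (is_derive_flow kap f B v0) (is_derive_cst (-1 : R) v 1).
  have := is_derive_mul (is_derive_expRM lam v) D1.
  rewrite (_ : _ + _ = 0)// fragE (eq_bigr (fun A => kap A (B :\: A))).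
    by rewrite -/(split_rate kap B) -/lam /cst; ring.
  move=> A sA; have [c1 c2] := splits_cards sA.
  have AB : A \subset B by case/andP: sA => /proper_sub.
  rewrite !IH ?mulr1//; [exact: leq_trans c2 Bn| |exact: leq_trans c1 Bn|] => C CA; apply: fB.
    by apply: fintype.subset_trans CA _; exact: finset.subsetDl.
  exact: fintype.subset_trans CA AB.
have := derive0_cst u0 D; rewrite flow0 fB ?subrr ?mulr0// => /eqP.
by rewrite mulf_eq0 gt_eqF ?expR_gt0//= subr_eq0 => /eqP.
Qed.

(** Only the rates of proper splits matter; this is lumping along the identity. It is used with
    [kappa_scale], which speaks of nonempty sets. *)
Lemma eq_value (k k' : {set I} -> {set I} -> R) (L : seq (R * ({set I} -> R))) s B :
  weights_ok L -> (forall A C, splits C A -> k A (C :\: A) = k' A (C :\: A)) -> value k L s B = value k' L s B.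
Proof.
move=> wL kk; have pre (A : {set I}) : id @^-1: A = A by apply/setP => i; rewrite inE.
have := @value_lump R I I id k k' _ L s B wL; rewrite pre.
rewrite (_ : [seq _ | p <- L] = L).
  apply => C A'; rewrite pre => sA; rewrite (big_pred1 A') ?kk// => A /=.
  rewrite pre; apply/andP/eqP => [[_ /eqP//]|->]; split => //.
  by case/andP: sA => /proper_sub.
rewrite -[RHS]map_id; apply: eq_map => -[t f] /=; congr (_, _); apply/funext => A; by rewrite pre.
Qed.

End FlowFacts.

Section EventLaws.
Context (R : realType) (l : nat) (Lambda : {measure set (borel (hyperplane R l)) -> \bar R})
  (hL : driving_measure Lambda) d (Omega : measurableType d) (P : probability Omega R)
  (Y : R -> Omega -> borel (FF [set: 'rV[R]_l.+1])) (hY : stit_process P Lambda Y) (W : window R l).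
Local Notation V := 'rV[R]_l.+1.
Local Notation avoid := (avoid Y).
Let Lfin := window_bound W hL.

(** [None] is a dummy point at the origin: it makes the index type inhabited even for empty K, as
    [future_almost_independent] needs a point. *)
Lemma indexing (K : seq (R * (V * V))) :
  exists (I : finType) (_ : I) (b : I -> V) (K' : seq (R * (I * I))), K = at_points b K'.
Proof.
pose n := size K; pose t := in_tuple K.
exists (option ('I_n * bool)), None.
exists (fun i => if i is Some (k, c) then if c then (tnth t k).2.2 else (tnth t k).2.1 else 0).
exists [seq ((tnth t k).1, (Some (k, false), Some (k, true))) | k <- enum 'I_n].
rewrite /at_points -map_comp -[LHS]/(tval t) -[in LHS](map_tnth_enum t).
by apply: eq_map => k /=; case: (tnth t k) => s [].
Qed.

Lemma avoid_sort K : exists2 K', avoid K = avoid K' & K =i K' /\ sorted <=%O (map fst K').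
Proof.
exists (sort (relpre fst <=%O) K).
  by apply/seteqP; split => w h k kK; apply: h; move: kK; rewrite mem_sort.
split; first by move=> k; rewrite mem_sort.
by rewrite sorted_map sort_sorted// => x y; exact: le_total.
Qed.

Section Indexed.
Variables (I : finType) (b : I -> V).
Local Notation kap := (kappa Lambda b).

Lemma avoid_law (K : seq (R * (I * I))) : sorted <=%O (map fst K) -> (forall k, k \in K -> 0 < k.1) ->
  (P (avoid (at_points b K)) = (value kap (pair_weights K) 0 finset.setT)%:E)%E.
Proof.
move=> sK K0; rewrite -(stit_value hL hY W).
- rewrite -integral_indicR; first by apply: eq_integral => w _; rewrite prod_pair.
  by apply: (measurable_avoid hY) => _ /mapP[k kK ->] /=; exact: K0.
- exact: pair_weights_ok.
- by rewrite map_fst_pair.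
- by move=> p /mapP[k /K0 k0 ->].
Qed.

End Indexed.

(** Contracting the points by c divides all split rates by c, and multiplying the times by c
    compensates for this. *)
Lemma avoid_scale_indexed (I : finType) (b : I -> V) (c : R) (K : seq (R * (I * I))) : 0 < c -> sorted <=%O (map fst K) -> (forall k, k \in K -> 0 < k.1) ->
  P (avoid [seq (c * k.1, (c^-1 *: k.2.1, c^-1 *: k.2.2)) | k <- at_points b K]) = P (avoid (at_points b K)).
Proof.
move=> c0 sK K0; set kap := kappa Lambda b; pose K' := [seq (c * k.1, k.2) | k <- K].
have ic0 : 0 < c^-1 by rewrite invr_gt0.
have -> : [seq (c * k.1, (c^-1 *: k.2.1, c^-1 *: k.2.2)) | k <- at_points b K] = at_points (fun i => c^-1 *: b i) K'.
  by rewrite /at_points -!map_comp; apply: eq_map.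
have K'0 k : k \in K' -> 0 < k.1 by move=> /mapP[q /K0 q0 ->] /=; rewrite mulr_gt0.
have sK' : sorted <=%O (map fst K').
  move: sK; rewrite -map_comp !sorted_map; apply: sub_sorted => x y /=.
  by rewrite ler_pM2l.
rewrite avoid_law// avoid_law//; congr EFin; rewrite (@eq_value _ _ _ (fun A B => c^-1 * kap A B)).
- rewrite (_ : pair_weights K' = [seq (p.1 / c^-1, p.2) | p <- pair_weights K]).
    by rewrite value_scale// mulr0.
  rewrite /pair_weights /K' -!map_comp; apply: eq_map => k /=.
  by rewrite invrK mulrC.
- exact: pair_weights_ok.
- move=> A C sA; rewrite (kappa_scale hL Lfin)//; first by case/andP: sA.
  by case/andP: (splits_setD sA).
Qed.

Definition rescale (c : R) (K : seq (R * (V * V))) : seq (R * (V * V)) :=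
  [seq (c * k.1, (c^-1 *: k.2.1, c^-1 *: k.2.2)) | k <- K].

Lemma avoid_scale (c : R) K : 0 < c -> (forall k, k \in K -> 0 < k.1) ->
  P (avoid (rescale c K)) = P (avoid K).
Proof.
move=> c0 K0; have [K' -> [KK' sK']] := avoid_sort K.
have -> : avoid (rescale c K) = avoid (rescale c K').
  by apply/seteqP; split => w h _ /mapP[k kK ->]; apply: h; apply/mapP; exists k => //; move: kK; rewrite KK'.
have [I [_ [b [M KM]]]] := indexing K'; rewrite KM; apply: avoid_scale_indexed => //.
  by move: sK'; rewrite KM -map_comp.
move=> k kM; apply: (K0 (k.1, (b k.2.1, b k.2.2))); rewrite KK' KM; exact: (map_f (fun k => (k.1, (b k.2.1, b k.2.2)))).
Qed.

Lemma point_in_cell t p : 0 < t -> P [set w | ~ together (cells (Y t w)) p p] = 0%E.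
Proof.
move=> t0; have -> : [set w | ~ together (cells (Y t w)) p p] = avoid (at_points (fun _ : unit => p) [:: (t, (tt, tt))]).
  by apply/seteqP; split => w h; [move=> k; rewrite inE => /eqP ->|apply: (h (t, (p, p))); rewrite mem_head].
rewrite avoid_law//; last by move=> k; rewrite inE => /eqP ->.
congr EFin; rewrite /= ltW// (_ : (fun A => _) = (fun A : {set unit} => (tt \notin A)%:R)).
  by rewrite flow_avoid ?subr0 ?(ltW t0)// finset.in_setT.
by apply/funext => A; rewrite mulr1 /pair_weight/= andbb.
Qed.

(** If p and q are apart at time t, no block of that time contains both, and by [flow_one] the
    expected weight of being apart at u is 1. So the probability of being apart at t equals that of
    being apart at t and at u. *)
Lemma together_decreasing t u p q : 0 < t -> t <= u ->
  P [set w | ~ together (cells (Y t w)) p q /\ together (cells (Y u w)) p q] = 0%E.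
Proof.
move=> t0 tu; pose b (c : bool) := if c then q else p; pose K : seq (R * (bool * bool)) := [:: (t, (false, true))].
have u0 : 0 < u by exact: lt_le_trans tu.
have AE : avoid (at_points b K) = [set w | ~ together (cells (Y t w)) p q].
  by apply/seteqP; split => w h; [apply: (h (t, (p, q))); rewrite mem_head|move=> k; rewrite inE => /eqP ->].
have mA : measurable (avoid (at_points b K)).
  by apply: (measurable_avoid hY) => k; rewrite inE => /eqP ->.
pose U := [set w | together (cells (Y u w)) p q]; have mU : measurable U by exact: (stit_together hY).
have Kt k : k \in K -> 0 < k.1 <= t by rewrite inE => /eqP -> /=; rewrite t0 lexx.
have tL x : x \in pair_weights [:: (u, (false, true))] -> t <= x.1 by rewrite inE => /eqP ->.
have := @expectation_future _ _ _ hL _ _ _ _ hY W _ _ b b K (pair_weights [:: (u, (false, true))]) t t0 isT Kt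
  (@pair_weights_ok _ _ _) isT tL.
have -> : (\int[P]_w (\1_(avoid (at_points b K)) w * Phi b (value (kappa Lambda b) (pair_weights [:: (u, (false, true))]) t) (cells (Y t w)))%:E =
           P (avoid (at_points b K)))%E.
  rewrite -integral_indicR//; apply: eq_integral => w _; congr EFin; rewrite indicE.
  case: (boolP (w \in avoid (at_points b K))) => [/set_mem wA|]; last by rewrite mul0r.
  rewrite mul1r /Phi big1// => B /andP[_ /asboolP[C SC CB]].
  rewrite /= tu flow_one ?subr_ge0// => D DB; rewrite mulr1 /pair_weight/=.
  case: andP => // -[/(fintype.subsetP DB) fB /(fintype.subsetP DB) tB].
  move: wA; rewrite AE => -[]; exists C => //.
  by move: fB tB; rewrite -CB => /in_blk ? /in_blk ?.
have -> : (\int[P]_w (\1_(avoid (at_points b K)) w * \prod_(p <- pair_weights [:: (u, (false, true))]) Phi b p.2 (cells (Y p.1 w)))%:E =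
           P (avoid (at_points b K) `&` ~` U))%E.
  rewrite -integral_indicR; last by apply: measurableI => //; exact: measurableC.
  apply: eq_integral => w _; congr EFin; rewrite big_seq1/= Phi_pair indicI/=; congr (_ * _).
  by rewrite indicE in_setC.
move=> e; rewrite (_ : [set w | _] = avoid (at_points b K) `&` U); last by rewrite AE.
have : P (avoid (at_points b K)) = (P (avoid (at_points b K) `&` ~` U) + P (avoid (at_points b K) `&` U))%E.
  by rewrite -setDE; exact: measureDI.
rewrite e => h.
have Afin : P (avoid (at_points b K)) \is a fin_num by exact: fin_num_measure.
have IU : P (avoid (at_points b K) `&` U) \is a fin_num by apply: fin_num_measure; exact: measurableI.
have hR : fine (P (avoid (at_points b K))) = fine (P (avoid (at_points b K))) + fine (P (avoid (at_points b K) `&` U)).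
  by apply: EFin_inj; rewrite EFinD !fineK.
rewrite -(fineK IU); congr EFin; lra.
Qed.

(** If all points of [bJ] share a cell at time r, the conditional expectation of the future is the
    constant [value] at the full set, whatever the past. The bound is the probability that they do
    not share a cell at time r. *)
Lemma future_almost_independent (I J : finType) (bI : I -> V) (bJ : J -> V) (j0 : J) (K : seq (R * (I * I)))
    (L : seq (R * (J * J))) r : 0 < r ->
  sorted <=%O (map fst K) -> (forall k, k \in K -> 0 < k.1 <= r) ->
  sorted <=%O (map fst L) -> (forall p, p \in L -> r <= p.1) ->
  `|fine (P (avoid (at_points bI K) `&` avoid (at_points bJ L))) -
    fine (P (avoid (at_points bI K))) * value (kappa Lambda bJ) (pair_weights L) r finset.setT| <=
  1 - expR (- split_rate (kappa Lambda bJ) finset.setT * r).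
Proof.
move=> r0 sK Kr sL Lr; set kJ := kappa Lambda bJ; set G := value kJ _ r; set g := G _.
have kJ0 A B : 0 <= kJ A B by exact: kappa_ge0.
have G01 B : 0 <= G B <= 1 by apply: value_bounds => //; exact: pair_weights_ok.
have g01 := G01 finset.setT; rewrite -/g in g01.
set A := avoid (at_points bI K); set B := avoid (at_points bJ L).
have mA : measurable A by apply: (measurable_avoid hY) => _ /mapP[k kK ->]; case/andP: (Kr k kK).
have mB : measurable B by apply: (measurable_avoid hY) => _ /mapP[k kL ->]; exact: lt_le_trans r0 (Lr k kL).
(* The product of these weights over the occurring blocks vanishes as soon as some nonempty block is
   not the full set. *)
pose fE (B : {set J}) : R := ((B == finset.set0) || (B == finset.setT))%:R.
have fE01 B' : 0 <= fE B' <= 1 by rewrite /fE ler0n lern1 leq_b1.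
(* Points in no cell interior would give an empty product, equal to 1 as well. The null event N that
   [j0] is such a point excludes this. *)
pose N := [set w | ~ together (cells (Y r w)) (bJ j0) (bJ j0)].
have mN : measurable N by apply: measurableC; exact: (stit_together hY).
pose X w : R := \1_A w * Phi bJ G (cells (Y r w)); pose Z w := \1_A w * g.
pose D w : R := (1 - Phi bJ fE (cells (Y r w))) + \1_N w.
have mPhi f : measurable_fun setT (fun w => Phi bJ f (cells (Y r w))) by exact: (measurable_stit_Phi hY).
have mIA : measurable_fun setT (\1_A : Omega -> R) by exact: measurable_indic.
apply: (@expectation_close _ _ _ P X Z D).
- exact: measurable_funM.
- exact: measurable_funM.
- apply: measurable_funD; last exact: measurable_indic.
  by apply: measurable_funB.
- by move=> w; rewrite mulr_ge0 ?indicE//; case/andP: (Phi_bounds bJ (cells (Y r w)) G01).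
- by move=> w; rewrite mulr_ge0 ?indicE//; case/andP: g01.
- move=> w; rewrite -mulrBr normrM; apply: le_trans (_ : `|Phi bJ G (cells (Y r w)) - g| <= _).
    by rewrite ler_piMl// indicE ger0_norm// lern1 leq_b1.
  have /andP[p0 p1] := Phi_bounds bJ (cells (Y r w)) G01; have /andP[q0 q1] := g01.
  have /andP[e0 e1] := Phi_bounds bJ (cells (Y r w)) fE01; rewrite /D indicE.
  have [wN|/negP wN] := boolP (w \in N).
    by rewrite ler_norml /=; lra.
  have [C SC [Cj _]] : together (cells (Y r w)) (bJ j0) (bJ j0).
    by apply: contrapT => h; apply: wN; exact/mem_set.
  rewrite mulr0n addr0.
  have [all_T|] := pselect (forall B', B' != finset.set0 -> occurs bJ (cells (Y r w)) B' -> B' = finset.setT).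
    have CT : blk bJ C = finset.setT.
      by apply: all_T; [apply/finset.set0Pn; exists j0; exact/in_blk|exists C].
    rewrite (_ : Phi bJ G _ = g) ?subrr ?normr0 ?subr_ge0//.
    rewrite /Phi (big_pred1 finset.setT)// => B' /=; apply/andP/eqP => [[b0 /asboolP /all_T]|->]; first exact.
    by rewrite -CT; split; [apply/finset.set0Pn; exists j0; exact/in_blk|apply/asboolP; exists C].
  move=> /existsNP[B' /not_implyP[B'0 /not_implyP[oB' /eqP B'T]]].
  rewrite [Phi bJ fE _](_ : _ = 0); first by rewrite ler_norml; lra.
  rewrite /Phi (bigD1 B')/=; last by rewrite B'0; exact/asboolP.
  by rewrite /fE (negbTE B'0) (negbTE B'T) mul0r.
- rewrite -[LHS](@expectation_future _ _ _ hL _ _ _ _ hY W _ _ bI bJ K (pair_weights L) r r0 sK Kr).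
  + rewrite fineK ?fin_num_measure//; last exact: measurableI.
    rewrite -integral_indicR; last exact: measurableI.
    by apply: eq_integral => w _; rewrite indicI/= prod_pair.
  + exact: pair_weights_ok.
  + by rewrite map_fst_pair.
  + by move=> p /mapP[q qL ->]; exact: Lr.
- rewrite /Z; under eq_integral do rewrite EFinM muleC.
  rewrite ge0_integralZl_EFin//; first by rewrite integral_indicR// EFinM fineK ?fin_num_measure// muleC.
  + exact/measurable_EFinP.
  + by case/andP: g01.
rewrite /D; under eq_integral do rewrite EFinD.
have mfE : measurable_fun setT (fun w => (1 - Phi bJ fE (cells (Y r w)))%:E).
  by apply/measurable_EFinP; exact: measurable_funB.
have b1 w : 0 <= Phi bJ fE (cells (Y r w)) <= 1 by exact: Phi_bounds.
rewrite ge0_integralD//; first last.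
- by apply/measurable_EFinP; exact: measurable_indic.
- by move=> w _; rewrite lee_fin subr_ge0; case/andP: (b1 w).
have -> : (\int[P]_w (\1_N w)%:E = 0)%E by rewrite integral_indicR//; exact: point_in_cell.
rewrite adde0.
have iE : (\int[P]_w (Phi bJ fE (cells (Y r w)))%:E = (expR (- split_rate kJ finset.setT * r))%:E)%E.
  transitivity (\int[P]_w (\prod_(p <- [:: (r, fE)]) Phi bJ p.2 (cells (Y p.1 w)))%:E)%E.
    by apply: eq_integral => w _; rewrite big_seq1.
  rewrite (stit_value hL hY W).
  - congr EFin; rewrite /= ltW// subr0 -flow_together ?(ltW r0)//.
      by congr (flow _ _ _ _); apply/funext => B'; rewrite mulr1.
    by apply/eqP => /setP/(_ j0); rewrite !inE.
  - by move=> p; rewrite inE => /eqP -> /=; split => //; rewrite /fE eqxx.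
  - by [].
  - by move=> p; rewrite inE => /eqP ->.
have : (\int[P]_w (1 - Phi bJ fE (cells (Y r w)))%:E + \int[P]_w (Phi bJ fE (cells (Y r w)))%:E = 1)%E.
  rewrite -ge0_integralD//; first last.
  - exact/measurable_EFinP.
  - by move=> w _; rewrite lee_fin; case/andP: (b1 w).
  - by move=> w _; rewrite lee_fin subr_ge0; case/andP: (b1 w).
  rewrite -[RHS](integral_one P); apply: eq_integral => w _; rewrite -EFinD; congr EFin; ring.
have fD : (\int[P]_w (1 - Phi bJ fE (cells (Y r w)))%:E)%E \is a fin_num.
  by apply: integral01_fin => [|w]; [exact: measurable_funB|have := b1 w; lra].
rewrite iE -(fineK fD) -EFinD => -[e]; congr EFin; lra.
Qed.

End EventLaws.

(** * The origin belongs to the window *)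

Section Entry.
Variables (R : realType) (l : nat).
Local Notation V := 'rV[R]_l.+1.
Variables (W W' : window R l) (c : R -> R) (y : R -> FF [set: V]) (s1 s2 : R).
Hypotheses (c0 : forall s, 0 < c s) (cc : continuous c) (ty : forall s, tessellation (y s)) (s12 : s1 <= s2).
Hypothesis hcad : cadlag (fun s => restrict_tess W (scale_tess (c s) (y s))).
Hypothesis W'0 : (W' : set V)° 0.
Hypothesis WW' : forall s x, s1 <= s <= s2 -> (W : set V) x -> (W' : set V)° ((c s)^-1 *: x).
Hypothesis rc : forall s, exists2 e : R, 0 < e & forall s', s <= s' < s + e -> restrict_tess W' (y s') = restrict_tess W' (y s).
Hypothesis mono : forall s s' n, s <= s' -> (W' : set V)° (dseq R l n) ->
  together (cells (y s')) 0 (dseq R l n) -> together (cells (y s)) 0 (dseq R l n).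
Hypothesis start : forall q, together (cells (y s1)) 0 q -> ~ (W : set V)° (c s1 *: q).
Hypothesis finish : exists2 q, together (cells (y s2)) 0 q & (W : set V)° (c s2 *: q).

Let S : set R := [set s | s1 <= s <= s2 /\ exists n, together (cells (y s)) 0 (dseq R l n) /\ (W : set V)° (c s *: dseq R l n)].

Let cn0 s : c s != 0. Proof. exact: lt0r_neq0. Qed.

Let oWc s : open [set q : V | (W : set V)° (c s *: q)].
Proof. by apply: open_comp; [move=> q _; exact: scale_continuous|exact: open_interior]. Qed.

Let WW'q s q : s1 <= s <= s2 -> (W : set V)° (c s *: q) -> (W' : set V)° q.
Proof.
move=> ss /interior_subset Wq; have := WW' ss Wq.
by rewrite scalerA mulVf// scale1r.
Qed.

Let dense_together s q : together (cells (y s)) 0 q -> (W : set V)° (c s *: q) ->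
  exists n, together (cells (y s)) 0 (dseq R l n) /\ (W : set V)° (c s *: dseq R l n).
Proof.
move=> [C yC [C0 Cq]] Wq; have oU : open (C° `&` [set q : V | (W : set V)° (c s *: q)]).
  by apply: openI; [exact: open_interior|exact: oWc].
have [n [Cn Wn]] := dseq_dense oU (ex_intro _ q (conj Cq Wq)).
exists n; split => //; exact: (ex_intro2 _ _ C yC (conj C0 Cn)).
Qed.

Let S2 : S s2.
Proof. by have [q tq Wq] := finish; split; [rewrite s12 lexx|exact: dense_together tq Wq]. Qed.

Let hi : has_inf S.
Proof. by split; [exists s2; exact: S2|exists s1 => s [/andP[]]]. Qed.

Let ss := inf S.

Let ss12 : s1 <= ss <= s2.
Proof.
apply/andP; split; last by apply: ge_inf; [exact: hi.2|exact: S2].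
by apply: lb_le_inf; [exact: hi.1|move=> s [/andP[]]].
Qed.

(** Meeting the interior of W persists for slightly earlier times: the dilation is continuous and,
    by [mono], the undilated cell was not smaller before. So the infimum of S is not attained. *)
Let notS : ~ S ss.
Proof.
move=> [_ [n [tn Wn]]]; have W'n := WW'q ss12 Wn.
have s1s : s1 < ss.
  rewrite lt_neqAle andbC; have /andP[-> _] := ss12; apply/eqP => e.
  by apply: (start (q := dseq R l n)); rewrite e.
have : \forall s \near ss, (W : set V)° (c s *: dseq R l n).
  have ct : (fun s => c s *: dseq R l n) @ ss --> c ss *: dseq R l n.
    by apply: cvgZr_tmp; exact: cc.
  by apply: ct; apply: open_nbhs_nbhs; split => //; exact: open_interior.
move=> /nbhs_ballP[e /= e0 We]; pose d := Num.min e (ss - s1); have d0 : 0 < d by rewrite lt_min e0 subr_gt0.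
have h : S (ss - d / 2).
  have d2 : d / 2 <= ss - s1.
    by apply: le_trans (_ : d <= _); [rewrite ler_pdivrMr// ler_peMr ?(ltW d0)// ler1n|rewrite ge_min lexx orbT].
  split; first by have /andP[? ?] := ss12; apply/andP; split; [lra|have : 0 <= d / 2 by [rewrite divr_ge0// ltW]; lra].
  exists n; split; last first.
    apply: We; rewrite -ball_normE/= opprB addrCA subrr addr0 gtr0_norm ?divr_gt0//.
    have de : d <= e by rewrite ge_min lexx.
    by apply: lt_le_trans de; rewrite ltr_pdivrMr// ltr_pMr// ltr1n.
  by apply: mono tn => //; rewrite gerBl divr_ge0// ltW.
have := ge_inf hi.2 h; rewrite -/ss lerBrDr gerDl leNgt divr_gt0//.
Qed.

(** At the infimum ss of the times at which the dilated cell of the origin meets the interior of W,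
    it does not yet meet it, while at times arbitrarily close after ss its trace is a cell of the
    restricted tessellation. These thin traces stay away from every cell present at ss, against
    right continuity. *)
Lemma no_entry : False.
Proof.
have [e e0 re] := rc ss; set T := restrict_tess W' (y ss) in re.
have near_S d : 0 < d -> exists2 s, ss < s < ss + d & S s.
  move=> d0; have [s Ss sd] := inf_adherent d0 hi; apply: (ex_intro2 _ _ s _ Ss); rewrite sd andbT lt_neqAle.
  apply/andP; split; last exact: (ge_inf hi.2 Ss).
  by apply/eqP => es; apply: notS; rewrite es.
have tgT s q : ss <= s < ss + e -> (W' : set V)° q -> together (cells (y s)) 0 q <-> together (cells (val T)) 0 q.
  by move=> se qW; rewrite -(re _ se); apply: iff_sym; exact: together_restrict.
have [C TC C0] : exists2 C, cells (val T) C & C° 0.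
  have [s /andP[s_gt s_lt] [s_in [n [tn Wn]]]] := near_S _ e0.
  have se : ss <= s < ss + e by rewrite (ltW s_gt).
  have [C TC [C0 _]] := (tgT _ _ se (WW'q s_in Wn)).1 tn; exact: (ex_intro2 _ _ C TC C0).
have [finT divT] := TW_divides T; have [polT disT covT] := divT.
have cC : closed C by apply: polytope_closed; exact: polT.
have miss q : C° q -> ~ (W : set V)° (c ss *: q).
  move=> Cq Wq; apply: notS; split; first exact: ss12.
  apply: (dense_together _ Wq); apply/tgT; [by rewrite lexx ltrDl|exact: WW'q ss12 Wq|].
  exact: (ex_intro2 _ _ C TC (conj C0 Cq)).
pose Z s := restrict_tess W (scale_tess (c s) (y s)).
have [finZ [polZ disZ covZ]] := TW_divides (Z ss).
(* Each cell G at time ss has an interior point g outside the dilated C, for otherwise C would have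
   interior points that are carried into the interior of W. A rational ball around g stays disjoint
   from the dilated C for times near ss. The index (0, 0) is a default for sets that are no
   cells. *)
have avoidG (G : set V) : exists i : nat * nat, cells (val (Z ss)) G -> (@rball R l i `&` G !=set0) /\
   \forall s \near ss, dil (c s) C `&` (@rball R l i) = set0.
  have [ZG|nG] := pselect (cells (val (Z ss)) G); last by exists (0, 0)%N.
  have [_ [g Gg]] := polZ _ ZG; have GW : G `<=` W by rewrite -covZ => x Gx; exists G.
  have gC : ~ C ((c ss)^-1 *: g).
    move=> /(convex_regular (polytope_convex (polT _ TC)) (ex_intro _ 0 C0)) clC.
    have oG : open [set q : V | G° (c ss *: q)].
      by apply: open_comp; [move=> q _; exact: scale_continuous|exact: open_interior].
    have nG : nbhs ((c ss)^-1 *: g) [set q : V | G° (c ss *: q)].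
      by apply: open_nbhs_nbhs; split; [exact: oG|rewrite /= scalerA (divff (cn0 ss)) scale1r; exact: Gg].
    have [q [Cq Gq]] := clC _ nG; apply: (miss q Cq); move: Gq; exact: interiorS.
  have ct : (fun z : R * V => (c z.1)^-1 *: z.2) @ (ss, g) --> (c ss)^-1 *: g.
    apply: cvgZ; last exact: cvg_snd.
    by apply: cvgV; [exact: cn0|apply: (@cvg_comp _ _ _ fst c); [exact: cvg_fst|exact: cc]].
  have nC : nbhs ((c ss)^-1 *: g) (~` C) by apply: open_nbhs_nbhs; split; [exact: closed_openC|exact: gC].
  have [[A B] /= [nA nB] AB] := ct _ nC.
  have [i [gi iB]] := rball_base (@open_interior _ B) nB.
  exists i => _; split; first by exists g; split; [exact: gi|exact: interior_subset].
  apply: filterS nA => s As; rewrite -subset0 => x [/(dilE _ _ (cn0 s)) Cx xi].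
  refine (AB (s, x) (conj As _) Cx); apply: interior_subset; apply: iB.
  by move: xi; rewrite /rball/rcball/= -ball_normE/= => /ltW.
have {avoidG} [b hb] := choice avoidG.
(* The sets missing all these balls form a compact set that contains no cell of time ss. Right
   continuity keeps it free of cells shortly after ss, yet it contains the trace of the cell of the
   origin at the times of S near ss. *)
pose K : set (Fne W) := [set F | forall G, cells (val (Z ss)) G -> val F `&` (@rball R l (b G)) = set0].
have cK : compact K.
  refine (@subclosed_compact (Fne W) K setT _ (@Fne_compact R l W) (fun x _ => Logic.I)).
  rewrite (_ : K = \bigcap_(G in cells (val (Z ss))) ~` [set F : Fne W | val F `&` (@rball R l (b G)) !=set0]).
    by apply: closed_bigI => G _; apply: open_closedC; exact: (@Fne_base_open R l W (true, b G)).
  apply/seteqP; split => F h G ZG; first by move=> [x]; rewrite (h G ZG).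
  by rewrite -subset0 => x Fx; apply: (h G ZG); exists x.
pose M := [set T : FF W | val T `&` K = set0].
have oK : open M.
  exists [set M]; last by rewrite bigcup_set1.
  move=> _ ->; exists [fset M]%fset.
    by move=> A /fset1P ->; rewrite inE; left; exists K.
  apply/seteqP; split => [T0|T0 MT0 A]; last by move=> /fset1P ->.
  by move=> /(_ M); apply; exact/fset1P.
have ZK : M (val (Z ss)).
  rewrite /M/= -subset0 => F [ZF KF]; have cF : cells (val (Z ss)) (val F) by exists F.
  have [[x [xb Fx]] _] := hb _ cF; have e0' := KF _ cF.
  by have : (set0 : set V) x by rewrite -e0'; split.
have [zr _] := hcad ss.
have nK : \forall s \near ss^'+, val (val (Z s)) `&` K = set0.
  have : nbhs (val (Z ss) : FF W) M by exact: (open_nbhs_nbhs (conj oK ZK)).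
  by move=> /(@TW_val_continuous R l W (Z ss)) => h; exact: (zr _ h).
have nb : \forall s \near ss, forall G, cells (val (Z ss)) G -> dil (c s) C `&` (@rball R l (b G)) = set0.
  have /finite_fsetP[D DE] := finZ.
  have := @filter_bigI _ _ D (fun G => [set s | cells (val (Z ss)) G -> dil (c s) C `&` (@rball R l (b G)) = set0]) (nbhs ss) _.
  move=> /(_ _)-h; apply: filterS (h _) => [s hs G ZG|G _].
    by have GD : [set` D] G by [rewrite -DE]; exact: hs GD ZG.
  have [ZG|nG] := pselect (cells (val (Z ss)) G); last by apply: filterS filterT => s _ /nG.
  by apply: filterS ((hb _ ZG).2) => s cb _.
have : \forall s \near ss^'+, (forall G, cells (val (Z ss)) G -> dil (c s) C `&` (@rball R l (b G)) = set0)
    /\ val (val (Z s)) `&` K = set0.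
  apply: filterI; last exact: nK.
  by apply: filterS nb => s cb _; exact: cb.
move=> /nbhs_ballP[d /= d0 hd].
have de0 : 0 < Num.min d e by rewrite lt_min d0.
have [s /andP[s_gt s_lt] [s_in [n [tn Wn]]]] := near_S _ de0.
have [] := hd s _ s_gt; first last.
- move=> sb sK.
  have se : ss <= s < ss + e.
    by apply/andP; split; [exact: ltW|apply: (lt_le_trans s_lt); rewrite lerD2l ge_min lexx orbT].
  have W'n := WW'q s_in Wn.
  have [D yD [D0 Dn]] := tn.
  have DC : D `&` W' = C.
    have TD : cells (val T) (D `&` W').
      rewrite -(re _ se) (restrict_cells _ (ty s)); refine (ex_intro2 _ _ D (conj yD _) erefl).
      by exists 0; rewrite interiorI; split; [exact: D0|exact: W'0].
    apply: (disjoint_cells_eq disT TD TC _ C0); by rewrite interiorI; split.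
  have ZD : cells (val (Z s)) (dil (c s) D `&` W).
    rewrite /Z restrict_cells; last exact: scale_tessellation.
    refine (ex_intro2 _ _ (dil (c s) D) (conj _ _) erefl); first by rewrite (scale_tess_cells _ (cn0 s)); refine (ex_intro2 _ _ D yD erefl).
    exists (c s *: dseq R l n); rewrite interiorI; split; last exact: Wn.
    rewrite (dil_interior _ (cn0 s)); apply/(dilE _ _ (cn0 s)); rewrite scalerA (mulVf (cn0 s)) scale1r; exact: Dn.
  have [F ZF FE] := ZD; have /seteqP[h _] := sK; apply: (h F); split; [exact: ZF|move=> G ZG].
  rewrite -subset0 => x; rewrite FE => -[[Dx Wx] xb].
  have /seteqP[h2 _] := sb G ZG; apply: (h2 x); split; [|exact: xb]; apply/dilE; [exact: cn0|rewrite -DC; split].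
    by apply/dilE; first exact: cn0.
  by apply: interior_subset; exact: WW' s_in Wx.
- rewrite -ball_normE/= distrC gtr0_norm; last by rewrite subr_gt0; exact: s_gt.
  by rewrite ltrBlDl; apply: (lt_le_trans s_lt); rewrite lerD2l ge_min lexx.
Qed.

End Entry.

Section FlowPositive.
Variables (R : realType) (I : finType) (kap : {set I} -> {set I} -> R).
Hypothesis k0 : forall A B, 0 <= kap A B.
Variables (f f' : {set I} -> R).
Hypotheses (f01 : forall B, 0 <= f B <= 1) (f'01 : forall B, 0 <= f' B <= 1) (ff' : forall B, 0 < f B -> 0 < f' B).

(* A state reachable at some time is reachable at all positive times. *)
Lemma flow_gt0 (B : {set I}) t t' : 0 <= t -> 0 < flow kap f t B -> 0 < t' -> 0 < flow kap f' t' B.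
Proof.
move: {2}(#|B|) (leqnn #|B|) => n; elim: n B t t' => [|n IH] B t t' Bn t0 ft t'0.
  have B0 : B = finset.set0 by apply/eqP; rewrite -cards_eq0 -leqn0.
  by move: ft; rewrite B0 !flow_set0 ?(ltW t'0)//; exact: ff'.
pose lam := split_rate kap B.
pose Q (g : {set I} -> R) v := \sum_(A | splits B A) kap A (B :\: A) * (flow kap g v A * flow kap g v (B :\: A)).
have Dg (g : {set I} -> R) (v : R) : 0 <= v -> is_derive v 1 (fun v => expR (lam * v) * flow kap g v B) (expR (lam * v) * Q g v).
  move=> v0; have := is_derive_mul (is_derive_expRM lam v) (is_derive_flow kap g B v0).
  rewrite fragE -/(Q g v) -/lam [X in is_derive _ _ _ X -> _](_ : _ = expR (lam * v) * Q g v)//.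
  by ring.
have Q0 (v : R) : 0 <= v -> 0 <= Q f' v.
  move=> v0; apply: sumr_ge0 => A _; rewrite mulr_ge0//.
  have /andP[? _] := flow_bounds A k0 f'01 v0; have /andP[? _] := flow_bounds (B :\: A) k0 f'01 v0.
  exact: mulr_ge0.
have pos (v x : R) : 0 < expR (lam * v) * x -> 0 < x by rewrite pmulr_rgt0// expR_gt0.
have [fB|fB] := ltP 0 (f' B).
  apply: (pos t'); apply: lt_le_trans (_ : expR (lam * 0) * flow kap f' 0 B <= _); first by rewrite mulr0 expR0 mul1r flow0.
  apply: (ge0_derive_le (f := fun v => expR (lam * v) * flow kap f' v B) (ltW t'0) (Dg f')) => v v0.
  by rewrite mulr_ge0 ?expR_ge0 ?Q0.
have f'B0 : f' B = 0 by apply/eqP; rewrite eq_le fB; case/andP: (f'01 B).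
have fB0 : f B = 0.
  by apply/eqP; rewrite eq_le; have /andP[-> _] := f01 B; rewrite andbT leNgt; apply/negP => /ff'; rewrite f'B0 ltxx.
(* Either some proper split of B has a positive rate and two parts that are positive at a common
   time, or the gain term is 0 at all times and the flow at B remains 0, against the hypothesis. *)
have [[A [s [sA s0 kA [fA fB']]]]|none] := pselect (exists A s, [/\ splits B A, 0 <= s, 0 < kap A (B :\: A) &
    0 < flow kap f s A /\ 0 < flow kap f s (B :\: A)]); last first.
  have D0 (v : R) : 0 <= v -> is_derive v 1 (fun v => expR (lam * v) * flow kap f v B) 0.
    move=> v0; have := Dg f v v0; rewrite (_ : Q f v = 0) ?mulr0//.
    apply: big1 => A sA; apply: contrapT => /eqP ne; apply: none; exists A, v.
    have /andP[a0 _] := flow_bounds A k0 f01 v0; have /andP[b0 _] := flow_bounds (B :\: A) k0 f01 v0.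
    move: ne; rewrite !mulf_eq0 !negb_or => /andP[kn /andP[an bn]].
    by split=> //; [|split]; rewrite lt_neqAle eq_sym ?kn ?an ?bn /=.
  have := derive0_cst t0 D0; rewrite /= flow0 fB0 mulr0 => /eqP.
  by rewrite gt_eqF// mulr_gt0 ?expR_gt0.
have [c1 c2] := splits_cards sA.
have Qp (v : R) : 0 < v -> 0 < Q f' v.
  move=> v0; rewrite /Q (bigD1 A)//= ltr_pwDl//.
    by rewrite !mulr_gt0//; [apply: IH fA v0 => //; exact: leq_trans c1 Bn|apply: IH fB' v0 => //; exact: leq_trans c2 Bn].
  apply: sumr_ge0 => C _; rewrite mulr_ge0//.
  have /andP[? _] := flow_bounds C k0 f'01 (ltW v0); have /andP[? _] := flow_bounds (B :\: C) k0 f'01 (ltW v0).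
  exact: mulr_ge0.
have cont : {within `[0, t'], continuous (fun v => expR (lam * v) * flow kap f' v B)}.
  apply: continuous_in_subspaceT => u; rewrite inE/= in_itv/= => /andP[u0 _].
  exact: is_derive_continuous (Dg f' u u0).
have Dc (x : R) : x \in `]0, t'[ -> is_derive x 1 (fun v => expR (lam * v) * flow kap f' v B) (expR (lam * x) * Q f' x).
  by rewrite in_itv/= => /andP[x0 _]; apply: Dg; exact: ltW.
have [c] := MVT t'0 Dc cont.
rewrite in_itv/= flow0 f'B0 !subr0 mulr0 subr0 => /andP[c0 _] e.
by apply: (pos t'); rewrite e !mulr_gt0 ?expR_gt0 ?Qp.
Qed.

End FlowPositive.

Lemma finite_net (R : realType) (V : normedModType R) (K : set V) (e : R) : compact K -> 0 < e ->
  exists2 X : seq V, (forall z, z \in X -> K z) & forall x, K x -> exists2 z, z \in X & `|z - x| < e.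
Proof.
move=> cK e0; have [X XK hX] : exists2 X : seq V, (forall z, z \in X -> K z) & forall x, K x -> K x -> exists2 z, z \in X & `|z - x| < e.
  apply: (compact_induction cK (Q := fun U => exists2 X : seq V, (forall z, z \in X -> K z) &
     forall x, U x -> K x -> exists2 z, z \in X & `|z - x| < e)).
  - by exists [::].
  - by move=> U U' [X XK hX] UU'; exists X => // x /UU'; exact: hX.
  - move=> U U' [X XK hX] [X' XK' hX']; exists (X ++ X'); first by move=> z; rewrite mem_cat => /orP[/XK|/XK'].
    move=> x [/hX h|/hX' h] /h[z zX zx]; exists z => //; by rewrite mem_cat zX ?orbT.
  - move=> x Kx; exists (ball x e); first exact: nbhsx_ballx.
    exists [:: x]; first by move=> z; rewrite inE => /eqP ->.
    by move=> y; rewrite -ball_normE/= => xy _; exists x; rewrite ?mem_head.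
by exists X => // x Kx; exact: hX.
Qed.

Lemma expectation_witness (R : realType) d (T : measurableType d) (P : probability T R) (X : T -> R) (v : R) (G : T -> Prop) :
  measurable_fun setT X -> (\int[P]_w (X w)%:E = v%:E)%E -> v != 0 -> {ae P, forall w, G w} ->
  exists2 w, G w & X w != 0.
Proof.
move=> mX iX v0 aG; apply: contrapT => h; move/eqP: v0; apply; apply: EFin_inj; rewrite -iX.
rewrite (@ae_integral _ _ _ P X (cst 0))//; first by rewrite integral0.
by apply: filterS aG => w Gw; apply/eqP; apply: contrapT => Xw; apply: h; exists w => //; exact/negP.
Qed.

Section Isolated.
Variables (R : realType) (l : nat) (I : finType) (b : I -> 'rV[R]_l.+1) (Ys : {set I}) (i0 : I).
Hypothesis i0Y : i0 \in Ys.
Variable S : set (set 'rV[R]_l.+1).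
Hypothesis dS : disjoint_cells S.

(** For points one of which lies in a cell interior, the product of these weights over the blocks is
    the indicator that [Ys] is exactly a block. *)
Definition isolated (B : {set I}) : R := ((B :&: Ys == finset.set0) || (B == Ys))%:R.

Lemma isolated_occurs : together S (b i0) (b i0) -> Phi b isolated S != 0 -> occurs b S Ys.
Proof.
move=> [C SC [C0 _]] P0; have i0C : i0 \in blk b C by exact/in_blk.
have oC : (blk b C != finset.set0) && `[< occurs b S (blk b C) >].
  by apply/andP; split; [apply/finset.set0Pn; exists i0|apply/asboolP; exists C].
move: P0; rewrite /Phi (bigD1 (blk b C))//= mulf_eq0 negb_or => /andP[+ _].
rewrite /isolated; have [e|_] := eqVneq (blk b C :&: Ys) finset.set0.
  by have := finset.in_set0 i0; rewrite -e inE i0C i0Y.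
by have [<- _|_ /=] := eqVneq (blk b C) Ys; [exists C|rewrite eqxx].
Qed.

Lemma occurs_isolated : occurs b S Ys -> Phi b isolated S = 1.
Proof.
move=> [C SC CY]; rewrite /Phi big1// => B /andP[_ /asboolP[D SD DB]].
rewrite /isolated; case: eqVneq => //= /finset.set0Pn[j]; rewrite inE -DB -CY => /andP[/in_blk Dj /in_blk Cj].
by rewrite (disjoint_cells_eq dS SD SC Dj Cj) eqxx.
Qed.

End Isolated.

Section Marked.
Variables (R : realType) (l : nat).

(** The origin, the points [s] whose hull surrounds it, and the net [X] that its cell has to
    avoid. *)
Definition marked_points (s X : seq 'rV[R]_l.+1) (i : option ('I_(size s) + 'I_(size X))) : 'rV[R]_l.+1 :=
  match i with None => 0 | Some (inl j) => s`_j | Some (inr j) => X`_j end.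

Definition inner_points (m n : nat) : {set option ('I_m + 'I_n)} :=
  finset (fun i => if i is Some (inr _) then false else true).

End Marked.

Section Origin.
Context (R : realType) (l : nat) (Lambda : {measure set (borel (hyperplane R l)) -> \bar R})
  (hL : driving_measure Lambda) d (Omega : measurableType d) (P : probability Omega R)
  (Y : R -> Omega -> borel (FF [set: 'rV[R]_l.+1])) (hY : stit_process P Lambda Y).
Local Notation V := 'rV[R]_l.+1.

Lemma right_constant (W : window R l) : {ae P, forall w, forall t, 0 < t -> exists2 e : R, 0 < e &
  forall u, t <= u < t + e -> restrict_tess W (Y u w) = restrict_tess W (Y t w)}.
Proof.
have [pj _] := stit_window hY W; apply: filterS pj => w pj t t0.
have [/nbhs_ballP[e /= e0 he] _] := pj t (ltW t0); exists e => // u /andP[tu ue].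
have [->//|ne] := eqVneq u t; have tu' : t < u by rewrite lt_neqAle eq_sym ne.
have := he u; rewrite t0 (lt_trans t0 tu'); apply => //.
by rewrite -ball_normE/= distrC gtr0_norm ?subr_gt0// ltrBlDl.
Qed.

Definition rational (n : nat) : R := ratr (odflt 0 (@choice.unpickle rat n)).

Lemma rational_between (x y : R) : x < y -> exists n, x < rational n < y.
Proof.
move=> /rat_in_itvoo[q]; rewrite in_itv/= => h; exists (choice.pickle q).
by rewrite /rational choice.pickleK.
Qed.

Lemma rational_decreasing (W : window R l) : {ae P, forall w i j n, 0 < rational i -> rational i <= rational j ->
  together (cells (Y (rational j) w)) 0 (dseq R l n) -> together (cells (Y (rational i) w)) 0 (dseq R l n)}.
Proof.
apply/ae_foralln => i; apply/ae_foralln => j; apply/ae_foralln => n.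
have [/andP[i0 ij]|h] := boolP ((0 < rational i) && (rational i <= rational j)); last first.
  by apply: nearW => w i0 ij; rewrite i0 ij in h.
have j0 : 0 < rational j by exact: lt_le_trans ij.
exists [set w | ~ together (cells (Y (rational i) w)) 0 (dseq R l n) /\ together (cells (Y (rational j) w)) 0 (dseq R l n)]; split.
- apply: measurableI; last exact: (stit_together hY).
  by apply: measurableC; exact: (stit_together hY).
- exact: (together_decreasing hL hY W).
- move=> w /= h; split; first by move=> t; apply: h.
  by apply: contrapT => t; apply: h => _ _ /t.
Qed.

Variables (a : R) (a1 : 1 < a) (W : window R l).
Hypothesis hcad : forall w, cadlag (fun s => restrict_tess W (renormalized a Y s w)).

Let a0 : 0 < a. Proof. exact: lt_trans a1. Qed.
Let lna : 0 < ln a. Proof. exact: ln_gt0. Qed.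

Lemma powR_log u : 0 < u -> a `^ (ln u / ln a) = u.
Proof. by move=> u0; rewrite /powR gt_eqF// divfK ?gt_eqF// lnK. Qed.

Lemma powR_continuous : continuous (fun s => a `^ s).
Proof.
move=> s; rewrite (_ : (fun s => a `^ s) = (fun s => expR (s * ln a))).
  apply: continuous_comp; last exact: continuous_expR.
  by move=> A; apply: (@mulrr_continuous R^o).
by apply/funext => x; rewrite /powR gt_eqF.
Qed.

Lemma powR_le s t : s <= t -> a `^ s <= a `^ t.
Proof. by move=> st; apply: ler_powR => //; exact: ltW. Qed.

Section Detach.
Hypothesis W0 : ~ (W : set V) 0.

(* Points in a small cell around the origin, and a net that any convex set joining this cell to W
   at time u1 must contain. *)
Let detached : exists (s X : seq V) (u1 e : R), [/\ 0 < u1, 0 < e, forall x : V, `|x| <= e -> conv_hull s x,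
   (forall C : set V, convex C -> cball e `<=` C -> (forall x, x \in X -> ~ C° x) -> forall q, C° q -> ~ (W : set V) (u1 *: q)) &
   0 < flow (kappa Lambda (@marked_points R l s X)) (isolated R (inner_points (size s) (size X))) 1 finset.setT].
Proof.
have cW := polytope_compact (windowP W).
have [dl dl0 hd] : exists2 dl : R, 0 < dl & forall x, (W : set V) x -> dl <= `|x|.
  have : nbhs (0 : V) (~` (W : set V)).
    by apply: open_nbhs_nbhs; split; [apply: closed_openC; exact: polytope_closed (windowP W)|exact: W0].
  move=> /nbhs_ballP[dl /= dl0 hd]; exists dl => // x Wx; rewrite leNgt; apply/negP => xd.
  by apply: (hd x) Wx; rewrite -ball_normE/= sub0r normrN.
have [W1 hW1] := window_cball W 1; have [[s1 Ws1] _] := windowP W1.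
(* A fixed bounded cell around the origin contains the points of [s n], which shrink like 1 / (n +
   1), and avoids the net [X n], which by [KX] lies at distance more than n + 1, once n is large.
   The constant dl in [u n] bounds the distance of W from the origin from below. *)
pose e (n : nat) : R := n.+1%:R^-1; have e0 n : 0 < e n by rewrite invr_gt0.
pose u n := dl / (2 * n.+2%:R); have u0 n : 0 < u n by rewrite divr_gt0// mulr_gt0.
pose s n := [seq e n *: x | x <- s1].
pose K n := [set (2 * u n)^-1 *: x | x in (W : set V)].
have cK n : compact (K n).
  by apply: continuous_compact => //; apply: continuous_subspaceT => x; exact: scale_continuous.
have netE n : exists X : seq V, (forall z, z \in X -> K n z) /\ forall x, K n x -> exists2 z, z \in X & `|z - x| < e n / 2.
  by have [|X XK hX] := finite_net (cK n) (_ : 0 < e n / 2); [rewrite divr_gt0|exists X].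
have {netE} [X hX] := choice netE.
have KX n z : K n z -> n.+1%:R < `|z|.
  move=> [x /hd xd <-]; rewrite normrZ gtr0_norm ?invr_gt0 ?mulr_gt0// ltr_pdivlMl ?mulr_gt0//.
  apply: lt_le_trans xd; rewrite /u (_ : 2 * _ = dl / n.+2%:R); last by rewrite invfM mulrCA mulVKf.
  by rewrite mulrAC ltr_pdivrMr// ltr_pM2l// ltr_nat.
have hull n x : `|x| <= e n -> conv_hull (s n) x.
  move=> xe; rewrite /s (conv_hull_affine (g := fun z => (e n)^-1 *: z)); last first.
  - by move=> z; rewrite scalerA divff ?scale1r// gt_eqF.
  - by move=> z z' t; rewrite scalerDr !scalerA ![_ * e n]mulrC.
  exists ((e n)^-1 *: x); last by rewrite scalerA divff ?scale1r// gt_eqF.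
  rewrite -Ws1; apply: hW1; rewrite /cball/= normrZ gtr0_norm ?invr_gt0// ler_pdivrMl// mulr1//.
pose b n := @marked_points R l (s n) (X n).
pose Ys n := inner_points (size (s n)) (size (X n)).
suff [n hn] : exists n, 0 < flow (kappa Lambda (b n)) (isolated R (Ys n)) 1 finset.setT.
  exists (s n), (X n), (u n), (e n); split => // [x|C cC eC CX q Cq Wq]; first exact: hull.
  have Kq : K n (2^-1 *: q).
    exists (u n *: q); first exact: Wq.
    by rewrite scalerA invfM -mulrA mulVf ?mulr1// gt_eqF.
  have [z zX zq] := (hX n).2 _ Kq.
  (* z is the midpoint of q, interior to C, and of 2 (z - q / 2), which lies in the ball of radius
     e; so z would be interior to C. This is the reason for the factor 2 in [K n]. *)
  apply: (CX z zX); rewrite (_ : z = 2^-1 *: q + (1 - 2^-1) *: (2 *: (z - 2^-1 *: q))).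
    apply: (convex_interior cC Cq); last by rewrite invr_gt0 ltr0n/= invf_le1// ler1n.
    by apply: eC; rewrite /cball/= normrZ gtr0_norm// -ler_pdivlMl// mulrC ltW.
  rewrite scalerA (_ : (1 - 2^-1) * 2 = 1 :> R); last by field.
  by rewrite scale1r addrC subrK.
(* If the flow vanished for every n, then almost surely no n would isolate its inner points at time
   1. But the cell of the origin is bounded and contains a ball, so some n does. *)
apply: contrapT => none.
have k0 n A B : 0 <= kappa Lambda (b n) A B by exact: kappa_ge0.
have f01 n B : 0 <= isolated R (Ys n) B <= 1 by rewrite /isolated ler0n lern1 leq_b1.
have mPhi n : measurable_fun setT (fun w => Phi (b n) (isolated R (Ys n)) (cells (Y 1 w))).
  exact: (measurable_stit_Phi hY).
have Phi0 n : {ae P, forall w, Phi (b n) (isolated R (Ys n)) (cells (Y 1 w)) = 0}.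
  have i0 : (\int[P]_w `|(Phi (b n) (isolated R (Ys n)) (cells (Y 1 w)))%:E| = 0)%E.
    transitivity (\int[P]_w (\prod_(p <- [:: (1, isolated R (Ys n))]) Phi (b n) p.2 (cells (Y p.1 w)))%:E)%E.
      apply: eq_integral => w _; rewrite big_seq1/= ger0_norm//.
      by case/andP: (Phi_bounds (b n) (cells (Y 1 w)) (f01 n)).
    rewrite (stit_value hL hY W).
    - congr EFin; rewrite /= ler01 subr0.
      rewrite (_ : (fun A => _) = isolated R (Ys n)); last by apply/funext => A; rewrite mulr1.
      have /andP[h _] := flow_bounds finset.setT (k0 n) (f01 n) ler01.
      by apply/eqP; rewrite eq_le h andbT leNgt; apply/negP => h'; apply: none; exists n.
    - by move=> p; rewrite inE => /eqP -> /=; split; rewrite // /isolated finset.set0I eqxx.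
    - by [].
    - by move=> p; rewrite inE => /eqP ->.
  have /(ae_eq_integral_abs _ measurableT) := i0; move=> /(_ _)-h.
  have : ae_eq P setT (fun w => (Phi (b n) (isolated R (Ys n)) (cells (Y 1 w)))%:E) (cst 0%E).
    by apply/ae_eq_integral_abs => //; exact/measurable_EFinP.
  by apply: filterS => w hw; apply: EFin_inj; exact: hw.
have in0 : {ae P, forall w, together (cells (Y 1 w)) 0 0}.
  exists [set w | ~ together (cells (Y 1 w)) 0 0]; split.
  - by apply: measurableC; exact: (stit_together hY).
  - exact: (point_in_cell hL hY W).
  - by move=> w.
have : {ae P, forall w, False}.
  apply: filterS2 (ae_foralln Phi0) in0 => w Pw [C yC [C0 _]].
  have [pC _ _] : divides_into_polytopes setT (cells (Y 1 w)) by have [] := stit_tessellation hY w ltr01.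
  have [r Cr] := polytope_bounded (pC _ yC).
  have /nbhs_ballP[dd /= dd0 hdd] := C0.
  have [r1 sr1] := conv_hull_bounded s1.
  pose n := Num.truncn (`|r| + (`|r1| + 1) / dd).
  have nE : `|r| + (`|r1| + 1) / dd < n.+1%:R by exact: truncnS_gt.
  have := Pw n; rewrite (@occurs_isolated _ _ _ (b n) (Ys n) (cells (Y 1 w))).
  - by move/eqP; rewrite oner_eq0.
  - exact: (stit_disjoint hY).
  exists C => //; apply/setP => i; rewrite !inE; case: i => [[j|j]|] /=.
  - apply/asboolP; have /mapP[x xs1 ->] := mem_nth 0 (ltn_ord j).
    have := interiorS hdd; rewrite (_ : (ball 0 dd)° = ball 0 dd); last by apply/interior_id; exact: ball_open.
    apply; rewrite -ball_normE/= sub0r normrN normrZ gtr0_norm// ltr_pdivrMl//.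
    have := sr1 _ (mem_conv_hull xs1); rewrite /cball/= => xr1.
    have h : (`|r1| + 1) / dd < n.+1%:R by apply: le_lt_trans nE; rewrite lerDr.
    rewrite ltr_pdivrMr// in h; apply: le_lt_trans xr1 _; apply: le_lt_trans h.
    by rewrite (le_trans (ler_norm _))// lerDl.
  - apply/negbTE/asboolPn => /interior_subset/Cr; rewrite /cball/=.
    have /KX := (hX n).1 _ (mem_nth 0 (ltn_ord j)); have : 0 <= (`|r1| + 1) / dd by rewrite divr_ge0// ltW.
    have := ler_norm r; lra.
  - by apply/asboolP.
move=> [A [mA A0 hA]]; have : P setT = 0%E by apply/eqP; rewrite eq_le measure_ge0 andbT -A0 le_measure ?inE//; move=> w _; apply: hA => -[].
move=> h; have := @probability_setT _ _ _ P; rewrite h => /eqP; by rewrite eq_sym onee_eq0.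
Qed.

Lemma entry_contradiction : False.
Proof.
have [s [X [u1 [e [u10 e0 es netX]]]]] := detached.
set b := @marked_points R l s X; set Ys := inner_points _ _ => flow1.
have i0Y : None \in Ys by rewrite inE.
(* At time u2 the cell of the origin will still contain the ball of radius e; dilated by u2 it then
   contains the interior point p of W, because |p| <= e u2. *)
have [p Wp] := (windowP W).2; pose u2 := u1 + `|p| / e.
have u12 : u1 <= u2 by rewrite lerDl divr_ge0// ltW.
have u20 : 0 < u2 by exact: lt_le_trans u12.
pose kap := kappa Lambda b.
have k0 A B : 0 <= kap A B by exact: kappa_ge0.
have f01 B : 0 <= isolated R Ys B <= 1 by rewrite /isolated ler0n lern1 leq_b1.
(* The inner points are required to be a block at u1, when the net keeps the cell away from W, and
   again at u2. Positive probability is enough: [flow_gt0] carries it from time 1 to u1 and on to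
   u2. *)
pose L := [:: (u1, isolated R Ys); (u2, isolated R Ys)].
have wL : weights_ok L.
  by move=> q; rewrite !inE => /orP[]/eqP -> /=; split => //; rewrite /isolated finset.set0I eqxx.
have v0 : value kap L 0 finset.setT != 0.
  rewrite gt_eqF//= ltW// u12 subr0.
  have F01 B : 0 <= isolated R Ys B * flow kap (fun A => isolated R Ys A * 1) (u2 - u1) B <= 1.
    by apply: mul01 => //; apply: flow_bounds; rewrite ?subr_ge0// => A; rewrite mulr1.
  apply: (flow_gt0 k0 f01 F01 _ _ flow1 u10) => // B fB; rewrite mulr_gt0//.
  have f01' A : 0 <= isolated R Ys A * 1 <= (1 : R) by rewrite mulr1.
  have [->|ne] := eqVneq u2 u1; first by rewrite subrr flow0 mulr1.
  have ff A : 0 < isolated R Ys A -> 0 < isolated R Ys A * 1 by rewrite mulr1.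
  have fB0 : 0 < flow kap (isolated R Ys) 0 B by rewrite flow0.
  apply: (flow_gt0 k0 f01 f01' ff (lexx 0) fB0).
  by rewrite subr_gt0 lt_neqAle eq_sym ne.
have L0 q : q \in L -> 0 < q.1 by rewrite !inE => /orP[]/eqP ->.
have sL : sorted <=%O (map fst L) by rewrite /= u12.
have iL := stit_value hL hY W b wL sL L0.
have [r rW] := polytope_bounded (windowP W).
have [W' hW'] := window_interior_cball W (`|r| / u1).
have W'0 : (W' : set V)° 0 by apply: hW'; rewrite normr0 divr_ge0// ltW.
have mX : measurable_fun setT (fun w => \prod_(p <- L) Phi b p.2 (cells (Y p.1 w))).
  by apply: measurable_prod_seq => q /L0 q0; exact: (measurable_stit_Phi hY).
have inner t : 0 < t -> {ae P, forall w, together (cells (Y t w)) 0 0}.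
  move=> t0; exists [set w | ~ together (cells (Y t w)) 0 0]; split.
  - by apply: measurableC; exact: (stit_together hY).
  - exact: (point_in_cell hL hY W).
  - by move=> w.
have aG : {ae P, forall w, [/\ (forall t, 0 < t -> exists2 e : R, 0 < e &
    forall u, t <= u < t + e -> restrict_tess W' (Y u w) = restrict_tess W' (Y t w)),
    (forall i j n, 0 < rational i -> rational i <= rational j ->
      together (cells (Y (rational j) w)) 0 (dseq R l n) -> together (cells (Y (rational i) w)) 0 (dseq R l n)),
    together (cells (Y u1 w)) 0 0 & together (cells (Y u2 w)) 0 0]}.
  by apply: filterS2 (filterI (right_constant W') (rational_decreasing W)) (filterI (inner _ u10) (inner _ u20)) => w [? ?] [].
have [w [rc rd t1 t2] Xw] := expectation_witness mX iL v0 aG.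
have [at1 at2] : occurs b (cells (Y u1 w)) Ys /\ occurs b (cells (Y u2 w)) Ys.
  move: Xw; rewrite /L !big_cons big_nil mulr1 mulf_eq0 negb_or => /andP[x1 x2].
  by split; [apply: (isolated_occurs i0Y t1 x1)|apply: (isolated_occurs i0Y t2 x2)].
have blkY (C : set V) : blk b C = Ys -> convex C -> cball e `<=` C° /\ forall x, x \in X -> ~ C° x.
  move=> CY cC; split => [x /es|x /(nthP 0)[j jX <-] Cx].
    apply: conv_hull_min; first exact: interior_convex.
    move=> z /(nthP 0)[j js <-]; have : Some (inl (Ordinal js)) \in Ys by rewrite inE.
    by rewrite -CY => /in_blk.
  have : Some (inr (Ordinal jX)) \in Ys by rewrite -CY; apply/in_blk.
  by rewrite inE.
pose c s := a `^ s; pose y s := Y (c s) w : FF [set: V].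
have c0 t : 0 < c t by exact: powR_gt0.
have ty t : tessellation (y t) by apply: (stit_tessellation hY); exact: c0.
pose s1 := ln u1 / ln a; pose s2 := ln u2 / ln a.
have c1 : c s1 = u1 by exact: powR_log.
have c2 : c s2 = u2 by exact: powR_log.
have tg t q : 0 < t -> (W' : set V)° q -> together (cells (Y t w)) 0 q <-> together (cells (val (restrict_tess W' (Y t w)))) 0 q.
  by move=> tt qW; apply: iff_sym; apply: together_restrict => //; exact: (stit_tessellation hY).
apply: (@no_entry R l W W' c y s1 s2 c0 powR_continuous ty).
- by rewrite ler_pM2r ?invr_gt0// ler_ln ?posrE.
- exact: (hcad w).
- exact: W'0.
- move=> t x /andP[st _] /rW xr; apply: hW'; rewrite normrZ gtr0_norm ?invr_gt0// mulrC.
  apply: ler_pM => //; first by rewrite invr_ge0 ltW.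
    by apply: le_trans xr _; exact: ler_norm.
  by rewrite lef_pV2 ?posrE// -c1; exact: powR_le.
- move=> t; have [d0 d00 hd] := rc (c t) (c0 t).
  have : \forall u \near t, c u < c t + d0.
    have h : nbhs (c t) [set x | x < c t + d0] by apply: lt_nbhsl; rewrite ltrDl.
    exact: (@powR_continuous t _ h).
  move=> /nbhs_ballP[d' /= d'0 hd']; exists d' => // u /andP[tu ud]; apply: hd; rewrite powR_le//=.
  by apply: hd'; rewrite -ball_normE/= distrC ger0_norm ?subr_ge0// ltrBlDl.
(* Almost surely, monotonicity is known at all rational times; right constancy of the restriction to
   W' transfers it to all times. *)
- move=> t u n tu nW; rewrite /y; have [->//|ne] := eqVneq (c t) (c u).
  have ctu : c t < c u by rewrite lt_neqAle ne powR_le.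
  have [dt dt0 hdt] := rc _ (c0 t); have [du du0 hdu] := rc _ (c0 u).
  have [i /andP[i1 i2]] : exists i, c t < rational i < Num.min (c t + dt) (c u).
    by apply: rational_between; rewrite lt_min ctu ltrDl dt0.
  have [j /andP[j1 j2]] : exists j, c u < rational j < c u + du by apply: rational_between; rewrite ltrDl.
  move: i2; rewrite lt_min => /andP[i2 i3].
  have i0 := lt_trans (c0 t) i1; have j0 := lt_trans (c0 u) j1.
  have hj : restrict_tess W' (Y (rational j) w) = restrict_tess W' (Y (c u) w) by apply: hdu; rewrite (ltW j1).
  have hi : restrict_tess W' (Y (rational i) w) = restrict_tess W' (Y (c t) w) by apply: hdt; rewrite (ltW i1).
  rewrite (tg _ _ (c0 u) nW) -hj -(tg _ _ j0 nW) => h.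
  rewrite (tg _ _ (c0 t) nW) -hi -(tg _ _ i0 nW); apply: rd h; first exact: i0.
  by rewrite ltW// (lt_trans i3).
- move=> q [D yD [D0 Dq]] /interior_subset; rewrite c1.
  have [C yC CY] := at1.
  have dY := stit_disjoint hY (w := w) u10.
  have C0 : C° 0 by have : None \in blk b C by [rewrite CY]; move/in_blk.
  rewrite /y c1 in yD; have DC : D = C by exact: (disjoint_cells_eq dY yD yC D0 C0).
  have cC : convex C.
    have := ty s1; rewrite /y c1 => -[_ _ [pC _ _]]; exact: polytope_convex (pC _ yC).
  have [h1 h2] := blkY C CY cC; apply: (netX C) => //; last by rewrite -DC.
  by move=> x /h1; exact: interior_subset.
have [C yC CY] := at2.
have C0 : C° 0 by have : None \in blk b C by [rewrite CY]; move/in_blk.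
have cC : convex C.
  have := ty s2; rewrite /y c2 => -[_ _ [pC _ _]]; exact: polytope_convex (pC _ yC).
have [h1 _] := blkY C CY cC.
exists (u2^-1 *: p); last by rewrite c2 scalerA divff ?gt_eqF// scale1r.
rewrite /y c2; refine (ex_intro2 _ _ C yC (conj C0 _)); apply: h1.
rewrite /cball/= normrZ gtr0_norm ?invr_gt0// mulrC ler_pdivrMr//.
by rewrite -ler_pdivrMl// mulrC /u2 lerDr ltW.
Qed.

End Detach.

Theorem origin_in_window : (W : set V) 0.
Proof. by apply: contrapT => W0; exact: entry_contradiction. Qed.

End Origin.

(** * Induction over generating events *)

Lemma sigma_induction (T : pointedType) (G : set (set T)) (Q : set T -> Prop) :
  setI_closed G -> Q setT -> G `<=` Q -> (forall S, <<s G >> S -> Q S -> Q (~` S)) ->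
  (forall F : (set T)^nat, (forall n, <<s G >> (F n)) -> trivIset setT F -> (forall n, Q (F n)) -> Q (\bigcup_n F n)) ->
  forall S, <<s G >> S -> Q S.
Proof.
move=> GI QT GQ QC QU; exact: (@dynkin_induction _ (g_sigma_algebraType G) G Q erefl GI QT GQ QC QU).
Qed.

Lemma preimage_generated d (T : measurableType d) (D : Type) (G : set (set D)) (f : T -> D) :
  (forall A, G A -> measurable (f @^-1` A)) -> forall A, <<s G >> A -> measurable (f @^-1` A).
Proof.
move=> mG; apply: smallest_sub => //; split => /=; first by rewrite preimage_set0.
- by move=> A mA; rewrite setTD preimage_setC; exact: measurableC.
- by move=> F mF; rewrite preimage_bigcup; exact: bigcupT_measurable.
Qed.

Section Induction.
Context d (Omega : measurableType d) (R : realType) (P : probability Omega R) (D : pointedType) (G : set (set D)).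
Hypothesis GI : setI_closed G.

Lemma fin_probability (A : set Omega) : measurable A -> P A = (fine (P A))%:E.
Proof. by move=> mA; rewrite fineK// fin_num_measure. Qed.

Lemma complement_probability (A : set Omega) : measurable A -> P (~` A) = (1 - fine (P A))%:E.
Proof.
move=> mA; have -> : P (~` A) = (1 - P A)%E by exact: probability_setC.
by rewrite {1}(fin_probability mA).
Qed.

Lemma law_induction (f g : Omega -> D) :
  (forall A, G A -> measurable (f @^-1` A)) -> (forall A, G A -> measurable (g @^-1` A)) ->
  (forall A, G A -> P (f @^-1` A) = P (g @^-1` A)) ->
  forall A, <<s G >> A -> P (f @^-1` A) = P (g @^-1` A).
Proof.
move=> mf mg fg; apply: sigma_induction => //.
- move=> S mS h; have mfS := preimage_generated mf mS; have mgS := preimage_generated mg mS.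
  transitivity (1 - fine (P (f @^-1` S)))%:E; first exact: (complement_probability mfS).
  by rewrite h; apply: esym; exact: (complement_probability mgS).
- move=> F mF tF h; have mfF n := preimage_generated mf (mF n); have mgF n := preimage_generated mg (mF n).
  have E k (mk : forall n, measurable (k @^-1` F n)) :
      P (k @^-1` \bigcup_n F n) = (\sum_(n <oo | n \in [set: nat]) P (k @^-1` F n))%E.
    rewrite preimage_bigcup measure_bigcup// => i j _ _ [w [Fi Fj]].
    by apply: tF => //; exists (k w).
  by rewrite (E f mfF) (E g mgF); apply: eq_eseriesr => n _; exact: h.
Qed.

(* Sums are interchanged with the limit by the tail bound [P (Phi t @^-1` A) = P (psi @^-1` A)],
   which is uniform in [t]. *)
Lemma mixing_induction (Phi : R -> Omega -> D) (psi : Omega -> D) (S : R -> set Omega) (c : R) :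
  (forall t A, G A -> measurable (Phi t @^-1` A)) -> (forall A, G A -> measurable (psi @^-1` A)) -> (forall t, measurable (S t)) ->
  (forall t A, <<s G >> A -> P (Phi t @^-1` A) = P (psi @^-1` A)) ->
  fine (P (S t)) @[t --> +oo] --> c ->
  (forall A, G A -> fine (P (S t `&` Phi t @^-1` A)) @[t --> +oo] --> c * fine (P (psi @^-1` A))) ->
  forall A, <<s G >> A -> fine (P (S t `&` Phi t @^-1` A)) @[t --> +oo] --> c * fine (P (psi @^-1` A)).
Proof.
move=> mG mGpsi mS inv limS limG.
have mpsi A : <<s G >> A -> measurable (psi @^-1` A) by exact: preimage_generated mGpsi A.
have mPhi t A : <<s G >> A -> measurable (Phi t @^-1` A) by exact: preimage_generated (mG t) A.
have P1 : P [set: Omega] = 1%E by exact: probability_setT.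
have disj (A B C : set Omega) : measurable A -> measurable B -> A `&` B = set0 -> C = A `|` B ->
    fine (P C) = fine (P A) + fine (P B).
  move=> mA mB AB ->; apply: EFin_inj; rewrite EFinD !fineK ?fin_num_measure//; last exact: measurableU.
  exact: measureU.
apply: sigma_induction => //.
- rewrite preimage_setT P1 mulr1; under eq_fun do rewrite preimage_setT setIT; exact: limS.
- move=> A sA h; have eA t : fine (P (S t `&` Phi t @^-1` (~` A))) = fine (P (S t)) - fine (P (S t `&` Phi t @^-1` A)).
    apply/eqP; rewrite eq_sym subr_eq eq_sym addrC; apply/eqP/esym.
    apply: disj.
    + by apply: measurableI; [exact: mS|exact: mPhi].
    + by rewrite preimage_setC; apply: measurableI; [exact: mS|apply: measurableC; exact: mPhi].
    + by rewrite preimage_setC -subset0 => w [[_ ?] [_ ?]].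
    + by rewrite -setIUr preimage_setC setUv setIT.
  under eq_fun do rewrite eA.
  have -> : fine (P (psi @^-1` (~` A))) = 1 - fine (P (psi @^-1` A)).
    by rewrite preimage_setC complement_probability//; exact: mpsi.
  by rewrite mulrBr mulr1; exact: cvgB.
move=> F mF tF h; set U := \bigcup_n F n.
pose head N := \bigcup_(n in `I_N) F n; pose tail N := \bigcup_(n in ~` `I_N) F n.
have sT N : <<s G >> (tail N).
  rewrite /tail; apply: (@bigcup_measurable _ (g_sigma_algebraType G)) => n _; exact: mF.
have sH N : <<s G >> (head N).
  rewrite /head; apply: (@bigcup_measurable _ (g_sigma_algebraType G)) => n _; exact: mF.
have HT N : head N `&` tail N = set0.
  rewrite -subset0 => x [[n /= nN Fnx] [m /= mN Fmx]].
  have := tF n m Logic.I Logic.I (ex_intro _ x (conj Fnx Fmx)) => nm.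
  by apply: mN; rewrite -nm.
have UHT N : U = head N `|` tail N by rewrite /head /tail -bigcup_setU setUv.
have headE N : fine (P (S t `&` Phi t @^-1` (head N))) @[t --> +oo] --> c * fine (P (psi @^-1` (head N))).
  elim: N => [|N IH].
    rewrite /head II0 bigcup_set0 preimage_set0 measure0 mulr0.
    under eq_fun do rewrite preimage_set0 setI0 measure0; exact: cvg_cst.
  have e t : fine (P (S t `&` Phi t @^-1` (head N.+1))) = fine (P (S t `&` Phi t @^-1` (head N))) + fine (P (S t `&` Phi t @^-1` (F N))).
    apply: disj.
    + by apply: measurableI => //; exact: mPhi.
    + by apply: measurableI => //; exact: mPhi.
    + rewrite -subset0 => w [[_ [n /= nN Fn]] [_ FN]].
      have := tF n N Logic.I Logic.I (ex_intro _ _ (conj Fn FN)) => nE.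
      by rewrite nE ltnn in nN.
    + by rewrite -setIUr -preimage_setU /head IISl bigcup_setU1 setUC.
  have e0 : fine (P (psi @^-1` (head N.+1))) = fine (P (psi @^-1` (head N))) + fine (P (psi @^-1` (F N))).
    apply: disj; [exact: mpsi|exact: mpsi| |].
    + rewrite -subset0 => w [[n /= nN Fn] FN].
      have := tF n N Logic.I Logic.I (ex_intro _ _ (conj Fn FN)) => nE.
      by rewrite nE ltnn in nN.
    + by rewrite -preimage_setU /head IISl bigcup_setU1 setUC.
  under eq_fun do rewrite e; rewrite e0 mulrDr; exact: cvgD.
have split_0 N : fine (P (psi @^-1` U)) = fine (P (psi @^-1` (head N))) + fine (P (psi @^-1` (tail N))).
  apply: disj; [exact: mpsi|exact: mpsi| |by rewrite -preimage_setU -UHT].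
  by rewrite -preimage_setI HT preimage_set0.
have tail0 : fine (P (psi @^-1` (tail N))) @[N --> \oo] --> (0 : R).
  have ndH : nondecreasing_seq (fun N => psi @^-1` (head N)).
    by apply/nondecreasing_seqP => N; apply/subsetPset => w [n /= nN Fn]; exists n => //=; exact: ltnW.
  have := @nondecreasing_cvg_mu _ _ _ P (fun N => psi @^-1` (head N)) (fun N => mpsi _ (sH N)) _ ndH.
  rewrite -preimage_bigcup (_ : \bigcup_N head N = U); last first.
    apply/seteqP; split => [x [N _ [n _ Fn]]|x [n _ Fn]]; first by exists n.
    by exists n.+1 => //; exists n => //=.
  move=> lim.
  have sU : <<s G >> U by rewrite (UHT 0%N); exact: (@measurableU _ (g_sigma_algebraType G) _ _ (sH 0%N) (sT 0%N)).
  have lim1 : (P \o (fun N => psi @^-1` (head N))) @ \oo --> (fine (P (psi @^-1` U)))%:E.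
    by rewrite -(fin_probability (mpsi _ sU)); exact: lim (mpsi _ sU).
  have lim' := fine_cvg lim1.
  rewrite (_ : (fun N => _) = (fun N => fine (P (psi @^-1` U)) - (fine \o (P \o (fun N => psi @^-1` (head N)))) N)); last first.
    apply/funext => N /=; apply/eqP; rewrite eq_sym subr_eq eq_sym addrC; apply/eqP.
    by rewrite -split_0.
  rewrite -[X in _ --> X](subrr (fine (P (psi @^-1` U)))); apply: cvgB; [exact: cvg_cst|exact: lim'].
have split_S t N : fine (P (S t `&` Phi t @^-1` U)) = fine (P (S t `&` Phi t @^-1` (head N))) + fine (P (S t `&` Phi t @^-1` (tail N))).
  apply: disj.
  - by apply: measurableI; [exact: mS|exact: mPhi].
  - by apply: measurableI; [exact: mS|exact: mPhi].
  - by rewrite -subset0 => w [[_ hw] [_ tw]]; have : (head N `&` tail N) (Phi t w) by []; rewrite HT.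
  - by rewrite -setIUr -preimage_setU -UHT.
apply/cvgrPdist_lt => e e0; have c1 : 0 < 1 + `|c| by rewrite ltr_pwDl.
have ec : 0 < e / 2 / (1 + `|c|) by rewrite !divr_gt0.
have [N _ /(_ N (leqnn N))] := (cvgrPdist_lt _ _).1 tail0 _ ec.
set tN := fine (P (psi @^-1` (tail N))); rewrite /= sub0r normrN => tN_lt.
have tN0 : 0 <= tN by exact: fine_ge0.
rewrite ger0_norm// ltr_pdivlMr// mulrDr mulr1 in tN_lt.
have /cvgrPdist_lt/(_ (e / 2)) hd := headE N; have {}hd := hd (divr_gt0 e0 (ltr0Sn _ 1)).
apply: filterS hd => t; rewrite (split_S t N) (split_0 N) -/tN.
set x := fine (P (psi @^-1` (head N))); set y := fine (P (S t `&` Phi t @^-1` (head N))) => hxy.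
set z := fine (P (S t `&` Phi t @^-1` (tail N))).
have z0 : 0 <= z by exact: fine_ge0.
have zt : z <= tN.
  rewrite /z /tN -(inv t _ (sT N)) fine_le ?fin_num_measure//.
  - by apply: measurableI; [exact: mS|exact: mPhi].
  - exact: mPhi.
  - rewrite le_measure ?inE//; first by apply: measurableI; [exact: mS|exact: mPhi].
    exact: mPhi.
rewrite (_ : c * (x + tN) - (y + z) = (c * x - y) + (c * tN - z)); last by ring.
apply: le_lt_trans (ler_normD _ _) _; rewrite [ltRHS]splitr; apply: ltrD => //.
apply: le_lt_trans (ler_normB _ _) _; rewrite normrM (ger0_norm tN0) (ger0_norm z0).
by apply: le_lt_trans tN_lt; rewrite mulrC addrC lerD2r.
Qed.

End Induction.

(** * Stationarity, mixing and the Markov property *)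

Section Renormalized.
Context (R : realType) (l : nat) (Lambda : {measure set (borel (hyperplane R l)) -> \bar R})
  (hL : driving_measure Lambda) d (Omega : measurableType d) (P : probability Omega R)
  (Y : R -> Omega -> borel (FF [set: 'rV[R]_l.+1])) (hY : stit_process P Lambda Y)
  (a : R) (a1 : 1 < a) (W : window R l).
Local Notation V := 'rV[R]_l.+1.
Local Notation c s := (a `^ s).
Implicit Types (K : seq (R * (V * V))).

Definition process_in_window (s : R) (w : Omega) : TW W := restrict_tess W (renormalized a Y s w).
Local Notation X := process_in_window.

Lemma scale_gt0 s : 0 < c s. Proof. by apply: powR_gt0; exact: lt_trans a1. Qed.

Lemma scaleD s t : c (s + t) = c t * c s.
Proof. by rewrite addrC powRD//; apply/implyP => _; rewrite gt_eqF// (lt_trans ltr01). Qed.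

Lemma process_together s w p q : W° p -> W° q ->
  together (cells (val (X s w))) p q <-> together (cells (Y (c s) w)) ((c s)^-1 *: p) ((c s)^-1 *: q).
Proof.
have c0 := scale_gt0 s; move=> Wp Wq; rewrite together_restrict//; first exact: together_scale (lt0r_neq0 c0).
by apply: scale_tessellation; [exact: lt0r_neq0|exact: (stit_tessellation hY)].
Qed.

Lemma measurable_process s : measurable_fun setT (X s : Omega -> borel (TW W)).
Proof.
apply: measurable_TW => n m nW mW.
rewrite (_ : _ @^-1` _ = [set w | together (cells (Y (c s) w)) ((c s)^-1 *: dseq R l n) ((c s)^-1 *: dseq R l m)]).
  by apply: (stit_together hY); exact: scale_gt0.
by apply/funext => w; apply/propext; exact: (process_together s w nW mW).
Qed.

Definition interior_points K : Prop := forall k, k \in K -> W° k.2.1 /\ W° k.2.2.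

Definition unscaled K : seq (R * (V * V)) :=
  [seq (c k.1, ((c k.1)^-1 *: k.2.1, (c k.1)^-1 *: k.2.2)) | k <- K].

Lemma unscaled_gt0 K k : k \in unscaled K -> 0 < k.1.
Proof. by move=> /mapP[q _ ->]; exact: scale_gt0. Qed.

Lemma unscaled_cat K L : unscaled (K ++ L) = unscaled K ++ unscaled L.
Proof. exact: map_cat. Qed.

Lemma avoid_cat K L : avoid Y (K ++ L) = avoid Y K `&` avoid Y L.
Proof.
apply/seteqP; split => [w h|w [h1 h2] k].
  by split => k kK; apply: h; rewrite mem_cat kK ?orbT.
by rewrite mem_cat => /orP[/h1|/h2].
Qed.

Section Trajectories.
Variables (D : pointedType) (ev : D -> R -> TW W) (Z : Omega -> D) (shift : R -> D -> D).
Hypotheses (hZ : forall w s, ev (Z w) s = X s w) (hshift : forall t x s, ev (shift t x) s = ev x (s + t)).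

(** Trajectories enter only through the evaluation [ev]. These events are stable under intersection,
    and their preimages are the events [avoid] of Y with known probabilities. *)
Definition path_event K : set D :=
  [set x | forall k, k \in K -> ~ together (cells (val (ev x k.1))) k.2.1 k.2.2].
Definition path_events : set (set D) := [set A | exists2 K, interior_points K & A = path_event K].

Lemma path_eventsI : setI_closed path_events.
Proof.
move=> _ _ [K iK ->] [L iL ->]; exists (K ++ L).
  by move=> k; rewrite mem_cat => /orP[/iK|/iL].
apply/seteqP; split => [x [h1 h2] k|x h].
  by rewrite mem_cat => /orP[/h1|/h2].
by split => k kK; apply: h; rewrite mem_cat kK ?orbT.
Qed.

Lemma path_event_preimage K : interior_points K -> Z @^-1` path_event K = avoid Y (unscaled K).
Proof.
move=> iK; apply/seteqP; split => [w h _ /mapP[k kK ->]|w h k kK] /=.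
  by rewrite -process_together; [rewrite -hZ; exact: h|exact: (iK k kK).1|exact: (iK k kK).2].
rewrite hZ process_together; [|exact: (iK k kK).1|exact: (iK k kK).2].
by apply: (h (c k.1, ((c k.1)^-1 *: k.2.1, (c k.1)^-1 *: k.2.2))); apply/mapP; exists k.
Qed.

Lemma shift_event_preimage t K : interior_points K ->
  (fun w => shift t (Z w)) @^-1` path_event K = avoid Y (rescale (c t) (unscaled K)).
Proof.
move=> iK; apply/seteqP; split => [w h _ /mapP[_ /mapP[k kK ->] ->]|w h k kK] /=.
  rewrite !scalerA -!invfM -scaleD -process_together; [|exact: (iK k kK).1|exact: (iK k kK).2].
  by rewrite -hZ -hshift; exact: h.
rewrite hshift hZ process_together; [|exact: (iK k kK).1|exact: (iK k kK).2].
have := h (c (k.1 + t), ((c (k.1 + t))^-1 *: k.2.1, (c (k.1 + t))^-1 *: k.2.2)); apply.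
apply/mapP; exists (c k.1, ((c k.1)^-1 *: k.2.1, (c k.1)^-1 *: k.2.2)); first by apply/mapP; exists k.
by rewrite /= !scalerA -!invfM -scaleD.
Qed.

Lemma measurable_path_event A : path_events A -> measurable (Z @^-1` A).
Proof.
by move=> [K iK ->]; rewrite path_event_preimage//; apply: (measurable_avoid hY) => k; exact: unscaled_gt0.
Qed.

Lemma measurable_shift_event t A : path_events A -> measurable ((fun w => shift t (Z w)) @^-1` A).
Proof.
move=> [K iK ->]; rewrite shift_event_preimage//; apply: (measurable_avoid hY) => _ /mapP[k /unscaled_gt0 k0 ->].
by rewrite mulr_gt0// scale_gt0.
Qed.

Theorem process_stationary t A : <<s path_events >> A ->
  P ((fun w => shift t (Z w)) @^-1` A) = P (Z @^-1` A).
Proof.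
apply: (law_induction path_eventsI); [exact: measurable_shift_event|exact: measurable_path_event|].
move=> _ [K iK ->]; rewrite shift_event_preimage// path_event_preimage//.
apply: (avoid_scale hL hY W); first exact: scale_gt0.
by move=> k; exact: unscaled_gt0.
Qed.

Let powR_large (M : R) : \forall t \near +oo, M < c t.
Proof.
pose N := Num.max M 1; have N0 : 0 < N by rewrite lt_max ltr01 orbT.
have NM : M <= N by rewrite le_max lexx.
near=> t; apply: (le_lt_trans NM).
rewrite -(powR_log a1 N0) /powR gt_eqF ?(lt_trans ltr01 a1)// ltr_expR ltr_pM2r ?ln_gt0//.
by near: t; apply: nbhs_pinfty_gt; exact: num_real.
Unshelve. all: by end_near. Qed.

Lemma mixing_path_events K L : interior_points K -> interior_points L ->
  fine (P (Z @^-1` path_event K `&` (fun w => shift t (Z w)) @^-1` path_event L)) @[t --> +oo] -->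
  fine (P (Z @^-1` path_event L)) * fine (P (Z @^-1` path_event K)).
Proof.
move=> iK iL; have [K1 eK [mK sK]] := avoid_sort Y (unscaled K).
have [L1 eL [mL sL]] := avoid_sort Y (unscaled L).
have K1_gt0 k : k \in K1 -> 0 < k.1 by rewrite -mK; exact: unscaled_gt0.
have L1_gt0 k : k \in L1 -> 0 < k.1 by rewrite -mL; exact: unscaled_gt0.
have [I [_ [bI [K2 eK2]]]] := indexing K1.
have [J [j0 [bJ [L2 eL2]]]] := indexing L1.
have sK2 : sorted <=%O (map fst K2) by move: sK; rewrite eK2 -map_comp.
have sL2 : sorted <=%O (map fst L2) by move: sL; rewrite eL2 -map_comp.
(* A fixed time of Y after all observations of the past event. *)
pose r := 1 + \sum_(k <- K1) k.1.
have r0 : 0 < r by rewrite ltr_pwDl// big_seq sumr_ge0// => k /K1_gt0/ltW.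
have Kr k : k \in K2 -> 0 < k.1 <= r.
  move=> kK; have kK1 : (k.1, (bI k.2.1, bI k.2.2)) \in K1.
    by rewrite eK2; exact: (map_f (fun k => (k.1, (bI k.2.1, bI k.2.2)))).
  rewrite (K1_gt0 _ kK1)/= /r (big_rem _ kK1)/= addrCA lerDl addr_ge0// big_seq sumr_ge0// => q /mem_rem/K1_gt0/ltW//.
pose lam := split_rate (kappa Lambda bJ) finset.setT.
have L2_gt0 k : k \in L2 -> 0 < k.1.
  move=> kL; apply: (L1_gt0 (k.1, (bJ k.2.1, bJ k.2.2))).
  by rewrite eL2; exact: (map_f (fun k => (k.1, (bJ k.2.1, bJ k.2.2)))).
have lam0 : 0 <= lam by apply: sumr_ge0 => A _; exact: kappa_ge0.
(* Once a^t exceeds M, all observations of the shifted event come after r. *)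
pose M := \sum_(k <- L2) r / k.1.
have key t : M < c t ->
    `|fine (P (Z @^-1` path_event K `&` (fun w => shift t (Z w)) @^-1` path_event L)) -
      fine (P (Z @^-1` path_event L)) * fine (P (Z @^-1` path_event K))| <= 2 * (lam * r / c t).
  move=> Mt; have c0 := scale_gt0 t; pose b j := (c t)^-1 *: bJ j; pose L' := [seq (c t * k.1, k.2) | k <- L2].
  have eL' : avoid Y (rescale (c t) (unscaled L)) = avoid Y (at_points b L').
    rewrite (_ : at_points b L' = rescale (c t) L1); last first.
      by rewrite /at_points /L' eL2 /rescale /at_points -!map_comp.
    by apply/seteqP; split => w h _ /mapP[k kL ->]; apply: h; apply/mapP; exists k; rewrite // ?mL// -mL.
  have sL' : sorted <=%O (map fst L').
    move: sL2; rewrite -map_comp !sorted_map; apply: sub_sorted => x y /=.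
    by rewrite ler_pM2l.
  have L'r k : k \in L' -> r <= k.1.
    move=> /mapP[q qL ->] /=; rewrite -ler_pdivrMr ?L2_gt0//; apply: le_trans (ltW Mt).
    rewrite /M (big_rem q)//= lerDl big_seq sumr_ge0// => k' /mem_rem/L2_gt0 k'0.
    by rewrite divr_ge0 ?(ltW r0) ?(ltW k'0).
  have lamE : split_rate (kappa Lambda b) finset.setT = (c t)^-1 * lam.
    rewrite /lam /split_rate mulr_sumr; apply: eq_bigr => A sA.
    rewrite (kappa_scale hL (window_bound W hL)) ?invr_gt0//; first by case/andP: sA.
    by case/andP: (splits_setD sA).
  (* [h1] compares the joint probability with P A times g, and [h2], with an empty past, compares P
     B with g; hence the factor 2. By homogeneity the split rate of the contracted points is lam /
     a^t, so the error tends to 0. *)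
  have h1 := @future_almost_independent _ _ _ hL _ _ _ _ hY W I J bI b j0 K2 L' r r0 sK2 Kr sL' L'r.
  have h2 := @future_almost_independent _ _ _ hL _ _ _ _ hY W I J bI b j0 [::] L' r r0 isT (fun k kn => False_ind _ (elimF idP erefl kn)) sL' L'r.
  rewrite path_event_preimage// shift_event_preimage// eK eL'.
  have -> : fine (P (Z @^-1` path_event L)) = fine (P (avoid Y (at_points b L'))).
    by rewrite -eL' -shift_event_preimage// process_stationary//; apply: sub_sigma_algebra; exists L.
  move: h1 h2; rewrite -eK2; set g := value _ _ _ _; set A := avoid Y K1; set B := avoid Y (at_points b L').
  have -> : avoid Y (at_points bI [::]) = setT by apply/seteqP; split.
  rewrite setTI; have -> : P setT = 1%E by exact: probability_setT.
  rewrite mul1r lamE; set e := 1 - _ => h1 h2.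
  have eE : e <= lam * r / c t.
    rewrite /e; set x := - _ * r; have := expR_ge1Dx x.
    have -> : x = - (lam * r / c t) by rewrite /x; ring.
    lra.
  have A01 : 0 <= fine (P A) <= 1.
    have mA : measurable A by apply: (measurable_avoid hY) => k /K1_gt0.
    rewrite fine_ge0//= -lee_fin -fin_probability//; exact: probability_le1.
  apply: le_trans (_ : 2 * e <= _); last by rewrite ler_pM2l.
  have : `|(g - fine (P B)) * fine (P A)| <= e.
    rewrite normrM; apply: le_trans (_ : e * 1 <= _); last by rewrite mulr1.
    case/andP: A01 => A0 A1; apply: ler_pM => //; [by rewrite distrC|by rewrite ger0_norm].
  move: h1; rewrite !ler_norml => /andP[? ?] /andP[? ?]; apply/andP; split; lra.
apply/cvgrPdist_le => e e0; near=> t; rewrite distrC; apply: le_trans (key t _) _.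
  by near: t; exact: powR_large.
rewrite mulrA ler_pdivrMr ?scale_gt0// [leRHS]mulrC -ler_pdivrMr//; apply: ltW.
by near: t; exact: powR_large.
Unshelve. all: by end_near. Qed.

Theorem process_mixing A B : <<s path_events >> A -> <<s path_events >> B ->
  fine (P (Z @^-1` A `&` (fun w => shift t (Z w)) @^-1` B)) @[t --> +oo] -->
  fine (P (Z @^-1` A)) * fine (P (Z @^-1` B)).
Proof.
have mZ C : <<s path_events >> C -> measurable (Z @^-1` C) by exact: preimage_generated measurable_path_event C.
(* First the past event is extended to the whole sigma-field while the future one stays elementary;
   a second induction then extends the future event. *)
have half C L : <<s path_events >> C -> interior_points L ->
    fine (P (Z @^-1` C `&` (fun w => shift t (Z w)) @^-1` path_event L)) @[t --> +oo] -->
    fine (P (Z @^-1` C)) * fine (P (Z @^-1` path_event L)).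
  move=> sC iL; rewrite mulrC.
  have pL : path_events (path_event L) by exists L.
  under eq_fun do rewrite setIC.
  apply: (@mixing_induction _ _ _ _ _ _ path_eventsI (fun=> Z) Z (fun t => (fun w => shift t (Z w)) @^-1` path_event L)) sC.
  - by move=> _; exact: measurable_path_event.
  - exact: measurable_path_event.
  - by move=> t; exact: measurable_shift_event.
  - by [].
  - have E t : fine (P ((fun w => shift t (Z w)) @^-1` path_event L)) = fine (P (Z @^-1` path_event L)).
      by rewrite process_stationary//; exact: sub_sigma_algebra.
    by under eq_fun do rewrite E; exact: cvg_cst.
  - by move=> _ [K iK ->]; under eq_fun do rewrite setIC; exact: mixing_path_events.
move=> sA; apply: (@mixing_induction _ _ _ _ _ _ path_eventsI (fun t w => shift t (Z w)) Z (fun=> Z @^-1` A)).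
- by move=> t; exact: measurable_shift_event.
- exact: measurable_path_event.
- by move=> _; exact: mZ.
- by move=> t; exact: process_stationary.
- exact: cvg_cst.
- by move=> _ [L iL ->]; exact: half.
Qed.

End Trajectories.
End Renormalized.

Section ConditionalInduction.
Context d (Omega : measurableType d) (R : realType) (P : probability Omega R) (G : set (set Omega)).
Hypotheses (GI : setI_closed G) (mG : forall A, G A -> measurable A).

Lemma conditional_induction (B : set Omega) (h : Omega -> R) :
  measurable B -> measurable_fun setT h -> (forall w, 0 <= h w <= 1) ->
  P B = (\int[P]_w (h w)%:E)%E ->
  (forall A, G A -> P (A `&` B) = (\int[P]_(w in A) (h w)%:E)%E) ->
  forall A, <<s G >> A -> P (A `&` B) = (\int[P]_(w in A) (h w)%:E)%E.
Proof.
move=> mB mh h01 hT hG.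
have mA A : <<s G >> A -> measurable A by exact: (preimage_generated (f := id) mG).
have mhE D : measurable_fun D (fun w => (h w)%:E) by apply: measurable_funTS; exact/measurable_EFinP.
have h0 w : (0 <= (h w)%:E)%E by rewrite lee_fin; case/andP: (h01 w).
have iB : (\int[P]_w (h w)%:E)%E \is a fin_num by rewrite -hT fin_num_measure.
apply: (@dynkin_induction _ (g_sigma_algebraType G) G) => //.
- by rewrite setTI.
- move=> S sS e; have mS := mA _ sS.
  have e1 : P B = (P (S `&` B) + P (~` S `&` B))%E.
    rewrite setIC (setIC (~` S)) -setDE addeC; exact: measureDI.
  have e2 : (\int[P]_w (h w)%:E = \int[P]_(w in S) (h w)%:E + \int[P]_(w in ~` S) (h w)%:E)%E.
    rewrite -ge0_integral_setU//; first by rewrite setUv.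
    - exact: measurableC.
    - by apply/disj_setPS; rewrite setICr.
  have f1 : P (S `&` B) \is a fin_num by apply: fin_num_measure; exact: measurableI.
  have E : (P (S `&` B) + P (~` S `&` B) = P (S `&` B) + \int[P]_(w in ~` S) (h w)%:E)%E.
    by rewrite -e1 hT e2 e.
  rewrite -[LHS](addeK _ f1) [X in (X - _)%E]addeC E [X in (X - _)%E]addeC addeK//.
- move=> F mF tF e; have mFO n := mA _ (mF n).
  rewrite ge0_integral_bigcup//; rewrite setI_bigcupl measure_bigcup//.
  + by rewrite (eq_eseriesl (Q := xpredT)) => [|n]; [apply: eq_eseriesr => n _; exact: e|rewrite in_setT].
  + by move=> n _; exact: measurableI.
  + by move=> i j _ _ [w [[Fi _] [Fj _]]]; apply: (tF i j Logic.I Logic.I); exists w.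
Qed.

End ConditionalInduction.

Section MarkovProperty.
Context (R : realType) (l : nat) (Lambda : {measure set (borel (hyperplane R l)) -> \bar R})
  (hL : driving_measure Lambda) d (Omega : measurableType d) (P : probability Omega R)
  (Y : R -> Omega -> borel (FF [set: 'rV[R]_l.+1])) (hY : stit_process P Lambda Y)
  (a : R) (a1 : 1 < a) (W : window R l) (W0 : (W : set 'rV[R]_l.+1) 0).
Local Notation V := 'rV[R]_l.+1.
Local Notation c s := (a `^ s).
Local Notation X := (@process_in_window R l d Omega Y a W).
Local Notation unscaled := (unscaled a).
Implicit Types (K : seq (R * (V * V))).

Definition past_events s : set (set Omega) :=
  [set A | exists2 K, interior_points W K /\ (forall k, k \in K -> k.1 <= s) & A = avoid Y (unscaled K)].

Lemma past_eventsI s : setI_closed (past_events s).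
Proof.
move=> _ _ [K [iK Ks] ->] [L [iL Ls] ->]; exists (K ++ L); last by rewrite unscaled_cat avoid_cat.
by split => k; rewrite mem_cat => /orP[]; [exact: iK|exact: iL|exact: Ks|exact: Ls].
Qed.

Lemma measurable_past_event s A : past_events s A -> measurable A.
Proof. by move=> [K _ ->]; apply: (measurable_avoid hY) => k; exact: (unscaled_gt0 a1). Qed.

Lemma sub_past s : past setT (fun s w => X s w : borel (TW W)) s `<=` <<s past_events s >>.
Proof.
apply: smallest_sub; first exact: smallest_sigma_algebra.
move=> _ [r [_ rs [B mB ->]]].
have mX : measurable_fun setT (X r : g_sigma_algebraType (past_events s) -> borel (TW W)).
  apply: measurable_TW => n m nW mW.
  rewrite (_ : _ @^-1` _ = ~` avoid Y (unscaled [:: (r, (dseq R l n, dseq R l m))])).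
    apply: measurableC; apply: sub_sigma_algebra; refine (ex_intro2 _ _ [:: (r, (dseq R l n, dseq R l m))] _ erefl).
    split => k; rewrite inE => /eqP ->; [by split; [exact: nW|exact: mW]|exact: rs].
  apply/funext => w; apply/propext; rewrite /= (process_together hY a1 r w nW mW); split.
    by move=> t /(_ _ (mem_head _ _)).
  by move=> h; apply: contrapT => t; apply: h => k; rewrite inE => /eqP ->.
by have := mX measurableT B mB; rewrite setTI.
Qed.

Definition state_event (K : seq (V * V)) : set (TW W) :=
  [set T | forall k, k \in K -> ~ together (cells (val T)) k.1 k.2].

Definition state_events : set (set (TW W)) :=
  [set B | exists2 K : seq (V * V), (forall k, k \in K -> W° k.1 /\ W° k.2) & B = state_event K].

Lemma state_eventsI : setI_closed state_events.
Proof.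
move=> _ _ [K iK ->] [L iL ->]; exists (K ++ L).
  by move=> k; rewrite mem_cat => /orP[/iK|/iL].
apply/seteqP; split => [x [h1 h2] k|x h].
  by rewrite mem_cat => /orP[/h1|/h2].
by split => k kK; apply: h; rewrite mem_cat kK ?orbT.
Qed.

(** Says that the identity, from the sigma-field of state events to the Borel sigma-field, is
    measurable; by [measurable_TW] only pairs from the dense sequence have to be tested. *)
Lemma borel_state_events (B : set (borel (TW W))) : measurable B -> <<s state_events >> B.
Proof.
move=> mB; have mid : measurable_fun setT (id : g_sigma_algebraType state_events -> borel (TW W)).
  apply: (@measurable_TW _ _ W _ (g_sigma_algebraType state_events) id) => n m nW mW.
  rewrite (_ : _ @^-1` _ = ~` state_event [:: (dseq R l n, dseq R l m)]).
    apply: measurableC; apply: sub_sigma_algebra; refine (ex_intro2 _ _ [:: (dseq R l n, dseq R l m)] _ erefl).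
    by move=> k; rewrite inE => /eqP ->; split; [exact: nW|exact: mW].
  apply/funext => T; apply/propext; split => /=; first by move=> t /(_ _ (mem_head _ _)).
  by move=> h; apply: contrapT => t; apply: h => k; rewrite inE => /eqP ->.
by have := mid measurableT B mB; rewrite setTI.
Qed.

Lemma indexing_pairs K : exists (I : finType) (b : I -> V) (K' : seq (R * (I * I))), K = at_points b K' /\
  forall i, exists2 k, k \in K & b i = k.2.1 \/ b i = k.2.2.
Proof.
pose n := size K; pose t := in_tuple K.
exists ('I_n * bool)%type, (fun i => if i.2 then (tnth t i.1).2.2 else (tnth t i.1).2.1).
exists [seq ((tnth t k).1, ((k, false), (k, true))) | k <- enum 'I_n]; split.
  rewrite /at_points -map_comp -[LHS]/(tval t) -[in LHS](map_tnth_enum t).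
  by apply: eq_map => k /=; case: (tnth t k) => s [].
move=> [k b]; exists (tnth t k); first exact: mem_tnth.
by case: b; [right|left].
Qed.

(* Each point seen at time [t] comes, in the coordinates of time [s], from a point closer to the
   origin; it was already inside the window because W is convex and contains the origin. *)
Lemma state_event_transition s t (K : seq (V * V)) : s <= t -> (forall k, k \in K -> W° k.1 /\ W° k.2) ->
  exists g : TW W -> R, [/\ measurable_fun setT (g : borel (TW W) -> R), forall T, 0 <= g T <= 1 &
    forall A, past_events s A -> P (A `&` X t @^-1` state_event K) = (\int[P]_(w in A) (g (X s w))%:E)%E].
Proof.
move=> st iK; pose Kt := [seq (t, k) | k <- K].
have iKt : interior_points W Kt by move=> _ /mapP[k /iK ? ->].
have XE : X t @^-1` state_event K = avoid Y (unscaled Kt).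
  apply/seteqP; split => [w h _ /mapP[_ /mapP[k kK ->] ->]|w h k kK] /=.
    by move=> /(process_together hY a1 t w (iK k kK).1 (iK k kK).2); exact: h.
  move=> /(process_together hY a1 t w (iK k kK).1 (iK k kK).2); apply: (h (c t, ((c t)^-1 *: k.1, (c t)^-1 *: k.2))).
  by apply/mapP; exists (t, k) => //; apply/mapP; exists k.
have [L eL [mL sL]] := avoid_sort Y (unscaled Kt).
have [J [b [L' [eL' hb]]]] := indexing_pairs L.
have ct := scale_gt0 a1 t; have cs := scale_gt0 a1 s.
have Wb j : W° (c s *: b j).
  have [p Wp ->] : exists2 p, W° p & b j = (c t)^-1 *: p.
    have [k kL bk] := hb j; move: kL; rewrite -mL => /mapP[_ /mapP[q /iK[q1 q2] ->] kE].
    by case: bk => ->; rewrite kE /=; [exists q.1|exists q.2].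
  rewrite scalerA -[_ *: p]addr0 -(scaler0 _ (1 - c s / c t)).
  apply: convex_interior => //; first exact: polytope_convex (windowP W).
  by rewrite divr_gt0//= ler_pdivrMr// mul1r powR_le.
have sL' : sorted <=%O (map fst (pair_weights (R := R) L')) by move: sL; rewrite eL' map_fst_pair -map_comp.
have Lr p : p \in pair_weights (R := R) L' -> c s <= p.1.
  move=> /mapP[q qL ->] /=; have : (q.1, (b q.2.1, b q.2.2)) \in L by rewrite eL'; exact: (map_f (fun k => (k.1, (b k.2.1, b k.2.2)))).
  by rewrite -mL => /mapP[_ /mapP[k _ ->] [-> _ _]]; exact: (powR_le a1 st).
pose G := value (kappa Lambda b) (pair_weights (R := R) L') (c s).
have G01 B : 0 <= G B <= 1 by apply: value_bounds; [move=> ? ?; exact: kappa_ge0|exact: pair_weights_ok].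
exists (fun T => Phi (fun j => c s *: b j) G (cells (val T))); split.
- exact: measurable_TW_Phi.
- by move=> T; exact: Phi_bounds.
move=> _ [K1 [iK1 K1s] ->]; have [K2 eK2 [mK2 sK2]] := avoid_sort Y (unscaled K1).
have [I [bI [K3 [eK3 _]]]] := indexing_pairs K2.
have sK3 : sorted <=%O (map fst K3) by move: sK2; rewrite eK3 -map_comp.
have K3s k : k \in K3 -> 0 < k.1 <= c s.
  move=> kK; have : (k.1, (bI k.2.1, bI k.2.2)) \in K2 by rewrite eK3; exact: (map_f (fun k => (k.1, (bI k.2.1, bI k.2.2)))).
  by rewrite -mK2 => /mapP[q /K1s qs [-> _ _]]; rewrite scale_gt0//= powR_le.
rewrite XE eL eK2 eK3 eL'; set A := avoid Y (at_points bI K3).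
have mA : measurable A by apply: (measurable_avoid hY) => _ /mapP[k /K3s/andP[k0 _] ->].
have mB : measurable (avoid Y (at_points b L')).
  by apply: (measurable_avoid hY) => k; rewrite -eL' -mL; exact: (unscaled_gt0 a1).
rewrite -integral_indicR; last exact: measurableI.
transitivity (\int[P]_w (\1_A w * \prod_(p <- pair_weights L') Phi b p.2 (cells (Y p.1 w)))%:E)%E.
  by apply: eq_integral => w _; rewrite prod_pair indicI.
rewrite (expectation_future hL hY W bI b cs sK3 K3s (@pair_weights_ok _ _ _) sL' Lr).
rewrite [RHS]integral_mkcond; apply: eq_integral => w _; rewrite /patch indicE.
case: (boolP (w \in A)) => wA; last by rewrite mul0r.
rewrite mul1r; congr EFin; apply: eq_Phi => [||i j]; [exact: (stit_disjoint hY)|exact: TW_disjoint|].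
rewrite (process_together hY a1 s w (Wb i) (Wb j)) !scalerA mulVf ?gt_eqF// !scale1r.
by [].
Qed.

Let Xb s : Omega -> borel (TW W) := X s.

Lemma measurable_past s A : past setT (fun s w => X s w : borel (TW W)) s A -> measurable A.
Proof. by move=> /sub_past; apply: (preimage_generated (f := id)); exact: measurable_past_event. Qed.

Let mX s : measurable_fun setT (Xb s). Proof. exact: (measurable_process hY a1 (W := W) s). Qed.

Let mXB s (B : set (borel (TW W))) : measurable B -> measurable (X s @^-1` B).
Proof. by move=> mB; have := mX s measurableT mB; rewrite setTI. Qed.

(** The conclusion of [markov_process] for a single B, set apart so that Dynkin induction can run
    over B. *)
Definition transition s t (B : set (borel (TW W))) : Prop := exists g : TW W -> R,
  [/\ measurable_fun setT (g : borel (TW W) -> R), forall T, 0 <= g T <= 1 &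
    forall A, past setT Xb s A -> P (A `&` X t @^-1` B) = (\int[P]_(w in A) (g (X s w))%:E)%E].

Let transitionT s t : transition s t setT.
Proof.
exists (fun=> 1); split => // [T|A pA]; first by rewrite ler01 lexx.
by rewrite preimage_setT setIT integral_cst ?mul1e//; exact: measurable_past pA.
Qed.

Let transitionC s t B : measurable B -> transition s t B -> transition s t (~` B).
Proof.
move=> mB [g [mg g01 gE]]; exists (fun T => 1 - g T); split.
- exact: measurable_funB.
- by move=> T; have := g01 T; lra.
move=> A pA; have mA := measurable_past pA; have mXt := mXB t mB.
have mgX (D : set Omega) : measurable_fun D (fun w => (g (X s w))%:E).
  by apply: measurable_funTS; apply/measurable_EFinP; exact: (measurableT_comp mg (mX s)).
have e1 : P A = (P (A `&` X t @^-1` B) + P (A `&` X t @^-1` (~` B)))%E.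
  by rewrite addeC preimage_setC -setDE; exact: measureDI.
have e2 : P A = (\int[P]_(w in A) (g (X s w))%:E + \int[P]_(w in A) (1 - g (X s w))%:E)%E.
  rewrite -ge0_integralD//.
  - transitivity (\int[P]_(w in A) (cst 1%E w))%E; first by rewrite integral_cst ?mul1e.
    by apply: eq_integral => w _; rewrite -EFinD addrCA subrr addr0.
  - by move=> w _; rewrite lee_fin; case/andP: (g01 (X s w)).
  - by move=> w _; rewrite lee_fin subr_ge0; case/andP: (g01 (X s w)).
  - apply/measurable_EFinP; apply: measurable_funB => //; apply: measurable_funTS.
    exact: (measurableT_comp mg (mX s)).
have f1 : P (A `&` X t @^-1` B) \is a fin_num by apply: fin_num_measure; exact: measurableI.
have E : (P (A `&` X t @^-1` B) + P (A `&` X t @^-1` (~` B)) =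
          P (A `&` X t @^-1` B) + \int[P]_(w in A) (1 - g (X s w))%:E)%E.
  by rewrite -e1 e2 gE.
by rewrite -[LHS](addeK _ f1) [X in (X - _)%E]addeC E [X in (X - _)%E]addeC addeK.
Qed.

(* The densities of disjoint events sum to at most 1 only almost surely, hence the truncation. *)
Let transition_bigcup s t (F : (set (borel (TW W)))^nat) : (forall n, measurable (F n)) ->
  trivIset setT F -> (forall n, transition s t (F n)) -> transition s t (\bigcup_n F n).
Proof.
move=> mF tF /choice[g hg].
have mg n : measurable_fun setT (g n : borel (TW W) -> R) by have [] := hg n.
have g01 n T : 0 <= g n T <= 1 by have [_ h _] := hg n.
have gE n A : past setT Xb s A -> P (A `&` X t @^-1` F n) = (\int[P]_(w in A) (g n (X s w))%:E)%E by have [_ _ h] := hg n; exact: h.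
pose S (T : borel (TW W)) : \bar R := (\sum_(n <oo) (g n T)%:E)%E.
have g0 n T : (0%E <= (g n T)%:E)%E by rewrite lee_fin; case/andP: (g01 n T).
have S0 T : (0 <= S T)%E by apply: nneseries_ge0 => n _ _; exact: g0.
have mS : measurable_fun setT S.
  apply: ge0_emeasurable_sum => [k x _ _|k _]; [exact: g0|exact/measurable_EFinP].
pose m (T : borel (TW W)) : \bar R := mine (S T) 1%E.
have mm : measurable_fun setT m by apply: measurable_mine.
have m01 T : (0 <= m T <= 1)%E by rewrite /m le_min S0 lee01 ge_min lexx orbT.
have mfin T : m T \is a fin_num.
  by have /andP[h1 h2] := m01 T; rewrite ge0_fin_numE// (le_lt_trans h2)// ltry.
exists (fun T => fine (m T)); split.
- by apply: (measurableT_comp _ mm); exact: fine_measurable.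
- by move=> T; rewrite -!lee_fin fineK.
move=> A pA; under eq_integral do rewrite fineK//.
have mXs D : measurable_fun D (Xb s) by exact: measurable_funTS.
have mSX D : measurable_fun D (fun w => S (X s w)) by apply: measurable_funTS; exact: (measurableT_comp mS (mX s)).
have mmX D : measurable_fun D (fun w => m (X s w)) by apply: measurable_funTS; exact: (measurableT_comp mm (mX s)).
have UF C : past setT Xb s C -> P (C `&` X t @^-1` \bigcup_n F n) = (\int[P]_(w in C) S (X s w))%E.
  move=> pC; have mC := measurable_past pC; rewrite integral_nneseries//; first last.
  - by move=> n; apply: measurable_funTS; apply/measurable_EFinP; exact: (measurableT_comp (mg n) (mX s)).
  rewrite preimage_bigcup setI_bigcupr measure_bigcup//; first last.
  - by move=> i j _ _ [w [[_ Fi] [_ Fj]]]; exact: (tF i j Logic.I Logic.I (ex_intro _ (X t w) (conj Fi Fj))).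
  - by move=> n _; apply: measurableI => //; apply: mXB; exact: mF.
  rewrite (eq_eseriesl (Q := xpredT)) => [|n]; last by rewrite in_setT.
  by apply: eq_eseriesr => n _; exact: gE.
pose U : set Omega := X s @^-1` (S @^-1` `]1%E, +oo[%classic).
have mSU : measurable (S @^-1` `]1%E, +oo[%classic : set (borel (TW W))).
  by rewrite -[X in measurable X]setTI; apply: mS => //; exact: emeasurable_itv.
have pU : past setT Xb s U.
  by apply: sub_sigma_algebra; exists s; split => //; exists (S @^-1` `]1%E, +oo[%classic).
have pAU : past setT Xb s (A `&` U) by exact: (@measurableI _ (g_sigma_algebraType _) _ _ pA pU).
have mA := measurable_past pA; have mU := measurable_past pU; have mAU := measurable_past pAU.
have mAD : measurable (A `\` U) by exact: measurableD.
have dAU : [disjoint A `&` U & A `\` U].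
  by apply/disj_setPS => w [[_ ?] [_ ?]].
rewrite UF// -(setUIDK A U) !ge0_integral_setU//; first last.
- by move=> w _; case/andP: (m01 (X s w)).
congr (_ + _)%E; last first.
  apply: eq_integral => w /set_mem[_ nU]; rewrite /m min_l// leNgt; apply/negP => h; apply: nU.
  by rewrite /U/= in_itv/= h.
have mU1 : (\int[P]_(w in A `&` U) m (X s w) = P (A `&` U))%E.
  rewrite -[RHS]mul1e -integral_cst//; apply: eq_integral => w /set_mem[_]; rewrite /U/= in_itv/= andbT => h.
  by rewrite /m min_r// ltW.
apply/eqP; rewrite eq_le; apply/andP; split.
  rewrite mU1 -UF// le_measure ?inE//; first by apply: measurableI => //; apply: mXB; exact: bigcupT_measurable.
by apply: ge0_le_integral => // w _; [case/andP: (m01 (X s w))|rewrite /m ge_min lexx].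
Qed.

Lemma measurable_state_event (K : seq (V * V)) : measurable (state_event K : set (borel (TW W))).
Proof.
elim: K => [|k K IH]; first by rewrite (_ : state_event _ = setT)//; apply/seteqP; split.
rewrite (_ : state_event _ = ~` [set T | together (cells (val T)) k.1 k.2] `&` state_event K).
  by apply: measurableI => //; apply: measurableC; exact: measurable_TW_together.
apply/seteqP; split => [w h|w [h1 h2] q].
  by split => [|q qK]; apply: h; rewrite inE ?eqxx ?qK ?orbT.
by rewrite inE => /orP[/eqP ->|/h2].
Qed.

Lemma state_events_borel (B : set (borel (TW W))) : <<s state_events >> B -> measurable B.
Proof.
by apply: (@preimage_generated _ (borel (TW W)) _ state_events id) => _ [K _ ->]; exact: measurable_state_event.
Qed.

Theorem process_markov : markov_process P setT Xb.
Proof.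
split => [t _|s t B _ _ st mB]; first exact: mX.
apply: (@dynkin_induction _ (g_sigma_algebraType state_events) state_events (transition s t) erefl state_eventsI).
- exact: transitionT.
- move=> _ [K iK ->]; have [g [mg g01 gE]] := state_event_transition st iK.
  exists g; split => // A /sub_past pA.
  have mB' : measurable (X t @^-1` state_event K) by apply: mXB; exact: measurable_state_event.
  apply: (conditional_induction (@past_eventsI s) (@measurable_past_event s)) pA => //.
  + exact: (measurableT_comp mg (mX s)).
  + have e0 : past_events s setT.
      exists [::]; first by split => k.
      by apply/seteqP; split.
    by have := gE _ e0; rewrite setTI.
- by move=> S /state_events_borel; exact: transitionC.
- by move=> F mF tF; apply: transition_bigcup tF => n; apply: state_events_borel; exact: mF.
- exact: borel_state_events.
Qed.

End MarkovProperty.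

(** * Borel sets of the Skorohod space *)

Section Bump.
Variable R : realType.
Implicit Types (u w a b s t : R).

Definition bump u w a b t : R :=
  if t <= u then t else if t <= a then u + (t - u) * ((b - u) / (a - u))
  else if t <= w then w - (w - t) * ((w - b) / (w - a)) else t.

Variant bump_spec u w a b t : R -> Type :=
  | BumpLow of t <= u : bump_spec u w a b t t
  | BumpLeft x of u < t <= a & u < x <= b & x = u + (t - u) * ((b - u) / (a - u)) : bump_spec u w a b t x
  | BumpRight x of a < t <= w & b < x <= w & x = w - (w - t) * ((w - b) / (w - a)) : bump_spec u w a b t x
  | BumpHigh of w < t : bump_spec u w a b t t.

Section OneBump.
Variables u w a b : R.
Hypotheses (ha : u < a < w) (hb : u < b < w).

Let ua : 0 < a - u. Proof. by rewrite subr_gt0; case/andP: ha. Qed.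
Let aw : 0 < w - a. Proof. by rewrite subr_gt0; case/andP: ha. Qed.
Let ub : 0 < b - u. Proof. by rewrite subr_gt0; case/andP: hb. Qed.
Let bw : 0 < w - b. Proof. by rewrite subr_gt0; case/andP: hb. Qed.

Lemma bumpP t : bump_spec u w a b t (bump u w a b t).
Proof.
rewrite /bump; case: (leP t u) => tu; first exact: BumpLow.
case: (leP t a) => ta.
  apply: BumpLeft => //; first by rewrite tu.
  have k0 : 0 < (b - u) / (a - u) by rewrite divr_gt0.
  rewrite ltrDl mulr_gt0 ?subr_gt0//= -lerBrDl mulrA ler_pdivrMr// mulrC.
  by rewrite ler_pM2l// lerD2r.
case: (leP t w) => tw; last exact: BumpHigh.
apply: BumpRight => //; first by rewrite ta.
have k0 : 0 < (w - b) / (w - a) by rewrite divr_gt0.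
rewrite gerBl mulr_ge0 ?subr_ge0 ?(ltW k0)// andbT ltrBrDl -ltrBrDr mulrA ltr_pdivrMr// mulrC.
by rewrite ltr_pM2l// ltrD2l ltrN2.
Qed.

Lemma bump_incr : {homo bump u w a b : s t / s < t}.
Proof.
move=> s t st; have k1 : 0 < (b - u) / (a - u) by rewrite divr_gt0.
have k2 : 0 < (w - b) / (w - a) by rewrite divr_gt0.
have /andP[? ?] := ha; have /andP[? ?] := hb.
case: bumpP => [su|x /andP[s1 s2] /andP[x1 x2] xE|x /andP[s1 s2] /andP[x1 x2] xE|sw];
case: bumpP => [tu|z /andP[t1 t2] /andP[z1 z2] zE|z /andP[t1 t2] /andP[z1 z2] zE|tw]; try lra.
- by rewrite xE zE ltrD2l ltr_pM2r// ltrD2r.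
- by rewrite xE zE ltrD2l ltrN2 ltr_pM2r// ltrD2l ltrN2.
Qed.

End OneBump.

Lemma bumpK u w a b : u < a < w -> u < b < w -> cancel (bump u w a b) (bump u w b a).
Proof.
move=> ha hb t; have /andP[ua aw] := ha; have /andP[ub bw] := hb.
have n1 : a - u != 0 by rewrite subr_eq0 gt_eqF.
have n2 : w - a != 0 by rewrite subr_eq0 gt_eqF.
have n3 : b - u != 0 by rewrite subr_eq0 gt_eqF.
have n4 : w - b != 0 by rewrite subr_eq0 gt_eqF.
case: (bumpP ha hb) => [tu|x /andP[t1 t2] /andP[x1 x2] xE|x /andP[t1 t2] /andP[x1 x2] xE|tw];
case: (bumpP hb ha) => [zu|z /andP[y1 y2] /andP[z1 z2] zE|z /andP[y1 y2] /andP[z1 z2] zE|zw] //; try (exfalso; lra).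
- by rewrite zE xE; field; rewrite n1 n3.
- by rewrite zE xE; field; rewrite n2 n4.
Qed.

Lemma bump_bijective u w a b : u < a < w -> u < b < w -> bijective (bump u w a b).
Proof. by move=> ha hb; exists (bump u w b a); apply: bumpK. Qed.

End Bump.

Section Skorohod.
Variables (R : realType) (l : nat) (W : window R l) (rho : compatible_metric R (FF W)).
Local Notation V := 'rV[R]_l.+1.
Local Notation ra := (@rational R).
Implicit Types (x y : R -> TW W).

Lemma near_ball (T : FF W) (e : R) : 0 < e -> nbhs T [set T' | rho T T' < e].
Proof. by move=> e0; apply/(mdistance_nbhs rho); exists e. Qed.

Lemma right_limit x t (e : R) : cadlag x -> 0 < e ->
  exists2 dl : R, 0 < dl & forall s, t <= s < t + dl -> rho (val (x t)) (val (x s)) < e.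
Proof.
move=> cx e0; have [xr _] := cx t.
have : \forall s \near t^'+, rho (val (x t)) (val (x s)) < e.
  have := @TW_val_continuous R l W (x t) _ (near_ball (val (x t)) e0) => h.
  exact: (xr _ h).
move=> /nbhs_ballP[dl /= dl0 h]; exists dl => // s /andP[ts sd].
have [->|ne] := eqVneq s t; first by rewrite (mdistance_eq0 rho _ _).2.
apply: h; last by rewrite lt_neqAle eq_sym ne.
by rewrite -ball_normE/= distrC ger0_norm ?subr_ge0// ltrBlDl.
Qed.

Lemma left_limit x t (e : R) : cadlag x -> 0 < e ->
  exists (L : FF W) (dl : R), 0 < dl /\ forall s, t - dl < s < t -> rho L (val (x s)) < e.
Proof.
move=> cx e0; have [_ [L xl]] := cx t; exists L.
have := xl _ (near_ball L e0) => /nbhs_ballP[dl /= dl0 h]; exists dl; split => // s /andP[ds st].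
by apply: h => //; rewrite -ball_normE/= gtr0_norm ?subr_gt0// ltrBlDr -ltrBlDl.
Qed.

(** A dense sequence: one tessellation from each nonempty finite intersection of members of the
    countable network, and [point] as a default for empty ones. *)
Definition net_point (n : nat) : FF W :=
  xget point [set T | forall i, List.In i (odflt [::] (@choice.unpickle (seq (bool * seq (bool * (nat * nat)))) n)) -> FF_network i T].

Lemma net_point_dense (T : FF W) (e : R) : 0 < e -> exists n, rho (net_point n) T < e.
Proof.
move=> e0; have := near_ball T e0; rewrite nbhsE => -[U [oU UT] Ue].
have [s [sT sU]] := FF_network_network oU UT.
exists (choice.pickle s); rewrite mdistance_sym; apply: Ue; apply: sU.
rewrite /net_point choice.pickleK /=; case: xgetP => [T' _ h|/(_ T)]; first exact: h.
by move=> h; exfalso; apply: h.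
Qed.

Variable e : R.
Hypothesis e0 : 0 < e.

Definition in_ball (b : nat) (T : TW W) : Prop := rho (net_point b) (val T) < e.

(* A finite record of the path on [r, rend): it moves from ball to ball, the change
   from b to b' happening somewhere in [p, q], where u < p < q < w. Only rational times are inspected. *)
Fixpoint itinerary (r : R) (b : nat) (L : seq (nat * nat * nat * nat * nat)) (rend : R) (y : R -> TW W) : Prop :=
  if L is (u, p, q, w, b') :: L' then
    [/\ r < ra u < ra p, ra p < ra q < ra w, ra w - ra u < e,
        [/\ forall i, r <= ra i < ra p -> in_ball b (y (ra i)),
            forall i j, ra p <= ra i /\ ra i < ra j < ra q -> in_ball b (y (ra i)) \/ in_ball b' (y (ra j)) &
            forall i, ra q <= ra i < ra w -> in_ball b' (y (ra i))] &
        itinerary (ra w) b' L' rend y]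
  else r < rend /\ forall i, r <= ra i < rend -> in_ball b (y (ra i)).

Lemma rational_dense_ball y b (r s : R) : cadlag y -> (forall i, r < ra i < s -> in_ball b (y (ra i))) ->
  forall t, r <= t < s -> rho (net_point b) (val (y t)) <= e.
Proof.
move=> cy h t /andP[rt ts]; apply/ler_addgt0Pr => eta eta0.
have [dl dl0 hd] := right_limit t cy eta0.
have [i /andP[i1 i2]] : exists i, t < ra i < Num.min s (t + dl).
  by apply: rational_between; rewrite lt_min ts ltrDl.
move: i2; rewrite lt_min => /andP[i2 i3].
apply: le_trans (mdistance_triangle rho _ (val (y (ra i))) _) _; apply: lerD.
  by apply: ltW; apply: h; rewrite (le_lt_trans rt).
by rewrite mdistance_sym; apply: ltW; apply: hd; rewrite ltW.
Qed.

(** The middle condition says that once the trajectory has left the ball b at a rational time of [p,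
    q[, it is in the ball b' at all later rational times before q. The switch is placed at the
    infimum of these departure times, or at q if there are none. Right continuity passes to all
    times, with weak inequalities. *)
Lemma switch_time y b b' (r p q w : R) : cadlag y -> r < p -> p < q -> q < w ->
  (forall i, r <= ra i < p -> in_ball b (y (ra i))) ->
  (forall i j, p <= ra i /\ ra i < ra j < q -> in_ball b (y (ra i)) \/ in_ball b' (y (ra j))) ->
  (forall i, q <= ra i < w -> in_ball b' (y (ra i))) ->
  exists tau, [/\ p <= tau <= q, forall t, r <= t < tau -> rho (net_point b) (val (y t)) <= e
    & forall t, tau <= t < w -> rho (net_point b') (val (y t)) <= e].
Proof.
move=> cy rp pq qw h1 h2 h3.
pose S : set R := [set s | s = q \/ exists i, [/\ s = ra i, p <= s, s < q & ~ in_ball b (y s)]].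
have Sp : lbound S p by move=> s [->|[i [_ ? _ _]]] //; exact: ltW.
have Sq : S q by left.
have hS : has_inf S by split; [exists q|exists p].
exists (inf S); split.
- by rewrite lb_le_inf ?ge_inf//; [exists p|exists q].
- apply: rational_dense_ball => // i /andP[ri iS].
  have [ip|pi] := ltP (ra i) p; first by apply: h1; rewrite ltW.
  apply: contrapT => nb; have : S (ra i).
    right; exists i; split => //; apply: lt_le_trans iS _; apply: ge_inf => //; by exists p.
  by move=> /(ge_inf hS.2); rewrite leNgt iS.
- apply: rational_dense_ball => // j /andP[Sj jw].
  have [qj|jq] := leP q (ra j); first by apply: h3; rewrite qj.
  have sj0 : 0 < ra j - inf S by rewrite subr_gt0.
  have [s Ss] := inf_adherent sj0 hS; rewrite addrCA subrr addr0 => sj.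
  have [se|[i [se ps sq nb]]] := Ss; first by move: sj; rewrite se ltNge (ltW jq).
  have pij : p <= ra i /\ ra i < ra j < q by rewrite -se ps sj jq.
  by case: (h2 i j pij) => //; rewrite -se => /nb.
Qed.

(** Trajectories with the same itinerary visit the same balls up to the positions of the switches.
    In each switching interval, shorter than e, a bump moves the switch of y to that of x; the bumps
    act on disjoint intervals, so their composition displaces no time by e or more. *)
Lemma itinerary_matching L r b rend x y : cadlag x -> cadlag y ->
  itinerary r b L rend x -> itinerary r b L rend y ->
  exists lam : R -> R, [/\ {homo lam : s t / s < t}, bijective lam, forall t, t <= r -> lam t = t
    & forall t, r <= t < rend -> `|lam t - t| < e /\ rho (val (y t)) (val (x (lam t))) <= 2 * e].
Proof.
move=> cx cy; have close b' s t : rho (net_point b') (val (y s)) <= e -> rho (net_point b') (val (x t)) <= e ->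
    rho (val (y s)) (val (x t)) <= 2 * e.
  move=> h1 h2; apply: le_trans (mdistance_triangle rho _ (net_point b') _) _.
  by rewrite mulr2n mulrDl mul1r lerD// mdistance_sym.
elim: L r b => [|[[[[u p] q] w] b'] L IH] r b /=.
  move=> [rr hx] [_ hy]; exists id; split => //; first by exists id.
  move=> t rt; rewrite subrr normr0; split; first exact: e0.
  by apply: (close b); apply: rational_dense_ball rt => // i /andP[/ltW ri ir]; [apply: hy|apply: hx]; rewrite ri.
move=> [/andP[ru up] /andP[pq qw] wu [x1 x2 x3] xL] [_ _ _ [y1 y2 y3] yL].
have [lam [lam_incr lam_bij lam_id lamP]] := IH _ _ xL yL.
have rp := lt_trans ru up.
have [s [/andP[ps sq] xs1 xs2]] := switch_time cx rp pq qw x1 x2 x3.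
have [t0 [/andP[pt tq] yt1 yt2]] := switch_time cy rp pq qw y1 y2 y3.
have ht : ra u < t0 < ra w by rewrite (lt_le_trans up pt) (le_lt_trans tq qw).
have hs : ra u < s < ra w by rewrite (lt_le_trans up ps) (le_lt_trans sq qw).
pose phi := bump (ra u) (ra w) t0 s.
have phi_incr := bump_incr ht hs.
exists (lam \o phi); split.
- by move=> v v' vv'; apply: lam_incr; exact: phi_incr.
- exact: bij_comp lam_bij (bump_bijective ht hs).
- move=> v vr /=; have vu : v <= ra u by rewrite ltW// (le_lt_trans vr).
  by rewrite /phi /bump vu lam_id// ltW// (le_lt_trans vu)// (lt_trans up)// (lt_trans pq).
move=> v /andP[rv vr] /=; have [vw|wv] := ltP v (ra w); last first.
  have -> : phi v = v.
    rewrite /phi; case: bumpP => // [z /andP[_ z1] _ _|z /andP[_ z1] _ zE]; first by case/andP: ht; lra.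
    by rewrite zE (_ : v = ra w) ?subrr ?mul0r ?subr0//; apply/eqP; rewrite eq_le z1.
  by apply: lamP; rewrite wv.
have pw : phi v < ra w.
  have -> : ra w = phi (ra w).
    rewrite /phi; case: bumpP => // [z /andP[_ z1] _ _|z _ _ ->]; first by case/andP: ht; lra.
    by rewrite subrr mul0r subr0.
  exact: phi_incr.
rewrite lam_id; last exact: ltW.
have [vu|uv] := leP v (ra u).
  have -> : phi v = v by rewrite /phi /bump vu.
  rewrite subrr normr0; split; first exact: e0.
  apply: (close b).
    by apply: yt1; rewrite rv (le_lt_trans vu)//; case/andP: ht.
  by apply: xs1; rewrite rv (le_lt_trans vu)//; case/andP: hs.
have upv : ra u < phi v.
  have <- : phi (ra u) = ra u by rewrite /phi /bump lexx.
  exact: phi_incr.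
have phit : phi t0 = s.
  have /andP[ut _] := ht; rewrite /phi /bump leNgt ut lexx /=; field.
  by rewrite subr_eq0 gt_eqF.
split.
  by rewrite ltr_norml; clear - wu pw upv uv vw; set z := phi v in pw upv *; apply/andP; split; lra.
have [vt|tv] := ltP v t0.
  apply: (close b); first by apply: yt1; rewrite rv.
  by apply: xs1; rewrite (ltW (lt_trans ru upv))/= -phit; exact: phi_incr.
apply: (close b'); first by apply: yt2; rewrite tv.
apply: xs2; rewrite pw andbT -phit; move: tv; rewrite le_eqVlt => /orP[/eqP -> //|tv].
by apply: ltW; exact: phi_incr.
Qed.

Definition first_change (L : seq (nat * nat * nat * nat * nat)) (rend : R) : R :=
  if L is (u, _, _, _, _) :: _ then ra u else rend.

Lemma itinerary_first r b L rend y : itinerary r b L rend y ->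
  [/\ r < first_change L rend, forall i, r <= ra i < first_change L rend -> in_ball b (y (ra i))
    & forall r', r <= r' < first_change L rend -> itinerary r' b L rend y].
Proof.
case: L => [[rr h]|[[[[u p] q] w] b'] L /= [/andP[ru up] pq wu [h1 h2 h3] hL]] /=.
  by split => // r' /andP[rr' r'r]; split => // i /andP[ri ir]; apply: h; rewrite ir (le_trans rr').
split => // [i /andP[ri iu]|r' /andP[rr' r'u]]; first by apply: h1; rewrite ri (lt_trans iu).
split => //; first by rewrite r'u.
by split => // i /andP[ri ip]; apply: h1; rewrite ip (le_trans rr').
Qed.

(** Compactness of the time interval, used backwards: if all starting times of itineraries were at
    least m, the left limit and the right continuity at their infimum rs would give an itinerary
    starting before rs. *)
Lemma itinerary_exists x (M : nat) (m : R) : cadlag x ->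
  exists i b L, ra i < m /\ itinerary (ra i) b L (ra M) x.
Proof.
move=> cx; have e20 : 0 < e / 2 by rewrite divr_gt0.
have near_net (T T' : FF W) b : rho (net_point b) T < e / 2 -> rho T T' < e / 2 -> rho (net_point b) T' < e.
  by move=> h1 h2; apply: le_lt_trans (mdistance_triangle rho _ T _) _; rewrite [ltRHS]splitr ltrD.
apply: contrapT => none.
pose S : set R := [set s | exists i b L, s = ra i /\ itinerary (ra i) b L (ra M) x].
have Sm : lbound S m.
  move=> s [i [b [L [-> h]]]]; rewrite leNgt; apply/negP => im; apply: none.
  by exists i, b, L.
have S0 : S !=set0.
  have [T [dl [dl0 hT]]] := left_limit (ra M) cx e20.
  have [b hb] := net_point_dense T e20.
  have [i /andP[i1 i2]] : exists i, ra M - dl < ra i < ra M by apply: rational_between; rewrite ltrBlDr ltrDl.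
  exists (ra i), i, b, [::]; split => //=; split => // j /andP[ij jM].
  by apply: near_net hb _; apply: hT; rewrite jM (lt_le_trans i1).
have hS : has_inf S by split => //; exists m.
set rs := inf S.
have [dr dr0 hr] := right_limit rs cx e20.
have [T [dl [dl0 hT]]] := left_limit rs cx e20.
have [b' hb'] := net_point_dense (val (x rs)) e20.
have [b0 hb0] := net_point_dense T e20.
have in_b' t : rs <= t < rs + dr -> in_ball b' (x t) by move=> /hr; exact: near_net.
have in_b0 t : rs - dl < t < rs -> in_ball b0 (x t) by move=> /hT; exact: near_net.
have [r Sr rd] := inf_adherent dr0 hS.
have rsr : rs <= r by apply: ge_inf => //; exact: hS.2.
have [i [b [L [rE /itinerary_first[fi fb fL]]]]] := Sr; rewrite -rE in fi fb fL.
set f := first_change L (ra M) in fi fb fL.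
pose w0 := Num.min f (rs + dr); have rw0 : r < w0 by rewrite lt_min fi.
have w0f : w0 <= f by rewrite ge_min lexx.
have w0d : w0 <= rs + dr by rewrite ge_min lexx orbT.
have [i0 /andP[i01 i02]] : exists i, Num.max (rs - dl) (rs - e / 2) < ra i < rs.
  by apply: rational_between; rewrite gt_max; clear - dl0 e20; apply/andP; split; lra.
move: i01; rewrite gt_max => /andP[i0l i0e].
have [u /andP[iu urs]] := rational_between i02.
have [p /andP[up prs]] := rational_between urs.
have [q /andP[rsq]] : exists q, rs < ra q < Num.min w0 (rs + e / 2).
  by apply: rational_between; rewrite lt_min (le_lt_trans rsr rw0)/=; clear - e20; lra.
rewrite lt_min => /andP[qw0 qe].
have [w /andP[qw]] : exists w, ra q < ra w < Num.min w0 (rs + e / 2) by apply: rational_between; rewrite lt_min qw0.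
rewrite lt_min => /andP[ww0 we].
pose z := Num.max (ra w) r; have zw0 : z < w0 by rewrite gt_max ww0.
have wz : ra w <= z by rewrite le_max lexx.
have rz : r <= z by rewrite le_max lexx orbT.
have [u2 /andP[zu2]] : exists u2, z < ra u2 < Num.min w0 (z + e) by apply: rational_between; rewrite lt_min zw0/= ltrDl.
rewrite lt_min => /andP[u2w0 u2e].
have [p2 /andP[up2]] : exists p2, ra u2 < ra p2 < Num.min w0 (z + e) by apply: rational_between; rewrite lt_min u2w0.
rewrite lt_min => /andP[p2w0 p2e].
have [q2 /andP[pq2]] : exists q2, ra p2 < ra q2 < Num.min w0 (z + e) by apply: rational_between; rewrite lt_min p2w0.
rewrite lt_min => /andP[q2w0 q2e].
have [w2 /andP[qw2]] : exists w2, ra q2 < ra w2 < Num.min w0 (z + e) by apply: rational_between; rewrite lt_min q2w0.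
rewrite lt_min => /andP[w2w0 w2e].
have : S (ra i0).
  (* rs itself need not be a starting time. A first switch around rs leads from the ball of the left
     limit to the ball of x rs; a second one, after the starting time r near rs, leads into the ball
     b of the given itinerary before its first change. *)
  exists i0, b0, [:: (u, p, q, w, b'), (u2, p2, q2, w2, b) & L]; split => //=.
  have qw' : ra q < ra w by [].
  split; [by rewrite iu up|by rewrite (lt_trans prs rsq) qw|clear - we iu i0e; lra| |].
    split => [j /andP[j1 j2]|j j' [j1 /andP[j2 j3]]|j /andP[j1 j2]].
    - by apply: in_b0; rewrite (lt_le_trans i0l j1) (lt_trans j2 prs).
    - have [jr|rj] := ltP (ra j) rs.
        left; apply: in_b0; rewrite jr andbT; exact: lt_le_trans (lt_trans i0l (lt_trans iu up)) j1.
      right; apply: in_b'; rewrite (ltW (le_lt_trans rj j2))/=.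
      exact: lt_le_trans (lt_trans j3 qw0) w0d.
    - by apply: in_b'; rewrite (ltW (lt_le_trans rsq j1))/=; exact: lt_le_trans (lt_trans j2 ww0) w0d.
  have wu2 : ra w < ra u2 := le_lt_trans wz zu2.
  have rw : rs <= ra w := ltW (lt_trans rsq qw).
  split; [by rewrite wu2 up2|by rewrite pq2 qw2|clear - w2e zu2; lra| |].
    split => [j /andP[j1 j2]|j j' [j1 /andP[j2 j3]]|j /andP[j1 j2]].
    - by apply: in_b'; rewrite (le_trans rw j1)/=; exact: lt_le_trans (lt_trans j2 p2w0) w0d.
    - left; apply: in_b'; rewrite (le_trans rw (ltW (lt_le_trans (lt_trans wu2 up2) j1)))/=.
      exact: lt_le_trans (lt_trans (lt_trans j2 j3) q2w0) w0d.
    - apply: fb; rewrite (lt_le_trans (lt_trans j2 w2w0) w0f) andbT.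
      exact: le_trans (ltW (le_lt_trans rz (lt_trans zu2 (lt_trans up2 pq2)))) j1.
  apply: fL; rewrite (lt_le_trans w2w0 w0f) andbT.
  exact: ltW (le_lt_trans rz (lt_trans zu2 (lt_trans up2 (lt_trans pq2 qw2)))).
by move=> /(ge_inf hS.2); rewrite -/rs leNgt i02.
Qed.

Lemma open_in_ball b : open [set T : TW W | in_ball b T].
Proof.
rewrite openE => T hT; have d0 : 0 < e - rho (net_point b) (val T) by rewrite subr_gt0.
have h := @TW_val_continuous R l W T _ (near_ball (val T) d0).
apply: (@filterS _ (nbhs (T : TW W)) _ _ _ _ h) => T' /= {}h.
apply: le_lt_trans (mdistance_triangle rho _ (val T) _) _; by rewrite -ltrBrDl.
Qed.

Lemma measurable_itinerary d (D : measurableType d) (ev : D -> R -> TW W) :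
  (forall s, measurable_fun setT (fun w => ev w s : borel (TW W))) ->
  forall L r b rend, measurable [set w | itinerary r b L rend (ev w)].
Proof.
move=> mev; have mb b s : measurable [set w | in_ball b (ev w s)].
  have := mev s measurableT [set T : TW W | in_ball b T] (sub_borel (@open_in_ball b)); by rewrite setTI.
have imp (A : Prop) (B : set D) : measurable B -> measurable [set w | A -> B w].
  move=> mB; have [a|na] := pselect A.
    rewrite (_ : [set w | A -> B w] = B)//; apply/seteqP; split => w; [exact|by move=> ? _].
  by rewrite (_ : [set w | A -> B w] = setT)//; apply/seteqP; split => w // _ /na.
have conj0 (A : Prop) (B : set D) : measurable B -> measurable [set w | A /\ B w].
  move=> mB; have [a|na] := pselect A.
    rewrite (_ : [set w | A /\ B w] = B)//; apply/seteqP; split => w; [by case|by split].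
  by rewrite (_ : [set w | A /\ B w] = set0)//; apply/seteqP; split => w // [].
have all_i (A : nat -> Prop) s (b : nat) : measurable [set w | forall i, A i -> in_ball b (ev w (s i))].
  rewrite (_ : [set _ | _] = \bigcap_i [set w | A i -> in_ball b (ev w (s i))]).
    by apply: bigcapT_measurable => i; apply: (imp _ [set w | in_ball b (ev w (s i))]).
  by apply/seteqP; split => w h i; [move=> _|]; exact: h.
have all_ij (A : nat -> nat -> Prop) s (b b' : nat) :
    measurable [set w | forall i j, A i j -> in_ball b (ev w (s i)) \/ in_ball b' (ev w (s j))].
  rewrite (_ : [set _ | _] = \bigcap_i \bigcap_j [set w | A i j -> (([set w | in_ball b (ev w (s i))] `|` [set w | in_ball b' (ev w (s j))]) w)]).
    apply: bigcapT_measurable => i; apply: bigcapT_measurable => j; apply: imp; exact: measurableU.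
  by apply/seteqP; split => w h i; [move=> _ j _|move=> j]; exact: h.
elim=> [|[[[[u p] q] w'] b'] L IH] r b rend /=.
  by apply: (conj0 _ [set w | forall i, _ -> in_ball b (ev w (ra i))]); exact: all_i.
rewrite (_ : [set _ | _] = [set w | (r < ra u < ra p /\ ra p < ra q < ra w' /\ ra w' - ra u < e) /\
   ([set w | forall i, r <= ra i < ra p -> in_ball b (ev w (ra i))] `&`
    [set w | forall i j, ra p <= ra i /\ ra i < ra j < ra q -> in_ball b (ev w (ra i)) \/ in_ball b' (ev w (ra j))] `&`
    [set w | forall i, ra q <= ra i < ra w' -> in_ball b' (ev w (ra i))] `&`
    [set w | itinerary (ra w') b' L rend (ev w)]) w]).
  apply: conj0; apply: measurableI => //; apply: measurableI; last exact: all_i.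
  by apply: measurableI; [exact: all_i|exact: all_ij].
by apply/seteqP; split => w /=; [move=> [h1 h2 h3 [h4 h5 h6] h7]|move=> [[h1 [h2 h3]] [[[h4 h5] h6] h7]]].
Qed.

End Skorohod.

Section SkorohodBorel.
Variables (R : realType) (l : nat) (W : window R l) (rho : compatible_metric R (FF W)).
Local Notation ra := (@rational R).
Local Notation events := (path_events (fun x : skorohod rho => trajectory_fun x)).

Lemma measurable_coordinate s :
  measurable_fun setT (fun x : g_sigma_algebraType events => (trajectory_fun x s : borel (TW W))).
Proof.
apply: measurable_TW => n m nW mW.
rewrite (_ : _ @^-1` _ = ~` path_event (fun x : skorohod rho => trajectory_fun x) [:: (s, (dseq R l n, dseq R l m))]).
  apply: measurableC; apply: sub_sigma_algebra; refine (ex_intro2 _ _ [:: (s, (dseq R l n, dseq R l m))] _ erefl).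
  by move=> k; rewrite inE => /eqP ->; split; [exact: nW|exact: mW].
apply/funext => w; apply/propext => /=; split; first by move=> t /(_ _ (mem_head _ _)).
by move=> h; apply: contrapT => t; apply: h => k; rewrite inE => /eqP ->.
Qed.

Definition itinerary_set (c : nat * nat * nat * nat * seq (nat * nat * nat * nat * nat)) : set (skorohod rho) :=
  let: (k, i, b, M, L) := c in [set y | itinerary rho k.+1%:R^-1 (ra i) b L (ra M) (trajectory_fun y)].

Lemma itinerary_network : network itinerary_set.
Proof.
move=> U x oU Ux; have [m [e [e0 sub]]] := oU x Ux.
(* [itinerary_matching] loses a factor 2 in the distance, hence the precision e / 2. *)
have [k hk] : exists k : nat, k.+1%:R^-1 < e / 2 :> R.
  have e20 : 0 < e / 2 by rewrite divr_gt0.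
  by have [k _ /(_ k (leqnn k))] := near_infty_natSinv_lt (PosNum e20); exists k.
have k0 : 0 < k.+1%:R^-1 :> R by rewrite invr_gt0.
have [M /andP[mM _]] : exists M, `|m| < ra M < `|m| + 1 by apply: rational_between; rewrite ltrDl.
have [i [b [L [im hL]]]] := itinerary_exists rho k0 M (- `|m|) (trajectory_cadlag x).
exists [:: (k, i, b, M, L)]; split; first by move=> c [<-|[]].
move=> y /(_ _ (or_introl erefl)) /= hy; apply: sub.
have [lam [l1 l2 _ l3]] := itinerary_matching k0 (trajectory_cadlag x) (trajectory_cadlag y) hL hy.
exists lam; split => // t tm; have tm' : `|t| <= `|m| := le_trans tm (ler_norm m).
have [|h1 h2] := l3 t.
  by move: tm'; rewrite ler_norml => /andP[t1 t2]; rewrite (ltW (lt_le_trans im t1)) (le_lt_trans t2).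
split; [apply: lt_trans h1 _|apply: le_lt_trans h2 _]; move: hk; set z := _^-1; move=> hk; lra.
Qed.

Lemma borel_path_events (A : set (borel (skorohod rho))) : measurable A -> <<s events >> A.
Proof.
move=> mA; have m_id : measurable_fun setT (id : g_sigma_algebraType events -> borel (skorohod rho)).
  apply: (network_measurable itinerary_network) => -[[[[k i] b] M] L].
  exact: (@measurable_itinerary _ _ _ rho k.+1%:R^-1 _ (g_sigma_algebraType events) _ measurable_coordinate L (ra i) b (ra M)).
by have := m_id measurableT A mA; rewrite setTI.
Qed.

Lemma open_shift t (U : set (skorohod rho)) : open U ->
  open ((shift_traj t : skorohod rho -> skorohod rho) @^-1` U).
Proof.
move=> oU; have sU : skorohod_open ((shift_traj t : skorohod rho -> skorohod rho) @^-1` U); last exact: sU.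
move=> x Ux; have [m [e [e0 sub]]] := oU _ Ux; exists (m + `|t|), e; split => // y [lam [l1 [g gK Kg] l3]]; apply: sub.
exists (fun s => lam (s + t) - t); split.
- by move=> u v uv; rewrite ltrD2r; apply: l1; rewrite ltrD2r.
- exists (fun s => g (s + t) - t) => s; first by rewrite subrK gK addrK.
  by rewrite subrK Kg addrK.
move=> s sm; have [|h1 h2] := l3 (s + t); first by rewrite (le_trans (ler_normD _ _))// lerD2r.
split; first by rewrite -addrA -opprD [t + s]addrC.
by rewrite /= subrK.
Qed.

Lemma measurable_shift t :
  measurable_fun setT (shift_traj t : borel (skorohod rho) -> borel (skorohod rho)).
Proof.
apply: (@measurability _ _ _ (borel (skorohod rho)) _ _ (@open (skorohod rho))) => // _ [U oU <-].
by rewrite setTI; apply: sub_borel; exact: open_shift.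
Qed.

End SkorohodBorel.

Theorem theorem1p2 (R : realType) (l : nat)
    (Lambda : {measure set (borel (hyperplane R l)) -> \bar R})
    (hLambda : driving_measure Lambda)
    (d : measure_display) (Omega : measurableType d) (P : probability Omega R)
    (Y : R -> Omega -> borel (FF [set: 'rV[R]_l.+1]))
    (hY : stit_process P Lambda Y)
    (a : R) (ha : 1 < a)
    (W : window R l) (rho : compatible_metric R (FF W))
    (hcadlag : forall w, cadlag (fun s => restrict_tess W (renormalized a Y s w))) :
  exists Z : {RV P >-> borel (skorohod rho)},
    [/\ forall w s, Z w s = restrict_tess W (renormalized a Y s w),
        forall (t : R) (A : set (borel (skorohod rho))), measurable A ->
          P [set w | A (shift_traj t (Z w))] = P [set w | A (Z w)],
        markov_process P setT (fun s w => Z w s : borel (TW W)),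
        forall A B : set (borel (skorohod rho)), measurable A -> measurable B ->
          P [set w | A (Z w) /\ B (shift_traj t (Z w))] @[t --> +oo]
            --> (P [set w | A (Z w)] * P [set w | B (Z w)])%E
      & is_flow (distribution P Z) (@shift_traj R l W) /\
        mixing (distribution P Z) (@shift_traj R l W)].
Proof.
pose Z w : borel (skorohod rho) := Trajectory (hcadlag w).
pose ev (x : skorohod rho) := trajectory_fun x.
have hZ w s : ev (Z w) s = process_in_window Y a W s w by [].
have hshift t x s : ev (shift_traj t x) s = ev x (s + t) by [].
have mZ : measurable_fun setT Z.
  move=> _ B mB; rewrite setTI.
  exact: preimage_generated (measurable_path_event hY ha hZ) _ (borel_path_events mB).
pose Zm := HB.pack_for {mfun Omega >-> borel (skorohod rho)} Z (isMeasurableFun.Build _ _ _ _ Z mZ).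
have stationary t (A : set (borel (skorohod rho))) : measurable A ->
    P [set w | A (shift_traj t (Z w))] = P [set w | A (Z w)].
  by move=> /borel_path_events; exact: (process_stationary hLambda hY ha hZ hshift t).
have mix (A B : set (borel (skorohod rho))) : measurable A -> measurable B ->
    P [set w | A (Z w) /\ B (shift_traj t (Z w))] @[t --> +oo] --> (P [set w | A (Z w)] * P [set w | B (Z w)])%E.
  move=> mA mB.
  have mZA (C : set (borel (skorohod rho))) : measurable C -> measurable [set w | C (Z w)].
    by move=> mC; have := mZ measurableT C mC; rewrite setTI.
  have mZs t (C : set (borel (skorohod rho))) : measurable C -> measurable [set w | C (shift_traj t (Z w))].
    by move=> mC; apply: (mZA (shift_traj t @^-1` C)); have := @measurable_shift R l W rho t measurableT C mC; rewrite setTI.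
  rewrite -[P [set w | A (Z w)]]fineK ?fin_num_measure//; last exact: mZA.
  rewrite -[P [set w | B (Z w)]]fineK ?fin_num_measure//; last exact: mZA.
  rewrite -EFinM (_ : (fun t => _) = (fun t => (fine (P ((Z @^-1` A) `&` ((fun w => shift_traj t (Z w)) @^-1` B))))%:E)).
    apply: cvg_EFin; first exact: nearW.
    exact: (process_mixing hLambda hY ha hZ hshift (borel_path_events mA) (borel_path_events mB)).
  apply/funext => t; rewrite fineK// fin_num_measure//.
  by apply: measurableI; [exact: mZA|exact: mZs].
have W0 := origin_in_window hLambda hY ha hcadlag.
exists Zm; split => //.
- exact: (process_markov hLambda hY ha W0).
- split => [t|A B mA mB].
    split => [|A mA]; first exact: measurable_shift.
    exact: (stationary t A mA).
  have h := mix B A mB mA; rewrite muleC in h.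
  rewrite (_ : (fun t => _) = (fun t => P [set w | B (Z w) /\ A (shift_traj t (Z w))])); first exact: h.
  by apply/funext => t; rewrite /distribution /pushforward setIC.
Qed.
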